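(* Let $\bm{T}\colon\mathbb{R}^q\to\mathrm{Sym}_p(\mathbb{R})$ be measurable with $\mathbb{P}(\bm{T}(\bm{y})\neq \bm{0}_{p\times p})>0$ and $\|\bm{T}(\bm{y})\|_{\mathrm{op}}\le C_T$ almost surely for some finite $C_T>0$. Suppose $n,d\to\infty$ with $n/d\to\alpha\in(0,\infty)$ while $r,q,p$ remain fixed. Let $\bm{P}_n=\frac1n\sum_{i=1}^n\bm{T}(\bm{y}_i)\otimes\bm{u}_i\bm{u}_i^\top\in\mathbb{R}^{p(d-r)\times p(d-r)}$ and $\bm{M}_n(z)=\operatorname{tr}_{d-r}^{(p)}\left((\bm{P}_n-z\bm{I}_{p(d-r)})^{-1}\right)\in\mathbb{C}^{p\times p}$ for $z\in\mathbb{C}_+$. Then, almost surely, $\bm{M}_n$ converges locally uniformly on $\mathbb{C}_+$ to a deterministic analytic function $\bm{M}_\alpha\colon\mathbb{C}_+\to\mathbb{C}^{p\times p}$. The limit belongs to the normalized matrix-valued Herglotz class, i.e. $$\Im\bm{M}_\alpha(z)\succeq0,\ z\in\mathbb{C}_+,\qquad\lim_{\eta\to\infty}i\eta\,\bm{M}_\alpha(i\eta)=-\bm{I}_p,$$ and is the unique solution in this class of the self-consistent equation $$\bm{M}_\alpha(z)^{-1}=-z\bm{I}_p+\mathbb{E}_{\bm{y}}\left[\bm{T}(\bm{y})\left(\bm{I}_p+\tfrac1\alpha\bm{M}_\alpha(z)\bm{T}(\bm{y})\right)^{-1}\right],\quad z\in\mathbb{C}_+.$$ In particular, for every fixed $z\in\mathbb{C}_+$,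 $\|\bm{M}_n(z)-\bm{M}_\alpha(z)\|_{\mathrm{op}}\to0$ almost surely. Consequently, the empirical spectral measure $\hat\mu_{\bm{P}_n}=\frac1{p(d-r)}\sum_{i=1}^{p(d-r)}\delta_{\lambda_i(\bm{P}_n)}$ converges weakly almost surely to a deterministic compactly supported probability measure $\mu_\alpha$ on $\mathbb{R}$, whose Stieltjes transform is $m_{\mu_\alpha}(z)=\int(\lambda-z)^{-1}\mu_\alpha(\mathrm{d}\lambda)=\frac1p\operatorname{Tr}\bm{M}_\alpha(z)$.
   Context: Model. Fix integers $r,q,p\ge1$ and a conditional probability distribution (Markov kernel) $P_\ast(\cdot\mid\bm{s})$, $\bm{s}\in\mathbb{R}^r$, on $\mathbb{R}^q$. For each $n$ (with $d=d_n>r$), $(\bm{s}_i,\bm{u}_i,\bm{y}_i)$, $i=1,\dots,n$, are independent across $i$, with $\bm{s}_i\sim\mathcal{N}(\bm{0}_r,\bm{I}_r)$, $\bm{y}_i\mid\bm{s}_i\sim P_\ast(\cdot\mid\bm{s}_i)$, and $\bm{u}_i\sim\mathcal{N}(\bm{0}_{d-r},\bm{I}_{d-r})$ independent of $(\bm{s}_i,\bm{y}_i)$. Everything lives on a common probability space. The generic $\bm{y}$ has the common law of the $\bm{y}_i$, and $\mathbb{E}_{\bm{y}}$ is expectation over $\bm{y}$. Notation. $\mathbb{C}_+=\{z\in\mathbb{C}\colon\Im z>0\}$; for a square matrix $\Im\bm{X}=(\bm{X}-\bm{X}^\ast)/(2i)$; $\mathrm{Sym}_p(\mathbb{R})$ is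 the space of real symmetric $p\times p$ matrices; $\bm{A}\otimes\bm{B}$ is the Kronecker product with blocks $A_{\mu\nu}\bm{B}$. For $\bm{X}=(\bm{X}_{\mu\nu})_{\mu,\nu\in[p]}$ with blocks $\bm{X}_{\mu\nu}\in\mathbb{C}^{m\times m}$, the normalized partial trace is $\operatorname{tr}_m^{(p)}(\bm{X})=\left(\frac1m\operatorname{Tr}\bm{X}_{\mu\nu}\right)_{\mu,\nu\in[p]}\in\mathbb{C}^{p\times p}$. *)

(* Defs.v *)
From HB Require Import structures.
From mathcomp Require Import all_boot all_order all_algebra.
From mathcomp Require Import all_classical all_reals all_analysis.
From mathcomp Require Import complex mxtens spectral sesquilinear.

Set Implicit Arguments.
Unset Strict Implicit.
Unset Printing Implicit Defensive.

Import Order.TTheory GRing.Theory Num.Theory.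
Import numFieldNormedType.Exports.

Local Open Scope classical_set_scope.
Local Open Scope ring_scope.
Local Open Scope complex_scope.
Local Open Scope sesquilinear_scope.

Section Probability.
Context d (Omega : measurableType d) (R : realType) (P : probability Omega R).

(* Subfamilies are covered by taking [B i = setT] outside of them. *)
Definition mutually_independent (I : finType) d' (E : measurableType d')
    (X : I -> Omega -> E) : Prop :=
  forall B : I -> set E, (forall i, measurable (B i)) ->
    P (\bigcap_i X i @^-1` B i) = (\prod_i P (X i @^-1` B i))%E.

Definition independent d1 d2 (E1 : measurableType d1) (E2 : measurableType d2)
    (X : Omega -> E1) (Y : Omega -> E2) : Prop :=
  forall A B, measurable A -> measurable B ->
    P (X @^-1` A `&` Y @^-1` B) = (P (X @^-1` A) * P (Y @^-1` B))%E.

(* X ~ N(0, I_k): the law of X is the k-fold product of N(0, 1), which is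
   determined by its values on measurable boxes. *)
Definition std_gaussian_vector k (X : Omega -> k.-tuple R) : Prop :=
  forall B : 'I_k -> set R, (forall j, measurable (B j)) ->
    P [set w | forall j, B j (tnth (X w) j)]
    = (\prod_(j < k) normal_prob 0 1 (B j))%E.

(* Y | X ~ K(. | X) *)
Definition conditional_law d1 d2 (E1 : measurableType d1)
    (E2 : measurableType d2) (X : Omega -> E1) (Y : Omega -> E2)
    (K : R.-pker E1 ~> E2) : Prop :=
  forall A B, measurable A -> measurable B ->
    P (X @^-1` A `&` Y @^-1` B) = (\int[P]_(w in X @^-1` A) K (X w) B)%E.

End Probability.

Section ComplexIntegral.
Context d (E : measurableType d) (R : realType).
Variable mu : {measure set E -> \bar R}.

Definition integrableC (f : E -> R[i]) : Prop :=
  mu.-integrable setT (EFin \o (@complex.Re R \o f)) /\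
  mu.-integrable setT (EFin \o (@complex.Im R \o f)).

Definition integralC (f : E -> R[i]) : R[i] :=
  (\int[mu]_x complex.Re (f x)) +i* (\int[mu]_x complex.Im (f x)).

End ComplexIntegral.

Section OperatorNorm.
Variables (R : realType) (K : pzSemiRingType) (absK : K -> R).

Definition norm2 n (v : 'cV[K]_n) : R :=
  Num.sqrt (\sum_i absK (v i ord0) ^+ 2).

Definition opnorm m n (A : 'M[K]_(m, n)) : R :=
  sup [set norm2 (A *m v) | v in [set v | norm2 v <= 1]].

End OperatorNorm.

Definition opnormR (R : realType) m n (A : 'M[R]_(m, n)) : R :=
  opnorm (fun x : R => `|x|) A.

Definition opnormC (R : realType) m n (A : 'M[R[i]]_(m, n)) : R :=
  opnorm (fun z : R[i] => ComplexField.Normc.normc z) A.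

Section MatrixFunctions.
Variable R : realType.

(* The topology of the field R[i] is carried by its regular copy R[i]^o. *)

Definition Cplus : set R[i] := [set z | 0 < complex.Im z].

Definition toC m n (A : 'M[R]_(m, n)) : 'M[R[i]]_(m, n) :=
  map_mx (real_complex R) A.

Definition Immx p (X : 'M[R[i]]_p) : 'M[R[i]]_p :=
  (2 * 'i%C)^-1 *: (X - X ^t*).

(* The order of R[i] is such that [0 <= z] entails that z is real. *)
Definition psdmx p (H : 'M[R[i]]_p) : Prop :=
  H \is hermsymmx /\
  forall v : 'cV[R[i]]_p, 0 <= (v ^t* *m H *m v) ord0 ord0.

Definition analytic_on p (D : set R[i]) (M : R[i] -> 'M[R[i]]_p) : Prop :=
  forall z0, D z0 -> exists a : nat -> 'M[R[i]]_p,
    \forall z \near (z0 : R[i]^o),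
      series (fun k => (z - z0) ^+ k *: a k : 'M[R[i]^o]_p) @ \oo
      --> (M z : 'M[R[i]^o]_p).

Definition locally_uniform_cvg p (D : set R[i])
    (F : nat -> R[i] -> 'M[R[i]]_p) (M : R[i] -> 'M[R[i]]_p) : Prop :=
  forall z0, D z0 -> exists2 U, nbhs (z0 : R[i]^o) U &
    {uniform U `&` D, (F : nat -> R[i] -> 'M[R[i]^o]_p) @ \oo
       --> (M : R[i] -> 'M[R[i]^o]_p)}.

Definition normalized_herglotz p (M : R[i] -> 'M[R[i]]_p) : Prop :=
  [/\ analytic_on Cplus M,
      forall z, Cplus z -> psdmx (Immx (M z))
    & ((0 +i* eta) *: M (0 +i* eta) : 'M[R[i]^o]_p) @[eta --> +oo]
        --> (- 1%:M : 'M[R[i]^o]_p)].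

(* [mxtens_index (mu, k)] is the position of row k of block mu in the
   numbering used by the Kronecker product [*t]. *)
Definition partial_trace p m (X : 'M[R[i]]_(p * m)) : 'M[R[i]]_p :=
  \matrix_(mu, nu) (m%:R^-1 *
    \sum_(k < m) X (mxtens_index (mu, k)) (mxtens_index (nu, k))).

Definition resolvent N (A : 'M[R]_N) (z : R[i]) : 'M[R[i]]_N :=
  invmx (toC A - z%:M).

Definition matrix_stieltjes p m (A : 'M[R]_(p * m)) (z : R[i]) :
    'M[R[i]]_p :=
  partial_trace (resolvent A z).

Definition sample_matrix q p m n (T : q.-tuple R -> 'M[R]_p)
    (y : 'I_n -> q.-tuple R) (u : 'I_n -> m.-tuple R) : 'M[R]_(p * m) :=
  n%:R^-1 *: \sum_(i < n)
    (T (y i) *t ((\col_j tnth (u i) j) *m (\col_j tnth (u i) j)^T)).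

(* Since [invmx] is total, both inverses are required to be genuine ones, and
   the expectation to be that of an integrable matrix. *)
Definition self_consistent q p (law_y : probability (q.-tuple R) R)
    (T : q.-tuple R -> 'M[R]_p) (alpha : R) (M : R[i] -> 'M[R[i]]_p) : Prop :=
  forall z, Cplus z ->
    let D y := 1%:M + (alpha^-1)%:C *: (M z *m toC (T y)) in
    let G y := toC (T y) *m invmx (D y) in
    [/\ M z \in unitmx,
        {ae law_y, forall y, D y \in unitmx},
        forall i j, integrableC law_y (fun y => G y i j)
      & invmx (M z) =
          - z%:M + \matrix_(i, j) integralC law_y (fun y => G y i j)].

(* Meant for symmetric A, where the diagonal given by the spectral theorem
   lists the eigenvalues with multiplicity and is real. *)
Definition eigenvalues N (A : 'M[R]_N) : seq R :=
  [seq complex.Re (spectral_diag (toC A) ord0 i) | i <- enum 'I_N].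

Definition empirical_spectral_measure N (A : 'M[R]_N) :
    {measure set R -> \bar R} :=
  mscale (N%:R^-1)%:nng (msum (fun k => \d_(nth 0 (eigenvalues A) k)) N).

Definition weak_cvg (mun : nat -> {measure set R -> \bar R})
    (mu : {measure set R -> \bar R}) : Prop :=
  forall f : R -> R, continuous f -> (exists c : R, forall x, `|f x| <= c) ->
    \int[mun n]_x f x @[n --> \oo] --> \int[mu]_x f x.

Definition compactly_supported (mu : {measure set R -> \bar R}) : Prop :=
  exists2 K : set R, compact K & mu (~` K) = 0%E.

Definition stieltjes (mu : {measure set R -> \bar R}) (z : R[i]) : R[i] :=
  integralC mu (fun x : R => (x%:C - z)^-1).

End MatrixFunctions.

(* Main.v *)
(* The equation reads M = Phi(M), with Phi(M)^-1 = -z + E[K(M, T)], where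
   K(M, T) = T (1 + M T / alpha)^-1. On the matrices with positive imaginary part
   Phi is a strict contraction for the distance under which X = M - M' has size N
   when 2 Re a*Xb <= N (Im a*Ma + Im b*M'b). This gives existence and uniqueness
   of the solution M(z), and shows that approximate solutions are close to it.

   Removing one sample from P_n changes its resolvent by a perturbation of rank at
   most p. By the Woodbury identity M_n(z) is therefore an approximate solution
   as soon as the quadratic forms of u_i in the resolvent without the i-th sample
   concentrate around their partial traces on average over i, and the empirical
   mean of K(M(z), T(y_i)) is close to its expectation. Both averages have fourth
   moments O(n^-2), which is summable, so no relation between the samples of
   different n is needed for almost sure convergence. Uniform power series
   expansions of resolvents then give locally uniform convergence and analyticity.

   The Poisson kernel is the imaginary part of (x - z)^-1, and Lipschitz functions
   are approximated by combinations of Poisson kernels: the spectral means of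
   such functions converge to limits determined by p^-1 tr M, which define the
   distribution function of mu. Far from the origin the fixed-point equation forces
   Im M(x + i eta) = O(eta), hence mu([x - h, x + h]) = O(h^2), so mu vanishes
   there. *)

Require Import Defs.
From HB Require Import structures.
From mathcomp Require Import all_boot all_order all_algebra.
From mathcomp Require Import all_classical all_reals all_analysis.
From mathcomp Require Import complex mxtens spectral sesquilinear.
From mathcomp Require Import measurable_realfun ring lra.

Set Implicit Arguments.
Unset Strict Implicit.
Unset Printing Implicit Defensive.

Import Order.TTheory GRing.Theory Num.Theory.
Import numFieldNormedType.Exports.

Local Open Scope classical_set_scope.
Local Open Scope ring_scope.
Local Open Scope complex_scope.
Local Open Scope sesquilinear_scope.

(** * Complex numbers and the Frobenius norm *)

(** All matrices M compared below satisfy Im M >= eta M M^*, where eta = Im z. Resolvents of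
    Hermitian matrices do, partial traces and Phi preserve this, and it yields |M| <= 1/eta, the
    invertibility of 1 + M T / alpha and a bound on K(M, T) whatever the size of T / alpha. The
    contraction is strict because the term -z of Phi(M)^-1 carries a fixed share of its imaginary
    part. The distance depends on the two points compared, so instead of a fixed-point theorem in
    one metric space, bounds are followed through one application of Phi at a time.

    Phi is built from an abstract mean: the finite matrix and the limit are then both approximate
    fixed points of one map, that of the empirical mean over the T(y_i).

    Two quantities lack a uniform bound. T is bounded only almost everywhere and is truncated. The
    squared length of u_i can be large; a long sample is charged to its own deviation from m, so
    that no event is excluded and the estimates up to the averages are deterministic.

    Pointwise limits of analytic functions are upgraded by recovering Taylor coefficients from
    values at real increments, with remainders uniform in n. *)

Section ComplexNumbers.
Variable R : realType.
Implicit Types (z w : R[i]).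
Local Notation nc := (@ComplexField.Normc.normc R).

Lemma ReD z w : complex.Re (z + w) = complex.Re z + complex.Re w.
Proof. by case: z => a b; case: w. Qed.
Lemma ImD z w : complex.Im (z + w) = complex.Im z + complex.Im w.
Proof. by case: z => a b; case: w. Qed.
Lemma ReN z : complex.Re (- z) = - complex.Re z. Proof. by case: z. Qed.
Lemma ImN z : complex.Im (- z) = - complex.Im z. Proof. by case: z. Qed.
Lemma ReM z w : complex.Re (z * w) = complex.Re z * complex.Re w - complex.Im z * complex.Im w.
Proof. by case: z => a b; case: w. Qed.
Lemma ImM z w : complex.Im (z * w) = complex.Re z * complex.Im w + complex.Im z * complex.Re w.
Proof. by case: z => a b; case: w => c d /=. Qed.
Lemma ReJ z : complex.Re (z^*)%R = complex.Re z. Proof. by case: z. Qed.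
Lemma ImJ z : complex.Im (z^*)%R = - complex.Im z. Proof. by case: z. Qed.
Lemma ReZ (a : R) z : complex.Re (a%:C * z) = a * complex.Re z.
Proof. by rewrite ReM /= mul0r subr0. Qed.
Lemma ImZ (a : R) z : complex.Im (a%:C * z) = a * complex.Im z.
Proof. by rewrite ImM /= mul0r addr0. Qed.
Lemma Re_sum (I : Type) (r : seq I) (P : pred I) (f : I -> R[i]) :
  complex.Re (\sum_(i <- r | P i) f i) = \sum_(i <- r | P i) complex.Re (f i).
Proof. by apply: (big_morph _ ReD). Qed.
Lemma Im_sum (I : Type) (r : seq I) (P : pred I) (f : I -> R[i]) :
  complex.Im (\sum_(i <- r | P i) f i) = \sum_(i <- r | P i) complex.Im (f i).
Proof. by apply: (big_morph _ ImD). Qed.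
Lemma complex_eq z w : complex.Re z = complex.Re w -> complex.Im z = complex.Im w -> z = w.
Proof. by case: z => a b; case: w => c d /= -> ->. Qed.

Lemma nc_ge0 z : 0 <= nc z. Proof. by case: z => a b /=; rewrite sqrtr_ge0. Qed.
Lemma nc2 z : nc z ^+ 2 = complex.Re z ^+ 2 + complex.Im z ^+ 2.
Proof. by case: z => a b /=; rewrite sqr_sqrtr // addr_ge0 ?sqr_ge0. Qed.
Lemma ncM z w : nc (z * w) = nc z * nc w.
Proof. exact: ComplexField.Normc.normcM. Qed.
Lemma ncD z w : nc (z + w) <= nc z + nc w. Proof. exact: le_normcD. Qed.
Lemma ncN z : nc (- z) = nc z. Proof. exact: normcN. Qed.
Lemma ncJ z : nc (z^*)%R = nc z. Proof. by case: z => a b /=; rewrite sqrrN. Qed.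
Lemma nc0 : nc 0 = 0. Proof. exact: ComplexField.Normc.normc0. Qed.
Lemma nc1 : nc 1 = 1. Proof. exact: ComplexField.Normc.normc1. Qed.
Lemma nc_eq0 z : nc z = 0 -> z = 0. Proof. exact: ComplexField.Normc.eq0_normc. Qed.
Lemma ncV z : nc z^-1 = (nc z)^-1. Proof. exact: ComplexField.Normc.normcV. Qed.
Lemma ncX z n : nc (z ^+ n) = nc z ^+ n.
Proof. by elim: n => [|n IH]; rewrite ?expr0 ?nc1 // !exprS ncM IH. Qed.
Lemma nc_real (a : R) : nc a%:C = `|a|.
Proof. by rewrite /= expr0n addr0 sqrtr_sqr. Qed.
Lemma nc_norm z : `|z| = (nc z)%:C. Proof. by rewrite normc_def; case: z. Qed.
Lemma nc_Re z : `|complex.Re z| <= nc z.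
Proof.
case: z => a b /=; rewrite -sqrtr_sqr ler_sqrt ?addr_ge0 ?sqr_ge0 //.
by rewrite lerDl sqr_ge0.
Qed.
Lemma nc_Im z : `|complex.Im z| <= nc z.
Proof.
case: z => a b /=; rewrite -sqrtr_sqr ler_sqrt ?addr_ge0 ?sqr_ge0 //.
by rewrite lerDr sqr_ge0.
Qed.
Lemma nc_le z : nc z <= `|complex.Re z| + `|complex.Im z|.
Proof.
have -> : z = (complex.Re z)%:C + 'i%C * (complex.Im z)%:C by exact: complexE.
apply: (le_trans (ncD _ _)); rewrite ncM !nc_real.
have -> : nc 'i%C = 1 by rewrite /= expr0n expr1n add0r sqrtr1.
by rewrite mul1r ReD ImD ReM ImM /= !(mul0r, mul1r, mulr0, subr0, add0r, addr0).
Qed.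
Lemma nc_sum (I : Type) (r : seq I) (P : pred I) (f : I -> R[i]) :
  nc (\sum_(i <- r | P i) f i) <= \sum_(i <- r | P i) nc (f i).
Proof.
elim/big_rec2: _ => [|i y1 y2 _ H]; first by rewrite nc0.
by apply: (le_trans (ncD _ _)); rewrite lerD2l.
Qed.
Lemma mulJz z : (z^*)%R * z = (nc z ^+ 2)%:C.
Proof.
apply: complex_eq; first by rewrite ReM ReJ ImJ nc2 /=; ring.
by rewrite ImM ReJ ImJ /=; ring.
Qed.

Lemma conj_real (a : R) : ((a%:C)^*)%R = a%:C :> R[i].
Proof. by apply: complex_eq; rewrite ?ReJ ?ImJ //= oppr0. Qed.

Lemma inv_le_nc z : complex.Im z != 0 -> nc z^-1 <= `|complex.Im z|^-1.
Proof.
move=> h; rewrite ncV lef_pV2 ?nc_Im // posrE ?normr_gt0 //.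
by apply: lt_le_trans (nc_Im z); rewrite normr_gt0.
Qed.

End ComplexNumbers.

Section EuclideanSums.
Variable R : realType.
Variables (I : finType) (x y : I -> R).

(** Y (X Y - Z^2) is the sum of the squares of Y x_i - Z y_i. When Y = 0 every y_i vanishes. *)
Lemma cauchy_schwarz_sum :
  (\sum_i x i * y i) ^+ 2 <= (\sum_i x i ^+ 2) * (\sum_i y i ^+ 2).
Proof.
set Z := \sum_i x i * y i; set X := \sum_i x i ^+ 2; set Y := \sum_i y i ^+ 2.
have Y0 : 0 <= Y by apply: sumr_ge0 => i _; apply: sqr_ge0.
have H : 0 <= Y * (X * Y - Z ^+ 2).
  have E a b : \sum_i (a * x i - b * y i) ^+ 2 = a ^+ 2 * X - a * b *+ 2 * Z + b ^+ 2 * Y.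
    rewrite /X /Y /Z !mulr_sumr -sumrB -big_split /=.
    by apply: eq_bigr => i _; ring.
  have -> : Y * (X * Y - Z ^+ 2) = \sum_i (Y * x i - Z * y i) ^+ 2 by rewrite E; ring.
  by apply: sumr_ge0 => i _; apply: sqr_ge0.
have [Yp|] := ltP 0 Y; first by move: H; rewrite pmulr_rge0 // subr_ge0.
move=> Yn; have Y00 : Y = 0 by apply/le_anti; rewrite Yn Y0.
have y0 i : y i = 0.
  have := @psumr_eq0P R I xpredT (fun i => y i ^+ 2) (fun i _ => sqr_ge0 _) Y00 i isT.
  by move/eqP; rewrite sqrf_eq0 => /eqP.
have -> : Z = 0 by rewrite /Z big1 // => i _; rewrite y0 mulr0.
by rewrite Y00 mulr0 expr0n.
Qed.

Lemma minkowski_sum :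
  Num.sqrt (\sum_i (x i + y i) ^+ 2) <=
  Num.sqrt (\sum_i x i ^+ 2) + Num.sqrt (\sum_i y i ^+ 2).
Proof.
set sx := Num.sqrt (\sum_i x i ^+ 2); set sy := Num.sqrt (\sum_i y i ^+ 2).
have sx0 : 0 <= sx by exact: sqrtr_ge0.
have sy0 : 0 <= sy by exact: sqrtr_ge0.
have X : sx ^+ 2 = \sum_i x i ^+ 2.
  by rewrite sqr_sqrtr // sumr_ge0 // => i _; apply: sqr_ge0.
have Y : sy ^+ 2 = \sum_i y i ^+ 2.
  by rewrite sqr_sqrtr // sumr_ge0 // => i _; apply: sqr_ge0.
have Z : \sum_i x i * y i <= sx * sy.
  apply: (le_trans (ler_norm _)).
  rewrite -(@ler_pXn2r _ 2) ?nnegrE ?mulr_ge0 // real_normK ?num_real //.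
  by rewrite exprMn X Y cauchy_schwarz_sum.
have -> : sx + sy = Num.sqrt ((sx + sy) ^+ 2).
  by rewrite sqrtr_sqr ger0_norm // addr_ge0.
rewrite ler_sqrt ?sqr_ge0 // sqrrD X Y.
have -> : \sum_i (x i + y i) ^+ 2 =
  \sum_i x i ^+ 2 + (\sum_i x i * y i) *+ 2 + \sum_i y i ^+ 2.
  rewrite -sumrMnl -!big_split /=; apply: eq_bigr => i _; ring.
by rewrite lerD2r lerD2l lerMn2r Z orbT.
Qed.

End EuclideanSums.

Section Frobenius.
Variable R : realType.
Local Notation C := R[i].
Local Notation nc := (@ComplexField.Normc.normc R).

(** The Frobenius norm; on columns it is the Euclidean norm, so one function measures vectors and
    matrices. The single sum over pairs of indices lets [minkowski_sum] apply as it stands. *)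
Definition fnorm m n (A : 'M[C]_(m, n)) : R :=
  Num.sqrt (\sum_(k : 'I_m * 'I_n) nc (A k.1 k.2) ^+ 2).

Lemma fnorm_ge0 m n (A : 'M[C]_(m, n)) : 0 <= fnorm A.
Proof. exact: sqrtr_ge0. Qed.
Hint Resolve fnorm_ge0 : core.

Lemma fnorm2 m n (A : 'M[C]_(m, n)) :
  fnorm A ^+ 2 = \sum_i \sum_j nc (A i j) ^+ 2.
Proof.
rewrite /fnorm sqr_sqrtr ?sumr_ge0 // => [|k _]; last exact: sqr_ge0.
by rewrite (pair_bigA _ (fun i j => nc (A i j) ^+ 2)).
Qed.

Lemma ler_fnorm m n m' n' (A : 'M[C]_(m, n)) (B : 'M[C]_(m', n')) (c : R) :
  0 <= c -> fnorm A ^+ 2 <= c ^+ 2 * fnorm B ^+ 2 -> fnorm A <= c * fnorm B.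
Proof.
by move=> c0 h; rewrite -(@ler_pXn2r _ 2) ?nnegrE ?mulr_ge0 // exprMn.
Qed.

Lemma fnorm_entry m n (A : 'M[C]_(m, n)) i j : nc (A i j) <= fnorm A.
Proof.
rewrite -(@ler_pXn2r _ 2) ?nnegrE ?nc_ge0 //.
rewrite /fnorm sqr_sqrtr ?sumr_ge0 // => [|k _]; last exact: sqr_ge0.
by rewrite (bigD1 (i, j)) //= lerDl sumr_ge0 // => k _; exact: sqr_ge0.
Qed.

Lemma fnorm_sum_entries m n (A : 'M[C]_(m, n)) :
  fnorm A <= \sum_(k : 'I_m * 'I_n) nc (A k.1 k.2).
Proof.
have S0 : 0 <= \sum_(k : 'I_m * 'I_n) nc (A k.1 k.2).
  by apply: sumr_ge0 => k _; exact: nc_ge0.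
rewrite -(@ler_pXn2r _ 2) ?nnegrE //.
rewrite /fnorm sqr_sqrtr ?sumr_ge0 // => [|k _]; last exact: sqr_ge0.
rewrite expr2 [leRHS]mulr_suml; apply: ler_sum => k _.
rewrite expr2 ler_wpM2l ?nc_ge0 // (bigD1 k) //= lerDl sumr_ge0 // => l _.
exact: nc_ge0.
Qed.

Lemma fnorm_le_entries m n (A : 'M[C]_(m, n)) (c : R) :
  (forall i j, nc (A i j) <= c) -> fnorm A <= (m * n)%:R * c.
Proof.
move=> h; apply: (le_trans (fnorm_sum_entries A)).
apply: (@le_trans _ _ (\sum_(k : 'I_m * 'I_n) c)); first exact: ler_sum.
by rewrite sumr_const card_prod !card_ord mulr_natl.
Qed.

Lemma fnormD m n (A B : 'M[C]_(m, n)) : fnorm (A + B) <= fnorm A + fnorm B.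
Proof.
apply: le_trans (minkowski_sum (fun k => nc (A k.1 k.2)) (fun k => nc (B k.1 k.2))).
rewrite ler_sqrt; last by apply: sumr_ge0 => k _; exact: sqr_ge0.
apply: ler_sum => k _; rewrite mxE ler_pXn2r ?nnegrE ?addr_ge0 ?nc_ge0 //.
exact: ncD.
Qed.

Lemma fnormZ m n c (A : 'M[C]_(m, n)) : fnorm (c *: A) = nc c * fnorm A.
Proof.
rewrite /fnorm -[nc c in RHS]ger0_norm ?nc_ge0 // -sqrtr_sqr -sqrtrM ?sqr_ge0 //.
congr (Num.sqrt _); rewrite mulr_sumr; apply: eq_bigr => k _.
by rewrite mxE ncM exprMn.
Qed.

Lemma fnormN m n (A : 'M[C]_(m, n)) : fnorm (- A) = fnorm A.
Proof. by rewrite -scaleN1r fnormZ ncN nc1 mul1r. Qed.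

Lemma fnormB m n (A B : 'M[C]_(m, n)) : fnorm (A - B) <= fnorm A + fnorm B.
Proof. by rewrite -(fnormN B); exact: fnormD. Qed.

Lemma fnormBC m n (A B : 'M[C]_(m, n)) : fnorm (A - B) = fnorm (B - A).
Proof. by rewrite -fnormN opprB. Qed.

Lemma fnorm0 m n : fnorm (0 : 'M[C]_(m, n)) = 0.
Proof. by rewrite -(scale0r (0 : 'M[C]_(m, n))) fnormZ nc0 mul0r. Qed.

Lemma fnorm_eq0 m n (A : 'M[C]_(m, n)) : fnorm A = 0 -> A = 0.
Proof.
move=> h; apply/matrixP => i j; rewrite mxE; apply: nc_eq0; apply/le_anti.
by rewrite nc_ge0 andbT -h fnorm_entry.
Qed.

Lemma fnorm_sum m n (I : Type) (r : seq I) (P : pred I) (f : I -> 'M[C]_(m, n)) :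
  fnorm (\sum_(i <- r | P i) f i) <= \sum_(i <- r | P i) fnorm (f i).
Proof.
elim/big_rec2: _ => [|i y1 y2 _ H]; first by rewrite fnorm0.
by apply: (le_trans (fnormD _ _)); rewrite lerD2l.
Qed.

Lemma fnormM m n l (A : 'M[C]_(m, n)) (B : 'M[C]_(n, l)) :
  fnorm (A *m B) <= fnorm A * fnorm B.
Proof.
rewrite -(@ler_pXn2r _ 2) ?nnegrE ?mulr_ge0 // exprMn !fnorm2.
rewrite [X in _ <= _ * X]exchange_big /= mulr_suml; apply: ler_sum => i _.
rewrite mulr_sumr; apply: ler_sum => j _; rewrite mxE.
apply: le_trans (cauchy_schwarz_sum _ _).
rewrite ler_pXn2r ?nnegrE ?nc_ge0 ?sumr_ge0 // => [|k _]; last first.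
  by rewrite mulr_ge0 ?nc_ge0.
by apply: (le_trans (nc_sum _ _ _)); apply: ler_sum => k _; rewrite ncM.
Qed.

Lemma fnorm_adj m n (A : 'M[C]_(m, n)) : fnorm (A ^t*) = fnorm A.
Proof.
apply: (@pexpIrn _ 2) => //; rewrite ?nnegrE // !fnorm2 exchange_big /=.
by apply: eq_bigr => i _; apply: eq_bigr => j _; rewrite !mxE ncJ.
Qed.

Lemma fnorm_scalar n (c : C) : fnorm (c%:M : 'M[C]_n) <= n%:R * nc c.
Proof.
apply: (le_trans (fnorm_sum_entries _)).
rewrite -(pair_bigA _ (fun i j => nc ((c%:M : 'M[C]_n) i j))) /=.
rewrite (eq_bigr (fun=> nc c)) ?sumr_const ?card_ord ?mulr_natl // => i _.
rewrite (bigD1 i) //= big1 ?addr0 => [|j ji]; first by rewrite mxE eqxx mulr1n.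
by rewrite mxE eq_sym (negPf ji) mulr0n nc0.
Qed.

Lemma fnorm_col m n (A : 'M[C]_(m, n)) :
  fnorm A ^+ 2 = \sum_j fnorm (col j A) ^+ 2.
Proof.
rewrite fnorm2 exchange_big /=; apply: eq_bigr => j _.
by rewrite fnorm2; apply: eq_bigr => i _; rewrite big_ord1 mxE.
Qed.

Lemma fnorm_cV n (v : 'cV[C]_n) : fnorm v ^+ 2 = \sum_i nc (v i 0) ^+ 2.
Proof. by rewrite fnorm2; apply: eq_bigr => i _; rewrite big_ord1. Qed.

Lemma ctrM m n l (A : 'M[C]_(m, n)) (B : 'M[C]_(n, l)) :
  (A *m B) ^t* = B ^t* *m A ^t*.
Proof. by rewrite trmx_mul map_mxM. Qed.
Lemma ctrD m n (A B : 'M[C]_(m, n)) : (A + B) ^t* = A ^t* + B ^t*.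
Proof. by rewrite linearD /= map_mxD. Qed.
Lemma ctrN m n (A : 'M[C]_(m, n)) : (- A) ^t* = - A ^t*.
Proof. by rewrite linearN /= map_mxN. Qed.
Lemma ctrZ m n (c : C) (A : 'M[C]_(m, n)) : (c *: A) ^t* = (c^*)%R *: A ^t*.
Proof. by rewrite linearZ /= map_mxZ. Qed.
Lemma ctr1 n : (1%:M : 'M[C]_n) ^t* = 1%:M.
Proof. by rewrite trmx1 map_mx1. Qed.
Lemma ctr_unit n (A : 'M[C]_n) : (A ^t* \in unitmx) = (A \in unitmx).
Proof. by rewrite map_unitmx unitmx_tr. Qed.
Lemma ctr_inv n (A : 'M[C]_n) : (invmx A) ^t* = invmx (A ^t*).
Proof. by rewrite trmx_inv map_invmx. Qed.

Definition cdot n (a b : 'cV[C]_n) : C := (a ^t* *m b) 0 0.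

Lemma cdotE n (a b : 'cV[C]_n) : cdot a b = \sum_i ((a i 0)^*)%R * b i 0.
Proof. by rewrite /cdot mxE; apply: eq_bigr => i _; rewrite !mxE. Qed.
Lemma cdotDl n (a b c : 'cV[C]_n) : cdot (a + b) c = cdot a c + cdot b c.
Proof. by rewrite /cdot ctrD mulmxDl mxE. Qed.
Lemma cdotDr n (a b c : 'cV[C]_n) : cdot a (b + c) = cdot a b + cdot a c.
Proof. by rewrite /cdot mulmxDr mxE. Qed.
Lemma cdotNr n (a b : 'cV[C]_n) : cdot a (- b) = - cdot a b.
Proof. by rewrite /cdot mulmxN mxE. Qed.
Lemma cdotZl n c (a b : 'cV[C]_n) : cdot (c *: a) b = (c^*)%R * cdot a b.
Proof. by rewrite /cdot ctrZ -scalemxAl mxE. Qed.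
Lemma cdotZr n c (a b : 'cV[C]_n) : cdot a (c *: b) = c * cdot a b.
Proof. by rewrite /cdot -scalemxAr mxE. Qed.
Lemma cdot0r n (a : 'cV[C]_n) : cdot a 0 = 0.
Proof. by rewrite /cdot mulmx0 mxE. Qed.
Lemma cdot_sumr n (I : Type) (r : seq I) (P : pred I) (a : 'cV[C]_n) (f : I -> 'cV[C]_n) :
  cdot a (\sum_(i <- r | P i) f i) = \sum_(i <- r | P i) cdot a (f i).
Proof. by rewrite /cdot mulmx_sumr summxE. Qed.
Lemma cdotC n (a b : 'cV[C]_n) : cdot b a = ((cdot a b)^*)%R.
Proof.
rewrite !cdotE rmorph_sum; apply: eq_bigr => i _.
by rewrite rmorphM /= conjCK mulrC.
Qed.
Lemma cdot_adj m n (A : 'M[C]_(m, n)) a b : cdot a (A *m b) = cdot (A ^t* *m a) b.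
Proof. by rewrite /cdot ctrM trmxCK mulmxA. Qed.
Lemma cdot_adjl m n (A : 'M[C]_(m, n)) a b : cdot (A *m a) b = cdot a (A ^t* *m b).
Proof. by rewrite cdot_adj trmxCK. Qed.
Lemma cdotaa n (a : 'cV[C]_n) : cdot a a = (fnorm a ^+ 2)%:C.
Proof.
rewrite cdotE fnorm_cV rmorph_sum; apply: eq_bigr => i _; exact: mulJz.
Qed.
Lemma cdot_le n (a b : 'cV[C]_n) : nc (cdot a b) <= fnorm a * fnorm b.
Proof.
apply: (le_trans (fnorm_entry _ _ _)); apply: (le_trans (fnormM _ _)).
by rewrite fnorm_adj.
Qed.
Lemma Re_cdot_le n (a b : 'cV[C]_n) : complex.Re (cdot a b) <= fnorm a * fnorm b.
Proof.
by apply: le_trans (cdot_le a b); apply: le_trans (ler_norm _) (nc_Re _).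
Qed.
Lemma Im_cdot_le n (a b : 'cV[C]_n) : `|complex.Im (cdot a b)| <= fnorm a * fnorm b.
Proof. exact: le_trans (nc_Im _) (cdot_le a b). Qed.
Lemma cdot_delta n (A : 'M[C]_n) i j :
  cdot (delta_mx i 0) (A *m delta_mx j 0) = A i j.
Proof.
rewrite cdotE (bigD1 i) //= big1 ?addr0 => [|k ki]; last first.
  by rewrite mxE (negPf ki) rmorph0 mul0r.
rewrite mxE !eqxx rmorph1 mul1r mxE (bigD1 j) //= big1 ?addr0 => [|k kj].
  by rewrite mxE !eqxx mulr1.
by rewrite mxE (negPf kj) mulr0.
Qed.
Lemma fnorm_delta n (i : 'I_n) : fnorm (delta_mx i 0 : 'cV[C]_n) = 1.
Proof.
apply: (@pexpIrn _ 2) => //; rewrite ?nnegrE // fnorm_cV (bigD1 i) //=.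
rewrite big1 ?addr0 => [|k ki]; last by rewrite mxE (negPf ki) nc0 expr0n.
by rewrite mxE !eqxx nc1 expr1n.
Qed.

(** An operator norm bound kept as a predicate, so that no supremum occurs in the estimates. *)
Definition opb m n (X : 'M[C]_(m, n)) (c : R) :=
  forall v : 'cV[C]_n, fnorm (X *m v) <= c * fnorm v.

(** |X^* v|^2 = <v, X X^* v> <= c |v| |X^* v|, and one factor |X^* v| cancels. *)
Lemma opb_adj m n (X : 'M[C]_(m, n)) (c : R) : 0 <= c -> opb X c -> opb (X ^t*) c.
Proof.
move=> c0 h v; have [->|nz] := eqVneq (fnorm (X ^t* *m v)) 0; first by rewrite mulr_ge0.
have p : 0 < fnorm (X ^t* *m v) by rewrite lt_neqAle eq_sym nz fnorm_ge0.
rewrite -(ler_pM2r p) -expr2.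
have -> : fnorm (X ^t* *m v) ^+ 2 = complex.Re (cdot v (X *m (X ^t* *m v))).
  by rewrite cdot_adj cdotaa.
apply: (le_trans (Re_cdot_le _ _)).
by rewrite (mulrC c) -mulrA ler_wpM2l.
Qed.

Lemma opb_mul m n l (X : 'M[C]_(m, n)) (B : 'M[C]_(n, l)) (c : R) : 0 <= c ->
  opb X c -> fnorm (X *m B) <= c * fnorm B.
Proof.
move=> c0 h; apply: ler_fnorm => //; rewrite !fnorm_col mulr_sumr.
apply: ler_sum => j _; rewrite -exprMn ler_pXn2r ?nnegrE ?mulr_ge0 //.
by rewrite !colE -mulmxA; exact: h.
Qed.

Lemma opb_mulr m n l (X : 'M[C]_(m, n)) (B : 'M[C]_(l, m)) (c : R) : 0 <= c ->
  opb X c -> fnorm (B *m X) <= c * fnorm B.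
Proof.
move=> c0 h; rewrite -fnorm_adj ctrM -(fnorm_adj B).
by apply: opb_mul => //; exact: opb_adj.
Qed.

Lemma opb_entry n (X : 'M[C]_n) (c : R) i j : opb X c -> nc (X i j) <= c.
Proof.
move=> h; rewrite -cdot_delta; apply: (le_trans (cdot_le _ _)).
by rewrite fnorm_delta mul1r; apply: (le_trans (h _)); rewrite fnorm_delta mulr1.
Qed.

Lemma opb_fnorm n (X : 'M[C]_n) (c : R) : opb X c -> fnorm X <= (n * n)%:R * c.
Proof. by move=> h; apply: fnorm_le_entries => i j; exact: opb_entry. Qed.

Lemma fnorm_opb m n (X : 'M[C]_(m, n)) : opb X (fnorm X).
Proof. by move=> v; exact: fnormM. Qed.

Lemma opb_comp m n l (X : 'M[C]_(m, n)) (Y : 'M[C]_(n, l)) (c d : R) :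
  0 <= c -> opb X c -> opb Y d -> opb (X *m Y) (c * d).
Proof.
move=> c0 hX hY v; rewrite -mulmxA; apply: (le_trans (hX _)).
by rewrite -mulrA ler_wpM2l.
Qed.

Lemma inj_unitmx n (A : 'M[C]_n) :
  (forall v : 'cV[C]_n, A *m v = 0 -> v = 0) -> A \in unitmx.
Proof.
move=> h; rewrite -unitmx_tr -row_free_unit; apply/row_freeP.
have : kermx A^T == 0.
  apply/eqP/row_matrixP => i; rewrite row0.
  have /h : A *m (row i (kermx A^T))^T = 0.
    by rewrite -[A]trmxK -trmx_mul trmxK -row_mul mulmx_ker row0 trmx0.
  by move/(congr1 trmx); rewrite trmxK trmx0.
by rewrite kermx_eq0 => /row_freeP.
Qed.

(* the quadratic form of the Hermitian matrix [Immx M] *)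
Definition imq n (M : 'M[C]_n) (a : 'cV[C]_n) : R := complex.Im (cdot a (M *m a)).

Lemma imq_adj n (M : 'M[C]_n) a : imq (M ^t*) a = - imq M a.
Proof. by rewrite /imq cdot_adj trmxCK cdotC ImJ. Qed.

Lemma imqE n (M : 'M[C]_n) a : imq M a = - complex.Im (cdot (M *m a) a).
Proof. by rewrite /imq cdotC ImJ. Qed.

Lemma imqD n (M N : 'M[C]_n) a : imq (M + N) a = imq M a + imq N a.
Proof. by rewrite /imq mulmxDl cdotDr ImD. Qed.
Lemma imqN n (M : 'M[C]_n) a : imq (- M) a = - imq M a.
Proof. by rewrite /imq mulNmx cdotNr ImN. Qed.
Lemma imqZ n (t : R) (M : 'M[C]_n) a : imq (t%:C *: M) a = t * imq M a.
Proof. by rewrite /imq -scalemxAl cdotZr ImZ. Qed.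
Lemma imq_scalar n (z : C) (a : 'cV[C]_n) :
  imq z%:M a = complex.Im z * fnorm a ^+ 2.
Proof. by rewrite /imq mul_scalar_mx cdotZr cdotaa ImM /= mulr0 add0r. Qed.
Lemma imq_sum n (I : Type) (r : seq I) (P : pred I) (f : I -> 'M[C]_n) a :
  imq (\sum_(i <- r | P i) f i) a = \sum_(i <- r | P i) imq (f i) a.
Proof. by rewrite /imq mulmx_suml cdot_sumr Im_sum. Qed.
Lemma imq_le n (M : 'M[C]_n) a : `|imq M a| <= fnorm M * fnorm a ^+ 2.
Proof.
apply: (le_trans (Im_cdot_le _ _)); rewrite expr2 mulrCA ler_wpM2l //.
exact: fnormM.
Qed.
Lemma imq_herm n (H : 'M[C]_n) a : H ^t* = H -> imq H a = 0.
Proof. by move=> h; have := imq_adj H a; rewrite h => /eqP; rewrite -addr_eq0 -mulr2n mulrn_eq0 => /eqP. Qed.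

End Frobenius.
#[global] Hint Extern 0 (is_true (0 <= fnorm _)) => solve [apply: fnorm_ge0] : core.

Global Opaque fnorm cdot.

(** * The self-consistent map *)

(** A self-improving bound. After enlarging N0 to at least L = e / (1 - k), the iterates of N -> k N
    + e are L + k^n D and decrease to L, which is approached but not reached: hence the slack t. The
    limit forgets N0, so any crude initial bound will do. *)
Lemma affine_improve (R : realType) (P : R -> Prop) (k e N0 : R) :
  0 <= k < 1 -> P N0 -> (forall N N', N <= N' -> P N -> P N') ->
  (forall N, e / (1 - k) <= N -> P N -> P (k * N + e)) ->
  forall t, 0 < t -> P (e / (1 - k) + t).
Proof.
move=> /andP[k0 k1] P0 mono step t t0.
have d0 : 0 < 1 - k by rewrite subr_gt0.
set L := e / (1 - k) in step *.
have eL : e = L * (1 - k) by rewrite /L mulfVK // gt_eqF.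
clearbody L.
pose D := Num.max (N0 - L) 0.
have D0 : 0 <= D by rewrite le_max lexx orbT.
have H n : P (L + k ^+ n * D).
  elim: n => [|n IH].
    by rewrite expr0 mul1r; apply: mono P0; rewrite -lerBlDl le_max lexx.
  have -> : L + k ^+ n.+1 * D = k * (L + k ^+ n * D) + e by rewrite eL exprS; ring.
  by apply: step => //; rewrite lerDl mulr_ge0 // exprn_ge0.
have : k ^+ n @[n --> \oo] --> (0 : R) by apply: cvg_expr; rewrite ger0_norm.
have De : 0 < t / (D + 1) by rewrite divr_gt0 // ltr_wpDl.
move/cvgrPdist_lt => /(_ _ De)[n _ /(_ n (leqnn n))].
rewrite sub0r normrN ger0_norm ?exprn_ge0 // => h.
apply: mono (H n); rewrite lerD2l.
have Dp : 0 < D + 1 by rewrite ltr_wpDl.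
move: h; rewrite ltr_pdivlMr // => h; apply: le_trans (ltW h).
by rewrite ler_wpM2l ?exprn_ge0 // lerDl.
Qed.

(** The second resolvent identity for the two expressions D1^-1 T and T D2^-1 of the kernel. *)
Lemma invmx_diff (F : comUnitRingType) p (T X D1 D2 : 'M[F]_p) :
  D1 \in unitmx -> D2 \in unitmx -> T *m D2 - D1 *m T = T *m X *m T ->
  invmx D1 *m T - T *m invmx D2 = invmx D1 *m T *m X *m (T *m invmx D2).
Proof.
move=> u1 u2 e; apply: (can_inj (mulKmx u1)); apply: (can_inj (mulmxK u2)).
rewrite mulmxBr (mulKVmx u1) mulmxBl -!mulmxA (mulVmx u2) mulmx1 (mulKVmx u1).
by rewrite e mulmxA.
Qed.

Lemma invmx_sub (F : comUnitRingType) p (A B : 'M[F]_p) :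
  A \in unitmx -> B \in unitmx -> invmx A - invmx B = invmx A *m (B - A) *m invmx B.
Proof.
move=> uA uB; rewrite mulmxBr mulmxBl (mulVmx uA) mul1mx -mulmxA (mulmxV uB).
by rewrite mulmx1.
Qed.

Lemma mulmx_diff (F : comUnitRingType) p (T M1 M2 : 'M[F]_p) (b1 b2 : F) :
  T *m (1%:M + b2 *: (M2 *m T)) - (1%:M + b1 *: (T *m M1)) *m T =
  T *m (b2 *: M2 - b1 *: M1) *m T.
Proof.
rewrite mulmxDr mulmx1 mulmxDl mul1mx opprD addrACA subrr add0r.
by rewrite mulmxBr mulmxBl -!scalemxAr -!scalemxAl !mulmxA.
Qed.

(** * Matrices with Im M >= eta M M^*, and the kernel K(M, T) *)

Section Herglotz.
Variable R : realType.
Local Notation C := R[i].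
Local Notation nc := (@ComplexField.Normc.normc R).

(* Im M >= eta M M^*, a class preserved by the self-consistent map. *)
Definition herg p (eta : R) (M : 'M[C]_p) :=
  forall a : 'cV[C]_p, eta * fnorm (M ^t* *m a) ^+ 2 <= imq M a.

(** By Cauchy-Schwarz, eta |M^* a|^2 <= Im <M^* a, a> <= |M^* a| |a|; one factor cancels. *)
Lemma herg_opb_adj p (eta : R) (M : 'M[C]_p) : 0 < eta -> herg eta M -> opb (M ^t*) eta^-1.
Proof.
move=> e0 h a; have := h a; rewrite /imq cdot_adj => h1.
have := le_trans h1 (le_trans (ler_norm _) (Im_cdot_le _ _)) => {}h1.
have [->|nz] := eqVneq (fnorm (M ^t* *m a)) 0.
  by rewrite mulr_ge0 ?invr_ge0 ?(ltW e0).
have q : 0 < fnorm (M ^t* *m a) by rewrite lt_neqAle eq_sym nz fnorm_ge0.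
rewrite -(ler_pM2l e0) mulrA mulfV ?gt_eqF // mul1r.
by rewrite -(ler_pM2l q) mulrCA -expr2.
Qed.

Lemma herg_opb p (eta : R) (M : 'M[C]_p) : 0 < eta -> herg eta M -> opb M eta^-1.
Proof.
move=> e0 h; rewrite -[M]trmxCK; apply: opb_adj; first by rewrite invr_ge0 ltW.
exact: herg_opb_adj.
Qed.

Lemma herg_ge0 p (eta : R) (M : 'M[C]_p) a : 0 < eta -> herg eta M -> 0 <= imq M a.
Proof.
by move=> e0 h; apply: le_trans (h a); rewrite mulr_ge0 ?sqr_ge0 // ltW.
Qed.

Lemma opb_imq p (c : R) (M : 'M[C]_p) a : opb M c -> imq M a <= c * fnorm a ^+ 2.
Proof.
move=> h; apply: (le_trans (le_trans (ler_norm _) (Im_cdot_le _ _))).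
by apply: le_trans (ler_wpM2l (fnorm_ge0 a) (h a)) _; rewrite expr2 mulrCA.
Qed.

(** Substituting a = A b turns the imaginary form of A^-1 into minus that of A, and a vector of the
    kernel of A has a zero form. The two versions, through A^-1 and through its adjoint, serve the
    right and the left factor in the contraction estimate. *)
Lemma accretive_inv p (eta : R) (A : 'M[C]_p) : 0 < eta ->
  (forall a, imq A a <= - (eta * fnorm a ^+ 2)) ->
  [/\ A \in unitmx, herg eta (invmx A),
      forall a, imq (invmx A) a = - imq A ((invmx A) ^t* *m a) &
      forall a, imq (invmx A) a = - imq A (invmx A *m a)].
Proof.
move=> e0 h.
have uA : A \in unitmx.
  apply: inj_unitmx => v Av; have := h v.
  rewrite /imq Av cdot0r /= oppr_ge0 => H.
  apply: fnorm_eq0; apply/eqP; rewrite -sqrf_eq0.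
  by rewrite eq_le sqr_ge0 andbT -(pmulr_rle0 _ e0).
have uA' : A ^t* \in unitmx by rewrite ctr_unit.
have E1 a : imq (invmx A) a = - imq A ((invmx A) ^t* *m a).
  rewrite imqE; congr (- _); rewrite ctr_inv.
  have {1 2}-> : a = A ^t* *m (invmx (A ^t*) *m a) by rewrite mulmxA mulmxV // mul1mx.
  set b := invmx _ *m a; rewrite /imq.
  by rewrite -cdot_adjl mulmxA (mulmxV uA) mul1mx cdot_adjl trmxCK.
have E2 a : imq (invmx A) a = - imq A (invmx A *m a).
  set b := invmx A *m a.
  have -> : a = A *m b by rewrite /b mulmxA mulmxV // mul1mx.
  by rewrite imqE mulmxA (mulVmx uA) mul1mx /imq cdotC ImJ.
split=> // a; rewrite E1.
have := h ((invmx A)^t* *m a); lra.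
Qed.

(** The kernel of the self-consistent equation. [beta] is 1/alpha in the limit and the ratio m/n for
    finite samples. *)
Definition Kf p (beta : R) (M T : 'M[C]_p) : 'M[C]_p :=
  T *m invmx (1%:M + beta%:C *: (M *m T)).

Lemma KfE p (beta : R) (M T : 'M[C]_p) : Kf beta M T = T *m invmx (1%:M + beta%:C *: (M *m T)).
Proof. by []. Qed.

Section Kernel.
Variables (p : nat) (beta eta : R) (M T : 'M[C]_p).
Hypotheses (beta_gt0 : 0 < beta) (eta_gt0 : 0 < eta) (hM : herg eta M).
Hypothesis Therm : T ^t* = T.
Local Notation D := (1%:M + beta%:C *: (M *m T)).
Local Notation D' := (1%:M + beta%:C *: (T *m M)).

Lemma cdot_herm_Im a : complex.Im (cdot a (T *m a)) = 0.
Proof. exact: (imq_herm a Therm). Qed.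

(** Let x + beta M^* v = 0 with v = T x. Pairing with v, where <v, x> is real, leaves Im <v, M v> =
    0; the class inequality then forces M^* v = 0, hence x = 0. *)
Lemma Kf_unit' : D' \in unitmx.
Proof.
rewrite -ctr_unit; apply: inj_unitmx => x.
rewrite ctrD ctr1 ctrZ ctrM Therm mulmxDl mul1mx -scalemxAl -mulmxA.
rewrite conj_real.
set v := T *m x => e.
have q0 : imq M v = 0.
  have : complex.Im (cdot v (x + beta%:C *: (M ^t* *m v))) = 0.
    by rewrite e cdot0r.
  rewrite cdotDr cdotZr ImD ImZ -cdot_adjl -[X in cdot X v]/(M *m v).
  have -> : complex.Im (cdot v x) = 0.
    by rewrite /v cdot_adjl Therm cdot_herm_Im.
  by rewrite add0r cdotC ImJ -/(imq M v) => /eqP; rewrite mulrN oppr_eq0 mulf_eq0 gt_eqF //= => /eqP.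
have m0 : M ^t* *m v = 0.
  apply: fnorm_eq0; apply/eqP; rewrite -sqrf_eq0 eq_le sqr_ge0 andbT.
  by rewrite -(pmulr_rle0 _ eta_gt0) -q0.
by move: e; rewrite m0 scaler0 addr0.
Qed.

(** The push-through identity: the inverse of 1 + beta M T is 1 - beta M (1 + beta T M)^-1 T. *)
Lemma Kf_unit : D \in unitmx.
Proof.
suff /mulmx1_unit[] : D *m (1%:M - beta%:C *: (M *m invmx D' *m T)) = 1%:M by [].
have HD : M *m D' = D *m M.
  by rewrite mulmxDr mulmxDl mulmx1 mul1mx -scalemxAr -scalemxAl mulmxA.
rewrite mulmxBr mulmx1 -scalemxAr !mulmxA -HD -(mulmxA M) mulmxV ?Kf_unit' //.
by rewrite mulmx1 addrK.
Qed.

Lemma KfE' : Kf beta M T = invmx D' *m T.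
Proof.
rewrite /Kf -/D; apply: (can_inj (mulKmx Kf_unit')).
rewrite mulKVmx ?Kf_unit' // mulmxA.
have -> : D' *m T = T *m D.
  by rewrite mulmxDr mulmxDl mulmx1 mul1mx -scalemxAr -scalemxAl mulmxA.
by rewrite mulmxK ?Kf_unit.
Qed.

(** With w = (1 + beta M T)^-1 a and k = T w, one has a = w + beta M k, and <w, T w> is real. Only
    the term in M survives: Im K = - beta K^* (Im M) K. This identity feeds the imaginary part of M
    back into that of Phi(M). *)
Lemma imq_Kf a : imq (Kf beta M T) a = - (beta * imq M (Kf beta M T *m a)).
Proof.
rewrite /imq /Kf -/D -!mulmxA; set w := invmx D *m a.
have -> : a = D *m w by rewrite /w mulKVmx // Kf_unit.
set k := T *m w.
have -> : D *m w = w + beta%:C *: (M *m k).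
  by rewrite mulmxDl mul1mx -scalemxAl -mulmxA.
rewrite cdotDl ImD cdot_herm_Im add0r cdotC ImJ cdotZr ImZ.
by [].
Qed.

Lemma Kf_adjE (b : 'cV_p) : (Kf beta M T) ^t* *m b =
  T *m (b - beta%:C *: (M ^t* *m ((Kf beta M T) ^t* *m b))).
Proof.
have e : (Kf beta M T) ^t* = T *m invmx (D' ^t*).
  by rewrite KfE' ctrM Therm ctr_inv.
rewrite e -mulmxA; set w := invmx (D' ^t*) *m b.
have {1}-> : b = D' ^t* *m w by rewrite /w mulKVmx // ctr_unit Kf_unit'.
congr (T *m _); rewrite ctrD ctr1 ctrZ ctrM Therm mulmxDl mul1mx -scalemxAl -mulmxA.
rewrite conj_real.
by rewrite -/w addrK.
Qed.

Lemma imq_Kf_adj a : imq (Kf beta M T) a = - (beta * imq M ((Kf beta M T) ^t* *m a)).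
Proof.
rewrite -[imq (Kf _ _ _) a]opprK -imq_adj; congr (- _).
rewrite /imq; set k := _ *m a.
have kE : k = T *m (a - beta%:C *: (M ^t* *m k)) by exact: Kf_adjE.
set w := a - _ in kE.
have {1}-> : a = w + beta%:C *: (M ^t* *m k) by rewrite /w subrK.
rewrite cdotDl ImD {1}kE cdot_herm_Im add0r cdotC ImJ cdotZr ImZ.
by rewrite -cdot_adjl cdotC ImJ; ring.
Qed.

(** With k = K^* b, [imq_Kf_adj] gives beta eta |M^* k|^2 <= |k| |b|. Inserted in k = T (b - beta
    M^* k), Young's inequality lets half of |k| be absorbed on the left, whatever the size of
    beta. *)
Lemma Kf_opb_adj (CT : R) : 0 <= CT -> opb T CT ->
  opb ((Kf beta M T) ^t*) (2 * CT + CT ^+ 2 * beta / eta).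
Proof.
move=> CT0 hT b; set k := _ *m b.
have kE : k = T *m (b - beta%:C *: (M ^t* *m k)) by exact: Kf_adjE.
set x := fnorm k; set y := fnorm b; set m := fnorm (M ^t* *m k).
have x0 : 0 <= x by exact: fnorm_ge0.
have y0 : 0 <= y by exact: fnorm_ge0.
have m0 : 0 <= m by exact: fnorm_ge0.
have h1 : x <= CT * (y + beta * m).
  rewrite /x kE; apply: (le_trans (hT _)); rewrite ler_wpM2l //.
  by apply: (le_trans (fnormB _ _)); rewrite fnormZ nc_real gtr0_norm.
have h2 : beta * eta * m ^+ 2 <= x * y.
  have : beta * imq M k <= x * y.
    have := imq_Kf_adj b; rewrite -/k.
    have := Im_cdot_le k b; rewrite /imq cdot_adj -/k ler_norml => /andP[+ _].
    by rewrite -/x -/y; lra.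
  by apply: le_trans; rewrite -mulrA ler_pM2l //; exact: hM.
have h3 : CT * beta * m <= x / 2 + CT ^+ 2 * beta / eta * y / 2.
  have C2 : 0 <= CT ^+ 2 * beta / eta * y.
    by rewrite !mulr_ge0 ?invr_ge0 ?sqr_ge0 // ltW.
  rewrite -(@ler_pXn2r _ 2) ?nnegrE //; last 2 first.
  - by rewrite !mulr_ge0 // ltW.
  - by rewrite addr_ge0 // mulr_ge0 // invr_ge0.
  have : (CT * beta * m) ^+ 2 <= CT ^+ 2 * beta / eta * y * x.
    have -> : CT ^+ 2 * beta / eta * y * x = (CT ^+ 2 * beta / eta) * (x * y) by ring.
    have -> : (CT * beta * m) ^+ 2 = (CT ^+ 2 * beta / eta) * (beta * eta * m ^+ 2).
      by field; rewrite gt_eqF.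
    by rewrite ler_wpM2l // !mulr_ge0 ?invr_ge0 ?sqr_ge0 // ltW.
  move=> H; apply: (le_trans H); set c := CT ^+ 2 * beta / eta * y.
  have := sqr_ge0 (x / 2 - c / 2); rewrite !expr2; nra.
have := h1; rewrite mulrDr mulrA; move: h3; set c := _ / eta; rewrite -/c.
rewrite mulrDl; lra.
Qed.

End Kernel.

(** The parameters and the class constants may differ: a leave-one-out form with the finite aspect
    ratio is compared with a matrix of the class at the limiting one. *)
Lemma Kf_sub p (b1 b2 : R) (M1 M2 T : 'M[C]_p) (e1 e2 : R) :
  0 < b1 -> 0 < b2 -> 0 < e1 -> 0 < e2 -> herg e1 M1 -> herg e2 M2 -> T ^t* = T ->
  Kf b1 M1 T - Kf b2 M2 T =
  Kf b1 M1 T *m (b2%:C *: M2 - b1%:C *: M1) *m Kf b2 M2 T.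
Proof.
move=> b10 b20 e10 e20 h1 h2 hT.
rewrite (KfE' b10 e10 h1 hT) {2}/Kf.
have u1 := Kf_unit' b10 e10 h1 hT; have u2 := Kf_unit b20 e20 h2 hT.
set D1 := _ + _ in u1 *; set D2 := _ + _ in u2 *.
rewrite [Kf b2 M2 T]/Kf -/D2.
exact: (invmx_diff u1 u2 (mulmx_diff _ _ _ _ _)).
Qed.

End Herglotz.

Global Opaque Kf.

(* Instantiated both by the average over the samples and by the expectation
   over y, so that the same map [Phi] describes finite n and the limit. *)
Record mean_functional (R : realType) (I : Type) := MeanFunctional {
  mdom : (I -> R) -> Prop;
  mean :> (I -> R) -> R;
  mdomD : forall f g, mdom f -> mdom g -> mdom (fun x => f x + g x);
  mdomZ : forall c f, mdom f -> mdom (fun x => c * f x);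
  mdom_cst : forall c, mdom (fun=> c);
  meanD : forall f g, mdom f -> mdom g -> mean (fun x => f x + g x) = mean f + mean g;
  meanZ : forall c f, mdom f -> mean (fun x => c * f x) = c * mean f;
  mean_cst : forall c, mean (fun=> c) = c;
  mean_le : forall f g, mdom f -> mdom g -> (forall x, f x <= g x) -> mean f <= mean g }.

Lemma sub_addl (V : zmodType) (x a b : V) : a - b = (x + a) - (x + b).
Proof. by rewrite opprD addrACA subrr add0r. Qed.

Lemma sub_split (V : zmodType) (x y a b : V) : x - y = (a - b) - ((a - x) - (b - y)).
Proof.
by rewrite -{1}(subKr a x) -{1}(subKr b y) [- (b - _)]opprD addrACA -opprD.
Qed.

Lemma Re_cdot_small (R : realType) p (Z : 'M[R[i]]_p) (eps : R) a b : fnorm Z <= eps ->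
  `|complex.Re (cdot a (Z *m b))| <= eps * (fnorm a * fnorm b).
Proof.
move=> h; apply: (le_trans (le_trans (nc_Re _) (cdot_le _ _))).
rewrite mulrCA ler_wpM2l //; apply: (le_trans (fnormM _ _)).
by rewrite ler_wpM2r.
Qed.

Lemma Re_cdot_perturb (R : realType) p (X1 X2 F1 F2 : 'M[R[i]]_p) (eps : R) a b :
  0 <= eps -> fnorm (F1 - X1) <= eps -> fnorm (F2 - X2) <= eps ->
  2 * complex.Re (cdot a ((X1 - X2) *m b)) <=
  2 * complex.Re (cdot a ((F1 - F2) *m b)) + 2 * eps * (fnorm a ^+ 2 + fnorm b ^+ 2).
Proof.
move=> e0 h1 h2; rewrite (sub_split X1 X2 F1 F2).
have := Re_cdot_small a b h1; have := Re_cdot_small a b h2.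
move: (F1 - X1) (F2 - X2) (F1 - F2) => Z1 Z2 Y.
rewrite !ler_norml 2!mulmxBl !(cdotDr, cdotNr) !(ReD, ReN).
move: (complex.Re _) (complex.Re _) (complex.Re _) => u v w {Z1 Z2 Y h1 h2 X1 X2 F1 F2}.
move=> /andP[n2 n2'] /andP[n1 n1'].
have : eps * (fnorm a * fnorm b) * 2 <= eps * (fnorm a ^+ 2 + fnorm b ^+ 2).
  rewrite -mulrA ler_wpM2l //.
  by have := sqr_ge0 (fnorm a - fnorm b); rewrite sqrrB; lra.
lra.
Qed.

Lemma cdot_sandwich (R : realType) p (A X B : 'M[R[i]]_p) u v :
  cdot u (A *m X *m B *m v) = cdot (A ^t* *m u) (X *m (B *m v)).
Proof. by rewrite -!mulmxA cdot_adj. Qed.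

(** One step of the perturbed contraction. Half of the gap pays for passing from the forms [fa],
    [fb] of Phi(M), Phi(M') to the forms [qa], [qb] of M, M'; the additive error 4 e / c comes from
    A + B <= (2 / c) (qa + qb). *)
Lemma stability_scalar (R : realType) (N c g e A B qa qb fa fb r' r : R) :
  0 <= N -> 0 < c -> 0 < g -> g <= 1 -> 0 <= e -> e <= c * g / 4 -> 0 <= A -> 0 <= B ->
  fa <= qa + e * A -> fb <= qb + e * B -> c / 2 * A <= qa -> c / 2 * B <= qb ->
  r' <= (1 - g) * N * (fa + fb) -> r <= r' + 2 * e * (A + B) ->
  r <= ((1 - g / 2) * N + 4 * e / c) * (qa + qb).
Proof.
move=> N0 c0 g0 g1 e0 eg A0 B0 ha hb ha' hb' h1 h2.
have g1' : 0 <= 1 - g by rewrite subr_ge0.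
have q3 : (1 - g) * N * (fa + fb) <= (1 - g) * N * (qa + qb + e * (A + B)).
  by rewrite ler_wpM2l ?mulr_ge0 //; lra.
move: (qa + qb) (lerD ha' hb') q3 => s; rewrite -mulrDr; set D := A + B => hs q3.
rewrite -/D in h2.
have D0 : 0 <= D by rewrite addr_ge0.
have s0 : 0 <= s by apply: le_trans hs; rewrite !mulr_ge0 // ltW.
have q4 : e * D <= e * (2 / c * s).
  rewrite ler_wpM2l // mulrAC ler_pdivlMr //; lra.
have q5 : e * (2 / c * s) <= g / 2 * s.
  rewrite mulrA ler_wpM2r // mulrA ler_pdivrMr //; lra.
have q6 : (1 - g) * N * (s + g / 2 * s) <= (1 - g / 2) * N * s.
  have : 0 <= N * s * (g ^+ 2) by rewrite !mulr_ge0 // ltW.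
  rewrite expr2; nra.
have q7 : (1 - g) * N * (s + e * D) <= (1 - g) * N * (s + g / 2 * s).
  by rewrite ler_wpM2l ?mulr_ge0 //; lra.
have e4 : 4 * e / c * s = 2 * (e * (2 / c * s)) by field; rewrite gt_eqF.
rewrite mulrDl e4; lra.
Qed.

(** * Means of matrix-valued functions *)

Section MeanTheory.
Variables (R : realType) (I : Type) (mu : mean_functional R I).
Local Notation C := R[i].
Local Notation nc := (@ComplexField.Normc.normc R).

Lemma mdomN f : mdom mu f -> mdom mu (fun x => - f x).
Proof.
by move=> h; rewrite (_ : (fun _ => _) = fun x => (-1) * f x) ?mulN1r;
  [exact: mdomZ | apply/funext => x; rewrite mulN1r].
Qed.
Lemma mdomB f g : mdom mu f -> mdom mu g -> mdom mu (fun x => f x - g x).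
Proof. by move=> hf hg; apply: mdomD => //; apply: mdomN. Qed.
Lemma mdom_sum (J : finType) (f : J -> I -> R) :
  (forall j, mdom mu (f j)) -> mdom mu (fun x => \sum_j f j x).
Proof.
move=> h; elim: (index_enum J) => [|j s IH].
  by rewrite (_ : (fun _ => _) = fun=> 0); [exact: mdom_cst | apply/funext => x; rewrite big_nil].
rewrite (_ : (fun _ => _) = fun x => f j x + \sum_(j <- s) f j x); first exact: mdomD.
by apply/funext => x; rewrite big_cons.
Qed.
Lemma mean_sum (J : finType) (f : J -> I -> R) :
  (forall j, mdom mu (f j)) -> mu (fun x => \sum_j f j x) = \sum_j mu (f j).
Proof.
move=> h; have : mdom mu (fun x => \sum_(j <- index_enum J) f j x) /\
   mu (fun x => \sum_(j <- index_enum J) f j x) = \sum_(j <- index_enum J) mu (f j); last by case.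
elim: (index_enum J) => [|j s [IH1 IH2]].
  rewrite big_nil (_ : (fun _ => _) = fun=> 0); last by apply/funext => x; rewrite big_nil.
  by split; [exact: mdom_cst | exact: mean_cst].
rewrite big_cons (_ : (fun _ => _) = fun x => f j x + \sum_(j <- s) f j x); last first.
  by apply/funext => x; rewrite big_cons.
by split; [exact: mdomD | rewrite meanD // IH2].
Qed.
Lemma mean_abs f c : mdom mu f -> (forall x, `|f x| <= c) -> `|mu f| <= c.
Proof.
move=> hf h; rewrite ler_norml -[X in - X](mean_cst mu) -[X in _ && (_ <= X)](mean_cst mu c).
have -> : - mu (fun=> c) = mu (fun=> - c) by rewrite !mean_cst.
by apply/andP; split; apply: mean_le => //; try exact: mdom_cst;
  move=> x; have := h x; rewrite ler_norml => /andP[].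
Qed.

Variable p : nat.

Definition mdomM (F : I -> 'M[C]_p) := forall i j,
  mdom mu (fun x => complex.Re (F x i j)) /\ mdom mu (fun x => complex.Im (F x i j)).
Definition meanM (F : I -> 'M[C]_p) : 'M[C]_p :=
  \matrix_(i, j) (mu (fun x => complex.Re (F x i j)) +i* mu (fun x => complex.Im (F x i j))).

Lemma cdot_mulmxE (A : 'M[C]_p) a b :
  cdot a (A *m b) = \sum_(k : 'I_p * 'I_p) (((a k.1 0)^*)%R * b k.2 0) * A k.1 k.2.
Proof.
rewrite cdotE -(pair_bigA _ (fun i j => ((a i 0)^*)%R * b j 0 * A i j)) /=.
apply: eq_bigr => i _; rewrite mxE mulr_sumr; apply: eq_bigr => j _.
by rewrite mulrAC mulrA.
Qed.

Lemma mean_Re_cdot (F : I -> 'M[C]_p) a b : mdomM F ->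
  mdom mu (fun x => complex.Re (cdot a (F x *m b))) /\
  mu (fun x => complex.Re (cdot a (F x *m b))) = complex.Re (cdot a (meanM F *m b)).
Proof.
move=> h; pose c (k : 'I_p * 'I_p) := ((a k.1 0)^*)%R * b k.2 0.
have E : (fun x => complex.Re (cdot a (F x *m b))) =
  (fun x => \sum_k (complex.Re (c k) * complex.Re (F x k.1 k.2) +
                    (- complex.Im (c k)) * complex.Im (F x k.1 k.2))).
  apply/funext => x; rewrite cdot_mulmxE Re_sum; apply: eq_bigr => k _.
  by rewrite ReM mulNr.
have dm k : mdom mu (fun x => complex.Re (c k) * complex.Re (F x k.1 k.2) +
                    (- complex.Im (c k)) * complex.Im (F x k.1 k.2)).
  by have [h1 h2] := h k.1 k.2; apply: mdomD; apply: mdomZ.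
rewrite E; split; first exact: mdom_sum.
rewrite mean_sum // cdot_mulmxE Re_sum; apply: eq_bigr => k _.
have [h1 h2] := h k.1 k.2.
rewrite meanD; [|exact: mdomZ|exact: mdomZ].
by rewrite !meanZ // [in RHS]ReM mxE /= mulNr.
Qed.

Lemma mean_Im_cdot (F : I -> 'M[C]_p) a b : mdomM F ->
  mdom mu (fun x => complex.Im (cdot a (F x *m b))) /\
  mu (fun x => complex.Im (cdot a (F x *m b))) = complex.Im (cdot a (meanM F *m b)).
Proof.
(* Im <a, F b> is the real part of the same form at -i b. *)
move=> h; have := mean_Re_cdot a ((0 -i* 1) *: b) h.
have E (A : 'M[C]_p) : complex.Re (cdot a (A *m ((0 -i* 1) *: b))) = complex.Im (cdot a (A *m b)).
  by rewrite -scalemxAr cdotZr ReM /= mul0r sub0r mulN1r opprK.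
by rewrite E (_ : (fun _ => _) = fun x => complex.Im (cdot a (F x *m b))) //;
  apply/funext => x; rewrite E.
Qed.

Lemma mean_imq (F : I -> 'M[C]_p) a : mdomM F ->
  mdom mu (fun x => imq (F x) a) /\ mu (fun x => imq (F x) a) = imq (meanM F) a.
Proof. exact: mean_Im_cdot. Qed.

Lemma fnorm_meanM (F : I -> 'M[C]_p) (c : R) : mdomM F ->
  (forall x i j, nc (F x i j) <= c) -> fnorm (meanM F) <= (p * p)%:R * (2 * c).
Proof.
move=> h hc; apply: fnorm_le_entries => i j; rewrite mxE.
apply: (le_trans (nc_le _)); rewrite /= mulr2n mulrDl mul1r.
have [h1 h2] := h i j; apply: lerD; apply: mean_abs => // x.
  exact: le_trans (nc_Re _) (hc x i j).
exact: le_trans (nc_Im _) (hc x i j).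
Qed.

Lemma mdomM_sub (F G : I -> 'M[C]_p) : mdomM F -> mdomM G -> mdomM (fun x => F x - G x).
Proof.
move=> hF hG i j; have [a b] := hF i j; have [c d] := hG i j.
rewrite (_ : (fun x => complex.Re _) = fun x => complex.Re (F x i j) - complex.Re (G x i j)).
  rewrite (_ : (fun x => complex.Im _) = fun x => complex.Im (F x i j) - complex.Im (G x i j)).
    by split; apply: mdomB.
  by apply/funext => x; rewrite !mxE ImD ImN.
by apply/funext => x; rewrite !mxE ReD ReN.
Qed.

Lemma meanM_sub (F G : I -> 'M[C]_p) : mdomM F -> mdomM G ->
  meanM (fun x => F x - G x) = meanM F - meanM G.
Proof.
move=> hF hG; apply/matrixP => i j; rewrite !mxE.
have [a b] := hF i j; have [c d] := hG i j.
have B f g : mdom mu f -> mdom mu g -> mu (fun x => f x - g x) = mu f - mu g.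
  move=> hf hg; rewrite meanD //; last exact: mdomN.
  rewrite -[X in _ + X]/(mu (fun x => - g x)).
  rewrite (_ : (fun x => - g x) = fun x => (-1) * g x) ?meanZ ?mulN1r //.
  by apply/funext => x; rewrite mulN1r.
apply: complex_eq => /=; rewrite -B //; congr (mu _); apply/funext => x.
  by rewrite !mxE ReD ReN.
by rewrite !mxE ImD ImN.
Qed.

End MeanTheory.

(** * Contraction and stability of the self-consistent map *)

Section SelfConsistentMap.
Variables (R : realType) (I : Type) (mu : mean_functional R I).
Local Notation C := R[i].
Local Notation nc := (@ComplexField.Normc.normc R).
Variables (p : nat) (T : I -> 'M[C]_p) (beta CT : R) (z : C).
Hypothesis p_gt0 : (0 < p)%N.
Hypotheses (beta_gt0 : 0 < beta) (CT_ge0 : 0 <= CT).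
Hypothesis T_herm : forall x, (T x) ^t* = T x.
Hypothesis T_opb : forall x, opb (T x) CT.
Local Notation eta := (complex.Im z).
Hypothesis eta_gt0 : 0 < eta.
Local Notation K M x := (Kf beta M (T x)).
Hypothesis K_dom : forall M, herg eta M -> mdomM mu (fun x => K M x).

(** [CK] bounds the kernels ([Kf_opb_adj]) and [CA] the matrix Phi(M)^-1. In [CA], p bounds the
    Frobenius norm of a scalar matrix relative to its entry, and the mean kernel is bounded entry by
    entry, real and imaginary parts apart, whence p * p and 2. *)
Definition CK : R := 2 * CT + CT ^+ 2 * beta / eta.
Definition CA : R := p%:R * nc z + (p * p)%:R * (2 * CK).
Definition Amx (M : 'M[C]_p) : 'M[C]_p := - z%:M + meanM mu (fun x => K M x).
Definition Phi (M : 'M[C]_p) : 'M[C]_p := invmx (Amx M).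

Lemma CK_ge0 : 0 <= CK.
Proof.
by rewrite addr_ge0 ?mulr_ge0 ?invr_ge0 ?sqr_ge0 ?(ltW eta_gt0) ?(ltW beta_gt0).
Qed.

Lemma eta_le_CA : eta <= CA.
Proof.
have h : eta <= nc z by apply: le_trans (nc_Im z); exact: ler_norm.
rewrite /CA; apply: (@le_trans _ _ (p%:R * nc z)).
  by apply: (le_trans h); rewrite ler_peMl ?nc_ge0 // ler1n.
by rewrite lerDl !mulr_ge0 // CK_ge0.
Qed.

Lemma CA_gt0 : 0 < CA. Proof. exact: lt_le_trans eta_gt0 eta_le_CA. Qed.

Lemma K_opb_adj M x : herg eta M -> opb ((K M x) ^t*) CK.
Proof. by move=> h; apply: Kf_opb_adj. Qed.

Lemma K_opb M x : herg eta M -> opb (K M x) CK.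
Proof.
by move=> h; rewrite -[K M x]trmxCK; apply: opb_adj (K_opb_adj _ h); exact: CK_ge0.
Qed.

Lemma imq_Amx M a : herg eta M ->
  imq (Amx M) a = - (eta * fnorm a ^+ 2) + mu (fun x => imq (K M x) a).
Proof.
by move=> h; rewrite /Amx imqD imqN imq_scalar (mean_imq a (K_dom h)).2.
Qed.

Lemma imq_K_le0 M x a : herg eta M -> imq (K M x) a <= 0.
Proof.
move=> h; rewrite (imq_Kf beta_gt0 eta_gt0 h (T_herm x)) oppr_le0.
by rewrite mulr_ge0 ?(ltW beta_gt0) ?(herg_ge0 _ eta_gt0 h).
Qed.

Lemma Amx_accretive M a : herg eta M -> imq (Amx M) a <= - (eta * fnorm a ^+ 2).
Proof.
move=> h; rewrite imq_Amx // gerDl -(mean_cst mu 0).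
apply: mean_le => [| |x]; [exact: (mean_imq a (K_dom h)).1|exact: mdom_cst|].
exact: imq_K_le0.
Qed.

Lemma Phi_props M : herg eta M ->
  [/\ Amx M \in unitmx, herg eta (Phi M),
      forall a, imq (Phi M) a = - imq (Amx M) ((Phi M) ^t* *m a) &
      forall a, imq (Phi M) a = - imq (Amx M) (Phi M *m a)].
Proof. by move=> h; apply: accretive_inv eta_gt0 _ => a; exact: Amx_accretive. Qed.

Lemma Amx_opb M : herg eta M -> opb (Amx M) CA.
Proof.
move=> h v; rewrite /Amx mulmxDl; apply: (le_trans (fnormD _ _)).
rewrite /CA mulrDl; apply: lerD.
  rewrite mulNmx fnormN; apply: (le_trans (fnormM _ _)).
  by rewrite ler_wpM2r // fnorm_scalar.
apply: (le_trans (fnormM _ _)); rewrite ler_wpM2r //.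
by apply: fnorm_meanM; [exact: K_dom|move=> x i j; apply: opb_entry; exact: K_opb].
Qed.

Lemma Phi_adj_lower M (a : 'cV_p) : herg eta M -> fnorm a <= CA * fnorm ((Phi M) ^t* *m a).
Proof.
move=> h; have [uA _ _ _] := Phi_props h.
have {1}-> : a = (Amx M) ^t* *m ((Phi M) ^t* *m a).
  by rewrite mulmxA -ctrM /Phi (mulVmx uA) ctr1 mul1mx.
by apply: opb_adj (Amx_opb h) _; exact: ltW CA_gt0.
Qed.

Lemma Phi_lower M (a : 'cV_p) : herg eta M -> fnorm a <= CA * fnorm (Phi M *m a).
Proof.
move=> h; have [uA _ _ _] := Phi_props h.
have {1}-> : a = Amx M *m (Phi M *m a) by rewrite mulmxA /Phi (mulmxV uA) mul1mx.
exact: Amx_opb.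
Qed.

(** Phi(M) is in the class and |Phi(M)^-1| <= CA, so Im Phi(M) >= eta Phi(M) Phi(M)^* is bounded
    below by eta / CA^2: the forms used as a metric are nondegenerate on values of Phi. *)
Definition lowc : R := eta / CA ^+ 2.

Lemma lowc_gt0 : 0 < lowc.
Proof. by rewrite divr_gt0 // exprn_gt0 // CA_gt0. Qed.

Lemma imq_Phi_lower M a : herg eta M -> lowc * fnorm a ^+ 2 <= imq (Phi M) a.
Proof.
move=> h; have [_ hP _ _] := Phi_props h; apply: le_trans (hP a).
rewrite /lowc -mulrA ler_pM2l // mulrC ler_pdivrMr ?exprn_gt0 ?CA_gt0 //.
rewrite mulrC -exprMn ler_pXn2r ?nnegrE ?mulr_ge0 ?(ltW CA_gt0) //.
exact: Phi_adj_lower.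
Qed.

(** A lower bound for the share of Im Phi(M) that comes from the term -z; at most 1 - gap of it is
    left to the kernel. *)
Definition gap : R := eta / CA.

Lemma gap_gt0 : 0 < gap. Proof. by rewrite divr_gt0 ?CA_gt0. Qed.
Lemma gap_le1 : gap <= 1.
Proof. by rewrite ler_pdivrMr ?CA_gt0 // mul1r eta_le_CA. Qed.

Lemma imq_Phi_le M a : herg eta M -> imq (Phi M) a <= CA * fnorm ((Phi M) ^t* *m a) ^+ 2.
Proof.
move=> h; rewrite /imq cdot_adj.
apply: (le_trans (le_trans (ler_norm _) (Im_cdot_le _ _))).
by rewrite expr2 mulrCA ler_wpM2l // Phi_adj_lower.
Qed.

Lemma imq_Phi_le' M a : herg eta M -> imq (Phi M) a <= CA * fnorm (Phi M *m a) ^+ 2.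
Proof.
move=> h; rewrite /imq.
apply: (le_trans (le_trans (ler_norm _) (Im_cdot_le _ _))).
by rewrite expr2 mulrA ler_wpM2r // Phi_lower.
Qed.

Lemma gap_mul (x y : R) : x <= CA * y -> gap * x <= eta * y.
Proof.
by move=> h; rewrite /gap -mulrA ler_pM2l // mulrC ler_pdivrMr ?CA_gt0 // mulrC.
Qed.

(** With b = Phi(M)^* a, the form Im Phi(M) at a equals eta |b|^2 plus beta times the mean of Im M
    at K^* b. The first term is at least gap times the whole. *)
Lemma Phi_gap_adj M a : herg eta M ->
  mdom mu (fun x => imq M ((K M x) ^t* *m ((Phi M) ^t* *m a))) /\
  beta * mu (fun x => imq M ((K M x) ^t* *m ((Phi M) ^t* *m a))) <= (1 - gap) * imq (Phi M) a.
Proof.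
move=> h; have [_ _ E _] := Phi_props h.
set b := (Phi M) ^t* *m a.
have e : (fun x => imq M ((K M x) ^t* *m b)) = (fun x => (- beta^-1) * imq (K M x) b).
  apply/funext => x; rewrite (imq_Kf_adj beta_gt0 eta_gt0 h (T_herm x)).
  by rewrite mulrN mulNr opprK mulKf // gt_eqF.
have [d dE] := mean_imq b (K_dom h).
rewrite e; split; first exact: mdomZ.
rewrite meanZ // mulNr mulrN mulVKf ?gt_eqF //.
have := E a; rewrite -/b imq_Amx // => E1.
have := gap_mul (imq_Phi_le a h); rewrite -/b; rewrite E1; lra.
Qed.

Lemma Phi_gap M a : herg eta M ->
  mdom mu (fun x => imq M (K M x *m (Phi M *m a))) /\
  beta * mu (fun x => imq M (K M x *m (Phi M *m a))) <= (1 - gap) * imq (Phi M) a.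
Proof.
move=> h; have [_ _ _ E] := Phi_props h.
set b := Phi M *m a.
have e : (fun x => imq M (K M x *m b)) = (fun x => (- beta^-1) * imq (K M x) b).
  apply/funext => x; rewrite (imq_Kf beta_gt0 eta_gt0 h (T_herm x)).
  by rewrite mulrN mulNr opprK mulKf // gt_eqF.
have [d dE] := mean_imq b (K_dom h).
rewrite e; split; first exact: mdomZ.
rewrite meanZ // mulNr mulrN mulVKf ?gt_eqF //.
have := E a; rewrite -/b imq_Amx // => E1.
have := gap_mul (imq_Phi_le' a h); rewrite -/b; rewrite E1; lra.
Qed.

(* [qbd N X M M'] says that [X] is bounded by [N] in the geometry given by
   the imaginary parts of [M] and [M'], i.e.
   |Im(M)^(-1/2) X Im(M')^(-1/2)| <= N; [Phi] contracts this norm. *)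
Definition qbd (N : R) (X M M' : 'M[C]_p) := forall a b,
  2 * complex.Re (cdot a (X *m b)) <= N * (imq M a + imq M' b).

Lemma Phi_sub M M' : herg eta M -> herg eta M' ->
  Phi M - Phi M' = Phi M *m (meanM mu (fun x => K M' x - K M x)) *m Phi M'.
Proof.
move=> h h'; have [u _ _ _] := Phi_props h; have [u' _ _ _] := Phi_props h'.
rewrite meanM_sub; [|exact: K_dom|exact: K_dom].
have -> : meanM mu (fun x => K M' x) - meanM mu (fun x => K M x) = Amx M' - Amx M.
  exact: sub_addl.
rewrite /Phi; exact: (invmx_sub u u').
Qed.

Lemma K_sub M M' x : herg eta M -> herg eta M' ->
  K M' x - K M x = beta%:C *: (K M x *m (M - M') *m K M' x).
Proof.
move=> h h'; rewrite -opprB (Kf_sub beta_gt0 beta_gt0 eta_gt0 eta_gt0 h h' (T_herm x)).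
by rewrite -scalerBr -scalemxAr -scalemxAl -scalerN -mulNmx -mulmxN opprB.
Qed.

(** Phi(M) - Phi(M') = beta Phi(M) E[K (M - M') K'] Phi(M'). The hypothesis is applied at K^* u and
    K' v inside the mean. Since [qbd] bounds by a sum of forms and not by a geometric mean, it
    passes through the mean by linearity; [Phi_gap_adj] and [Phi_gap] then bound the two
    summands. *)
Lemma Phi_contract (N : R) M M' : 0 <= N -> herg eta M -> herg eta M' ->
  qbd N (M - M') M M' -> qbd ((1 - gap) * N) (Phi M - Phi M') (Phi M) (Phi M').
Proof.
move=> N0 h h' q a b; rewrite Phi_sub // -!mulmxA cdot_adj.
set u := (Phi M) ^t* *m a; set v := Phi M' *m b.
have [dL gL] := Phi_gap_adj a h; have [dR gR] := Phi_gap b h'.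
rewrite -/u in dL gL; rewrite -/v in dR gR.
have [d <-] := mean_Re_cdot u v (mdomM_sub (K_dom h') (K_dom h)).
have le1 : mu (fun x => 2 * complex.Re (cdot u ((K M' x - K M x) *m v))) <=
  mu (fun x => (beta * N) * (imq M ((K M x) ^t* *m u) + imq M' (K M' x *m v))).
  apply: mean_le; [exact: mdomZ | by apply: mdomZ; apply: mdomD |move=> x].
  rewrite K_sub // -scalemxAl cdotZr ReZ mulrCA -mulrA ler_pM2l //.
  rewrite (cdot_sandwich (K M x) (M - M') (K M' x) u v); exact: q.
move: le1; rewrite meanZ // meanZ; last exact: mdomD.
rewrite meanD // => le1; apply: (le_trans le1).
have -> : (1 - gap) * N * (imq (Phi M) a + imq (Phi M') b) =
  N * ((1 - gap) * imq (Phi M) a + (1 - gap) * imq (Phi M') b) by ring.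
by rewrite (mulrC beta) -mulrA ler_wpM2l // mulrDr lerD.
Qed.

Lemma qbd_opb (N s : R) X M M' : 0 <= N -> 0 <= s ->
  (forall a, imq M a <= s * fnorm a ^+ 2) -> (forall a, imq M' a <= s * fnorm a ^+ 2) ->
  qbd N X M M' -> opb X (N * s).
Proof.
move=> N0 s0 hM hM' q b.
have [->|nz] := eqVneq (fnorm (X *m b)) 0; first by rewrite !mulr_ge0.
have xp : 0 < fnorm (X *m b) by rewrite lt_neqAle eq_sym nz fnorm_ge0.
have [b0|bz] := eqVneq (fnorm b) 0.
  by rewrite (fnorm_eq0 b0) mulmx0 !fnorm0 mulr0.
have bp : 0 < fnorm b by rewrite lt_neqAle eq_sym bz fnorm_ge0.
(* Taking a = t X b of the same length as b balances the two terms of the bound. *)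
set t := fnorm b / fnorm (X *m b).
have t0 : 0 < t by rewrite divr_gt0.
have := q (t%:C *: (X *m b)) b.
rewrite cdotZl conj_real ReZ cdotaa /=.
have e1 : t * fnorm (X *m b) ^+ 2 = fnorm b * fnorm (X *m b).
  by rewrite /t expr2 mulrA mulfVK.
rewrite e1 => H.
have e2 : fnorm (t%:C *: (X *m b)) = fnorm b.
  by rewrite fnormZ nc_real gtr0_norm // /t mulfVK.
have : N * (imq M (t%:C *: (X *m b)) + imq M' b) <= N * (s * fnorm b ^+ 2 + s * fnorm b ^+ 2).
  by rewrite ler_wpM2l // lerD // -[X in s * X ^+ 2]e2.
move=> /(le_trans H) {}H.
rewrite -(ler_pM2l bp); nra.
Qed.

Lemma qbd_init (c : R) X M M' : 0 < c ->
  (forall a, c * fnorm a ^+ 2 <= imq M a) -> (forall a, c * fnorm a ^+ 2 <= imq M' a) ->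
  qbd (fnorm X / c) X M M'.
Proof.
move=> c0 h h' a b.
have h1 := h a; have h2 := h' b.
apply: (@le_trans _ _ (fnorm X * (fnorm a ^+ 2 + fnorm b ^+ 2))); last first.
  rewrite -mulrA ler_wpM2l // mulrC ler_pdivlMr //; nra.
have : complex.Re (cdot a (X *m b)) <= fnorm X * (fnorm a * fnorm b).
  apply: (le_trans (Re_cdot_le _ _)); rewrite mulrCA ler_wpM2l //; exact: fnormM.
have := sqr_ge0 (fnorm a - fnorm b); have := fnorm_ge0 X.
set x := fnorm X; set y := fnorm a; set w := fnorm b; nra.
Qed.

(** A bound N on M - M' passes to Phi(M) - Phi(M') by contraction and returns to M - M' at the cost
    of eps, so N improves to (1 - gap / 2) N + 4 eps / lowc. [affine_improve] yields 8 eps / (lowc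
    gap). Passing to the Frobenius norm costs 1/eta and p^2. *)
Lemma approx_fixpoints_close (eps : R) M M' : 0 <= eps -> herg eta M -> herg eta M' ->
  fnorm (Phi M - M) <= eps -> fnorm (Phi M' - M') <= eps ->
  eps <= lowc / 2 -> eps <= lowc * gap / 4 ->
  fnorm (M - M') <= (p * p)%:R * (8 * eps / (lowc * gap) / eta).
Proof.
move=> e0 h h' he he' el eg.
have c0 := lowc_gt0; have g0 := gap_gt0; have g1 := gap_le1.
have lo (X : 'M[C]_p) a : herg eta X -> fnorm (Phi X - X) <= eps ->
   imq (Phi X) a <= imq X a + eps * fnorm a ^+ 2 /\ lowc / 2 * fnorm a ^+ 2 <= imq X a.
  move=> hX heX.
  have := imq_le (Phi X - X) a; rewrite imqD imqN ler_norml => /andP[_ i1].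
  have i2 : fnorm (Phi X - X) * fnorm a ^+ 2 <= eps * fnorm a ^+ 2.
    by rewrite ler_wpM2r // sqr_ge0.
  have i3 := imq_Phi_lower a hX.
  have i4 : eps * fnorm a ^+ 2 <= lowc / 2 * fnorm a ^+ 2 by rewrite ler_wpM2r ?sqr_ge0.
  move: (imq (Phi X) a) (imq X a) (fnorm a ^+ 2) (fnorm (Phi X - X)) i1 i2 i3 i4 => x y w v.
  by clear; split; lra.
pose P (N : R) := 0 <= N /\ qbd N (M - M') M M'.
have key t : 0 < t -> P (8 * eps / (lowc * gap) + t).
  have -> : 8 * eps / (lowc * gap) = 4 * eps / lowc / (1 - (1 - gap / 2)).
    have -> : 1 - (1 - gap / 2) = gap / 2 by ring.
    by field; rewrite !gt_eqF.
  apply: (@affine_improve R P (1 - gap / 2) (4 * eps / lowc) (fnorm (M - M') / (lowc / 2))).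
  - by apply/andP; split; lra.
  - split; first by rewrite divr_ge0 // ltW // divr_gt0.
    apply: qbd_init => [|a|a]; first by rewrite divr_gt0.
      exact: (lo M a h he).2.
    exact: (lo M' a h' he').2.
  - move=> N N' NN' [N0 qN]; split; first exact: le_trans NN'.
    move=> a b; apply: (le_trans (qN a b)); rewrite ler_wpM2r //.
    by rewrite addr_ge0 // (herg_ge0 _ eta_gt0).
  - move=> N _ [N0 qN].
    have k0 : 0 <= 1 - gap / 2 by lra.
    split; first by rewrite addr_ge0 // ?(mulr_ge0 k0 N0) // divr_ge0 ?(ltW c0) // mulr_ge0.
    move=> a b.
    have q1 := Phi_contract N0 h h' qN a b.
    have [a1 a2] := lo M a h he; have [b1 b2] := lo M' b h' he'.
    set A2 := fnorm a ^+ 2 in a1 a2; set B2 := fnorm b ^+ 2 in b1 b2.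
    have A20 : 0 <= A2 by exact: sqr_ge0.
    have B20 : 0 <= B2 by exact: sqr_ge0.
    have q2 : 2 * complex.Re (cdot a ((M - M') *m b)) <=
       2 * complex.Re (cdot a ((Phi M - Phi M') *m b)) + 2 * eps * (A2 + B2).
      exact: Re_cdot_perturb.
    exact: (stability_scalar N0 c0 g0 g1 e0 eg A20 B20 a1 b1 a2 b2 q1 q2).
apply/ler_addgt0Pr => d d0.
have s0 : 0 <= eta^-1 by rewrite invr_ge0 ltW.
pose t := d * eta / (p * p)%:R.
have pp : 0 < (p * p)%:R :> R by rewrite ltr0n muln_gt0 p_gt0.
have t0 : 0 < t by rewrite divr_gt0 // mulr_gt0.
have [N0 q] := key _ t0.
have := opb_fnorm (qbd_opb N0 s0 _ _ q); move=> H.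
apply: le_trans (H _ _) _ => [a|a|]; try by apply: opb_imq; apply: herg_opb.
rewrite (mulrDl _ t) mulrDr lerD2l /t.
move: ((p * p)%:R : R) pp => P2 P20.
have -> // : P2 * (d * eta / P2 / eta) = d.
by field; rewrite !gt_eqF.
Qed.

End SelfConsistentMap.

(** * Limits of real and matrix sequences *)

Section SequenceLimits.
Variable R : realType.
Local Notation C := R[i].
Local Notation nc := (@ComplexField.Normc.normc R).

Lemma cvg0_le (u v : nat -> R) : (\forall n \near \oo, 0 <= u n <= v n) ->
  v n @[n --> \oo] --> (0 : R) -> u n @[n --> \oo] --> (0 : R).
Proof. by move=> h hv; apply: (squeeze_cvgr h); [exact: cvg_cst|exact: hv]. Qed.

Lemma cvg0_eventually (v : nat -> R) (e : R) : v n @[n --> \oo] --> (0 : R) -> 0 < e ->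
  exists k, forall n, (k <= n)%N -> v n <= e.
Proof.
move=> h e0; move/cvgrPdist_le: h => /(_ e e0)[k _ hk]; exists k => n kn.
by have := hk n kn; rewrite /= sub0r normrN; apply: le_trans; exact: ler_norm.
Qed.

Lemma cvg_norm_sub0 (u : nat -> R) (l : R) :
  `|u n - l| @[n --> \oo] --> (0 : R) -> u n @[n --> \oo] --> l.
Proof. by move=> /norm_cvg0 /cvg_sub0; apply; exact: cvg_cst. Qed.

Lemma cvg_sub_norm0 (u : nat -> R) (l : R) :
  u n @[n --> \oo] --> l -> `|u n - l| @[n --> \oo] --> (0 : R).
Proof.
move=> h; have : u n - l @[n --> \oo] --> l - l by apply: cvgB h (cvg_cst _).
by rewrite subrr => /cvg_norm; rewrite normr0.
Qed.

Lemma geometric_cvg (u : nat -> R) (c k : R) : 0 <= k < 1 ->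
  (forall n, `|u n.+1 - u n| <= c * k ^+ n) -> exists l : R, u n @[n --> \oo] --> l.
Proof.
move=> /andP[k0 k1] h.
have c0 : 0 <= c by have := le_trans (normr_ge0 _) (h 0%N); rewrite expr0 mulr1.
have : cvgn (series (telescope u)).
  apply: normed_cvg; apply: (@series_le_cvg _ _ (geometric c k)).
  - by move=> n /=; exact: normr_ge0.
  - by move=> n /=; rewrite mulr_ge0 // exprn_ge0.
  - by move=> n; exact: h.
  - by apply: is_cvg_geometric_series; rewrite ger0_norm.
move=> /cvg_ex[l hl]; exists (u 0%N + l).
rewrite (_ : u = fun n => u 0%N + series (telescope u) n); last first.
  by apply/funext => n; exact: eq_sum_telescope.
rewrite -(eq_sum_telescope u 0); exact: cvgD (cvg_cst _) hl.
Qed.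

Lemma cvg_sumr (J : Type) (s : seq J) (f : nat -> J -> R) (l : J -> R) :
  (forall j, f k j @[k --> \oo] --> l j) ->
  \sum_(j <- s) f k j @[k --> \oo] --> \sum_(j <- s) l j.
Proof.
move=> h; elim: s => [|j s IH].
  rewrite big_nil (_ : (fun _ => _) = fun=> 0); first exact: cvg_cst.
  by apply/funext => k; rewrite big_nil.
rewrite big_cons (_ : (fun _ => _) = fun k => f k j + \sum_(i <- s) f k i).
  exact: cvgD.
by apply/funext => k; rewrite big_cons.
Qed.

Lemma fnorm_cvg0 m n (u : nat -> 'M[C]_(m, n)) (M : 'M[C]_(m, n)) :
  (forall i j, complex.Re (u k i j) @[k --> \oo] --> complex.Re (M i j)) ->
  (forall i j, complex.Im (u k i j) @[k --> \oo] --> complex.Im (M i j)) ->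
  fnorm (u k - M) @[k --> \oo] --> (0 : R).
Proof.
move=> hr hi; apply: (@cvg0_le _ (fun k => \sum_(l : 'I_m * 'I_n)
   (`|complex.Re (u k l.1 l.2) - complex.Re (M l.1 l.2)| +
    `|complex.Im (u k l.1 l.2) - complex.Im (M l.1 l.2)|))).
  apply: nearW => k; rewrite fnorm_ge0 /=; apply: (le_trans (fnorm_sum_entries _)).
  by apply: ler_sum => l _; rewrite !mxE -ReN -ImN -ReD -ImD; exact: nc_le.
have := @cvg_sumr ('I_m * 'I_n)%type (index_enum _) (fun k l =>
   (`|complex.Re (u k l.1 l.2) - complex.Re (M l.1 l.2)| +
    `|complex.Im (u k l.1 l.2) - complex.Im (M l.1 l.2)|)) (fun=> 0).
rewrite (big1 _ xpredT) //; apply => l.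
rewrite -[X in _ --> X](addr0 0); apply: cvgD; exact: cvg_sub_norm0.
Qed.

Lemma cvg_fnorm_entry m n (u : nat -> 'M[C]_(m, n)) (M : 'M[C]_(m, n)) i j :
  fnorm (u k - M) @[k --> \oo] --> (0 : R) ->
  complex.Re (u k i j) @[k --> \oo] --> complex.Re (M i j) /\
  complex.Im (u k i j) @[k --> \oo] --> complex.Im (M i j).
Proof.
move=> h; split; apply: cvg_norm_sub0; apply: cvg0_le h; apply: nearW => k; rewrite normr_ge0 /=.
  apply: le_trans (fnorm_entry _ i j); rewrite !mxE; apply: le_trans (nc_Re _).
  by rewrite ReD ReN.
apply: le_trans (fnorm_entry _ i j); rewrite !mxE; apply: le_trans (nc_Im _).
by rewrite ImD ImN.
Qed.

Lemma geometric_cvg_mx m n (u : nat -> 'M[C]_(m, n)) (c k : R) : 0 <= k < 1 ->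
  (forall l, fnorm (u l.+1 - u l) <= c * k ^+ l) ->
  exists M : 'M[C]_(m, n), fnorm (u l - M) @[l --> \oo] --> (0 : R).
Proof.
move=> kb h.
have hr i j : exists l : R, complex.Re (u k i j) @[k --> \oo] --> l.
  apply: geometric_cvg kb _ => l; apply: le_trans (h l).
  apply: le_trans (fnorm_entry _ i j); rewrite !mxE; apply: le_trans (nc_Re _).
  by rewrite ReD ReN.
have hi i j : exists l : R, complex.Im (u k i j) @[k --> \oo] --> l.
  apply: geometric_cvg kb _ => l; apply: le_trans (h l).
  apply: le_trans (fnorm_entry _ i j); rewrite !mxE; apply: le_trans (nc_Im _).
  by rewrite ImD ImN.
exists (\matrix_(i, j) (sval (cid (hr i j)) +i* sval (cid (hi i j)))).
apply: fnorm_cvg0 => i j; rewrite mxE /=; [exact: svalP (cid (hr i j)) | exact: svalP (cid (hi i j))].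
Qed.

Lemma herg_closed_scalar (eta e x x' A q q' : R) : 0 < eta -> 0 < e ->
  0 <= x -> 0 <= x' -> 0 <= A -> eta * x' ^+ 2 <= q' -> q' <= q + e * A ^+ 2 ->
  x <= x' + e * A -> eta * x ^+ 2 <= q + e * (A ^+ 2 + 2 * eta * A * x).
Proof.
move=> h0 e0 x0 x'0 A0 h1 h2 h3.
have h4 : x ^+ 2 <= x' ^+ 2 + 2 * e * A * x.
  have [xe|xe] := leP x (e * A).
    have : x * x <= e * A * x by rewrite ler_wpM2r.
    have : 0 <= e * A * x by rewrite !mulr_ge0 // ltW.
    have := sqr_ge0 x'; rewrite !expr2; lra.
  have : (x - e * A) ^+ 2 <= x' ^+ 2.
    by rewrite ler_pXn2r ?nnegrE ?subr_ge0 // ?(ltW xe) // lerBlDr.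
  have := sqr_ge0 (e * A); rewrite sqrrB expr2; lra.
have h6 : eta * x ^+ 2 <= eta * (x' ^+ 2 + 2 * e * A * x) by rewrite ler_pM2l.
by rewrite mulrDr in h6; rewrite mulrDr; lra.
Qed.

(** The class inequality is continuous in M: an error |M' - M| <= e costs at most e (|a|^2 + 2 eta
    |a| |M^* a|). *)
Lemma herg_closed p (eta : R) (M : 'M[C]_p) : 0 < eta ->
  (forall e, 0 < e -> exists2 M', herg eta M' & fnorm (M' - M) <= e) -> herg eta M.
Proof.
move=> e0 h a; apply/ler_addgt0Pr => d d0.
set x := fnorm (M ^t* *m a); set A := fnorm a.
have x0 : 0 <= x by exact: fnorm_ge0.
have A0 : 0 <= A by exact: fnorm_ge0.
pose D := A ^+ 2 + 2 * eta * A * x.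
have D0 : 0 <= D by rewrite addr_ge0 ?sqr_ge0 // !mulr_ge0 // ltW.
pose e := d / (D + 1).
have ep : 0 < e by rewrite divr_gt0 // ltr_wpDl.
have [M' hM' le] := h e ep.
have h1 := hM' a; set x' := fnorm (M' ^t* *m a) in h1.
have x'0 : 0 <= x' by exact: fnorm_ge0.
have h2 : imq M' a <= imq M a + e * A ^+ 2.
  have := imq_le (M' - M) a; rewrite imqD imqN => /(le_trans (ler_norm _)) h2.
  have h3 : fnorm (M' - M) * fnorm a ^+ 2 <= e * A ^+ 2 by rewrite ler_wpM2r ?sqr_ge0.
  by rewrite -lerBlDl; exact: le_trans h2 h3.
have h3 : x <= x' + e * A.
  rewrite /x -[M ^t*](subrK (M' ^t*)) mulmxDl addrC; apply: (le_trans (fnormD _ _)).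
  rewrite lerD2l; apply: (le_trans (fnormM _ _)).
  by rewrite -ctrN -ctrD fnorm_adj fnormBC ler_wpM2r.
apply: (le_trans (herg_closed_scalar e0 ep x0 x'0 A0 h1 h2 h3)).
rewrite lerD2l -/D /e mulrAC ler_pdivrMr ?ltr_wpDl //.
by rewrite [leRHS]mulrDr mulr1 lerDl ltW.
Qed.

End SequenceLimits.

(** * Existence and uniqueness of the fixed point *)

Section FixedPoint.
Variables (R : realType) (I : Type) (mu : mean_functional R I).
Local Notation C := R[i].
Local Notation nc := (@ComplexField.Normc.normc R).
Variables (p : nat) (T : I -> 'M[C]_p) (beta CT : R) (z : C).
Hypothesis p_gt0 : (0 < p)%N.
Hypotheses (beta_gt0 : 0 < beta) (CT_ge0 : 0 <= CT).
Hypothesis T_herm : forall x, (T x) ^t* = T x.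
Hypothesis T_opb : forall x, opb (T x) CT.
Local Notation eta := (complex.Im z).
Hypothesis eta_gt0 : 0 < eta.
Hypothesis K_dom : forall M, herg eta M -> mdomM mu (fun x => Kf beta M (T x)).
Local Notation Phi := (Phi mu T beta z).
Local Notation gap := (gap p beta CT z).
Local Notation lowc := (lowc p beta CT z).
Local Notation CK := (CK beta CT z).

Lemma fixpoint_unique M M' : herg eta M -> herg eta M' -> Phi M = M -> Phi M' = M' -> M = M'.
Proof.
move=> h h' e e'; apply/eqP; rewrite -subr_eq0; apply/eqP; apply: fnorm_eq0; apply/le_anti.
rewrite fnorm_ge0 andbT.
have g0 : 0 < gap by apply: gap_gt0.
have c0 : 0 < lowc by apply: lowc_gt0.
have := @approx_fixpoints_close R I mu p T beta CT z p_gt0 beta_gt0 CT_ge0 T_herm T_opb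
  eta_gt0 K_dom 0 M M' (lexx 0) h h'.
rewrite e e' !subrr fnorm0 => /(_ (lexx 0) (lexx 0)); rewrite !(mulr0, mul0r); apply.
  by rewrite divr_ge0 // ltW.
by rewrite divr_ge0 // mulr_ge0 ?(ltW c0) ?(ltW g0).
Qed.

(** The contraction refers to forms that move with the points. Continuity in a fixed norm is needed
    separately, to pass to the limit in u_(k+1) = Phi(u_k). *)
Lemma Phi_lipschitz : exists2 L : R, 0 <= L & forall M M', herg eta M -> herg eta M' ->
  fnorm (Phi M - Phi M') <= L * fnorm (M - M').
Proof.
have eV : 0 <= eta^-1 by rewrite invr_ge0 ltW.
pose F := (p * p)%:R * eta^-1.
have F0 : 0 <= F by rewrite mulr_ge0.
have CK0 : 0 <= CK by apply: CK_ge0.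
pose G := (p * p)%:R * (2 * (beta * (CK * CK))).
have G0 : 0 <= G by rewrite !mulr_ge0 // ltW.
exists (F * G * F) => [|M M' h h']; first exact: mulr_ge0 (mulr_ge0 F0 G0) F0.
rewrite (Phi_sub beta_gt0 T_herm eta_gt0 K_dom h h').
have PF X : herg eta X -> fnorm (Phi X) <= F.
  move=> hX; apply: opb_fnorm; apply: (herg_opb eta_gt0).
  by have [_ hP _ _] := Phi_props beta_gt0 T_herm eta_gt0 K_dom hX; exact: hP.
apply: (le_trans (fnormM _ _)).
apply: (@le_trans _ _ (F * (G * fnorm (M - M')) * F)); last first.
  by rewrite le_eqVlt; apply/orP; left; apply/eqP; ring.
apply: ler_pM => //; last exact: PF.
apply: (le_trans (fnormM _ _)); apply: ler_pM => //; first exact: PF.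
have -> : G * fnorm (M - M') = (p * p)%:R * (2 * (beta * (CK * CK) * fnorm (M - M'))).
  by rewrite /G; ring.
apply: fnorm_meanM.
  by apply: mdomM_sub; exact: K_dom.
move=> x i j; rewrite (K_sub beta_gt0 T_herm eta_gt0 x h h') mxE ncM nc_real gtr0_norm //.
rewrite -!mulrA ler_pM2l // mulrCA mulrC -mulrA.
rewrite -mulmxA; apply: opb_entry; apply: opb_comp => //.
  exact: (K_opb beta_gt0 CT_ge0 T_herm T_opb eta_gt0 _ h).
apply: opb_comp => //; first exact: fnorm_opb.
exact: (K_opb beta_gt0 CT_ge0 T_herm T_opb eta_gt0 _ h').
Qed.

(** Successive differences decrease geometrically for the moving forms; since Im M <= 1/eta on the
    class, they also do in norm, and the iterates converge. The limit stays in the class by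
    [herg_closed]. *)
Lemma fixpoint_exists : exists2 M, herg eta M & Phi M = M.
Proof.
(* The scalar i / eta satisfies the class inequality with equality. *)
pose M0 : 'M[C]_p := ((0 +i* eta^-1)%C)%:M.
have hM0 : herg eta M0.
  move=> a; rewrite imq_scalar /=.
  have -> : M0 ^t* *m a = (((0 +i* eta^-1)%C)^*)%R *: a.
    by rewrite /M0 tr_scalar_mx map_scalar_mx mul_scalar_mx.
  rewrite fnormZ ncJ exprMn nc2 /= expr0n add0r mulrA exprVn expr2 invfM.
  by rewrite mulVKf ?gt_eqF.
pose u k := iter k Phi M0.
have u0 : u 0%N = M0 by [].
have uS k : u k.+1 = Phi (u k) by [].
clearbody u.
have hu k : herg eta (u k).
  elim: k => [|k IH]; first by rewrite u0.
  rewrite uS.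
  by have [_ hP _ _] := Phi_props beta_gt0 T_herm eta_gt0 K_dom IH; exact: hP.
have g0 : 0 < gap by apply: gap_gt0.
have g1 : gap <= 1 by apply: gap_le1.
have c0 : 0 < lowc by apply: lowc_gt0.
pose N0 := fnorm (u 1%N - u 2%N) / lowc.
have N00 : 0 <= N0 by rewrite divr_ge0 // ltW.
have kN k : 0 <= (1 - gap) ^+ k * N0 by rewrite mulr_ge0 // exprn_ge0 // subr_ge0.
(* The induction starts at u_1 - u_2: these are values of Phi, to which the lower bound
   [imq_Phi_lower] applies. *)
have q k : qbd ((1 - gap) ^+ k * N0) (u k.+1 - u k.+2) (u k.+1) (u k.+2).
  elim: k => [|k IH].
    rewrite expr0 mul1r; apply: qbd_init => [|a|a]; first exact: c0.
      rewrite (uS 0%N); exact: (imq_Phi_lower p_gt0 beta_gt0 CT_ge0 T_herm T_opb eta_gt0 K_dom a (hu 0%N)).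
    rewrite (uS 1%N); exact: (imq_Phi_lower p_gt0 beta_gt0 CT_ge0 T_herm T_opb eta_gt0 K_dom a (hu 1%N)).
  rewrite exprS -mulrA (uS k.+1) (uS k.+2).
  exact: (Phi_contract p_gt0 beta_gt0 CT_ge0 T_herm T_opb eta_gt0 K_dom (kN k) (hu _) (hu _) IH).
have eV : 0 <= eta^-1 by rewrite invr_ge0 ltW.
have d k : fnorm (u k.+2 - u k.+1) <= ((p * p)%:R * (N0 * eta^-1)) * (1 - gap) ^+ k.
  rewrite fnormBC.
  have -> : ((p * p)%:R * (N0 * eta^-1)) * (1 - gap) ^+ k =
            (p * p)%:R * (((1 - gap) ^+ k * N0) * eta^-1) by ring.
  apply: opb_fnorm; apply: (qbd_opb (kN k) eV _ _ (q k)) => a; apply: opb_imq; apply: (herg_opb eta_gt0); exact: hu.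
have kb : 0 <= 1 - gap < 1 by rewrite subr_ge0 g1 /= ltrBlDr ltrDl.
have [M hM] := @geometric_cvg_mx R p p (fun k => u k.+1) _ (1 - gap) kb d.
have near e : 0 < e -> exists k, fnorm (u k.+1 - M) <= e /\ fnorm (u k.+2 - M) <= e.
  move=> e0; have [k hk] := cvg0_eventually hM e0.
  by exists k; split; [exact: hk (leqnn k)|exact: hk (leqnSn k)].
have hM' : herg eta M.
  apply: herg_closed => // e e0; have [k [h1 _]] := near e e0.
  by exists (u k.+1).
exists M => //; apply/eqP; rewrite -subr_eq0; apply/eqP; apply: fnorm_eq0; apply/le_anti.
rewrite fnorm_ge0 andbT; have [L L0 lip] := Phi_lipschitz.
apply/ler_addgt0Pr => t t0; rewrite add0r.
have e0 : 0 < t / (L + 1) by rewrite divr_gt0 // ltr_wpDl.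
have [k [h1 h2]] := near _ e0.
rewrite uS in h2.
rewrite -[Phi M - M](subrKA (Phi (u k.+1))).
apply: (le_trans (fnormD _ _)).
apply: (@le_trans _ _ (L * (t / (L + 1)) + t / (L + 1))).
  apply: lerD => //; apply: (le_trans (lip _ _ hM' (hu _))).
  rewrite fnormBC; exact: ler_wpM2l L0 _ _ h1.
by rewrite -{2}[t / _]mul1r -mulrDl mulrC mulfVK // gt_eqF // ltr_wpDl.
Qed.

End FixedPoint.

(** * Independence and Gaussian moments *)

Section Independence.
Context d (Omega : measurableType d) (R : realType) (P : probability Omega R).

Definition mfun_pack d1 (E1 : measurableType d1) (X : Omega -> E1)
    (mX : measurable_fun setT X) : {mfun Omega >-> E1} :=
  HB.pack X (isMeasurableFun.Build _ _ _ _ X mX).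

(** The joint law of an independent pair is the product of the laws. The result is pulled back to an
    iterated integral over Omega, where the inner variable w' acts as a fresh copy of the randomness
    of X. *)
Lemma indep_fubini d1 d2 (E1 : measurableType d1) (E2 : measurableType d2)
    (X : Omega -> E1) (Z : Omega -> E2) (f : E1 * E2 -> \bar R) :
  measurable_fun setT X -> measurable_fun setT Z -> independent P X Z ->
  measurable_fun [set: E1 * E2] f -> (forall x, (0 <= f x)%E) ->
  (\int[P]_w f (X w, Z w) = \int[P]_w \int[P]_w' f (X w', Z w))%E.
Proof.
move=> mX mZ ind mf f0.
pose X' := mfun_pack mX; pose Z' := mfun_pack mZ.
pose XZ := mfun_pack (measurable_fun_pair mX mZ).
have E1' : (\int[P]_w f (X w, Z w) = \int[distribution P XZ]_x f x)%E.
  by rewrite (ge0_integral_distribution XZ mf f0).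
have E2' : (\int[distribution P XZ]_x f x = \int[distribution P X' \x distribution P Z']_x f x)%E.
  apply: eq_measure_integral => A mA _; apply/esym/product_measure_unique => //.
rewrite E1' E2' fubini_tonelli2 // /fubini_G.
rewrite (ge0_integral_distribution Z'); last 2 first.
- exact: (measurable_fun_fubini_tonelli_G (m1 := distribution P X') f mf f0).
- by move=> y; apply: integral_ge0 => x _.
apply: eq_integral => w _ /=.
rewrite (ge0_integral_distribution X' (f := fun x => f (x, Z w))) //.
apply: (measurableT_comp mf); apply: measurable_fun_pair; [exact: measurable_id|exact: measurable_cst].
Qed.

(** Resampling of one coordinate: with the others frozen, expectations conditional on them become
    plain integrals over Omega. *)
Definition upd d' (E : measurableType d') n (t : n.-tuple E) (i : 'I_n) (x : E) : n.-tuple E :=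
  [tuple if j == i then x else tnth t j | j < n].

Lemma tnth_upd d' (E : measurableType d') n (t : n.-tuple E) i (x : E) j :
  tnth (upd t i x) j = if j == i then x else tnth t j.
Proof. by rewrite tnth_mktuple. Qed.

Lemma upd_upd d' (E : measurableType d') n (t : n.-tuple E) i (x y : E) :
  upd (upd t i x) i y = upd t i y.
Proof. by apply: eq_from_tnth => j; rewrite !tnth_upd; case: eqP. Qed.

Lemma upd_id d' (E : measurableType d') n (t : n.-tuple E) i : upd t i (tnth t i) = t.
Proof. by apply: eq_from_tnth => j; rewrite tnth_upd; case: eqP => [->|]. Qed.

Lemma measurable_upd d' (E : measurableType d') n (i : 'I_n) :
  measurable_fun [set: E * n.-tuple E] (fun p => upd p.2 i p.1).
Proof.
apply/measurable_fun_tnthP => j; rewrite /comp.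
have [->|ji] := eqVneq j i.
  by rewrite (_ : (fun _ => _) = fst) //; apply/funext => x; rewrite tnth_upd eqxx.
rewrite (_ : (fun _ => _) = (@tnth _ E ^~ j) \o snd).
  exact: measurableT_comp (measurable_tnth j) measurable_snd.
by apply/funext => x; rewrite tnth_upd (negPf ji).
Qed.

Lemma measurable_updr d' (E : measurableType d') n (t : n.-tuple E) (i : 'I_n) :
  measurable_fun setT (upd t i).
Proof.
apply/measurable_fun_tnthP => j; rewrite /comp.
have [->|ji] := eqVneq j i.
  by rewrite (_ : (fun _ => _) = id) //; apply/funext => x; rewrite tnth_upd eqxx.
rewrite (_ : (fun _ => _) = cst (tnth t j)); first exact: measurable_cst.
by apply/funext => x; rewrite tnth_upd (negPf ji).
Qed.

Definition tuple_boxes d' (E : measurableType d') n : set (set (n.-tuple E)) :=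
  [set B | exists2 b : 'I_n -> set E, (forall j, measurable (b j)) &
           B = [set t | forall j, b j (tnth t j)]].

Lemma measurable_tuple_boxes d' (E : measurableType d') n :
  measurable = <<s @tuple_boxes d' E n >> :> set (set (n.-tuple E)).
Proof.
rewrite eqEsubset; split.
  apply: smallest_sub; first exact: smallest_sigma_algebra.
  rewrite -bigcup_seq => A [i /= _ [B mB <-]]; apply: sub_sigma_algebra.
  exists (fun j => if j == i then B else setT).
    by move=> j; case: ifP.
  rewrite setTI; apply/seteqP; split => t /=.
    by move=> Bt j; case: eqP => // ->.
  by move=> /(_ i); rewrite eqxx.
apply: smallest_sub; first exact: sigma_algebra_measurable.
move=> B [b mb ->].
rewrite (_ : [set _ | _] = \bigcap_(j in [set: 'I_n]) ((@tnth n E ^~ j) @^-1` b j)).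
  apply: fin_bigcap_measurable; first exact: finite_finset.
  move=> j _; rewrite -[_ @^-1` _]setTI; exact: measurable_tnth.
by apply/seteqP; split => t h j; [move=> _; exact: h | exact: (h j Logic.I)].
Qed.

Lemma tuple_boxesI d' (E : measurableType d') n : setI_closed (@tuple_boxes d' E n).
Proof.
move=> A B [a ma ->] [b mb ->]; exists (fun j => a j `&` b j).
  by move=> j; exact: measurableI.
by apply/seteqP; split => t /=; [move=> [h1 h2] j; split | move=> h; split => j; have [] := h j].
Qed.

Section Family.
Context d' (E : measurableType d') (n : nat) (X : 'I_n -> Omega -> E).
Hypothesis mX : forall i, measurable_fun setT (X i).
Hypothesis indX : mutually_independent P X.

Definition jointX (w : Omega) : n.-tuple E := [tuple X j w | j < n].

Lemma measurable_jointX : measurable_fun setT jointX.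
Proof.
apply/measurable_fun_tnthP => j; rewrite (_ : _ \o _ = X j) //.
by apply/funext => w /=; rewrite tnth_mktuple.
Qed.

Lemma measurable_others i (e0 : E) : measurable_fun setT (fun w => upd (jointX w) i e0).
Proof.
rewrite (_ : (fun w => _) = (fun x : E * n.-tuple E => upd x.2 i x.1) \o
  (fun w => (e0, jointX w))) //.
apply: measurableT_comp; first exact: measurable_upd.
exact: measurable_fun_pair (measurable_cst e0) measurable_jointX.
Qed.

(** Overwriting coordinate i by a constant [e0] keeps the remaining samples in the same tuple type.
    For fixed A both sides are finite measures in B, so it suffices to compare them on boxes. *)
Lemma independent_others i (e0 : E) : independent P (X i) (fun w => upd (jointX w) i e0).
Proof.
move=> A B mA; move: B.
set Z := fun w => _.
have mZ : measurable_fun setT Z by exact: measurable_others.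
have mXA : measurable (X i @^-1` A) by rewrite -[_ @^-1` _]setTI; exact: mX.
pose Z' := mfun_pack mZ.
pose m1' : {measure set (n.-tuple E) -> \bar R} := pushforward (mrestr P mXA) Z'.
pose m1 := m1' mZ.
have p0 : 0 <= fine (P (X i @^-1` A)) by exact: fine_ge0.
pose m2 : {measure set (n.-tuple E) -> \bar R} := mscale (NngNum p0) (distribution P Z').
have H (B : set (n.-tuple E)) : measurable B -> m1 B = m2 B.
  move: B.
  apply: (measure_unique (@tuple_boxes d' E n) (fun=> setT)).
  - exact: measurable_tuple_boxes.
  - exact: tuple_boxesI.
  - move=> _; exists (fun=> setT) => //; apply/seteqP; by split.
  - by apply/seteqP; split => // t _; exists 0%N.
  - move=> B [b mb ->].
    (* Coordinate i of Z is the constant [e0], so the box condition on it either holds always or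
       never; this is encoded by leaving [c] or the empty set for sample i. The cases c = A and c =
       setT together give the product. *)
    have prodE (c : set E) : measurable c ->
       P (X i @^-1` c `&` Z @^-1` [set t | forall j, b j (tnth t j)]) =
       (P (X i @^-1` c) * (\d_e0 (b i) * \prod_(j | j != i) P (X j @^-1` b j)))%E.
      move=> mc.
      have := indX (B := fun j => if j == i then (if e0 \in b i then c else set0) else b j).
      rewrite (bigD1 i) //= eqxx => h.
      have -> : X i @^-1` c `&` Z @^-1` [set t | forall j, b j (tnth t j)] =
        \bigcap_j X j @^-1` (if j == i then (if e0 \in b i then c else set0) else b j).
        apply/seteqP; split => w /=.
          move=> [cw bw] j _ /=; have := bw j; rewrite /Z tnth_upd tnth_mktuple.
          by case: eqP => [->|//] be; rewrite mem_set.
        move=> hw; have := hw i I; rewrite /= eqxx; case: ifPn => // be cw; split => // j.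
        rewrite /Z tnth_upd tnth_mktuple; case: eqP => [->|/eqP ji]; first by rewrite inE in be.
        by have := hw j I; rewrite /= (negPf ji).
      rewrite h; last by move=> j; case: ifP => // _; case: ifP.
      rewrite (eq_bigr (fun j => P (X j @^-1` b j))); last by move=> j /negPf ->.
      rewrite diracE; case: ifPn => _ /=; first by rewrite mul1e.
      by rewrite preimage_set0 measure0 !mul0e mule0.
    have h1 := prodE A mA; have h2 := prodE setT measurableT.
    rewrite preimage_setT setTI probability_setT mul1e in h2.
    rewrite /m1 /m1' /= /mrestr /= /mscale /= /distribution /pushforward /= fineK ?fin_num_measure //.
    by rewrite setIC h1 h2.
  - move=> _; rewrite /m1 /m1' /= /pushforward /mrestr /=.
    apply: le_lt_trans (probability_le1 P _) (ltry _); apply: measurableI => //.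
  by rewrite preimage_setT.
move=> B mB; have := H B mB.
rewrite /m1 /m1' /= /mrestr /= /mscale /= /distribution /pushforward /= fineK ?fin_num_measure //.
by rewrite setIC.
Qed.

Lemma fubini_family i (e0 : E) (f : n.-tuple E -> \bar R) :
  measurable_fun [set: n.-tuple E] f -> (forall x, (0 <= f x)%E) ->
  (\int[P]_w f (jointX w) = \int[P]_w \int[P]_w' f (upd (jointX w) i (X i w')))%E.
Proof.
move=> mf f0.
have := @indep_fubini _ _ _ _ (X i) (fun w => upd (jointX w) i e0) (fun x => f (upd x.2 i x.1))
  (mX i) (measurable_others i e0) (independent_others i e0)
  (measurableT_comp mf (measurable_upd i)) (fun=> f0 _).
under eq_integral do rewrite /= upd_upd.
move=> H; transitivity (\int[P]_w f (upd (jointX w) i (X i w)))%E.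
  by apply: eq_integral => w _; rewrite -{1}(upd_id (jointX w) i) tnth_mktuple.
rewrite H; apply: eq_integral => w _; apply: eq_integral => w' _ /=.
by rewrite upd_upd.
Qed.

Lemma measurable_inner_integral i (f : n.-tuple E -> \bar R) :
  measurable_fun [set: n.-tuple E] f -> (forall x, (0 <= f x)%E) ->
  measurable_fun setT (fun w => \int[P]_w' f (upd (jointX w) i (X i w')))%E.
Proof.
move=> mf f0.
have mg : measurable_fun [set: E * Omega] (fun x => f (upd (jointX x.2) i x.1)).
  apply: (measurableT_comp mf).
  have h : measurable_fun [set: E * Omega] (fun x => (x.1, jointX x.2)).
    apply: measurable_fun_pair; first exact: measurable_fst.
    exact: measurableT_comp measurable_jointX measurable_snd.
  by have := measurableT_comp (measurable_upd i) h.
have := @measurable_fun_fubini_tonelli_G _ _ _ _ R (distribution P (mfun_pack (mX i))) _ mg.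
move=> /(_ (fun=> f0 _)); apply: eq_measurable_fun => w _; rewrite /fubini_G.
rewrite (ge0_integral_distribution (mfun_pack (mX i)) (f := fun x => f (upd (jointX w) i x))) //.
exact: measurableT_comp mf (measurable_updr _ i).
Qed.

End Family.

End Independence.

(** * A fourth-moment inequality for martingales *)

Section FourthMoment.
Context d (Omega : measurableType d) (R : realType) (P : probability Omega R).

(** The term linear in v is kept exactly because it will integrate to 0; the terms of degree 2 and 3
    in v are split by Young's inequality. The weight l trades the growth of S^4 against the cost of
    v^4. *)
Lemma pow4D_le (S v l : R) : 0 < l ->
  (S + v) ^+ 4 <= (1 + 4 * l) * S ^+ 4 + 4 * S ^+ 3 * v + (3 + 4 / l) * v ^+ 4.
Proof.
move=> l0.
have h1 : 2 * (S * v) ^+ 2 <= l * S ^+ 4 + v ^+ 4 / l.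
  have : 0 <= (l * S ^+ 2 - v ^+ 2) ^+ 2 / l by rewrite divr_ge0 ?sqr_ge0 // ltW.
  have -> : (l * S ^+ 2 - v ^+ 2) ^+ 2 / l = l * S ^+ 4 - 2 * (S * v) ^+ 2 + v ^+ 4 / l.
    by field; rewrite gt_eqF.
  lra.
have h2 : 2 * (S * v ^+ 3) <= (S * v) ^+ 2 + v ^+ 4.
  have := sqr_ge0 (S * v - v ^+ 2).
  rewrite (_ : (S * v - v ^+ 2) ^+ 2 = (S * v) ^+ 2 - 2 * (S * v ^+ 3) + v ^+ 4); last by ring.
  by lra.
have -> : (S + v) ^+ 4 = S ^+ 4 + 4 * S ^+ 3 * v + 6 * (S * v) ^+ 2 + 4 * (S * v ^+ 3) + v ^+ 4 by ring.
have -> : (3 + 4 / l) * v ^+ 4 = 3 * v ^+ 4 + 4 * (v ^+ 4 / l) by ring.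
by have := sqr_ge0 (S * v); lra.
Qed.

Lemma integral_pow4D_le (V : Omega -> R) (S l : R) : 0 < l ->
  P.-integrable setT (EFin \o V) -> (\int[P]_w (V w)%:E = 0)%E ->
  P.-integrable setT (fun w => (V w ^+ 4)%:E) ->
  (\int[P]_w ((S + V w) ^+ 4)%:E <=
   ((1 + 4 * l) * S ^+ 4)%:E + (3 + 4 / l)%:E * \int[P]_w (V w ^+ 4)%:E)%E.
Proof.
move=> l0 iV V0 iV4.
have mV : measurable_fun setT V by apply/measurable_EFinP; exact: (measurable_int P).
have mVn k : measurable_fun setT (fun w => V w ^+ k).
  by elim: k => [|k IH]; [exact: measurable_cst | under eq_fun do rewrite exprS; exact: measurable_funM].
pose g w := ((((1 + 4 * l) * S ^+ 4)%:E + (4 * S ^+ 3)%:E * (V w)%:E) + (3 + 4 / l)%:E * (V w ^+ 4)%:E)%E.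
have i1 : P.-integrable setT (fun w => (4 * S ^+ 3)%:E * (V w)%:E)%E by exact: integrableZl.
have i2 : P.-integrable setT (fun w => (3 + 4 / l)%:E * (V w ^+ 4)%:E)%E by exact: integrableZl.
have i0 : P.-integrable setT (fun=> ((1 + 4 * l) * S ^+ 4)%:E).
  by apply: (finite_measure_integrable_cst P).
have i01 : P.-integrable setT (fun w => ((1 + 4 * l) * S ^+ 4)%:E + (4 * S ^+ 3)%:E * (V w)%:E)%E.
  exact: integrableD.
have : (\int[P]_w ((S + V w) ^+ 4)%:E <= \int[P]_w g w)%E.
  apply: ge0_le_integral => //.
  - by move=> w _; rewrite lee_fin exprn_even_ge0.
  - apply/measurable_EFinP; have := @measurable_funX _ _ _ setT (fun w => S + V w) 4; apply.
    exact: measurable_funD (measurable_cst _) mV.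
  - by apply: (measurable_int P); exact: integrableD.
  - by move=> w _; rewrite /g -!EFinM -!EFinD lee_fin; exact: pow4D_le.
move=> /le_trans; apply; rewrite /g integralD // integralD // !integralZl // V0 mule0 adde0.
by rewrite integral_cst //= probability_setT mule1.
Qed.

Context d' (E : measurableType d') (n : nat) (X : 'I_n -> Omega -> E).
Hypothesis mX : forall i, measurable_fun setT (X i).
Hypothesis indX : mutually_independent P X.
Variables (D : 'I_n -> n.-tuple E -> R) (l h : 'I_n -> R).
Hypothesis mD : forall i, measurable_fun setT (D i).
Hypothesis adapted : forall (i : 'I_n) (t t' : n.-tuple E),
  (forall j : 'I_n, (j <= i)%N -> tnth t j = tnth t' j) -> D i t = D i t'.
Hypothesis l_gt0 : forall i, 0 < l i.
Hypothesis h_ge0 : forall i, 0 <= h i.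
Hypothesis D_int : forall i t, P.-integrable setT (fun w => (D i (upd t i (X i w)))%:E).
Hypothesis D_mean0 : forall i t, (\int[P]_w (D i (upd t i (X i w)))%:E = 0)%E.
Hypothesis D4_int : forall i t, P.-integrable setT (fun w => (D i (upd t i (X i w)) ^+ 4)%:E).
Hypothesis D4_le : forall i, (\int[P]_w (D i (jointX X w) ^+ 4)%:E <= (h i)%:E)%E.

(* (S + v)^4 <= (1 + 4 l) S^4 + 4 S^3 v + (3 + 4 / l) v^4, and the cubic term has
   mean 0 when v is a martingale increment. *)
Lemma martingale_fourth_moment :
  (\int[P]_w ((\sum_i D i (jointX X w)) ^+ 4)%:E <=
   (expR (4 * \sum_i l i) * \sum_i (3 + 4 / l i) * h i)%:E)%E.
Proof.
pose S k t := \sum_(i < n | (i < k)%N) D i t.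
have mS k : measurable_fun setT (S k).
  rewrite /S; under eq_fun do rewrite big_mkcond /=.
  have H (i : 'I_n) : measurable_fun setT (fun t => if (i < k)%N then D i t else 0).
    by have [_|_] := boolP (i < k)%N; [exact: mD|exact: measurable_cst].
  exact: (measurable_sum _ H).
have mJ : measurable_fun setT (jointX X) by exact: measurable_jointX.
have l4 i : 0 <= 3 + 4 / l i by rewrite addr_ge0 // divr_ge0 // ltW.
suff H k : (k <= n)%N -> (\int[P]_w (S k (jointX X w) ^+ 4)%:E <=
   (expR (4 * \sum_(i < n | (i < k)%N) l i) * \sum_(i < n | (i < k)%N) (3 + 4 / l i) * h i)%:E)%E.
  have all_lt (F : 'I_n -> R) : \sum_(i < n | (i < n)%N) F i = \sum_i F i.
    by apply: eq_bigl => i; rewrite ltn_ord.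
  have := H n (leqnn n); rewrite !all_lt; congr (_ <= _)%E.
  by apply: eq_integral => w _; rewrite /S all_lt.
elim: k => [_|k IH kn].
  rewrite [X in (_ * X)%:E]big1 // mulr0.
  under eq_integral do rewrite /S big1 // expr0n.
  by rewrite integral0.
pose i := Ordinal kn.
have SS t : S k.+1 t = S k t + D i t.
  rewrite /S (bigD1 i) //= addrC; congr (_ + _); apply: eq_bigl => j.
  rewrite ltnS leq_eqVlt -(inj_eq val_inj) /=.
  by case: (ltngtP j k).
have Supd t x : S k (upd t i x) = S k t.
  apply: eq_bigr => j jk; apply: adapted => j' j'j; rewrite tnth_upd.
  case: eqP => // e; move: j'j; rewrite e /= leqNgt; by rewrite jk.
have bigS (F : 'I_n -> R) : \sum_(j < n | (j < k.+1)%N) F j = \sum_(j < n | (j < k)%N) F j + F i.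
  rewrite (bigD1 i) //= addrC; congr (_ + _); apply: eq_bigl => j.
  rewrite ltnS leq_eqVlt -(inj_eq val_inj) /=.
  by case: (ltngtP j k).
have e0 : E by exact: point.
have m4 (f : n.-tuple E -> R) : measurable_fun [set: n.-tuple E] f ->
  measurable_fun [set: n.-tuple E] (fun t => (f t ^+ 4)%:E).
  by move=> mf; apply/measurable_EFinP; exact: measurable_funX.
have p4 (f : n.-tuple E -> R) t : (0 <= (f t ^+ 4)%:E)%E by rewrite lee_fin exprn_even_ge0.
rewrite (fubini_family mX indX i e0 (m4 _ (mS k.+1)) (p4 (S k.+1))).
pose J w := (\int[P]_w' (D i (upd (jointX X w) i (X i w')) ^+ 4)%:E)%E.
have J0 w : (0 <= J w)%E by apply: integral_ge0 => w' _; rewrite lee_fin exprn_even_ge0.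
have mJ' : measurable_fun setT J by exact: (measurable_inner_integral P mX i (m4 _ (mD i)) (p4 (D i))).
have JE : (\int[P]_w J w <= (h i)%:E)%E.
  by rewrite /J -(fubini_family mX indX i e0 (m4 _ (mD i)) (p4 (D i))).
apply: (@le_trans _ _ (\int[P]_w ((((1 + 4 * l i) * S k (jointX X w) ^+ 4)%:E +
    (3 + 4 / l i)%:E * J w)))%E).
  apply: ge0_le_integral => //.
  - by move=> w _; apply: integral_ge0 => w' _; exact: p4.
  - exact: (measurable_inner_integral P mX i (m4 _ (mS k.+1)) (p4 (S k.+1))).
  - apply: emeasurable_funD.
      apply/measurable_EFinP; apply: measurable_funM => //.
      by apply: measurable_funX; exact: measurableT_comp.
    exact: emeasurable_funM.
  - move=> w _; under eq_integral do rewrite SS Supd.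
    exact: (@integral_pow4D_le (fun w' => D i (upd (jointX X w) i (X i w')))
      (S k (jointX X w)) (l i) (l_gt0 i) (D_int i _) (D_mean0 i _) (D4_int i _)).
rewrite ge0_integralD //; last 4 first.
- by move=> w _; rewrite lee_fin mulr_ge0 ?exprn_even_ge0 // addr_ge0 // mulr_ge0 // ltW.
- apply/measurable_EFinP; apply: measurable_funM => //.
  by apply: measurable_funX; exact: measurableT_comp.
- by move=> w _; rewrite mule_ge0 // lee_fin.
- exact: emeasurable_funM.
under eq_integral do rewrite EFinM.
rewrite ge0_integralZl //; last 2 first.
- exact: (measurableT_comp (m4 _ (mS k)) mJ).
- by rewrite lee_fin addr_ge0 // mulr_ge0 // ltW.
rewrite ge0_integralZl //; last by rewrite lee_fin.
have IHk := IH (ltnW kn).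
set a := \sum_(i < n | (i < k)%N) l i in IHk.
set b := \sum_(i < n | (i < k)%N) _ * _ in IHk.
have b0 : 0 <= b by apply: sumr_ge0 => j _; rewrite mulr_ge0.
apply: (@le_trans _ _ ((1 + 4 * l i)%:E * (expR (4 * a) * b)%:E + (3 + 4 / l i)%:E * (h i)%:E)%E).
  apply: leeD; apply: lee_wpmul2l => //; rewrite lee_fin // addr_ge0 // mulr_ge0 // ltW //.
rewrite !bigS -/a -/b -!EFinM -EFinD lee_fin (mulrDr 4) expRD.
have e1 : 1 + 4 * l i <= expR (4 * l i) by exact: expR_ge1Dx.
have e2 : 1 <= expR (4 * a).
  rewrite -expR0 ler_expR mulr_ge0 // sumr_ge0 // => j _; exact: ltW.
have e3 : 1 <= expR (4 * l i) by rewrite -expR0 ler_expR mulr_ge0 // ltW.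
have hh : 0 <= (3 + 4 / l i) * h i by rewrite mulr_ge0.
have ea : 0 <= expR (4 * a) * b by rewrite mulr_ge0 // expR_ge0.
rewrite mulrDr; apply: lerD.
  by rewrite [leRHS]mulrAC [leRHS]mulrC; apply: ler_wpM2r.
by rewrite -[leLHS]mul1r; apply: ler_wpM2r => //; apply: mulr_ege1.
Qed.

End FourthMoment.

(** * Moments of the standard Gaussian law *)

Section GaussianMoments.
Variable R : realType.
Local Notation leb := (@lebesgue_measure R).
Local Notation N := (@normal_prob R 0 1).

Lemma ge0_integral_normal_prob (f : R -> R) :
  measurable_fun setT f -> (forall x, 0 <= f x) ->
  (\int[N]_x (f x)%:E = \int[leb]_x (f x * normal_pdf 0 1 x)%:E)%E.
Proof.
move=> mf f0.
have mE : measurable_fun [set: measurableTypeR R] (EFin \o f) by exact/measurable_EFinP.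
have dom : (N `<< leb)%E by exact: normal_prob_dominates.
rewrite -(@Radon_Nikodym_SigmaFinite.change_of_variables _ _ _ N leb dom (EFin \o f) setT) //.
have mpdf : measurable_fun setT (fun x => (normal_pdf 0 1 x : R)%:E).
  by apply/measurable_EFinP; exact: measurable_normal_pdf.
have irn := Radon_Nikodym_SigmaFinite.f_integrable dom.
transitivity (\int[leb]_x ((f x)%:E * (normal_pdf 0 1 x)%:E))%E; last first.
  by apply: eq_integral => x _; rewrite EFinM.
apply: ae_eq_integral => //.
- by apply: emeasurable_funM => //; exact: (measurable_int leb irn).
- exact: emeasurable_funM.
- apply: ae_eqe_mul2l; apply: integral_ae_eq => // E _ mE'.
  by rewrite -(Radon_Nikodym_SigmaFinite.f_integral dom mE').
Qed.

(** An exponential tilt of N(0, 1) is a multiple of another Gaussian density. Exponential moments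
    are thus exact, and all the polynomial moments below are deduced from them without integration
    by parts. *)
Lemma normal_pdf_scale (s x : R) : 0 < s ->
  expR (- (s ^+ 2 - 1) * x ^+ 2 / 2) * normal_pdf 0 1 x = s^-1 * normal_pdf 0 s^-1 x.
Proof.
move=> s0; have sn : s != 0 by rewrite gt_eqF.
rewrite !normal_pdfE ?oner_eq0 ?invr_eq0 // /normal_fun /normal_peak !subr0.
have -> : Num.sqrt (s^-1 ^+ 2 * pi *+ 2) = s^-1 * Num.sqrt (1 ^+ 2 * pi *+ 2).
  rewrite -[s^-1 in RHS]gtr0_norm ?invr_gt0 // -sqrtr_sqr -sqrtrM ?sqr_ge0 //.
  by rewrite expr1n mul1r -mulrnAr.
rewrite invfM invrK mulrCA [RHS]mulrA [s^-1 * _]mulrA mulVf // mul1r; congr (_ * _).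
rewrite -expRD; congr expR; rewrite expr1n (_ : (1 *+ 2 : R) = 2) // -[s^-1 ^+ 2 *+ 2]mulr_natr.
by field.
Qed.

Lemma normal_pdf_shift (t x : R) :
  expR (t * x) * normal_pdf 0 1 x = expR (t ^+ 2 / 2) * normal_pdf t 1 x.
Proof.
rewrite !normal_pdfE ?oner_eq0 // /normal_fun mulrCA [RHS]mulrCA; congr (_ * _).
rewrite -!expRD; congr expR; rewrite subr0 expr1n (_ : (1 *+ 2 : R) = 2) //.
by field.
Qed.

Lemma integral_normal_expsq (s : R) : 0 < s ->
  (\int[N]_x (expR (- (s ^+ 2 - 1) * x ^+ 2 / 2))%:E = (s^-1)%:E)%E.
Proof.
move=> s0; rewrite ge0_integral_normal_prob; last 2 first.
- apply: measurableT_comp => //; apply: measurable_funM => //; apply: measurable_funM => //.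
- by move=> x; exact: expR_ge0.
under eq_integral do rewrite normal_pdf_scale // EFinM.
rewrite ge0_integralZl //; last 3 first.
- by apply/measurable_EFinP; exact: measurable_normal_pdf.
- by move=> x _; rewrite lee_fin normal_pdf_ge0.
- by rewrite lee_fin invr_ge0 ltW.
by rewrite integral_normal_pdf mule1.
Qed.

Lemma integral_normal_exp (t : R) : (\int[N]_x (expR (t * x))%:E = (expR (t ^+ 2 / 2))%:E)%E.
Proof.
rewrite ge0_integral_normal_prob; last 2 first.
- by apply: measurableT_comp => //; apply: measurable_funM.
- by move=> x; exact: expR_ge0.
under eq_integral do rewrite normal_pdf_shift // EFinM.
rewrite ge0_integralZl //; last 2 first.
- by apply/measurable_EFinP; exact: measurable_normal_pdf.
- by move=> x _; rewrite lee_fin normal_pdf_ge0.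
by rewrite integral_normal_pdf mule1.
Qed.

Lemma normal_moment8 : exists2 c : R, 0 <= c & (\int[N]_x (x ^+ 8)%:E <= c%:E)%E.
Proof.
(* This makes the exponent x^2 / 4, still integrable against the Gaussian density; x^8 is then
   controlled by y^4 / 4! <= exp y with y = x^2 / 4. *)
pose s : R := Num.sqrt (1 / 2).
have s0 : 0 < s by rewrite sqrtr_gt0.
have s2 : s ^+ 2 = 1 / 2 by rewrite sqr_sqrtr.
have c0 : 0 <= 4 ^+ 4 * (4`!)%:R :> R by rewrite mulr_ge0 ?exprn_ge0.
exists (4 ^+ 4 * (4`!)%:R * s^-1); first by rewrite mulr_ge0 // invr_ge0 ltW.
rewrite EFinM -(integral_normal_expsq s0) -ge0_integralZl //; last first.
  apply/measurable_EFinP; apply: measurableT_comp => //; apply: measurable_funM => //; exact: measurable_funM.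
apply: ge0_le_integral => //.
- by move=> x _; rewrite lee_fin exprn_even_ge0.
- by apply/measurable_EFinP; exact: measurable_funX.
- apply: emeasurable_funM => //; apply/measurable_EFinP; apply: measurableT_comp => //.
  by apply: measurable_funM => //; exact: measurable_funM.
move=> x _; rewrite -EFinM lee_fin s2.
have -> : - (1 / 2 - 1) * x ^+ 2 / 2 = x ^+ 2 / 4 by field.
have h : 0 <= x ^+ 2 / 4 by rewrite divr_ge0 ?sqr_ge0.
have := expR_ge1Dxn 3 h; set y := expR _ => hy.
have -> : x ^+ 8 = 4 ^+ 4 * (x ^+ 2 / 4) ^+ 4.
  by rewrite -exprMn mulrC mulfVK // -exprM.
rewrite -[leRHS]mulrA; apply: ler_wpM2l; first exact: exprn_ge0.
rewrite -ler_pdivrMl ?ltr0n ?fact_gt0 // mulrC.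
by apply: le_trans hy; rewrite lerDr.
Qed.

Lemma integrable_normal_poly (f : R -> R) (c : R) : measurable_fun setT f ->
  (forall x, `|f x| <= c * (1 + x ^+ 8)) -> N.-integrable setT (EFin \o f).
Proof.
move=> mf fc; have [c8 c80 h8] := normal_moment8.
have i8 : N.-integrable setT (fun x => (x ^+ 8)%:E).
  apply/integrableP; split; first by apply/measurable_EFinP; exact: measurable_funX.
  under eq_integral do rewrite gee0_abs ?lee_fin ?exprn_even_ge0 //.
  exact: le_lt_trans h8 (ltry _).
have i0 : N.-integrable setT (fun=> 1%E : \bar R) by exact: (finite_measure_integrable_cst N 1).
have ig : N.-integrable setT (fun x => c%:E * (1 + (x ^+ 8)%:E))%E.
  by apply: integrableZl => //; exact: integrableD.
apply: (le_integrable measurableT _ _ ig); first exact/measurable_EFinP.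
move=> x _; rewrite -EFinD -EFinM /= lee_fin.
by apply: le_trans (fc x) (ler_norm _).
Qed.

Lemma pow_le_1D8 (x : R) (k : nat) : (k <= 8)%N -> `|x ^+ k| <= 1 + x ^+ 8.
Proof.
move=> k8; rewrite normrX.
have -> : x ^+ 8 = `|x| ^+ 8 by rewrite -normrX ger0_norm // exprn_even_ge0.
have x0 := normr_ge0 x; move: `|x| x0 => y y0.
have [y1|y1] := leP y 1.
  by apply: (@le_trans _ _ 1); [exact: exprn_ile1 | rewrite lerDl exprn_ge0].
by apply: (@le_trans _ _ (y ^+ 8)); [exact: ler_weXn2l (ltW y1) _ _ _ | rewrite lerDr].
Qed.

Lemma integrable_normal_pow (k : nat) : (k <= 8)%N -> N.-integrable setT (fun x => (x ^+ k)%:E).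
Proof.
move=> k8; apply: (@integrable_normal_poly (fun x => x ^+ k) 1); first exact: measurable_funX.
by move=> x; rewrite mul1r pow_le_1D8.
Qed.

Lemma normal_integral_cst (c : R) : (\int[N]_x c%:E = c%:E)%E.
Proof. by rewrite integral_cst //= probability_setT mule1. Qed.

(** For the mean A, 1 + t A <= E exp(t x) = exp(t^2 / 2), hence t A <= t^2 for small t of either
    sign, which forces A = 0. *)
Lemma integral_normal_id : (\int[N]_x (x%:E) = 0)%E.
Proof.
have i1 : N.-integrable setT (fun x : R => x%:E).
  by have := integrable_normal_pow (isT : (1 <= 8)%N); under eq_fun do rewrite expr1.
have fin1 : (\int[N]_x (x%:E) \is a fin_num)%E by exact: integrable_fin_num.
have ie t : N.-integrable setT (fun x : R => (expR (t * x))%:E).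
  apply/integrableP; split.
    by apply/measurable_EFinP; apply: measurableT_comp => //; exact: measurable_funM.
  under eq_integral do rewrite gee0_abs ?lee_fin ?expR_ge0 //.
  by rewrite integral_normal_exp ltry.
have i0 : N.-integrable setT (fun=> 1%E : \bar R) by exact: (finite_measure_integrable_cst N 1).
rewrite -(fineK fin1); congr EFin; set A := fine _.
have key t : 1 + t * A <= expR (t ^+ 2 / 2).
  rewrite -lee_fin -integral_normal_exp EFinD EFinM fineK //.
  rewrite -[X in (X + _)%E](normal_integral_cst 1) -integralZl // -integralD //; last exact: integrableZl.
  apply: le_integral => //; first by apply: integrableD => //; exact: integrableZl.
  by move=> x _; rewrite -EFinM -EFinD lee_fin; exact: expR_ge1Dx.
have bnd t : `|t| <= 1 -> t * A <= t ^+ 2.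
  move=> t1; have := key t.
  have t2 : t ^+ 2 <= 1 by rewrite -real_normK ?num_real // expr_le1.
  have := expR_ge1Dx (- (t ^+ 2 / 2)); rewrite expRN => h.
  have e0 := expR_gt0 (t ^+ 2 / 2); set e := expR _ in h e0 *.
  have : e * (1 - t ^+ 2 / 2) <= 1 by rewrite -ler_pdivlMl // mulr1.
  have := sqr_ge0 t; set q := t ^+ 2 in t2 h *; move=> q0 h1 h2.
  suff : e <= 1 + q by lra.
  nra.
apply/le_anti/andP; split; apply/ler_addgt0Pr => e e0.
  rewrite add0r; pose t := Num.min e 1.
  have t0 : 0 < t by rewrite lt_min e0 ltr01.
  have : `|t| <= 1 by rewrite gtr0_norm // ge_min lexx orbT.
  by move/bnd; rewrite expr2 ler_pM2l // => /le_trans; apply; rewrite ge_min lexx.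
pose t := Num.min e 1.
have t0 : 0 < t by rewrite lt_min e0 ltr01.
have : `|- t| <= 1 by rewrite normrN gtr0_norm // ge_min lexx orbT.
move/bnd; rewrite sqrrN expr2 mulNr -mulrN ler_pM2l // lerNl => h.
have : t <= e by rewrite ge_min lexx.
lra.
Qed.

(** For the second moment A, exp(y) >= 1 + y gives 1 + (1 - s^2) A / 2 <= 1/s. Taking s = 1 - e and
    s = 1 + e squeezes A to 1 as e tends to 0. *)
Lemma integral_normal_sqr : (\int[N]_x ((x ^+ 2)%:E) = 1)%E.
Proof.
have i2 := integrable_normal_pow (isT : (2 <= 8)%N).
have fin2 : (\int[N]_x ((x ^+ 2)%:E) \is a fin_num)%E by exact: integrable_fin_num.
have ie s : 0 < s -> N.-integrable setT (fun x : R => (expR (- (s ^+ 2 - 1) * x ^+ 2 / 2))%:E).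
  move=> s0; apply/integrableP; split.
    apply/measurable_EFinP; apply: measurableT_comp => //; apply: measurable_funM => //; exact: measurable_funM.
  under eq_integral do rewrite gee0_abs ?lee_fin ?expR_ge0 //.
  by rewrite integral_normal_expsq // ltry.
have i0 : N.-integrable setT (fun=> 1%E : \bar R) by exact: (finite_measure_integrable_cst N 1).
rewrite -(fineK fin2); congr EFin; set A := fine _.
have A0 : 0 <= A by apply: fine_ge0; apply: integral_ge0 => x _; rewrite lee_fin sqr_ge0.
have key s : 0 < s -> 1 + (- (s ^+ 2 - 1) / 2) * A <= s^-1.
  move=> s0; rewrite -lee_fin -integral_normal_expsq // EFinD EFinM fineK //.
  rewrite -[X in (X + _)%E](normal_integral_cst 1) -integralZl // -integralD //; last exact: integrableZl.
  apply: le_integral => //; first by apply: integrableD => //; exact: integrableZl.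
    exact: ie.
  move=> x _; rewrite -EFinM -EFinD lee_fin mulrAC; exact: expR_ge1Dx.
have up e : 0 < e -> e < 1 -> A * (2 - 3 * e) <= 2.
  move=> e0 e1; have s0 : 0 < 1 - e by rewrite subr_gt0.
  have := key _ s0 => h.
  have h2 : (1 - e) * (1 + (- ((1 - e) ^+ 2 - 1) / 2) * A) <= 1.
    by rewrite -ler_pdivlMl // mulr1.
  have h3 : e * ((1 - e) * (2 - e) / 2 * A - 1) <= 0.
    have -> : e * ((1 - e) * (2 - e) / 2 * A - 1) =
      (1 - e) * (1 + (- ((1 - e) ^+ 2 - 1) / 2) * A) - 1 by field.
    by rewrite subr_le0.
  move: h3; rewrite pmulr_rle0 // subr_le0 => h3.
  have : 0 <= A * e ^+ 2 by rewrite mulr_ge0 // sqr_ge0.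
  rewrite expr2; nra.
have lo e : 0 < e -> e < 1 -> 2 <= A * (2 + 4 * e).
  move=> e0 e1; have s0 : 0 < 1 + e by rewrite addr_gt0.
  have := key _ s0 => h.
  have h2 : (1 + e) * (1 + (- ((1 + e) ^+ 2 - 1) / 2) * A) <= 1.
    by rewrite -ler_pdivlMl // mulr1.
  have h3 : e * (1 - (1 + e) * (2 + e) / 2 * A) <= 0.
    have -> : e * (1 - (1 + e) * (2 + e) / 2 * A) =
      (1 + e) * (1 + (- ((1 + e) ^+ 2 - 1) / 2) * A) - 1 by field.
    by rewrite subr_le0.
  move: h3; rewrite pmulr_rle0 // subr_le0 => h3.
  have : A * e ^+ 2 <= A * e by rewrite ler_wpM2l // expr2 ler_piMr // ltW.
  rewrite expr2; nra.
have D0 : 0 < 3 * A + 1 by rewrite ltr_wpDl // mulr_ge0.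
apply/le_anti/andP; split; apply/ler_addgt0Pr => e e0.
  pose t := Num.min (e / (3 * A + 1)) (1 / 2).
  have t0 : 0 < t by rewrite lt_min divr_gt0 //=.
  have t1 : t < 1 by rewrite gt_min; apply/orP; right; lra.
  have := up t t0 t1.
  have : (3 * A + 1) * t <= e by rewrite mulrC -ler_pdivlMr // ge_min lexx.
  nra.
pose t := Num.min (e / (3 * A + 1)) (1 / 2).
have t0 : 0 < t by rewrite lt_min divr_gt0 //=.
have t1 : t < 1 by rewrite gt_min; apply/orP; right; lra.
have := lo t t0 t1.
have : (3 * A + 1) * t <= e by rewrite mulrC -ler_pdivlMr // ge_min lexx.
nra.
Qed.

(** This is the martingale increment of linear and quadratic forms in one Gaussian coordinate x: [a]
    is a diagonal coefficient and [b] depends on the coordinates already revealed. *)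
Lemma gaussian_increment : exists2 k : R, 0 < k & forall a b : R,
  [/\ N.-integrable setT (fun x => (a * (x ^+ 2 - 1) + b * x)%:E),
      (\int[N]_x (a * (x ^+ 2 - 1) + b * x)%:E = 0)%E,
      N.-integrable setT (fun x => ((a * (x ^+ 2 - 1) + b * x) ^+ 4)%:E) &
      (\int[N]_x ((a * (x ^+ 2 - 1) + b * x) ^+ 4)%:E <= (k * (a ^+ 4 + b ^+ 4))%:E)%E].
Proof.
have [c c0 h8] := normal_moment8.
exists (64 * (1 + c)); first by rewrite mulr_gt0 // ltr_pwDl.
move=> a b.
have i0 : N.-integrable setT (fun=> 1%E : \bar R) by exact: (finite_measure_integrable_cst N 1).
have i1 : N.-integrable setT (fun x : R => x%:E).
  by have := integrable_normal_pow (isT : (1 <= 8)%N); under eq_fun do rewrite expr1.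
have i2 := integrable_normal_pow (isT : (2 <= 8)%N).
have i8 := integrable_normal_pow (isT : (8 <= 8)%N).
have E : (fun x : R => (a * (x ^+ 2 - 1) + b * x)%:E) =
   (fun x => a%:E * ((x ^+ 2)%:E - 1) + b%:E * x%:E)%E.
  by apply/funext => x; rewrite EFinD !EFinM EFinB.
have i3 : N.-integrable setT (fun x => a%:E * ((x ^+ 2)%:E - 1))%E.
  by apply: integrableZl => //; exact: integrableB.
have i4 : N.-integrable setT (fun x : R => b%:E * x%:E)%E by exact: integrableZl.
have pt x : (a * (x ^+ 2 - 1) + b * x) ^+ 4 <= 64 * (a ^+ 4 + b ^+ 4) * (1 + x ^+ 8).
  have p4 (u v : R) : (u + v) ^+ 4 <= 8 * (u ^+ 4 + v ^+ 4).
    have h1 := sqr_ge0 (u - v); have h2 := sqr_ge0 (u ^+ 2 - v ^+ 2).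
    have -> : (u + v) ^+ 4 = ((u + v) ^+ 2) ^+ 2 by ring.
    have h3 : (u + v) ^+ 2 <= 2 * (u ^+ 2 + v ^+ 2).
      by move: h1; rewrite !expr2; lra.
    have h4 : ((u + v) ^+ 2) ^+ 2 <= (2 * (u ^+ 2 + v ^+ 2)) ^+ 2.
      by rewrite ler_pXn2r ?nnegrE ?sqr_ge0 ?mulr_ge0 ?addr_ge0 ?sqr_ge0.
    apply: (le_trans h4).
    have -> : (2 * (u ^+ 2 + v ^+ 2)) ^+ 2 = 8 * (u ^+ 4 + v ^+ 4) - 4 * (u ^+ 2 - v ^+ 2) ^+ 2 by ring.
    lra.
  apply: (le_trans (p4 _ _)); rewrite !exprMn.
  have h1 : (x ^+ 2 - 1) ^+ 4 <= 8 * (1 + x ^+ 8).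
    apply: (le_trans (p4 _ _)); rewrite -exprM (_ : (-1) ^+ 4 = 1 :> R); last by ring.
    by rewrite addrC.
  have h2 : x ^+ 4 <= 1 + x ^+ 8.
    by apply: le_trans (pow_le_1D8 x (isT : (4 <= 8)%N)); exact: ler_norm.
  have x8 : 0 <= x ^+ 8 by rewrite exprn_even_ge0.
  have a4 : 0 <= a ^+ 4 by rewrite exprn_even_ge0.
  have b4 : 0 <= b ^+ 4 by rewrite exprn_even_ge0.
  have h3 : a ^+ 4 * (x ^+ 2 - 1) ^+ 4 <= a ^+ 4 * (8 * (1 + x ^+ 8)) by rewrite ler_wpM2l.
  have h4 : b ^+ 4 * x ^+ 4 <= b ^+ 4 * (1 + x ^+ 8) by rewrite ler_wpM2l.
  have h5 : 0 <= b ^+ 4 * (1 + x ^+ 8) by rewrite mulr_ge0 // addr_ge0.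
  move: h3 h4 h5; lra.
have mp : measurable_fun setT (fun x : R => a * (x ^+ 2 - 1) + b * x).
  apply: measurable_funD; apply: measurable_funM => //.
  by apply: measurable_funB => //; exact: measurable_funX.
split.
- by rewrite E; exact: integrableD.
- rewrite E integralD // !integralZl //; last exact: integrableB.
  rewrite integralB // integral_normal_sqr integral_normal_id normal_integral_cst.
  by rewrite subee // !mule0 adde0.
- apply: (@integrable_normal_poly (fun x => (a * (x ^+ 2 - 1) + b * x) ^+ 4)).
    exact: measurable_funX.
  by move=> x; rewrite ger0_norm ?exprn_even_ge0 //; exact: pt.
- apply: (@le_trans _ _ (\int[N]_x ((64 * (a ^+ 4 + b ^+ 4))%:E * (1 + (x ^+ 8)%:E)))%E).
    apply: ge0_le_integral => //.
    + by move=> x _; rewrite lee_fin exprn_even_ge0.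
    + by apply/measurable_EFinP; exact: measurable_funX.
    + apply: emeasurable_funM => //; apply: emeasurable_funD => //.
      by apply/measurable_EFinP; exact: measurable_funX.
    + by move=> x _; rewrite -EFinD -EFinM lee_fin.
  have k0 : 0 <= 64 * (a ^+ 4 + b ^+ 4) by rewrite mulr_ge0 // addr_ge0 // exprn_even_ge0.
  rewrite integralZl //; last exact: integrableD.
  rewrite integralD // normal_integral_cst.
  rewrite (_ : 64 * (1 + c) * _ = (64 * (a ^+ 4 + b ^+ 4)) * (1 + c)); last by ring.
  by rewrite [X in (_ <= X)%E]EFinM; apply: lee_wpmul2l; rewrite ?lee_fin // EFinD leeD2l.
Qed.

End GaussianMoments.

Section BorelTransfer.
Variable R : realType.

(* [measurableTypeR R] and [R] have the same measurable sets, but their displays are not convertible. *)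
Lemma measurable_idR : measurable_fun [set: measurableTypeR R] (id : measurableTypeR R -> R).
Proof. by move=> _ B mB; rewrite setTI. Qed.

Lemma ge0_integral_borel (nu : {measure set (measurableTypeR R) -> \bar R})
    (mu : {measure set R -> \bar R}) (f : R -> \bar R) :
  (forall B : set R, measurable B -> mu B = nu B) ->
  measurable_fun setT f -> (forall x, (0 <= f x)%E) ->
  (\int[mu]_x f x = \int[nu]_x f x)%E.
Proof.
move=> h mf f0; pose nu1 : {measure set R -> \bar R} := pushforward nu (id : measurableTypeR R -> R).
pose nu' := nu1 measurable_idR; transitivity (\int[nu']_x f x)%E.
  by apply: eq_measure_integral => B mB _; exact: h.
by rewrite (ge0_integral_pushforward measurable_idR).
Qed.
End BorelTransfer.

Section GaussianForms.
Context d (Omega : measurableType d) (R : realType) (P : probability Omega R).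
Local Notation N := (@normal_prob R 0 1).
Context m (U : {RV P >-> m.-tuple R}).
Hypothesis gaussU : std_gaussian_vector P U.
Local Notation X := (fun j w => tnth (U w) j).

Lemma measurable_coord j : measurable_fun setT (X j).
Proof. exact: measurableT_comp (measurable_tnth j) (measurable_funP U). Qed.

Lemma jointX_coord w : jointX X w = U w.
Proof. by apply: eq_from_tnth => j; rewrite tnth_mktuple. Qed.

Lemma coord_law j B : measurable B -> P (X j @^-1` B) = N B.
Proof.
move=> mB; have := @gaussU (fun k => if k == j then B else setT).
rewrite (bigD1 j) //= eqxx big1 ?mule1; last first.
  by move=> k /negPf ->; exact: probability_setT.
move=> <-; last by move=> k; case: ifP.
congr (P _); apply/seteqP; split => w /=; last by move=> /(_ j); rewrite eqxx.
by move=> Bw k; case: eqP => // ->.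
Qed.

Lemma coord_indep : mutually_independent P X.
Proof.
move=> B mB; under [in RHS]eq_bigr => j _ do rewrite coord_law //.
rewrite -gaussU //; congr (P _); apply/seteqP; split => w /=; first by move=> h j; exact: h.
by move=> h j _; exact: h.
Qed.

Lemma ge0_integral_coord j (f : R -> \bar R) : measurable_fun setT f ->
  (forall x, (0 <= f x)%E) -> (\int[P]_w f (X j w) = \int[N]_x f x)%E.
Proof.
move=> mf f0.
rewrite -(ge0_integral_distribution (mfun_pack (measurable_coord j)) mf f0).
by apply: ge0_integral_borel => // B mB; exact: coord_law.
Qed.

Lemma integrable_coord j (f : R -> \bar R) : N.-integrable setT f ->
  P.-integrable setT (fun w => f (X j w)).
Proof.
move=> /integrableP[mf fi]; apply/integrableP; split.
  exact: measurableT_comp mf (measurable_coord j).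
by rewrite (ge0_integral_coord _ (f := fun x => `|f x|%E)) //; exact: measurableT_comp.
Qed.

Lemma integral_coord j (f : R -> \bar R) : N.-integrable setT f ->
  (\int[P]_w f (X j w) = \int[N]_x f x)%E.
Proof.
move=> fi; have [mf _] := integrableP _ _ _ fi.
rewrite integralE [RHS]integralE; congr (_ - _)%E.
  have <- := @ge0_integral_coord j (f^\+%E) (measurable_funepos mf) (fun x => funepos_ge0 f x).
  by apply: eq_integral => w _; rewrite !funeposE.
have <- := @ge0_integral_coord j (f^\-%E) (measurable_funeneg mf) (fun x => funeneg_ge0 f x).
by apply: eq_integral => w _; rewrite !funenegE.
Qed.

End GaussianForms.

(** * Fourth moments of Gaussian linear and quadratic forms *)

Section GaussianFourthMoments.
Context d (Omega : measurableType d) (R : realType) (P : probability Omega R).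

Lemma measurable_linear_form m (c : 'I_m -> R) :
  measurable_fun [set: m.-tuple R] (fun t => \sum_j c j * tnth t j).
Proof.
apply: (@measurable_sum _ _ _ _ _ _ (fun j t => c j * tnth t j)) => j.
by apply: measurable_funM => //; exact: measurable_tnth.
Qed.

Lemma gaussian_linear_form : exists2 K : R, 0 < K &
  forall m (U : {RV P >-> m.-tuple R}), std_gaussian_vector P U ->
  forall (c : 'I_m -> R) (b : R), \sum_j c j ^+ 2 <= b ->
  (\int[P]_w ((\sum_j c j * tnth (U w) j) ^+ 4)%:E <= (K * b ^+ 2)%:E)%E.
Proof.
have [k k0 inc] := gaussian_increment R.
exists (expR 8 * (7 * k)); first by rewrite !mulr_gt0 ?expR_gt0.
move=> m U gU c b cb.
have b0 : 0 <= b by apply: le_trans cb; apply: sumr_ge0 => j _; exact: sqr_ge0.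
have cjb j : c j ^+ 2 <= b.
  by apply: le_trans cb; rewrite (bigD1 j) //= lerDl sumr_ge0 // => i _; exact: sqr_ge0.
pose D (i : 'I_m) (t : m.-tuple R) := c i * tnth t i.
(* The weights sum to at most 2. The part c_i^2 / b gives c_i^4 / l_i <= b c_i^2, whose sum is at
   most b^2; the part 1/m keeps the weight positive when c_i = 0. *)
pose l (i : 'I_m) : R := c i ^+ 2 / b + m%:R^-1.
have m0 (i : 'I_m) : 0 < m%:R^-1 :> R by rewrite invr_gt0 ltr0n (leq_ltn_trans _ (ltn_ord i)).
have l0 i : 0 < l i by rewrite /l ltr_wpDl ?(m0 i) // divr_ge0 ?sqr_ge0.
have E (i : 'I_m) (x : R) : c i * x = 0 * (x ^+ 2 - 1) + c i * x by rewrite mul0r add0r.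
have mD i : measurable_fun setT (D i).
  by apply: measurable_funM => //; exact: measurable_tnth.
have DU i t w : D i (upd t i (tnth (U w) i)) = 0 * (tnth (U w) i ^+ 2 - 1) + c i * tnth (U w) i.
  by rewrite /D tnth_upd eqxx -E.
have := @martingale_fourth_moment _ _ _ P _ _ _ _ (measurable_coord U) (coord_indep gU) D l
   (fun i => k * c i ^+ 4) mD.
under eq_integral do rewrite jointX_coord.
move=> H; apply: (le_trans (H _ _ _ _ _ _ _)) => {H}.
- by move=> i t t' h; rewrite /D h.
- by [].
- by move=> i; rewrite mulr_ge0 ?exprn_even_ge0 // ltW.
- move=> i t; under eq_fun do rewrite DU.
  have [ia _ _ _] := inc 0 (c i).
  exact: (integrable_coord gU i ia).
- move=> i t; under eq_integral do rewrite DU.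
  have [ia <- _ _] := inc 0 (c i).
  exact: (integral_coord gU i ia).
- move=> i t; under eq_fun do rewrite DU.
  have [_ _ ia _] := inc 0 (c i).
  exact: (integrable_coord gU i ia).
- move=> i; under eq_integral do rewrite jointX_coord /D E.
  have [_ _ ia hi] := inc 0 (c i).
  rewrite (integral_coord gU i ia); apply: (le_trans hi).
  by rewrite expr0n /= add0r.
rewrite lee_fin -!mulrA; apply: ler_pM.
- exact: expR_ge0.
- apply: sumr_ge0 => i _; rewrite mulr_ge0 //.
    by rewrite addr_ge0 // divr_ge0 // ltW.
  by rewrite mulr_ge0 ?exprn_even_ge0 // ltW.
- rewrite ler_expR (_ : 8 = 4 * (1 + 1)); last by ring.
  rewrite ler_pM2l // big_split /=; apply: lerD.
    rewrite -mulr_suml; have [->|bn] := eqVneq b 0; first by rewrite invr0 mulr0.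
    by rewrite ler_pdivrMr ?mul1r // lt_def bn.
  rewrite sumr_const card_ord -[_ *+ m]mulr_natr; have [->|mn] := eqVneq m 0%N; first by rewrite mulr0.
  by rewrite mulVf // pnatr_eq0.
have h i : (3 + 4 / l i) * (k * c i ^+ 4) <= 7 * k * (b * c i ^+ 2).
  have h1 : c i ^+ 4 <= b * c i ^+ 2.
    by rewrite (_ : c i ^+ 4 = c i ^+ 2 * c i ^+ 2) ?ler_wpM2r ?sqr_ge0 // -exprD.
  have h2 : c i ^+ 4 / l i <= b * c i ^+ 2.
    rewrite ler_pdivrMr // /l.
    have [b0'|bn] := eqVneq b 0.
      have : c i ^+ 2 <= 0 by rewrite -b0'.
      rewrite le_eqVlt ltNge sqr_ge0 orbF => /eqP c0.
      by rewrite (_ : c i ^+ 4 = c i ^+ 2 * c i ^+ 2) -?[RHS]exprD // c0 !mulr0 mul0r.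
    apply: (@le_trans _ _ (b * c i ^+ 2 * (c i ^+ 2 / b))).
      by rewrite (_ : _ * _ = c i ^+ 4) //; field.
    by rewrite ler_wpM2l ?lerDl ?(ltW (m0 i)) // mulr_ge0 ?sqr_ge0.
  have -> : (3 + 4 / l i) * (k * c i ^+ 4) = k * (3 * c i ^+ 4 + 4 * (c i ^+ 4 / l i)) by ring.
  have -> : 7 * k * (b * c i ^+ 2) = k * (7 * (b * c i ^+ 2)) by ring.
  rewrite ler_pM2l //; move: h1 h2; clear; lra.
apply: le_trans (ler_sum _ (fun i _ => h i)) _.
rewrite -mulr_sumr mulrA ler_wpM2l ?mulr_ge0 ?(ltW k0) // -mulr_sumr expr2.
by rewrite ler_wpM2l.
Qed.

Definition quadratic_form m (B : 'I_m -> 'I_m -> R) (t : m.-tuple R) : R :=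
  \sum_i \sum_j B i j * (tnth t i * tnth t j).

(** Revealing the coordinates in order, the centred form is a martingale with increments B_ii (x_i^2
    - 1) + L_i x_i, where L_i is linear in the earlier coordinates and is controlled by
    [gaussian_linear_form]. Its coefficients mix row i and column i of B, which is why both are
    bounded. With weights 1/m the m increments contribute O(m^2). *)
Lemma gaussian_quadratic_form : exists2 K : R, 0 < K &
  forall m (U : {RV P >-> m.-tuple R}), std_gaussian_vector P U ->
  forall (B : 'I_m -> 'I_m -> R) (b : R),
  (forall i, \sum_j B i j ^+ 2 <= b) -> (forall j, \sum_i B i j ^+ 2 <= b) ->
  (\int[P]_w ((quadratic_form B (U w) - \sum_i B i i) ^+ 4)%:E <= (K * (m%:R ^+ 2 * b ^+ 2))%:E)%E.
Proof.
have [k k0 inc] := gaussian_increment R.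
have [K2 K20 lin] := gaussian_linear_form.
exists (expR 4 * (7 * (k * (1 + 16 * K2)))).
  by rewrite !mulr_gt0 ?expR_gt0 // addr_gt0 // mulr_gt0.
move=> m U gU B b rowB colB.
pose c (i j : 'I_m) : R := if (j < i)%N then B i j + B j i else 0.
pose L (i : 'I_m) (t : m.-tuple R) := \sum_j c i j * tnth t j.
pose D (i : 'I_m) (t : m.-tuple R) := B i i * (tnth t i ^+ 2 - 1) + L i t * tnth t i.
have b0 (i : 'I_m) : 0 <= b by apply: le_trans (rowB i); apply: sumr_ge0 => j _; exact: sqr_ge0.
have BB (i : 'I_m) : B i i ^+ 2 <= b.
  by apply: le_trans (rowB i); rewrite (bigD1 i) //= lerDl sumr_ge0 // => j _; exact: sqr_ge0.
have sumD t : \sum_i D i t = quadratic_form B t - \sum_i B i i.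
  rewrite /D big_split /= /quadratic_form.
  under eq_bigr do rewrite mulrBr mulr1.
  rewrite sumrB addrAC; congr (_ - _).
  transitivity (\sum_i \sum_j ((j == i)%:R * (B i j * (tnth t i * tnth t j)) +
     (j < i)%N%:R * (B i j * (tnth t i * tnth t j)) + (j < i)%N%:R * (B j i * (tnth t i * tnth t j)))).
    rewrite -big_split /=; apply: eq_bigr => i _; rewrite !big_split /= -addrA; congr (_ + _).
      rewrite (bigD1 i) //= eqxx mul1r big1 ?addr0 ?expr2 //.
      by move=> j /negPf ->; rewrite mul0r.
    rewrite -big_split mulr_suml /=; apply: eq_bigr => j _; rewrite /c.
    by case: ifP => _; rewrite ?mul0r ?addr0 // !mul1r; ring.
  under eq_bigr do rewrite !big_split /=.
  rewrite !big_split /= [X in _ + _ + X]exchange_big /= -!big_split /=.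
  apply: eq_bigr => i _; rewrite -!big_split; apply: eq_bigr => j _ /=.
  rewrite [tnth t j * _]mulrC -!mulrDl -[RHS]mul1r; congr (_ * _).
  rewrite -val_eqE /=; case: (ltngtP i j) => _; rewrite ?addr0 ?add0r //.
have updL i t x : L i (upd t i x) = L i t.
  apply: eq_bigr => j _; rewrite /c tnth_upd; case: ifP => [ji|_]; last by rewrite !mul0r.
  by rewrite -val_eqE /= ltn_eqF.
have DU i t w : D i (upd t i (tnth (U w) i)) = B i i * (tnth (U w) i ^+ 2 - 1) + L i t * tnth (U w) i.
  by rewrite /D updL tnth_upd eqxx.
have mL i : measurable_fun setT (L i) by exact: measurable_linear_form.
have mD i : measurable_fun setT (D i).
  apply: measurable_funD; apply: measurable_funM => //; last exact: measurable_tnth.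
  apply: measurable_funB => //; apply: measurable_funX; exact: measurable_tnth.
have sc i : \sum_j c i j ^+ 2 <= 4 * b.
  have -> : 4 * b = 2 * b + 2 * b by ring.
  apply: le_trans (lerD (ler_wpM2l (ler0n _ 2) (rowB i)) (ler_wpM2l (ler0n _ 2) (colB i))).
  rewrite !mulr_sumr -big_split; apply: ler_sum => j _ /=; rewrite /c.
  have h1 := sqr_ge0 (B i j); have h2 := sqr_ge0 (B j i); have h3 := sqr_ge0 (B i j - B j i).
  move: (B i j) (B j i) h1 h2 h3 => {}b1 b2 h1 h2 h3; clear -h1 h2 h3.
  case: ifP => _; last by rewrite expr0n /=; lra.
  by move: h3; rewrite !expr2; lra.
have := @martingale_fourth_moment _ _ _ P _ _ _ _ (measurable_coord U) (coord_indep gU) D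
   (fun=> m%:R^-1) (fun i => k * (1 + 16 * K2) * b ^+ 2) mD.
under eq_integral do rewrite jointX_coord sumD.
have m0 (i : 'I_m) : 0 < m%:R :> R by rewrite ltr0n (leq_ltn_trans _ (ltn_ord i)).
have K0 : 0 <= k * (1 + 16 * K2) by rewrite mulr_ge0 ?(ltW k0) // addr_ge0 // mulr_ge0 // ltW.
move=> H; apply: (le_trans (H _ _ _ _ _ _ _)) => {H}.
- move=> i t t' h; rewrite /D h //; congr (_ + _ * _).
  apply: eq_bigr => j _; rewrite /c; case: ifP => [ji|_]; last by rewrite !mul0r.
  by rewrite h // ltnW.
- by move=> i; rewrite invr_gt0 (m0 i).
- by move=> i; rewrite mulr_ge0 ?sqr_ge0.
- move=> i t; under eq_fun do rewrite DU.
  have [ia _ _ _] := inc (B i i) (L i t).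
  exact: (integrable_coord gU i ia).
- move=> i t; under eq_integral do rewrite DU.
  have [ia <- _ _] := inc (B i i) (L i t).
  exact: (integral_coord gU i ia).
- move=> i t; under eq_fun do rewrite DU.
  have [_ _ ia _] := inc (B i i) (L i t).
  exact: (integrable_coord gU i ia).
- move=> i.
  have mX4 (f : m.-tuple R -> R) : measurable_fun setT f -> measurable_fun setT (fun t => (f t ^+ 4)%:E).
    by move=> mf; apply/measurable_EFinP; exact: measurable_funX.
  rewrite (@fubini_family _ _ _ P _ _ _ _ (measurable_coord U) (coord_indep gU) i 0
    (fun t => (D i t ^+ 4)%:E)) //; last by move=> t; rewrite lee_fin exprn_even_ge0.
    apply: (@le_trans _ _ (\int[P]_w (k%:E * ((B i i ^+ 4)%:E + (L i (U w) ^+ 4)%:E)))%E).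
      apply: ge0_le_integral => //.
      - by move=> w _; apply: integral_ge0 => w' _; rewrite lee_fin exprn_even_ge0.
      - apply: (@measurable_inner_integral _ _ _ P _ _ _ _ (measurable_coord U) i
          (fun t => (D i t ^+ 4)%:E)); first exact: mX4.
        by move=> t; rewrite lee_fin exprn_even_ge0.
      - apply: emeasurable_funM => //; apply: emeasurable_funD => //.
        exact: measurableT_comp (mX4 _ (mL i)) (measurable_funP U).
      move=> w _; rewrite jointX_coord.
      under eq_integral do rewrite DU.
      have [_ _ ia hi] := inc (B i i) (L i (U w)).
      by rewrite (integral_coord gU i ia) -EFinD -EFinM.
    have mLU : measurable_fun setT (fun w => (L i (U w) ^+ 4)%:E).
      exact: measurableT_comp (mX4 _ (mL i)) (measurable_funP U).
    rewrite ge0_integralZl //; last 2 first.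
    + by move=> w _; rewrite -EFinD lee_fin addr_ge0 // exprn_even_ge0.
    + by rewrite lee_fin ltW.
    + rewrite ge0_integralD //; last 2 first.
      * by move=> w _; rewrite lee_fin exprn_even_ge0.
      * by move=> w _; rewrite lee_fin exprn_even_ge0.
      rewrite integral_cst //= probability_setT mule1.
      rewrite -mulrA [X in (_ <= X)%E]EFinM; apply: lee_wpmul2l; first by rewrite lee_fin ltW.
      rewrite mulrDl mul1r EFinD; apply: leeD.
        rewrite lee_fin (_ : B i i ^+ 4 = (B i i ^+ 2) ^+ 2); last by rewrite -exprM.
        by rewrite ler_pXn2r ?nnegrE ?sqr_ge0 ?(b0 i).
      apply: (le_trans (lin _ _ gU (c i) _ (sc i))).
      by rewrite (_ : K2 * (4 * b) ^+ 2 = 16 * K2 * b ^+ 2) //; ring.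
    + exact: emeasurable_funD.
  exact: mX4.
rewrite lee_fin [X in _ * X <= _]sumr_const card_ord -[X in _ * X <= _]mulr_natr.
have [m00|mn] := eqVneq m 0%N.
  have mr0 : m%:R = 0 :> R by rewrite m00.
  by rewrite mr0 !mulr0 expr0n /= mul0r mulr0.
have mp : 0 < m%:R :> R by rewrite ltr0n lt0n.
have m1 : 1 <= m%:R :> R by rewrite ler1n lt0n.
have -> : 4 * \sum_(i < m) m%:R^-1 = 4 :> R.
  by rewrite sumr_const card_ord -[_ *+ m]mulr_natr mulVf ?mulr1 // gt_eqF.
rewrite -!mulrA ler_wpM2l ?expR_ge0 // invrK.
rewrite -subr_ge0 (_ : _ - _ = k * (1 + 16 * K2) * b ^+ 2 * (m%:R * (3 * m%:R - 3))); last by ring.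
apply: mulr_ge0; first by rewrite mulr_ge0 // sqr_ge0.
by rewrite mulr_ge0 ?(ltW mp) // subr_ge0 ler_peMr.
Qed.

End GaussianFourthMoments.

(** * Almost sure convergence from summable moments *)

Section AlmostSure.
Context d (Omega : measurableType d) (R : realType) (P : probability Omega R).

Lemma bounded_integrable (f : Omega -> R) (c : R) : measurable_fun setT f ->
  (forall w, `|f w| <= c) -> P.-integrable setT (fun w => (f w)%:E).
Proof.
move=> mf fc; have ic : P.-integrable setT (fun=> c%:E : \bar R) by exact: (finite_measure_integrable_cst P c).
apply: (le_integrable measurableT _ _ ic); first exact/measurable_EFinP.
by move=> w _; rewrite /= lee_fin; apply: le_trans (fc _) (ler_norm _).
Qed.

Lemma bounded_fourth_moment d' (E : measurableType d') n (X : 'I_n -> Omega -> E)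
    (f : E -> R) (c e : R) :
  (forall i, measurable_fun setT (X i)) -> mutually_independent P X ->
  measurable_fun setT f -> (forall x, `|f x| <= c) ->
  (forall i, \int[P]_w (f (X i w))%:E = e%:E)%E ->
  (\int[P]_w ((\sum_i (f (X i w) - e)) ^+ 4)%:E <= (expR 4 * 7 * (2 * c) ^+ 4 * n%:R ^+ 2)%:E)%E.
Proof.
move=> mX indX mf fc fe.
have [n0|n0] := posnP n.
  subst n; rewrite (eq_integral (fun=> 0%E)) ?integral0.
    by rewrite expr0n /= mulr0.
  by move=> w _; rewrite big_ord0 expr0n.
have np : 0 < n%:R :> R by rewrite ltr0n.
have n1 : 1 <= n%:R :> R by rewrite ler1n.
pose i0 := Ordinal n0.
have mfX i : measurable_fun setT (fun w => f (X i w)) by exact: measurableT_comp.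
have ifX i : P.-integrable setT (fun w => (f (X i w))%:E).
  exact: (bounded_integrable (c := c)).
have e_le : `|e| <= c.
  rewrite -lee_fin -abse_EFin -(fe i0).
  apply: le_trans (le_abse_integral P measurableT _) _; first by apply/measurable_EFinP.
  apply: (@le_trans _ _ (\int[P]_w c%:E)%E).
    apply: ge0_le_integral => //; first by apply/measurable_EFinP; exact: measurableT_comp.
    by move=> w _; rewrite lee_fin.
  by rewrite integral_cst //= probability_setT mule1.
have bnd x : `|f x - e| <= 2 * c.
  by apply: le_trans (ler_normB _ _) _; rewrite mulrDl mul1r lerD.
have bnd4 x : (f x - e) ^+ 4 <= (2 * c) ^+ 4.
  have <- : `|f x - e| ^+ 4 = (f x - e) ^+ 4 by rewrite -normrX ger0_norm // exprn_even_ge0.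
  by rewrite ler_pXn2r // nnegrE; apply: le_trans (bnd x).
pose D (i : 'I_n) (t : n.-tuple E) := f (tnth t i) - e.
have mD i : measurable_fun setT (D i).
  by apply: measurable_funB => //; exact: measurableT_comp mf (measurable_tnth i).
have DU i t w : D i (upd t i (X i w)) = f (X i w) - e by rewrite /D tnth_upd eqxx.
have := @martingale_fourth_moment _ _ _ P _ _ _ _ mX indX D (fun=> n%:R^-1) (fun i => (2 * c) ^+ 4) mD.
rewrite (eq_integral (fun w => ((\sum_i (f (X i w) - e)) ^+ 4)%:E)); last first.
  move=> w _; congr (_ ^+ 4)%:E.
  by apply: eq_bigr => i _; rewrite /D tnth_mktuple.
move=> H; apply: (le_trans (H _ _ _ _ _ _ _)) => {H}.
- by move=> i t t' h; rewrite /D h.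
- by move=> i; rewrite invr_gt0.
- by move=> i; rewrite exprn_even_ge0.
- move=> i t; under eq_fun do rewrite DU EFinB.
  by apply: integrableB => //; exact: (finite_measure_integrable_cst P).
- move=> i t; under eq_integral do rewrite DU EFinB.
  rewrite integralB //; last exact: (finite_measure_integrable_cst P).
  by rewrite fe integral_cst //= probability_setT mule1 subee.
- move=> i t; under eq_fun do rewrite DU.
  apply: (bounded_integrable (f := fun w => (f (X i w) - e) ^+ 4) (c := (2 * c) ^+ 4)).
    by apply: measurable_funX; exact: measurable_funB.
  by move=> w; rewrite ger0_norm ?exprn_even_ge0.
- move=> i; apply: (@le_trans _ _ (\int[P]_w ((2 * c) ^+ 4)%:E)%E).
    apply: ge0_le_integral => //.
    + by move=> w _; rewrite lee_fin exprn_even_ge0.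
    + apply/measurable_EFinP; apply: measurable_funX.
      by apply: measurableT_comp (mD i) _; exact: measurable_jointX.
    + by move=> w _; rewrite lee_fin; exact: bnd4.
  by rewrite integral_cst //= probability_setT mule1.
have -> : 4 * \sum_(i < n) n%:R^-1 = 4 :> R.
  by rewrite sumr_const card_ord -[_ *+ n]mulr_natr mulVf ?mulr1 // gt_eqF.
rewrite lee_fin sumr_const card_ord -[_ *+ n]mulr_natr invrK.
have -> : expR 4 * ((3 + 4 * n%:R) * (2 * c) ^+ 4 * n%:R) =
   expR 4 * (2 * c) ^+ 4 * n%:R * (3 + 4 * n%:R) :> R by ring.
have -> : expR 4 * 7 * (2 * c) ^+ 4 * n%:R ^+ 2 =
   expR 4 * (2 * c) ^+ 4 * n%:R * (7 * n%:R) :> R by ring.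
apply: ler_wpM2l; last by move: (n%:R) n1 => x x1; lra.
by rewrite mulr_ge0 ?(ltW np) // mulr_ge0 ?expR_ge0 // exprn_even_ge0.
Qed.

Lemma sum_invsq_le (n : nat) : \sum_(k < n) (k.+1%:R ^+ 2)^-1 <= 2 :> R.
Proof.
suff H : \sum_(k < n.+1) (k.+1%:R ^+ 2)^-1 <= 2 - n.+1%:R^-1 :> R.
  apply: (@le_trans _ _ (\sum_(k < n.+1) (k.+1%:R ^+ 2)^-1)).
    by rewrite big_ord_recr lerDl invr_ge0 sqr_ge0.
  by apply: le_trans H _; rewrite gerBl invr_ge0 ler0n.
elim: n => [|n IH].
  by rewrite big_ord1 expr1n invr1; lra.
rewrite big_ord_recr /=; apply: (le_trans (lerD IH (lexx _))).
have n1 : 0 < n.+1%:R :> R by rewrite ltr0n.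
have -> : n.+2%:R = n.+1%:R + 1 :> R by rewrite -natr1.
move: n.+1%:R n1 => x x0; have x1 : 0 < x + 1 by rewrite addr_gt0.
have -> : 2 - x^-1 + ((x + 1) ^+ 2)^-1 = 2 - (x + 1)^-1 - (x * (x + 1) ^+ 2)^-1.
  by field; rewrite !gt_eqF.
by rewrite gerBl invr_ge0 mulr_ge0 ?sqr_ge0 ?ltW.
Qed.

(** The series of the Y n, from the index n0 + 1 on, has finite expectation, hence is almost surely
    finite, so its terms tend to 0. Only the individual laws of the Y n enter. *)
Lemma ae_cvg0_of_moments (Y : nat -> Omega -> R) (C : R) (n0 : nat) :
  (forall n, measurable_fun setT (Y n)) -> (forall n w, 0 <= Y n w) ->
  (forall n, (n0 <= n)%N -> (\int[P]_w (Y n w)%:E <= (C / n%:R ^+ 2)%:E)%E) ->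
  {ae P, forall w, Y n w @[n --> \oo] --> 0}.
Proof.
move=> mY Y0 YC; pose N := n0.+1.
pose Z k w := Y (k + N)%N w.
have C0 : 0 <= C.
  have := YC N (leqnSn _); move=> h.
  have : (0 <= (C / N%:R ^+ 2)%:E)%E.
    by apply: le_trans h; apply: integral_ge0 => w _; rewrite lee_fin.
  by rewrite lee_fin pmulr_lge0 // invr_gt0 exprn_gt0 // ltr0n.
have Zk k : (\int[P]_w (Z k w)%:E <= (C * (k.+1%:R ^+ 2)^-1)%:E)%E.
  apply: le_trans (YC _ _) _; first by rewrite /N addnS ltnW // ltnS leq_addl.
  rewrite lee_fin ler_wpM2l // lef_pV2 ?posrE ?exprn_gt0 ?ltr0n ?addnS //.
  by rewrite ler_pXn2r ?nnegrE ?ler0n // ler_nat ltnS leq_addr.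
have mZ k : measurable_fun setT (fun w => (Z k w)%:E) by apply/measurable_EFinP; exact: mY.
have Z0 k w : (0 <= (Z k w)%:E)%E by rewrite lee_fin; exact: Y0.
have iS : P.-integrable setT (fun w => \sum_(k <oo) (Z k w)%:E)%E.
  apply/integrableP; split.
    by apply: ge0_emeasurable_sum => // k w _ _.
  rewrite (eq_integral (fun w => \sum_(k <oo) (Z k w)%:E)%E); last first.
    by move=> w _; rewrite gee0_abs // nneseries_ge0.
  rewrite integral_nneseries // (@le_lt_trans _ _ (C * 2)%:E) ?ltry //.
  apply: lime_le; first by apply: is_cvg_nneseries => k _ _; exact: integral_ge0.
  apply: nearW => n; rewrite big_mkord.
  apply: (@le_trans _ _ (\sum_(k < n) (C * (k.+1%:R ^+ 2)^-1)%:E)%E).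
    by apply: lee_sum => k _.
  rewrite sumEFin lee_fin -mulr_sumr ler_wpM2l //; exact: sum_invsq_le.
have := integrable_ae measurableT iS; apply: filterS => w /(_ I) fS.
have : Z k w @[k --> \oo] --> 0.
  apply: (@cvg_series_cvg_0 R).
  apply: nondecreasing_is_cvgn.
    by apply: nondecreasing_series => k _ _; rewrite -lee_fin.
  exists (fine (\sum_(k <oo) (Z k w)%:E)%E) => _ [n _ <-].
  rewrite -lee_fin fineK // /series /= -sumEFin.
  exact: nneseries_lim_ge.
by rewrite /Z -(cvg_shiftn N (Y ^~ w)).
Qed.

End AlmostSure.

(** * Partial traces and leave-one-out resolvents *)

Section BlockMatrices.
Variables (R : realType) (p m : nat).
Local Notation C := R[i].
Local Notation nc := (@ComplexField.Normc.normc R).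

(** The isometry v -> v (x) e_k from C^p. The partial trace is the average over k of the
    compressions by these isometries ([partial_traceE]). *)
Definition blk (k : 'I_m) : 'M[C]_(p * m, p) :=
  \matrix_(a, nu) (a == mxtens_index (nu, k))%:R.

Lemma mulmx_blk q (X : 'M[C]_(q, p * m)) k a nu :
  (X *m blk k) a nu = X a (mxtens_index (nu, k)).
Proof.
rewrite mxE (bigD1 (mxtens_index (nu, k))) //= mxE eqxx mulr1 big1 ?addr0 //.
by move=> b /negPf nb; rewrite mxE nb mulr0.
Qed.

Lemma blk_adj k : (blk k) ^t* = (blk k)^T.
Proof. by apply/matrixP => i j; rewrite !mxE conjC_nat. Qed.

Lemma blk_mulmx q (X : 'M[C]_(p * m, q)) k mu b :
  ((blk k) ^t* *m X) mu b = X (mxtens_index (mu, k)) b.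
Proof.
rewrite blk_adj mxE (bigD1 (mxtens_index (mu, k))) //= !mxE eqxx mul1r big1 ?addr0 //.
by move=> c /negPf nc; rewrite !mxE nc mul0r.
Qed.

Lemma mxtens_index_eq (i i' : 'I_p) (j j' : 'I_m) :
  (mxtens_index (i, j) == mxtens_index (i', j')) = (i == i') && (j == j').
Proof. by rewrite (can_eq (@mxtens_indexK p m)) xpair_eqE. Qed.

Lemma blk_ortho k l : (blk k) ^t* *m blk l = (k == l)%:R%:M.
Proof.
apply/matrixP => i j; rewrite blk_mulmx !mxE mxtens_index_eq andbC.
by case: (k == l); case: (i == j).
Qed.

Lemma sum_mxtens (V : nmodType) (F : 'I_(p * m) -> V) :
  \sum_a F a = \sum_(mu < p) \sum_(k < m) F (mxtens_index (mu, k)).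
Proof.
rewrite pair_big /=; rewrite (reindex (@mxtens_index p m)) /=.
  by apply: eq_bigr => -[i j] _.
by exists (@mxtens_unindex p m) => i _; rewrite (mxtens_indexK, mxtens_unindexK).
Qed.

Lemma fnorm2_blk q (X : 'M[C]_(p * m, q)) :
  fnorm X ^+ 2 = \sum_k fnorm ((blk k) ^t* *m X) ^+ 2.
Proof.
rewrite fnorm2 sum_mxtens exchange_big /=; apply: eq_bigr => k _.
rewrite fnorm2; apply: eq_bigr => mu _; apply: eq_bigr => b _.
by rewrite blk_mulmx.
Qed.

(** The matrix I_p (x) u, so that T (x) u u^T factors as [liftv u] T ([liftv u])^* through C^p. *)
Definition liftv (u : 'I_m -> R) : 'M[C]_(p * m, p) := \sum_k (u k)%:C *: blk k.

Lemma liftvE u mu k nu : liftv u (mxtens_index (mu, k)) nu = (mu == nu)%:R * (u k)%:C.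
Proof.
rewrite summxE (bigD1 k) //= big1 ?addr0; last first.
  move=> l /negPf lk; rewrite !mxE mxtens_index_eq [k == l]eq_sym lk andbF.
  by rewrite mulr0.
by rewrite !mxE mxtens_index_eq eqxx andbT mulrC.
Qed.

Lemma liftv_adj u : (liftv u) ^t* = \sum_k (u k)%:C *: (blk k) ^t*.
Proof.
rewrite /liftv; elim/big_rec2: _ => [|k X Y _ IH].
  by rewrite trmx0 map_mx0.
by rewrite ctrD IH ctrZ conj_real.
Qed.

Lemma blk_liftv k u : (blk k) ^t* *m liftv u = ((u k)%:C)%:M.
Proof.
apply/matrixP => i j; rewrite blk_mulmx liftvE !mxE.
by case: (i == j); rewrite ?mul1r ?mul0r.
Qed.

Lemma liftv_gram u : (liftv u) ^t* *m liftv u = ((\sum_k u k ^+ 2)%:C)%:M.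
Proof.
rewrite liftv_adj mulmx_suml.
under eq_bigr do rewrite -scalemxAl blk_liftv -scalemx1 scalerA -rmorphM /= -expr2.
by rewrite -scaler_suml -[RHS]scalemx1 rmorph_sum.
Qed.

Lemma fnorm_liftv u (v : 'cV_p) : fnorm (liftv u *m v) ^+ 2 = (\sum_k u k ^+ 2) * fnorm v ^+ 2.
Proof.
have := cdotaa (liftv u *m v); rewrite cdot_adj mulmxA liftv_gram mul_scalar_mx cdotZl.
by rewrite cdotaa conj_real -rmorphM => /= -[].
Qed.

Lemma opb_liftv u : opb (liftv u) (Num.sqrt (\sum_k u k ^+ 2)).
Proof.
move=> v; apply: ler_fnorm; first exact: sqrtr_ge0.
have s0 : 0 <= \sum_k u k ^+ 2 by apply: sumr_ge0 => k _; exact: sqr_ge0.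
by rewrite fnorm_liftv -{1}(sqr_sqrtr s0).
Qed.

Lemma opb_liftv_adj u : opb ((liftv u) ^t*) (Num.sqrt (\sum_k u k ^+ 2)).
Proof. by apply: opb_adj; [exact: sqrtr_ge0 | exact: opb_liftv]. Qed.

Lemma tensmx_liftv (T : 'M[R]_p) (t : m.-tuple R) :
  toC (T *t ((\col_j tnth t j) *m (\col_j tnth t j)^T)) =
  liftv (tnth t) *m toC T *m (liftv (tnth t)) ^t*.
Proof.
apply/matrixP => a b.
case: (mxtens_indexP a) => mu k; case: (mxtens_indexP b) => nu l.
rewrite !mxE !mxtens_indexK /= big_ord1 !mxE.
rewrite (bigD1 nu) //= big1 ?addr0; last first.
  move=> i /negPf ni; rewrite !mxE liftvE [nu == i]eq_sym ni mul0r.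
  by rewrite conjC0 mulr0.
rewrite [X in _ = _ * X]mxE [X in _ = _ * (X^*)%R]mxE liftvE eqxx mul1r conj_real.
rewrite mxE (bigD1 mu) //= big1 ?addr0; last first.
  by move=> i /negPf ni; rewrite liftvE [mu == i]eq_sym ni !mul0r.
by rewrite liftvE eqxx mul1r /toC mxE !rmorphM /= mulrCA mulrA.
Qed.

Lemma partial_traceE (X : 'M[C]_(p * m)) :
  partial_trace X = (m%:R^-1 : R)%:C *: \sum_k (blk k) ^t* *m X *m blk k.
Proof.
apply/matrixP => i j; rewrite !mxE summxE.
rewrite fmorphV rmorph_nat; congr (_ * _); apply: eq_bigr => k _.
by rewrite mulmx_blk blk_mulmx.
Qed.

Lemma partial_traceD (X Y : 'M[C]_(p * m)) :
  partial_trace (X + Y) = partial_trace X + partial_trace Y.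
Proof.
rewrite !partial_traceE -scalerDr -big_split; congr (_ *: _).
by apply: eq_bigr => k _; rewrite mulmxDr mulmxDl.
Qed.

Lemma partial_traceZ c (X : 'M[C]_(p * m)) : partial_trace (c *: X) = c *: partial_trace X.
Proof.
rewrite !partial_traceE scalerA [c * _]mulrC -scalerA [c *: \sum_k _]scaler_sumr; congr (_ *: _).
by apply: eq_bigr => k _; rewrite -scalemxAr -scalemxAl.
Qed.

Lemma partial_trace0 : partial_trace (0 : 'M[C]_(p * m)) = 0.
Proof. by rewrite -(scale0r (0 : 'M[C]_(p * m))) partial_traceZ scale0r. Qed.

Lemma partial_traceN (X : 'M[C]_(p * m)) : partial_trace (- X) = - partial_trace X.
Proof. by rewrite -scaleN1r partial_traceZ scaleN1r. Qed.

Lemma partial_trace_sum (I : Type) (r : seq I) (F : I -> 'M[C]_(p * m)) :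
  partial_trace (\sum_(i <- r) F i) = \sum_(i <- r) partial_trace (F i).
Proof.
elim: r => [|i r IH]; first by rewrite !big_nil partial_trace0.
by rewrite !big_cons partial_traceD IH.
Qed.

Hypothesis m_gt0 : (0 < m)%N.

Lemma partial_trace1 : partial_trace (1%:M : 'M[C]_(p * m)) = 1%:M.
Proof.
rewrite partial_traceE; under eq_bigr do rewrite mulmx1 blk_ortho eqxx.
rewrite sumr_const card_ord -[X in _ *: X = _]scaler_nat scalerA fmorphV rmorph_nat mulVf ?scale1r //.
by rewrite pnatr_eq0 -lt0n.
Qed.

(** Cyclicity of the trace in the second tensor factor moves u around X, while A stays on the
    left. *)
Lemma partial_trace_liftv u (A : 'M[C]_p) (X : 'M[C]_(p * m)) :
  partial_trace (liftv u *m A *m (liftv u) ^t* *m X) =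
  A *m ((m%:R^-1 : R)%:C *: ((liftv u) ^t* *m X *m liftv u)).
Proof.
rewrite partial_traceE -scalemxAr; congr (_ *: _).
under eq_bigr do rewrite !mulmxA blk_liftv -!mulmxA mul_scalar_mx.
rewrite [in RHS]/liftv !mulmx_sumr; apply: eq_bigr => k _.
by rewrite -/(liftv u) -!scalemxAr -!mulmxA.
Qed.

Lemma fnorm_blk_mul k (v : 'cV_p) : fnorm (blk k *m v) = fnorm v.
Proof.
have := cdotaa (blk k *m v); rewrite cdot_adj mulmxA blk_ortho eqxx mul1mx cdotaa.
by move=> [] /esym /(@pexpIrn _ 2); apply; rewrite ?nnegrE.
Qed.

(** The partial trace averages compressions by isometries: the form on the right is linear in G, and
    on the left the square of an average is at most the average of the squares. *)
Lemma herg_partial_trace (eta : R) (G : 'M[C]_(p * m)) : 0 < eta ->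
  herg eta G -> herg eta (partial_trace G).
Proof.
move=> e0 hG a; have m0 : 0 < m%:R :> R by rewrite ltr0n.
have mV : 0 <= m%:R^-1 :> R by rewrite invr_ge0 ltW.
rewrite partial_traceE imqZ imq_sum ctrZ conj_real -scalemxAl fnormZ nc_real ger0_norm //.
have q k : imq ((blk k) ^t* *m G *m blk k) a = imq G (blk k *m a).
  by rewrite /imq -!mulmxA cdot_adj trmxCK.
rewrite (eq_bigr _ (fun k _ => q k)).
have E : (\sum_k (blk k) ^t* *m G *m blk k) ^t* = \sum_k (blk k) ^t* *m G ^t* *m blk k.
  elim/big_rec2: _ => [|k X Y _ IH]; first by rewrite trmx0 map_mx0.
  by rewrite ctrD -IH !ctrM trmxCK mulmxA.
rewrite E mulmx_suml.
have h1 : fnorm (\sum_k (blk k) ^t* *m G ^t* *m blk k *m a) <= \sum_k fnorm (G ^t* *m (blk k *m a)).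
  apply: (le_trans (fnorm_sum _ _ _)); apply: ler_sum => k _.
  rewrite -!mulmxA -[X in _ <= X]mul1r; apply: ler_fnorm => //.
  rewrite expr1n mul1r [leRHS]fnorm2_blk (bigD1 k) //= lerDl sumr_ge0 // => l _.
  exact: sqr_ge0.
have h2 : (\sum_k fnorm (G ^t* *m (blk k *m a))) ^+ 2 <=
    m%:R * \sum_k fnorm (G ^t* *m (blk k *m a)) ^+ 2.
  have := cauchy_schwarz_sum (fun k : 'I_m => 1 : R) (fun k => fnorm (G ^t* *m (blk k *m a))).
  under eq_bigr do rewrite mul1r.
  by under [X in _ <= X * _]eq_bigr do rewrite expr1n; rewrite sumr_const card_ord.
have h3 : \sum_k eta * fnorm (G ^t* *m (blk k *m a)) ^+ 2 <= \sum_k imq G (blk k *m a).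
  by apply: ler_sum => k _; exact: hG.
rewrite -mulr_sumr in h3.
have h4 := le_trans (lerXn2r 2 _ _ h1) h2.
move: h3 h4; rewrite !nnegrE fnorm_ge0.
have : 0 <= \sum_k fnorm (G ^t* *m (blk k *m a)) by rewrite sumr_ge0.
move: (fnorm (\sum_k _)) (\sum_k fnorm (_ *m (_ *m _)) ^+ 2) (\sum_k imq _ _) (\sum_k fnorm _).
move: (m%:R) m0 mV => x x0 xV; clear -e0 x0 xV => f s2 s3 s1 s10 h3 /(_ isT s10) h4.
rewrite exprMn mulrCA expr2 -!mulrA ler_wpM2l //.
apply: le_trans h3; rewrite mulrCA ler_pM2l //.
by rewrite mulrC ler_pdivrMr // mulrC.
Qed.

End BlockMatrices.

Section Resolvent.
Variable R : realType.
Local Notation C := R[i].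
Local Notation nc := (@ComplexField.Normc.normc R).

Lemma imq_sub_scalar N (H : 'M[C]_N) (z : C) a : H ^t* = H ->
  imq (H - z%:M) a = - (complex.Im z * fnorm a ^+ 2).
Proof. by move=> h; rewrite imqD imqN imq_scalar imq_herm // add0r. Qed.

Lemma hermitian_resolvent N (H : 'M[C]_N) (z : C) : H ^t* = H -> 0 < complex.Im z ->
  H - z%:M \in unitmx /\ herg (complex.Im z) (invmx (H - z%:M)).
Proof.
move=> h z0; have [|u hg _ _] := accretive_inv (A := H - z%:M) z0; last by split.
by move=> a; rewrite imq_sub_scalar.
Qed.

End Resolvent.

Lemma invmx_sub_shift (F : comUnitRingType) N (A B Z : 'M[F]_N) :
  A - Z \in unitmx -> B - Z \in unitmx ->
  invmx (A - Z) - invmx (B - Z) = invmx (A - Z) *m (B - A) *m invmx (B - Z).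
Proof.
move=> uA uB; rewrite (invmx_sub uA uB); congr (_ *m _ *m _).
by rewrite opprB addrA subrK.
Qed.

Lemma mulmx_sub_split (F : pzRingType) p (K1 K2 M X : 'M[F]_p) :
  K1 *m M - K2 *m X = (K1 - K2) *m M + K2 *m (M - X).
Proof. by rewrite mulmxBl mulmxBr addrA subrK. Qed.

(** The scalars of [loo_form_eq], where c = 1/n, d = 1/m and e = m/n. *)
Lemma scaled_sandwich (F : comPzRingType) p N (c d e : F) (X : 'M[F]_(p, N)) (Y : 'M[F]_(N, p))
    (G1 G2 : 'M[F]_N) (A : 'M[F]_p) : d * c = e * (d * d) ->
  d *: (X *m (G1 *m (c *: (Y *m A *m X)) *m G2) *m Y) =
  e *: ((d *: (X *m G1 *m Y)) *m A *m (d *: (X *m G2 *m Y))).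
Proof.
move=> h; rewrite -!(scalemxAr, scalemxAl) !scalerA h mulrA !mulmxA.
by rewrite -!mulrA.
Qed.

Lemma scaler_sub_split (F : pzRingType) (V : lmodType F) (a b : F) (x y : V) :
  a *: x - b *: y = a *: (x - y) + (a - b) *: y.
Proof. by rewrite scalerBr scalerBl addrA subrK. Qed.

Lemma fnorm_triangle (R : realType) m n (X Y Z : 'M[R[i]]_(m, n)) :
  fnorm (X - Z) <= fnorm (X - Y) + fnorm (Y - Z).
Proof.
have e : forall (V : zmodType) (a b c : V), a - c = (a - b) + (b - c).
  by move=> V a b c; rewrite addrA subrK.
by rewrite (e _ X Y Z); exact: fnormD.
Qed.

(** In the application X is a leave-one-out form: the class constant eta / 2 comes from a sample of
    squared length at most 2 m, and [b <= 2 * beta] from an aspect ratio close to its limit. *)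
Lemma kernel_product_diff (R : realType) p (A M X : 'M[R[i]]_p) (b beta eta kb : R) :
  0 < eta -> 0 < beta -> 0 < b -> b <= 2 * beta -> 0 <= kb ->
  herg eta M -> herg (eta / 2) X -> A ^t* = A ->
  opb (Kf beta M A) kb -> opb (Kf b X A) kb ->
  fnorm (Kf beta M A *m M - Kf b X A *m X) <=
  (kb ^+ 2 / eta * (2 * beta) + kb) * fnorm (X - M) + kb ^+ 2 * (p * p)%:R / eta ^+ 2 * `|b - beta|.
Proof.
move=> e0 beta0 b0 bb k0 hM hX hA hK1 hK2.
have e2 : 0 < eta / 2 by rewrite divr_gt0.
have eV : 0 <= eta^-1 by rewrite invr_ge0 ltW.
have dM := Kf_sub beta0 b0 e0 e2 hM hX hA.
have oM := herg_opb e0 hM.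
have fM : fnorm M <= (p * p)%:R / eta by exact: opb_fnorm.
rewrite mulmx_sub_split dM; clear dM; move: (Kf beta M A) (Kf b X A) hK1 hK2 => K1 K2 hK1 hK2.
have f1 : fnorm (b%:C *: X - beta%:C *: M) <= 2 * beta * fnorm (X - M) + `|b - beta| * ((p * p)%:R / eta).
  rewrite scaler_sub_split -rmorphB.
  apply: (le_trans (fnormD _ _)); rewrite !fnormZ !nc_real (gtr0_norm b0).
  by apply: lerD; [apply: ler_wpM2r | apply: ler_wpM2l].
move: (b%:C *: X - beta%:C *: M) f1 => Y f1.
have f2 : fnorm (K1 *m Y *m K2 *m M) <= eta^-1 * (kb * (kb * fnorm Y)).
  apply: (le_trans (opb_mulr _ eV oM)); apply: ler_wpM2l => //.
  apply: (le_trans (opb_mulr _ k0 hK2)); apply: ler_wpM2l => //.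
  exact: opb_mul.
have f3 : fnorm (K2 *m (M - X)) <= kb * fnorm (X - M).
  by rewrite fnormBC; exact: opb_mul.
apply: (le_trans (fnormD _ _)); apply: (le_trans (lerD f2 f3)).
move: (fnorm (X - M)) (fnorm Y) f1 => f g f1.
have h : eta^-1 * (kb * (kb * g)) <= eta^-1 * (kb * (kb * (2 * beta * f + `|b - beta| * ((p * p)%:R / eta)))).
  by rewrite !ler_wpM2l.
apply: (le_trans (lerD h (lexx _))).
by rewrite le_eqVlt; apply/orP; left; apply/eqP; rewrite -exprVn; ring.
Qed.

Section RankOneBlocks.
Variables (R : realType) (p m : nat).
Local Notation C := R[i].
Local Notation nc := (@ComplexField.Normc.normc R).
Hypothesis m_gt0 : (0 < m)%N.

Lemma fnorm_liftv_le (u : 'I_m -> R) :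
  fnorm (liftv p u) ^+ 2 <= p%:R ^+ 2 * \sum_k u k ^+ 2.
Proof.
rewrite fnorm2_blk mulr_sumr; apply: ler_sum => k _; rewrite blk_liftv.
rewrite -[u k ^+ 2]real_normK ?num_real // -exprMn -nc_real.
by apply: lerXn2r; rewrite ?nnegrE ?mulr_ge0 ?nc_ge0 ?fnorm_scalar.
Qed.

(** Cauchy-Schwarz over the blocks: a product that factors through C^p has a partial trace of order
    1/m, which makes the removal of one sample negligible. *)
Lemma partial_trace_mul_le (X : 'M[C]_(p * m, p)) (Y : 'M[C]_(p, p * m)) :
  fnorm (partial_trace (X *m Y)) <= m%:R^-1 * (fnorm X * fnorm Y).
Proof.
rewrite partial_traceE fnormZ nc_real ger0_norm ?invr_ge0 // ler_wpM2l ?invr_ge0 //.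
apply: (le_trans (fnorm_sum _ _ _)).
apply: (@le_trans _ _ (\sum_k fnorm ((blk R p k) ^t* *m X) * fnorm ((blk R p k) ^t* *m Y ^t*))).
  apply: ler_sum => k _; rewrite mulmxA -[_ *m Y *m _]mulmxA.
  have -> : fnorm ((blk R p k) ^t* *m Y ^t*) = fnorm (Y *m blk R p k) by rewrite -ctrM fnorm_adj.
  exact: fnormM.
rewrite -(@ler_pXn2r _ 2) ?nnegrE ?mulr_ge0 ?sumr_ge0 //; last by move=> k _; rewrite mulr_ge0.
apply: (le_trans (cauchy_schwarz_sum _ _)).
by rewrite exprMn -(fnorm_adj Y) !fnorm2_blk.
Qed.

End RankOneBlocks.

(** * Leave-one-out identities and the approximate fixed-point equation *)

Section SampleResolvent.
Variables (R : realType) (p m n : nat).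
Local Notation C := R[i].
Local Notation nc := (@ComplexField.Normc.normc R).
Variables (A : 'I_n -> 'M[C]_p) (u : 'I_n -> 'I_m -> R) (z : C) (CT : R).
Hypotheses (m_gt0 : (0 < m)%N) (n_gt0 : (0 < n)%N) (CT_ge0 : 0 <= CT).
Hypothesis A_herm : forall i, (A i) ^t* = A i.
Hypothesis A_opb : forall i, opb (A i) CT.
Local Notation eta := (complex.Im z).
Hypothesis eta_gt0 : 0 < eta.
Local Notation U i := (liftv p (u i)).
Local Notation nV := ((n%:R^-1 : R)%:C).
Local Notation mV := ((m%:R^-1 : R)%:C).
Local Notation sq i := (\sum_k u i k ^+ 2).

(** The set I of retained samples is a parameter: [predT] gives the full matrix and [predC1 i] the
    one without sample i. *)
Definition sample_mx (I : pred 'I_n) : 'M[C]_(p * m) :=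
  nV *: \sum_(i | I i) U i *m A i *m (U i) ^t*.
Definition sample_res I : 'M[C]_(p * m) := invmx (sample_mx I - z%:M).

Local Notation G := (sample_res predT).
Local Notation Gi i := (sample_res (predC1 i)).
Local Notation M := (partial_trace G).
(** A form of u_i in a resolvent that does not involve u_i: this one concentrates. The form in the
    full resolvent, [res_form], is the one that occurs in the exact identity [sample_res_trace]. *)
Definition loo_form i : 'M[C]_p := mV *: ((U i) ^t* *m Gi i *m U i).
Definition res_form i : 'M[C]_p := mV *: ((U i) ^t* *m G *m U i).
Local Notation Ri i := (loo_form i).
Local Notation S i := (res_form i).
Definition aspect : R := m%:R / n%:R.

Lemma sample_mx_herm I : (sample_mx I) ^t* = sample_mx I.
Proof.
rewrite /sample_mx ctrZ conj_real; congr (_ *: _).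
elim/big_rec: _ => [|i X _ IH]; first by rewrite trmx0 map_mx0.
by rewrite ctrD IH !ctrM trmxCK A_herm mulmxA.
Qed.

Lemma sample_res_unit I : sample_mx I - z%:M \in unitmx.
Proof. by have [] := hermitian_resolvent (sample_mx_herm I) eta_gt0. Qed.

Lemma herg_sample_res I : herg eta (sample_res I).
Proof. by have [] := hermitian_resolvent (sample_mx_herm I) eta_gt0. Qed.

Lemma opb_sample_res I : opb (sample_res I) eta^-1.
Proof. exact: herg_opb eta_gt0 (herg_sample_res I). Qed.

Lemma herg_sample_trace : herg eta M.
Proof. exact: (herg_partial_trace m_gt0 eta_gt0 (herg_sample_res predT)). Qed.

(** The partial trace of P G = 1 + z G, where P is the full sample matrix. *)
Lemma sample_res_trace : 1%:M + z *: M = nV *: \sum_i A i *m S i.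
Proof.
have E : sample_mx predT *m G = 1%:M + z *: G.
  have := mulmxV (sample_res_unit predT); rewrite -/G mulmxBl mul_scalar_mx => /eqP.
  by rewrite subr_eq => /eqP.
rewrite -(partial_trace1 R p m_gt0) -partial_traceZ -partial_traceD -E.
rewrite /sample_mx -scalemxAl partial_traceZ mulmx_suml partial_trace_sum.
by congr (_ *: _); apply: eq_bigr => i _; exact: partial_trace_liftv.
Qed.

Lemma sample_mx_split i : sample_mx predT - sample_mx (predC1 i) = nV *: (U i *m A i *m (U i) ^t*).
Proof. by rewrite /sample_mx -scalerBr (bigD1 i) //= addrK. Qed.

Lemma loo_sub i : Gi i - G = Gi i *m (nV *: (U i *m A i *m (U i) ^t*)) *m G.
Proof.
rewrite -sample_mx_split.
exact: (invmx_sub_shift (sample_res_unit (predC1 i)) (sample_res_unit predT)).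
Qed.

(** The resolvent difference is sandwiched between the factors of u_i. Solved for the full form S,
    the relation gives S = (1 + (m/n) R A)^-1 R, which is how the kernel [Kf] arises in
    [res_form_good]. *)
Lemma loo_form_eq i : Ri i - S i = aspect%:C *: (Ri i *m A i *m S i).
Proof.
rewrite /loo_form /res_form -scalerBr -mulmxBl -mulmxBr loo_sub.
apply: scaled_sandwich; rewrite /aspect -!rmorphM; congr (_%:C).
by field; rewrite !pnatr_eq0 -!lt0n m_gt0.
Qed.

(** Compression by a factor of squared norm at most s, followed by division by m, multiplies the
    class constant by m/s. *)
Lemma herg_loo_form i (s : R) : 0 < s -> sq i <= s -> herg (eta * (m%:R / s)) (Ri i).
Proof.
move=> s0 us a; have m0 : 0 < m%:R :> R by rewrite ltr0n.
rewrite /loo_form imqZ ctrZ conj_real -scalemxAl fnormZ nc_real ger0_norm ?invr_ge0 ?(ltW m0) //.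
have -> : imq ((U i) ^t* *m Gi i *m U i) a = imq (Gi i) (U i *m a).
  by rewrite /imq -!mulmxA cdot_adj trmxCK.
have h1 := herg_sample_res (predC1 i) (U i *m a).
have h2 : fnorm (((U i)^t* *m Gi i *m U i) ^t* *m a) ^+ 2 <= s * fnorm ((Gi i) ^t* *m (U i *m a)) ^+ 2.
  rewrite !ctrM trmxCK -!mulmxA.
  have := opb_liftv_adj (u i) ((Gi i) ^t* *m (U i *m a)).
  move/(lerXn2r 2); rewrite !nnegrE fnorm_ge0 mulr_ge0 ?sqrtr_ge0 // => /(_ isT isT).
  have s0' : 0 <= sq i by apply: sumr_ge0 => k _; exact: sqr_ge0.
  rewrite exprMn (sqr_sqrtr s0') => h; apply: (le_trans h).
  by rewrite ler_wpM2r // sqr_ge0.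
move: (fnorm _) (fnorm _) (imq _ _) h1 h2 => f g q h1 h2.
have -> : eta * (m%:R / s) * (m%:R^-1 * f) ^+ 2 = m%:R^-1 * (eta * (f ^+ 2 / s)).
  by field; rewrite !gt_eqF.
rewrite ler_wpM2l ?invr_ge0 ?(ltW m0) //; apply: le_trans h1.
by rewrite ler_wpM2l ?(ltW eta_gt0) // ler_pdivrMr // mulrC.
Qed.

Lemma res_form_good i : sq i <= 2 * m%:R ->
  herg (eta / 2) (Ri i) /\ A i *m S i = Kf aspect (Ri i) (A i) *m Ri i.
Proof.
move=> us; have m0 : 0 < m%:R :> R by rewrite ltr0n.
have h : herg (eta / 2) (Ri i).
  have := herg_loo_form (mulr_gt0 (ltr0Sn R 1) m0) us.
  by rewrite (_ : eta * (m%:R / (2 * m%:R)) = eta / 2) //; field; rewrite gt_eqF.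
have b0 : 0 < aspect by rewrite divr_gt0 // ltr0n.
have e2 : 0 < eta / 2 by rewrite divr_gt0.
split; [exact: h|]; have uD := Kf_unit b0 e2 h (A_herm i).
rewrite KfE -mulmxA; congr (_ *m _); apply: (can_inj (mulKmx uD)).
rewrite mulKVmx // mulmxDl mul1mx -scalemxAl -loo_form_eq.
by rewrite addrC subrK.
Qed.

Lemma fnorm_res_form i : fnorm (A i *m S i) <= CT * ((p * p)%:R * (sq i / m%:R / eta)).
Proof.
apply: (le_trans (opb_mul _ CT_ge0 (A_opb i))); rewrite ler_wpM2l //.
have m0 : 0 <= m%:R^-1 :> R by rewrite invr_ge0.
have s0 : 0 <= sq i by apply: sumr_ge0 => k _; exact: sqr_ge0.
apply: opb_fnorm => a; rewrite /res_form -scalemxAl fnormZ nc_real ger0_norm //.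
rewrite -!mulmxA; apply: (le_trans (ler_wpM2l m0 (opb_liftv_adj _ _))).
have h1 := opb_sample_res predT (U i *m a); have h2 := opb_liftv (u i) a.
have r0 := sqrtr_ge0 (sq i).
apply: (@le_trans _ _ (m%:R^-1 * (Num.sqrt (sq i) * (eta^-1 * (Num.sqrt (sq i) * fnorm a))))).
  rewrite ler_wpM2l // ler_wpM2l //; apply: (le_trans h1).
  by rewrite ler_wpM2l // invr_ge0 ltW.
rewrite [leLHS](_ : _ = Num.sqrt (sq i) ^+ 2 / m%:R / eta * fnorm a); last by ring.
by rewrite sqr_sqrtr.
Qed.

Lemma partial_trace_loo i : fnorm (partial_trace (Gi i) - M) <=
  p%:R ^+ 2 * CT / eta ^+ 2 / n%:R * (sq i / m%:R).
Proof.
rewrite -partial_traceN -partial_traceD loo_sub.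
have -> : Gi i *m (nV *: (U i *m A i *m (U i) ^t*)) *m G =
   (Gi i *m U i) *m (nV *: (A i *m ((U i) ^t* *m G))).
  by rewrite -!(scalemxAr, scalemxAl) !mulmxA.
apply: (le_trans (partial_trace_mul_le _ _)).
have n0 : 0 <= n%:R^-1 :> R by rewrite invr_ge0.
have m0 : 0 <= m%:R^-1 :> R by rewrite invr_ge0.
have eV : 0 <= eta^-1 by rewrite invr_ge0 ltW.
have h1 : fnorm (Gi i *m U i) <= eta^-1 * fnorm (U i) by exact: opb_mul eV (opb_sample_res _).
have h2 : fnorm (nV *: (A i *m ((U i) ^t* *m G))) <= n%:R^-1 * (CT * (eta^-1 * fnorm (U i))).
  rewrite fnormZ nc_real ger0_norm // ler_wpM2l //.
  apply: (le_trans (opb_mul _ CT_ge0 (A_opb i))); rewrite ler_wpM2l //.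
  apply: (le_trans (opb_mulr _ eV (opb_sample_res _))).
  by rewrite fnorm_adj.
apply: (@le_trans _ _ (m%:R^-1 * (eta^-1 * fnorm (U i) * (n%:R^-1 * (CT * (eta^-1 * fnorm (U i))))))).
  by rewrite ler_wpM2l // ler_pM.
rewrite [leLHS](_ : _ = m%:R^-1 * eta^-1 ^+ 2 * n%:R^-1 * CT * fnorm (U i) ^+ 2); last by ring.
rewrite [leRHS](_ : _ = m%:R^-1 * eta^-1 ^+ 2 * n%:R^-1 * CT * (p%:R ^+ 2 * sq i)); last first.
  by rewrite exprVn; ring.
rewrite ler_wpM2l ?fnorm_liftv_le //.
by rewrite !mulr_ge0 ?sqr_ge0.
Qed.

Variable beta : R.
Hypothesis beta_gt0 : 0 < beta.

(** Serves both pairs (beta, eta) and ([aspect], eta / 2): when [aspect] is at most 2 beta, the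
    ratio 2 beta / (eta / 2) gives the factor 4. *)
Definition kernel_bound : R := 2 * CT + 4 * CT ^+ 2 * beta / eta.
(** The sum of the coefficients met in [step_error_good] and [step_error_bad], so that one constant
    covers both cases. *)
Definition step_bound : R :=
  let c := 2 * p%:R ^+ 2 * CT / eta ^+ 2 in
  let a := kernel_bound ^+ 2 / eta * (2 * beta) + kernel_bound in
  a + a * c + kernel_bound ^+ 2 * (p * p)%:R / eta ^+ 2 + (p * p)%:R / eta * (kernel_bound + 2 * CT).
Local Notation x i := (fnorm (Ri i - partial_trace (Gi i))).
Local Notation y i := `|sq i / m%:R - 1|.
Local Notation K i := (Kf beta M (A i)).

Lemma kernel_bound_ge0 : 0 <= kernel_bound.
Proof.
have h1 : 0 <= 2 * CT by rewrite mulr_ge0.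
have h2 : 0 <= 4 * CT ^+ 2 * beta by rewrite !mulr_ge0 ?sqr_ge0 ?(ltW beta_gt0).
by rewrite /kernel_bound addr_ge0 // divr_ge0 // ltW.
Qed.

Lemma Kf_opb_kernel (b e : R) X i : 0 < b -> 0 < e -> herg e X ->
  b / e <= 4 * beta / eta -> opb (Kf b X (A i)) kernel_bound.
Proof.
move=> b0 e0 hX be.
have k0 : 0 <= 2 * CT + CT ^+ 2 * b / e.
  have h1 : 0 <= 2 * CT by rewrite mulr_ge0.
  have h2 : 0 <= CT ^+ 2 * b by rewrite mulr_ge0 ?sqr_ge0 ?(ltW b0).
  by rewrite addr_ge0 // divr_ge0 // ltW.
have h := opb_adj k0 (Kf_opb_adj b0 e0 hX (A_herm i) CT_ge0 (A_opb i)).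
rewrite trmxCK in h; move=> v; apply: (le_trans (h v)); rewrite ler_wpM2r //.
rewrite /kernel_bound lerD2l [leLHS](_ : _ = CT ^+ 2 * (b / e)); last by ring.
rewrite [leRHS](_ : _ = CT ^+ 2 * (4 * beta / eta)); last by ring.
by rewrite ler_wpM2l // sqr_ge0.
Qed.

Lemma step_error_good i : sq i <= 2 * m%:R -> aspect <= 2 * beta ->
  fnorm (K i *m M - A i *m S i) <= (kernel_bound ^+ 2 / eta * (2 * beta) + kernel_bound) *
     (x i + 2 * p%:R ^+ 2 * CT / eta ^+ 2 / n%:R) +
     kernel_bound ^+ 2 * (p * p)%:R / eta ^+ 2 * `|aspect - beta|.
Proof.
move=> us ab; have [hR ->] := res_form_good us.
have m0 : 0 < m%:R :> R by rewrite ltr0n.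
have n0 : 0 < n%:R :> R by rewrite ltr0n.
have a0 : 0 < aspect by rewrite divr_gt0.
have e2 : 0 < eta / 2 by rewrite divr_gt0.
have eV : 0 <= eta^-1 by rewrite invr_ge0 ltW.
have k0 := kernel_bound_ge0.
have hK1 : opb (K i) kernel_bound.
  apply: (Kf_opb_kernel i beta_gt0 eta_gt0 herg_sample_trace); rewrite ler_pM2r ?invr_gt0 //.
  by rewrite ler_peMl ?(ltW beta_gt0) //; lra.
have hK2 : opb (Kf aspect (Ri i) (A i)) kernel_bound.
  apply: (Kf_opb_kernel i a0 e2 hR); rewrite invfM invrK mulrCA mulrC ler_wpM2r //.
  by rewrite mulrC; lra.
apply: (le_trans (kernel_product_diff eta_gt0 beta_gt0 a0 ab k0 herg_sample_trace hR (A_herm i) hK1 hK2)).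
rewrite lerD2r; apply: ler_wpM2l.
  by rewrite addr_ge0 // !mulr_ge0 ?sqr_ge0 ?(ltW beta_gt0).
apply: (le_trans (fnorm_triangle _ (partial_trace (Gi i)) _)).
rewrite lerD2l; apply: (le_trans (partial_trace_loo i)).
rewrite [leRHS](_ : _ = p%:R ^+ 2 * CT / eta ^+ 2 / n%:R * 2); last by ring.
rewrite ler_wpM2l ?ler_pdivrMr //.
by rewrite !mulr_ge0 ?invr_ge0 ?sqr_ge0 ?(ltW n0).
Qed.

(** A sample longer than twice its typical squared length has deviation y_i > 1. The crude bound, of
    order |u_i|^2 / m, is then absorbed by a multiple of y_i. *)
Lemma step_error_bad i : 2 * m%:R < sq i ->
  fnorm (K i *m M - A i *m S i) <= (p * p)%:R / eta * (kernel_bound + 2 * CT) * y i.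
Proof.
move=> us; have m0 : 0 < m%:R :> R by rewrite ltr0n.
have eV : 0 <= eta^-1 by rewrite invr_ge0 ltW.
have k0 := kernel_bound_ge0.
have hK1 : opb (K i) kernel_bound.
  apply: (Kf_opb_kernel i beta_gt0 eta_gt0 herg_sample_trace); rewrite ler_pM2r ?invr_gt0 //.
  by rewrite ler_peMl ?(ltW beta_gt0) //; lra.
have fM : fnorm M <= (p * p)%:R / eta by exact: opb_fnorm (herg_opb eta_gt0 herg_sample_trace).
apply: (le_trans (fnormB _ _)).
have h1 : fnorm (K i *m M) <= kernel_bound * ((p * p)%:R / eta).
  by apply: (le_trans (opb_mul _ k0 hK1)); rewrite ler_wpM2l.
apply: (le_trans (lerD h1 (fnorm_res_form i))).
have : 2 < sq i / m%:R by rewrite ltr_pdivlMr.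
move: (sq i / m%:R) => t t2.
have -> : `|t - 1| = t - 1 by rewrite ger0_norm //; lra.
rewrite [leLHS](_ : _ = (p * p)%:R / eta * (kernel_bound + CT * t)); last by ring.
rewrite -[leRHS]mulrA; apply: ler_wpM2l; first by rewrite mulr_ge0.
have h2 : kernel_bound * 1 <= kernel_bound * (t - 1) by rewrite ler_wpM2l //; lra.
have h3 : CT * t <= CT * (2 * (t - 1)) by rewrite ler_wpM2l //; lra.
lra.
Qed.

Lemma step_bound_split : [/\ 0 <= step_bound,
  0 <= kernel_bound ^+ 2 / eta * (2 * beta) + kernel_bound,
  0 <= 2 * p%:R ^+ 2 * CT / eta ^+ 2,
  0 <= kernel_bound ^+ 2 * (p * p)%:R / eta ^+ 2 &
  0 <= (p * p)%:R / eta * (kernel_bound + 2 * CT)].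
Proof.
have eV : 0 <= eta^-1 by rewrite invr_ge0 ltW.
have k0 := kernel_bound_ge0; have b0 := ltW beta_gt0.
have h1 : 0 <= kernel_bound ^+ 2 / eta * (2 * beta) + kernel_bound.
  by rewrite addr_ge0 // !mulr_ge0 ?sqr_ge0.
have h2 : 0 <= 2 * p%:R ^+ 2 * CT / eta ^+ 2.
  by rewrite divr_ge0 ?sqr_ge0 // !mulr_ge0 ?sqr_ge0.
have h3 : 0 <= kernel_bound ^+ 2 * (p * p)%:R / eta ^+ 2.
  by rewrite divr_ge0 ?sqr_ge0 // !mulr_ge0 ?sqr_ge0.
have h4 : 0 <= (p * p)%:R / eta * (kernel_bound + 2 * CT).
  by rewrite !mulr_ge0 // addr_ge0 // mulr_ge0.
by split=> //; exact: (addr_ge0 (addr_ge0 (addr_ge0 h1 (mulr_ge0 h1 h2)) h3) h4).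
Qed.

Lemma step_error i : aspect <= 2 * beta ->
  fnorm (K i *m M - A i *m S i) <= step_bound * (x i + y i + `|aspect - beta| + n%:R^-1).
Proof.
move=> ab; have [s0 a0 c0 b0 d0] := step_bound_split.
have x0 : 0 <= x i by []. have y0 : 0 <= y i by [].
have v0 : 0 <= `|aspect - beta| by [].
have n0 : 0 <= n%:R^-1 :> R by rewrite invr_ge0.
have key (f a c b d X Y V N : R) : 0 <= a -> 0 <= c -> 0 <= b -> 0 <= d ->
   0 <= X -> 0 <= Y -> 0 <= V -> 0 <= N ->
   f <= a * (X + c * N) + b * V \/ f <= d * Y -> f <= (a + a * c + b + d) * (X + Y + V + N).
  move=> ha hc hb hd hX hY hV hN.
  have q1 : 0 <= a * X + a * c * X + b * X + a * Y + a * c * Y + b * Y.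
    by rewrite !addr_ge0 // !mulr_ge0.
  have q2 : 0 <= a * V + a * c * V + b * N + a * N + d * X + d * V + d * N.
    by rewrite !addr_ge0 // !mulr_ge0.
  have q3 : 0 <= a * X + a * c * N + b * V by rewrite !addr_ge0 // !mulr_ge0.
  have q4 : 0 <= a * c * X by rewrite !mulr_ge0.
  have q5 : 0 <= b * X by rewrite !mulr_ge0.
  have q6 : 0 <= a * Y + a * c * Y + b * Y by rewrite !addr_ge0 // !mulr_ge0.
  have q7 : 0 <= d * Y by rewrite mulr_ge0.
  by case=> h; lra.
apply: key => //.
have [us|us] := leP (sq i) (2 * m%:R); last by right; exact: step_error_bad.
by left; exact: step_error_good.
Qed.

Lemma sample_fixpoint_error : aspect <= 2 * beta ->
  fnorm (nV *: \sum_i K i *m M - (1%:M + z *: M)) <=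
  step_bound * (n%:R^-1 * \sum_i (x i + y i) + `|aspect - beta| + n%:R^-1).
Proof.
move=> ab; rewrite sample_res_trace -scalerBr -sumrB fnormZ nc_real.
have n0 : 0 < n%:R :> R by rewrite ltr0n.
have nV0 : 0 <= n%:R^-1 :> R by rewrite invr_ge0 ltW.
rewrite ger0_norm //; apply: (le_trans (ler_wpM2l nV0 (fnorm_sum _ _ _))).
apply: (le_trans (ler_wpM2l nV0 (ler_sum _ (fun i _ => step_error i ab)))).
rewrite -mulr_sumr mulrCA; have [s0 _ _ _ _] := step_bound_split.
rewrite ler_wpM2l // -[leRHS]addrA; under eq_bigr do rewrite -addrA.
rewrite big_split /= sumr_const card_ord mulrDr lerD2l -[X in _ * X]mulr_natr mulrC mulfK //.
by rewrite gt_eqF.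
Qed.

End SampleResolvent.

(** * Almost sure convergence at a fixed spectral parameter *)

Section ComplexMeasurability.
Context d (X : measurableType d) (R : realType).
Local Notation C := R[i].
Implicit Types (f g : X -> C).

Definition measurable_cfun f := measurable_fun setT (fun x => complex.Re (f x)) /\
  measurable_fun setT (fun x => complex.Im (f x)).

Lemma measurable_cfun_cst c : measurable_cfun (fun=> c).
Proof. by split; exact: measurable_cst. Qed.

Lemma measurable_cfun_real (f : X -> R) : measurable_fun setT f -> measurable_cfun (fun x => (f x)%:C).
Proof. by move=> mf; split => //=; exact: measurable_cst. Qed.

Lemma measurable_cfunD f g : measurable_cfun f -> measurable_cfun g -> measurable_cfun (fun x => f x + g x).
Proof.
move=> [fr fi] [gr gi]; split; [under eq_fun do rewrite ReD|under eq_fun do rewrite ImD];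
  exact: measurable_funD.
Qed.

Lemma measurable_cfunM f g : measurable_cfun f -> measurable_cfun g -> measurable_cfun (fun x => f x * g x).
Proof.
move=> [fr fi] [gr gi]; split; [under eq_fun do rewrite ReM|under eq_fun do rewrite ImM].
  by apply: measurable_funB; exact: measurable_funM.
by apply: measurable_funD; exact: measurable_funM.
Qed.

Lemma measurable_cfun_sum (I : Type) (s : seq I) (P : pred I) (f : I -> X -> C) :
  (forall i, measurable_cfun (f i)) -> measurable_cfun (fun x => \sum_(i <- s | P i) f i x).
Proof.
move=> h; elim: s => [|i s IH].
  by under eq_fun do rewrite big_nil; exact: measurable_cfun_cst.
under eq_fun do rewrite big_cons.
by case: (P i) => //; exact: measurable_cfunD.
Qed.

Lemma measurable_cfun_prod (I : Type) (s : seq I) (P : pred I) (f : I -> X -> C) :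
  (forall i, measurable_cfun (f i)) -> measurable_cfun (fun x => \prod_(i <- s | P i) f i x).
Proof.
move=> h; elim: s => [|i s IH].
  by under eq_fun do rewrite big_nil; exact: measurable_cfun_cst.
under eq_fun do rewrite big_cons.
by case: (P i) => //; exact: measurable_cfunM.
Qed.

(** Real powers are measurable and agree with the inverse on nonnegative numbers, 0 included. *)
Lemma measurable_inv (f : X -> R) : measurable_fun setT f -> (forall x, 0 <= f x) ->
  measurable_fun setT (fun x => (f x)^-1).
Proof.
move=> mf f0; rewrite (_ : (fun x => _) = (@powR R ^~ (-1)) \o f).
  exact: measurableT_comp (measurable_powR _) mf.
by apply/funext => x /=; rewrite powR_inv1.
Qed.

Lemma measurable_cfunV f : measurable_cfun f -> measurable_cfun (fun x => (f x)^-1).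
Proof.
move=> [fr fi].
have mn : measurable_fun setT (fun x => (complex.Re (f x) ^+ 2 + complex.Im (f x) ^+ 2)^-1).
  apply: measurable_inv => [|x]; last by rewrite addr_ge0 ?sqr_ge0.
  by apply: measurable_funD; exact: measurable_funX.
split.
  rewrite (_ : (fun x => _) = fun x => complex.Re (f x) *
     (complex.Re (f x) ^+ 2 + complex.Im (f x) ^+ 2)^-1); first exact: measurable_funM.
  by apply/funext => x; case: (f x).
rewrite (_ : (fun x => _) = fun x => - complex.Im (f x) *
   (complex.Re (f x) ^+ 2 + complex.Im (f x) ^+ 2)^-1).
  by apply: measurable_funM => //; exact: measurableT_comp.
by apply/funext => x; case: (f x) => a b /=; rewrite mulNr.
Qed.

Definition measurableM m n (F : X -> 'M[C]_(m, n)) := forall i j, measurable_cfun (fun x => F x i j).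

Lemma measurableM_cst m n (A : 'M[C]_(m, n)) : measurableM (fun=> A).
Proof. by move=> i j; exact: measurable_cfun_cst. Qed.

Lemma measurableMD m n (F G : X -> 'M[C]_(m, n)) : measurableM F -> measurableM G ->
  measurableM (fun x => F x + G x).
Proof.
by move=> hF hG i j; under eq_fun do rewrite mxE; exact: measurable_cfunD.
Qed.

Lemma measurableMM m n l (F : X -> 'M[C]_(m, n)) (G : X -> 'M[C]_(n, l)) :
  measurableM F -> measurableM G -> measurableM (fun x => F x *m G x).
Proof.
move=> hF hG i j; under eq_fun do rewrite mxE; apply: measurable_cfun_sum => k.
exact: measurable_cfunM.
Qed.

Lemma measurableMZ m n (c : X -> C) (F : X -> 'M[C]_(m, n)) : measurable_cfun c -> measurableM F ->
  measurableM (fun x => c x *: F x).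
Proof.
by move=> hc hF i j; under eq_fun do rewrite mxE; exact: measurable_cfunM.
Qed.

Lemma measurableM_sum m n (I : Type) (s : seq I) (P : pred I) (F : I -> X -> 'M[C]_(m, n)) :
  (forall i, measurableM (F i)) -> measurableM (fun x => \sum_(i <- s | P i) F i x).
Proof.
by move=> h i j; under eq_fun do rewrite summxE; apply: measurable_cfun_sum => k; exact: h.
Qed.

Lemma measurable_cfun_det n (F : X -> 'M[C]_n) : measurableM F -> measurable_cfun (fun x => \det (F x)).
Proof.
move=> h; rewrite /determinant; apply: measurable_cfun_sum => s.
apply: measurable_cfunM; first exact: measurable_cfun_cst.
by apply: measurable_cfun_prod => i; exact: h.
Qed.

Lemma measurableM_inv n (F : X -> 'M[C]_n) : measurableM F -> (forall x, F x \in unitmx) ->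
  measurableM (fun x => invmx (F x)).
Proof.
move=> h u i j; rewrite (_ : (fun x => _) = fun x => (\det (F x))^-1 * cofactor (F x) j i).
  apply: measurable_cfunM; first by apply: measurable_cfunV; exact: measurable_cfun_det.
  apply: measurable_cfunM; first exact: measurable_cfun_cst.
  by apply: measurable_cfun_det => k l; under eq_fun do rewrite !mxE; exact: h.
by apply/funext => x; rewrite /invmx u !mxE.
Qed.

Lemma measurableM_Kf p (beta eta : R) (M : 'M[C]_p) (T : X -> 'M[C]_p) :
  0 < beta -> 0 < eta -> herg eta M -> (forall x, (T x) ^t* = T x) ->
  measurableM T -> measurableM (fun x => Kf beta M (T x)).
Proof.
move=> b0 e0 hM hT mT i j; under eq_fun do rewrite KfE; move: i j.
apply: measurableMM => //; apply: measurableM_inv; last first.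
  by move=> x; exact: (Kf_unit b0 e0 hM (hT x)).
apply: measurableMD; first exact: measurableM_cst.
apply: measurableMZ; first exact: measurable_cfun_cst.
by apply: measurableMM => //; exact: measurableM_cst.
Qed.

Lemma measurableM_liftv p m (v : X -> m.-tuple R) : measurable_fun setT v ->
  measurableM (fun x => liftv p (tnth (v x))).
Proof.
move=> mv; rewrite /liftv; apply: measurableM_sum => k; apply: measurableMZ.
  by apply: measurable_cfun_real; exact: measurableT_comp (measurable_tnth k) mv.
exact: measurableM_cst.
Qed.

Lemma measurableM_ctr m n (F : X -> 'M[C]_(m, n)) : measurableM F -> measurableM (fun x => (F x) ^t*).
Proof.
move=> h i j; under eq_fun do rewrite !mxE; have [hr hi] := h j i.
split; [under eq_fun do rewrite ReJ | under eq_fun do rewrite ImJ] => //.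
exact: measurableT_comp hi.
Qed.

Lemma measurableM_sample_res p m n (A : 'I_n -> X -> 'M[C]_p) (v : 'I_n -> X -> m.-tuple R)
    (z : C) (I : pred 'I_n) : 0 < complex.Im z ->
  (forall i, measurableM (A i)) -> (forall i x, (A i x) ^t* = A i x) ->
  (forall i, measurable_fun setT (v i)) ->
  measurableM (fun x => sample_res (fun i => A i x) (fun i => tnth (v i x)) z I).
Proof.
move=> z0 mA hA mv; rewrite /sample_res; apply: measurableM_inv; last first.
  by move=> x; apply: sample_res_unit => // i; exact: hA.
apply: measurableMD; last exact: measurableM_cst.
rewrite /sample_mx; apply: measurableMZ; first exact: measurable_cfun_cst.
apply: measurableM_sum => i; apply: measurableMM; last first.
  by apply: measurableM_ctr; exact: measurableM_liftv.
by apply: measurableMM => //; exact: measurableM_liftv.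
Qed.

End ComplexMeasurability.

Section RowSums.
Variable R : realType.
Local Notation C := R[i].
Local Notation nc := (@ComplexField.Normc.normc R).

Lemma opb_col_sum N (X : 'M[C]_N) (c : R) j : opb X c -> \sum_i nc (X i j) ^+ 2 <= c ^+ 2.
Proof.
move=> h; have := h (delta_mx j 0); rewrite fnorm_delta mulr1 => h1.
have c0 : 0 <= c by exact: le_trans h1.
have := lerXn2r 2 (fnorm_ge0 (X *m delta_mx j 0)) c0 h1; rewrite fnorm_cV.
by under eq_bigr do rewrite -colE mxE.
Qed.

Lemma opb_row_sum N (X : 'M[C]_N) (c : R) i : 0 <= c -> opb X c -> \sum_j nc (X i j) ^+ 2 <= c ^+ 2.
Proof.
move=> c0 h; have := opb_col_sum i (opb_adj c0 h).
by under eq_bigr do rewrite !mxE ncJ.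
Qed.

(** The boolean selects the real or the imaginary part, so that the moment estimates for real
    variables are stated once for both. *)
Definition part (b : bool) (z : C) : R := if b then complex.Re z else complex.Im z.

Lemma part_sqr_le b z : part b z ^+ 2 <= nc z ^+ 2.
Proof.
rewrite nc2; case: b => /=; first by rewrite lerDl sqr_ge0.
by rewrite lerDr sqr_ge0.
Qed.

Lemma part_linear b (c : R) (z w : C) : part b (c%:C * (z - w)) = c * (part b z - part b w).
Proof. by case: b => /=; rewrite ?ReZ ?ImZ ?ReD ?ReN ?ImD ?ImN. Qed.

Lemma part_sum b (I : Type) (s : seq I) (f : I -> C) :
  part b (\sum_(i <- s) f i) = \sum_(i <- s) part b (f i).
Proof. by case: b => /=; rewrite ?Re_sum ?Im_sum. Qed.

Lemma part_real b (c : R) (z : C) : part b (z * c%:C) = part b z * c.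
Proof. by case: b => /=; rewrite mulrC ?ReZ ?ImZ mulrC. Qed.

Variables (p m : nat).

Lemma block_form_entry (u : 'I_m -> R) (G : 'M[C]_(p * m)) mu nu :
  ((liftv p u) ^t* *m G *m liftv p u) mu nu =
  \sum_k \sum_l G (mxtens_index (mu, k)) (mxtens_index (nu, l)) * (u k * u l)%:C.
Proof.
rewrite liftv_adj mulmx_suml mulmx_suml summxE; apply: eq_bigr => k _.
rewrite [liftv p u]/liftv mulmx_sumr summxE; apply: eq_bigr => l _.
rewrite -!scalemxAl -scalemxAr mxE mxE mulmx_blk blk_mulmx rmorphM mulrCA mulrC.
by rewrite [_ * G _ _]mulrC mulrA.
Qed.

End RowSums.

Lemma sub_mxE (V : zmodType) m n (A B : 'M[V]_(m, n)) i j : (A - B) i j = A i j - B i j.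
Proof. by rewrite !mxE. Qed.

Lemma sample_res_ext (R : realType) p m n (A A' : 'I_n -> 'M[R[i]]_p) (u u' : 'I_n -> 'I_m -> R)
    (z : R[i]) (I : pred 'I_n) :
  (forall j, I j -> A j = A' j) -> (forall j, I j -> u j = u' j) ->
  sample_res A u z I = sample_res A' u' z I.
Proof.
move=> hA hu; suff e : sample_mx A u I = sample_mx A' u' I by rewrite /sample_res e.
rewrite /sample_mx; congr (_ *: _); by apply: eq_bigr => j Ij; rewrite hA ?hu.
Qed.

(** * Concentration of the leave-one-out forms *)

Section LeaveOneOut.
Local Opaque sample_res.
Context d (Omega : measurableType d) (R : realType) (P : probability Omega R).
Local Notation C := R[i].
Local Notation nc := (@ComplexField.Normc.normc R).

(** With the other samples frozen, the real or imaginary part of an entry is a centred Gaussian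
    quadratic form, whose matrix is a block of a fixed resolvent. Its rows and columns have squared
    norm at most (Im z)^-2 in every dimension, which is why K can be chosen before n, m and p. *)
Lemma loo_fourth_moment : exists2 K : R, 0 < K &
  forall d' (E : measurableType d') (n m p : nat) (X : 'I_n -> Omega -> E)
    (v : E -> m.-tuple R) (A : E -> 'M[C]_p) (z : C),
  (forall i, measurable_fun setT (X i)) -> mutually_independent P X ->
  measurable_fun setT v -> (forall i, std_gaussian_vector P (v \o X i)) ->
  measurableM A -> (forall x, (A x) ^t* = A x) -> 0 < complex.Im z -> (0 < m)%N ->
  forall i b mu nu,
  let GG w := sample_res (fun j => A (X j w)) (fun j => tnth (v (X j w))) z (predC1 i) in
  let LL w := loo_form (fun j => A (X j w)) (fun j => tnth (v (X j w))) z i in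
  let q w := part b ((LL w - partial_trace (GG w)) mu nu) in
  measurable_fun setT q /\
  (\int[P]_w (q w ^+ 4)%:E <= (K * (complex.Im z)^-1 ^+ 4 / m%:R ^+ 2)%:E)%E.
Proof.
have [K K0 gq] := gaussian_quadratic_form P.
exists K => // d' E n m p X v A z mX indX mv gv mA hA z0 m0 i b mu nu GG LL q.
pose Gt (t : n.-tuple E) := sample_res (fun j => A (tnth t j)) (fun j => tnth (v (tnth t j))) z (predC1 i).
pose B (t : n.-tuple E) (k l : 'I_m) : R :=
  part b (Gt t (mxtens_index (mu, k)) (mxtens_index (nu, l))).
pose Q t := quadratic_form (B t) (v (tnth t i)) - \sum_k B t k k.
have GJ w : Gt (jointX X w) = GG w.
  by apply: sample_res_ext => j _; rewrite tnth_mktuple.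
have mp : 0 < m%:R :> R by rewrite ltr0n.
have qE w : q w = m%:R^-1 * Q (jointX X w).
  rewrite /q /LL /loo_form -/(GG w) -GJ partial_traceE -scalerBr mxE.
  rewrite sub_mxE part_linear; congr (_ * (_ - _)).
    rewrite block_form_entry /quadratic_form tnth_mktuple part_sum; apply: eq_bigr => k _.
    by rewrite part_sum; apply: eq_bigr => l _; rewrite part_real.
  rewrite summxE part_sum; apply: eq_bigr => k _.
  by rewrite mulmx_blk blk_mulmx.
have mGt : measurableM Gt.
  apply: (measurableM_sample_res _ z0) => j.
  - move=> a c; have [h1 h2] := mA a c.
    by split; [exact: measurableT_comp h1 (measurable_tnth j) |
               exact: measurableT_comp h2 (measurable_tnth j)].
  - by move=> x; exact: hA.
  - exact: measurableT_comp mv (measurable_tnth j).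
have mB k l : measurable_fun setT (fun t => B t k l).
  have [h1 h2] := mGt (mxtens_index (mu, k)) (mxtens_index (nu, l)).
  by rewrite /B /part; case: b @q @B @Q qE.
have mvt k : measurable_fun setT (fun t : n.-tuple E => tnth (v (tnth t i)) k).
  exact: measurableT_comp (measurable_tnth k) (measurableT_comp mv (measurable_tnth i)).
have mQ : measurable_fun setT Q.
  apply: measurable_funB; last by apply: measurable_sum => k; exact: mB.
  apply: measurable_sum => k; apply: measurable_sum => l.
  by apply: measurable_funM; [exact: mB | exact: measurable_funM].
have mQ4 : measurable_fun setT (fun t => (Q t ^+ 4)%:E).
  by apply/measurable_EFinP; exact: measurable_funX.
have mJ : measurable_fun setT (jointX X) by exact: measurable_jointX.
have mq : measurable_fun setT q.
  rewrite (_ : q = fun w => m%:R^-1 * Q (jointX X w)); last by apply/funext => w; exact: qE.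
  exact: (measurable_funM (measurable_cst _) (measurableT_comp mQ mJ)).
split; first exact: mq.
under eq_integral do rewrite qE exprMn EFinM.
rewrite ge0_integralZl //; last 2 first.
- exact: measurableT_comp mQ4 mJ.
- by move=> w _; rewrite lee_fin exprn_even_ge0.
have h : (\int[P]_w (Q (jointX X w) ^+ 4)%:E <= (K * (m%:R ^+ 2 * (complex.Im z)^-1 ^+ 2 ^+ 2))%:E)%E.
  (* Resampling overwrites coordinate i by some point of E. If there is none, Omega is empty as well
     and the integral vanishes. *)
  case: (pselect (exists e0 : E, True)) => [[e0 _]|noE]; last first.
    rewrite (eq_integral (fun=> 0%E)).
      by rewrite integral0 lee_fin !mulr_ge0 ?(ltW K0) ?sqr_ge0 ?invr_ge0 ?(ltW z0).
    by move=> w _; exfalso; apply: noE; exists (X i w).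
  rewrite (@fubini_family _ _ _ P _ _ _ _ mX indX i e0 (fun t => (Q t ^+ 4)%:E)) //; last first.
    by move=> t; rewrite lee_fin exprn_even_ge0.
  apply: (@le_trans _ _ (\int[P]_w (K * (m%:R ^+ 2 * (complex.Im z)^-1 ^+ 2 ^+ 2))%:E)%E); last first.
    by rewrite integral_cst //= probability_setT mule1.
  apply: ge0_le_integral => //.
  - by move=> w _; apply: integral_ge0 => w' _; rewrite lee_fin exprn_even_ge0.
  - apply: (@measurable_inner_integral _ _ _ P _ _ _ _ mX i (fun t => (Q t ^+ 4)%:E)) => //.
    by move=> t; rewrite lee_fin exprn_even_ge0.
  move=> w _; set t := jointX X w.
  have Gupd x : Gt (upd t i x) = Gt t.
    by apply: sample_res_ext => j /= /negPf ji; rewrite tnth_upd ji.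
  have Bupd x : B (upd t i x) = B t.
    by apply/funext => k; apply/funext => l; rewrite /B Gupd.
  pose Ui : {RV P >-> m.-tuple R} := mfun_pack (measurableT_comp mv (mX i)).
  have E1 w' : Q (upd t i (X i w')) = quadratic_form (B t) (Ui w') - \sum_k B t k k.
    by rewrite /Q Bupd tnth_upd eqxx.
  under eq_integral do rewrite E1.
  have o := @opb_sample_res R p m n (fun j => A (tnth t j)) (fun j => tnth (v (tnth t j))) z
    (fun j => hA _) z0 (predC1 i).
  have zV : 0 <= (complex.Im z)^-1 by rewrite invr_ge0 ltW.
  have sub (F : 'I_(p * m) -> R) (nu' : 'I_p) : (forall a, 0 <= F a) ->
      \sum_(l < m) F (mxtens_index (nu', l)) <= \sum_a F a.
    move=> F0; rewrite sum_mxtens (bigD1 nu') //= lerDl; apply: sumr_ge0 => a _.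
    by apply: sumr_ge0 => c _.
  apply: (gq m Ui (gv i)) => [k|l].
    apply: le_trans (opb_row_sum (mxtens_index (mu, k)) zV o).
    apply: le_trans (sub (fun a => nc (Gt t (mxtens_index (mu, k)) a) ^+ 2) nu (fun a => sqr_ge0 _)).
    by apply: ler_sum => l _; exact: part_sqr_le.
  apply: le_trans (opb_col_sum (mxtens_index (nu, l)) o).
  apply: le_trans (sub (fun a => nc (Gt t a (mxtens_index (nu, l))) ^+ 2) mu (fun a => sqr_ge0 _)).
  by apply: ler_sum => k _; exact: part_sqr_le.
apply: (@le_trans _ _ ((m%:R^-1 ^+ 4)%:E * (K * (m%:R ^+ 2 * (complex.Im z)^-1 ^+ 2 ^+ 2))%:E)%E).
  by apply: lee_wpmul2l => //; rewrite lee_fin exprn_ge0 // invr_ge0 ltW.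
rewrite -EFinM lee_fin.
rewrite [leLHS](_ : _ = K * (complex.Im z)^-1 ^+ 4 / m%:R ^+ 2) //.
by field; rewrite !gt_eqF.
Qed.

End LeaveOneOut.

Section MeanInstances.
Variable R : realType.
Local Notation C := R[i].

Section Average.
Variables (n : nat) (n_gt0 : (0 < n)%N).
Let avg (f : 'I_n -> R) : R := n%:R^-1 * \sum_i f i.
Let dom (f : 'I_n -> R) := True.

Fact avgD f g : dom f -> dom g -> avg (fun x => f x + g x) = avg f + avg g.
Proof. by move=> _ _; rewrite /avg big_split mulrDr. Qed.
Fact avgZ c f : dom f -> avg (fun x => c * f x) = c * avg f.
Proof. by move=> _; rewrite /avg -mulr_sumr mulrCA. Qed.
Fact avg_cst c : avg (fun=> c) = c.
Proof.
rewrite /avg sumr_const card_ord -[X in _ * X]mulr_natl mulKf //.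
by rewrite pnatr_eq0 -lt0n.
Qed.
Fact avg_le f g : dom f -> dom g -> (forall x, f x <= g x) -> avg f <= avg g.
Proof.
move=> _ _ h; rewrite /avg ler_wpM2l ?invr_ge0 //.
by apply: ler_sum => i _; exact: h.
Qed.
Definition average : mean_functional R 'I_n :=
  @MeanFunctional R 'I_n dom avg (fun _ _ _ _ => I) (fun _ _ _ => I) (fun _ => I)
    avgD avgZ avg_cst avg_le.

Lemma mdomM_average p (F : 'I_n -> 'M[C]_p) : mdomM average F.
Proof. by []. Qed.

Lemma meanM_average p (F : 'I_n -> 'M[C]_p) :
  meanM average F = (n%:R^-1 : R)%:C *: \sum_i F i.
Proof.
apply/matrixP => i j; rewrite !mxE summxE; apply: complex_eq.
  by rewrite ReZ Re_sum.
by rewrite ImZ Im_sum.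
Qed.
End Average.

Section Expectation.
Context d (X : measurableType d) (P : probability X R).
Let dom (f : X -> R) := P.-integrable setT (EFin \o f).
Let E (f : X -> R) : R := \int[P]_x f x.

Fact expD_dom f g : dom f -> dom g -> dom (fun x => f x + g x).
Proof. by move=> hf hg; exact: (integrableD measurableT hf hg). Qed.
Fact expZ_dom c f : dom f -> dom (fun x => c * f x).
Proof. by move=> hf; exact: (integrableZl measurableT c hf). Qed.
Fact exp_cst_dom c : dom (fun=> c).
Proof. exact: (finite_measure_integrable_cst P c). Qed.
Fact expD f g : dom f -> dom g -> E (fun x => f x + g x) = E f + E g.
Proof. by move=> hf hg; exact: RintegralD. Qed.
Fact expZ c f : dom f -> E (fun x => c * f x) = c * E f.
Proof. by move=> hf; exact: RintegralZl. Qed.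
Fact exp_cst c : E (fun=> c) = c.
Proof. by rewrite /E Rintegral_cst //= probability_setT mulr1. Qed.
Fact exp_le f g : dom f -> dom g -> (forall x, f x <= g x) -> E f <= E g.
Proof. by move=> hf hg h; apply: le_Rintegral => // x _; exact: h. Qed.
Definition expectation_mean : mean_functional R X :=
  @MeanFunctional R X dom E expD_dom expZ_dom exp_cst_dom expD expZ exp_cst exp_le.
End Expectation.
End MeanInstances.

Section Limits.
Variable R : realType.

(** Used with [young4] to pass from averages of fourth powers to averages of absolute values: dl is
    fixed first, then n is taken large. *)
Lemma cvg0_young (u v : nat -> R) (c : R) : (forall n, 0 <= u n) ->
  (forall dl, 0 < dl -> \forall n \near \oo, u n <= c * dl + v n / dl ^+ 3) ->
  v n @[n --> \oo] --> (0 : R) -> u n @[n --> \oo] --> (0 : R).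
Proof.
move=> u0 h hv; apply/cvgrPdist_le => e e0.
pose dl := e / (2 * (`|c| + 1)).
have c1 : 0 < `|c| + 1 by rewrite ltr_wpDl.
have dl0 : 0 < dl by rewrite divr_gt0 // mulr_gt0.
have d3 : 0 < dl ^+ 3 * (e / 2) by rewrite mulr_gt0 ?exprn_gt0 ?divr_gt0.
have [k hk] := cvg0_eventually hv d3.
have cd : c * dl <= e / 2.
  apply: (@le_trans _ _ (`|c| * dl)); first by rewrite ler_wpM2r ?ler_norm ?(ltW dl0).
  apply: (@le_trans _ _ ((`|c| + 1) * dl)); first by rewrite ler_wpM2r ?lerDl ?(ltW dl0).
  rewrite /dl le_eqVlt; apply/orP; left; apply/eqP.
  by field; rewrite gt_eqF.
near=> n; rewrite sub0r normrN ger0_norm //.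
have : u n <= c * dl + v n / dl ^+ 3 by near: n; exact: h.
have kn : (k <= n)%N by near: n; exists k.
have : v n / dl ^+ 3 <= e / 2 by rewrite ler_pdivrMr ?exprn_gt0 // mulrC hk.
move=> h1 /le_trans; apply; lra.
Unshelve. all: by end_near. Qed.

Lemma cvg_invn : n%:R^-1 @[n --> \oo] --> (0 : R).
Proof.
by rewrite -(cvg_shiftS (fun n => n%:R^-1 : R)); exact: cvg_harmonic.
Qed.

Lemma cvg0_mull (c : R) (u : nat -> R) : u n @[n --> \oo] --> (0 : R) ->
  c * u n @[n --> \oo] --> (0 : R).
Proof. by move=> h; rewrite -(mulr0 c); exact: cvgMr. Qed.

Lemma cvg0_add (u v : nat -> R) : u n @[n --> \oo] --> (0 : R) -> v n @[n --> \oo] --> (0 : R) ->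
  u n + v n @[n --> \oo] --> (0 : R).
Proof. by move=> h h'; rewrite -(addr0 0); exact: cvgD. Qed.

Lemma young4 (x dl : R) : 0 < dl -> `|x| <= dl + x ^+ 4 / dl ^+ 3.
Proof.
move=> d0; have -> : x ^+ 4 = `|x| ^+ 4 by rewrite -normrX ger0_norm // exprn_even_ge0.
have := normr_ge0 x; move: `|x| => y y0.
have [yd|yd] := leP y dl.
  by apply: (le_trans yd); rewrite lerDl divr_ge0 ?exprn_ge0 // ltW.
apply: (@le_trans _ _ (y ^+ 4 / dl ^+ 3)); last by rewrite lerDr ltW.
rewrite ler_pdivlMr ?exprn_gt0 // (_ : y ^+ 4 = y * y ^+ 3); last by rewrite exprS.
by rewrite ler_wpM2l // lerXn2r ?nnegrE // ltW.
Qed.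

End Limits.

(** * From small errors to convergence of the partial trace *)

Section DeterministicLimit.
Variables (R : realType) (I : Type) (mu : mean_functional R I).
Local Notation C := R[i].
Local Notation nc := (@ComplexField.Normc.normc R).
Variables (p : nat) (T : I -> 'M[C]_p) (beta CT : R) (z : C).
Hypothesis p_gt0 : (0 < p)%N.
Hypotheses (beta_gt0 : 0 < beta) (CT_ge0 : 0 <= CT).
Hypothesis T_herm : forall x, (T x) ^t* = T x.
Hypothesis T_opb : forall x, opb (T x) CT.
Local Notation eta := (complex.Im z).
Hypothesis eta_gt0 : 0 < eta.
Hypothesis K_dom : forall M, herg eta M -> mdomM mu (fun x => Kf beta M (T x)).
Variable M : 'M[C]_p.
Hypotheses (herg_M : herg eta M) (fix_M : Phi mu T beta z M = M).

Lemma Phi_average_sub n (n_gt0 : (0 < n)%N) (y : 'I_n -> I) (e : R) :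
  fnorm ((n%:R^-1 : R)%:C *: \sum_i Kf beta M (T (y i)) - meanM mu (fun x => Kf beta M (T x))) <= e ->
  fnorm (Phi (average R n_gt0) (fun i => T (y i)) beta z M - M) <= eta^-1 * (eta^-1 * e).
Proof.
move=> he.
have [u1 h1 _ _] := Phi_props beta_gt0 T_herm eta_gt0 K_dom herg_M.
have [u2 h2 _ _] := Phi_props (mu := average R n_gt0) (T := fun i => T (y i)) beta_gt0
  (fun i => T_herm (y i)) eta_gt0 (fun M _ => mdomM_average n_gt0 _) herg_M.
rewrite -{2}fix_M /Phi (invmx_sub u2 u1).
have eV : 0 <= eta^-1 by rewrite invr_ge0 ltW.
apply: (le_trans (opb_mulr _ eV (herg_opb eta_gt0 h1))); rewrite ler_wpM2l //.
apply: (le_trans (opb_mul _ eV (herg_opb eta_gt0 h2))); rewrite ler_wpM2l //.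
apply: le_trans he; rewrite fnormBC /Amx meanM_average.
by rewrite -sub_addl.
Qed.

Lemma Phi_average_approx n (n_gt0 : (0 < n)%N) (y : 'I_n -> I) (N : 'M[C]_p) (e : R) :
  herg eta N ->
  fnorm ((n%:R^-1 : R)%:C *: \sum_i Kf beta N (T (y i)) *m N - (1%:M + z *: N)) <= e ->
  fnorm (Phi (average R n_gt0) (fun i => T (y i)) beta z N - N) <= eta^-1 * e.
Proof.
move=> hN he.
have [u h _ _] := Phi_props (mu := average R n_gt0) (T := fun i => T (y i)) beta_gt0
  (fun i => T_herm (y i)) eta_gt0 (fun M _ => mdomM_average n_gt0 _) hN.
have eV : 0 <= eta^-1 by rewrite invr_ge0 ltW.
set A := Amx _ _ _ _ _ in u; rewrite /Phi -/A.
have E : invmx A - N = invmx A *m (1%:M - A *m N).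
  by rewrite mulmxBr mulmx1 (mulKmx u).
rewrite E; apply: (le_trans (opb_mul _ eV (herg_opb eta_gt0 h))); rewrite ler_wpM2l //.
apply: le_trans he; rewrite fnormBC /A /Amx meanM_average mulmxDl mulNmx mul_scalar_mx.
rewrite -scalemxAl mulmx_suml (_ : _ - 1%:M = (n%:R^-1 : R)%:C *: \sum_i Kf beta N (T (y i)) *m N - (1%:M + z *: N)) //.
by rewrite opprD addrA [- (z *: N) + _]addrC addrAC.
Qed.

Variables (m : nat -> nat) (y : forall n, 'I_n -> I) (u : forall n, 'I_n -> 'I_(m n) -> R).
Hypothesis m_gt0 : forall n, (0 < m n)%N.
Hypothesis aspect_cvg : aspect R (m n) n @[n --> \oo] --> beta.
Local Notation A n := (fun i => T (@y n i)).
Hypothesis loo_cvg : n%:R^-1 * \sum_(i < n)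
   (fnorm (loo_form (A n) (@u n) z i - partial_trace (sample_res (A n) (@u n) z (predC1 i))) +
    `|(\sum_k @u n i k ^+ 2) / (m n)%:R - 1|) @[n --> \oo] --> (0 : R).
Hypothesis kernel_cvg :
  fnorm ((n%:R^-1 : R)%:C *: \sum_i Kf beta M (T (@y n i)) - meanM mu (fun x => Kf beta M (T x)))
    @[n --> \oo] --> (0 : R).

(** Both the partial trace and M are approximate fixed points of the map built from the empirical
    mean: the former by the leave-one-out analysis, the latter by the law of large numbers. That law
    is thus required only at the deterministic matrix M, and not uniformly over the random partial
    traces. *)
Lemma trace_cvg_fixpoint :
  fnorm (partial_trace (sample_res (A n) (@u n) z predT) - M) @[n --> \oo] --> (0 : R).
Proof.
pose e1 n := fnorm ((n%:R^-1 : R)%:C *: \sum_i Kf beta M (T (@y n i)) - meanM mu (fun x => Kf beta M (T x))).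
pose e2 (n : nat) : R := n%:R^-1 * \sum_(i < n)
   (fnorm (loo_form (A n) (@u n) z i - partial_trace (sample_res (A n) (@u n) z (predC1 i))) +
    `|(\sum_k @u n i k ^+ 2) / (m n)%:R - 1|) + `|aspect R (m n) n - beta| + n%:R^-1.
have eV : 0 <= eta^-1 by rewrite invr_ge0 ltW.
pose S := step_bound p z CT beta.
have e20 : e2 n @[n --> \oo] --> (0 : R).
  apply: cvg0_add; first apply: cvg0_add.
  - exact: loo_cvg.
  - exact: cvg_sub_norm0 aspect_cvg.
  - exact: cvg_invn.
pose eps n := eta^-1 * (eta^-1 * e1 n) + eta^-1 * (S * e2 n).
have eps0 : eps n @[n --> \oo] --> (0 : R).
  by apply: cvg0_add; do 2 apply: cvg0_mull; [exact: kernel_cvg | exact: e20].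
pose gp := gap p beta CT z; pose lc := lowc p beta CT z.
have g0 : 0 < gp by apply: gap_gt0.
have c0 : 0 < lc by apply: lowc_gt0.
apply: (@cvg0_le _ _ (fun n => (p * p)%:R * (8 * eps n / (lc * gp) / eta))); last first.
  rewrite (_ : (fun n => _) = fun n => ((p * p)%:R * 8 / (lc * gp) / eta) * eps n); last first.
    by apply/funext => n; ring.
  exact: cvg0_mull.
have lt1 : 0 < lc / 2 by rewrite divr_gt0.
have lt2 : 0 < lc * gp / 4 by rewrite divr_gt0 // mulr_gt0.
have [k1 hk1] := cvg0_eventually eps0 lt1.
have [k2 hk2] := cvg0_eventually eps0 lt2.
have [k3 hk3] := cvg0_eventually (cvg_sub_norm0 aspect_cvg) beta_gt0.
near=> n.
have n0 : (0 < n)%N by near: n; exists 1%N.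
have l1 : eps n <= lc / 2 by apply: hk1; near: n; exists k1.
have l2 : eps n <= lc * gp / 4 by apply: hk2; near: n; exists k2.
have l3 : aspect R (m n) n <= 2 * beta.
  have h : `|aspect R (m n) n - beta| <= beta by apply: hk3; near: n; exists k3.
  have := le_trans (ler_norm _) h; lra.
have hN := @herg_sample_trace R p (m n) n (A n) (@u n) z (m_gt0 n) (fun i => T_herm (@y n i)) eta_gt0.
rewrite fnorm_ge0 /=.
have e1n : 0 <= e1 n by exact: fnorm_ge0.
have e2n : 0 <= e2 n.
  rewrite !addr_ge0 ?invr_ge0 // mulr_ge0 ?invr_ge0 //.
  by apply: sumr_ge0 => i _; rewrite addr_ge0.
have S0 : 0 <= S.
  by have [] := step_bound_split p CT_ge0 eta_gt0 beta_gt0.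
have x1 : 0 <= eta^-1 * (eta^-1 * e1 n) by rewrite !mulr_ge0.
have x2 : 0 <= eta^-1 * (S * e2 n) by rewrite !mulr_ge0.
apply: (approx_fixpoints_close (mu := average R n0) (T := A n) p_gt0 beta_gt0 CT_ge0
  (fun i => T_herm (@y n i)) (fun i => T_opb (@y n i)) eta_gt0
  (fun M _ => mdomM_average n0 _) _ hN herg_M _ _ l1 l2).
- by rewrite addr_ge0.
- have h := sample_fixpoint_error (@u n) (m_gt0 n) n0 CT_ge0 (fun i => T_herm (@y n i))
    (fun i => T_opb (@y n i)) eta_gt0 beta_gt0 l3.
  apply: (le_trans (Phi_average_approx n0 hN h)).
  by rewrite lerDr.
- apply: (le_trans (Phi_average_sub n0 (lexx _))).
  by rewrite lerDl.
Unshelve. all: by end_near. Qed.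

End DeterministicLimit.

Lemma fnorm_le_parts (R : realType) p (X : 'M[R[i]]_p) :
  fnorm X <= \sum_(k : 'I_p * 'I_p * bool) `|part k.2 (X k.1.1 k.1.2)|.
Proof.
apply: (le_trans (fnorm_sum_entries X)).
rewrite -(pair_bigA _ (fun k b => `|part b (X k.1 k.2)|)) /=; apply: ler_sum => k _.
by rewrite big_bool /=; exact: nc_le.
Qed.

Lemma sum_cst (R : realType) (J : finType) (c : R) : \sum_(j : J) c = #|J|%:R * c.
Proof. by rewrite sumr_const mulr_natl. Qed.

Lemma sum_option (V : nmodType) (J : finType) (F : option J -> V) :
  \sum_o F o = F None + \sum_j F (Some j).
Proof.
rewrite (bigD1 None) //=; congr (_ + _).
rewrite (reindex_omap Some id) => [|[j|]] //=.
by apply: eq_bigl => j; rewrite eqxx.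
Qed.

(** * Almost sure convergence for the Gaussian samples *)

Section GaussianSamples.
Context (R : realType) (r q p : nat) (disp : measure_display) (Omega : measurableType disp)
  (P : probability Omega R) (d : nat -> nat).
Variables (s : forall n, 'I_n -> {RV P >-> r.-tuple R})
  (u : forall n, 'I_n -> {RV P >-> (d n - r).-tuple R})
  (y : forall n, 'I_n -> {RV P >-> q.-tuple R}).
Hypothesis p_gt0 : (0 < p)%N.
Hypothesis r_lt_d : forall n, (r < d n)%N.
Hypothesis u_gaussian : forall n (i : 'I_n), std_gaussian_vector P (@u n i).
Hypothesis samples_indep : forall n,
  mutually_independent P (fun (i : 'I_n) w => (@s n i w, @u n i w, @y n i w)).
Variable law_y : probability (q.-tuple R) R.
Hypothesis law_yE : forall n (i : 'I_n) B, measurable B ->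
  distribution P (@y n i) B = law_y B.
Variable T : q.-tuple R -> 'M[R[i]]_p.
Hypothesis T_meas : measurableM T.
Variable CT : R.
Hypothesis CT_ge0 : 0 <= CT.
Hypothesis T_herm : forall t, (T t) ^t* = T t.
Hypothesis T_opb : forall t, opb (T t) CT.
Variable alpha : R.
Hypothesis alpha_gt0 : 0 < alpha.
Hypothesis n_over_d : (n%:R / (d n)%:R : R) @[n --> \oo] --> alpha.
Local Notation m n := (d n - r)%N.
Local Notation sample n := (fun (i : 'I_n) w => (@s n i w, @u n i w, @y n i w)).
Local Notation A n w := (fun i => T (@y n i w)).
Local Notation U n w := (fun i => tnth (@u n i w)).

Lemma dim_gt0 n : (0 < m n)%N. Proof. by rewrite subn_gt0. Qed.

Lemma measurable_sample n (i : 'I_n) : measurable_fun setT (sample n i).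
Proof.
apply: measurable_fun_pair; last exact: measurable_funP.
by apply: measurable_fun_pair; exact: measurable_funP.
Qed.

Lemma aspect_sample_cvg : aspect R (m n) n @[n --> \oo] --> alpha^-1.
Proof.
have h1 : ((n%:R / (d n)%:R)^-1 : R) @[n --> \oo] --> alpha^-1.
  by apply: cvgV => //; rewrite gt_eqF.
have h2 : r%:R * n%:R^-1 @[n --> \oo] --> (0 : R) by apply: cvg0_mull; exact: cvg_invn.
rewrite -(subr0 alpha^-1); apply: cvg_trans (cvgB h1 h2); apply: near_eq_cvg.
near=> n; rewrite !fctE /aspect natrB ?(ltnW (r_lt_d n)) // invf_div -mulrBl //.
Unshelve. all: by end_near. Qed.

Lemma inv_dim_le : exists2 c : R, 0 < c & exists k, forall n, (k <= n)%N ->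
  ((m n)%:R ^+ 2)^-1 <= c / n%:R ^+ 2 :> R.
Proof.
have a0 : 0 < alpha^-1 / 2 by rewrite divr_gt0 ?invr_gt0.
exists ((alpha^-1 / 2) ^- 2); first by rewrite invr_gt0 exprn_gt0.
have [k hk] := cvg0_eventually (cvg_sub_norm0 aspect_sample_cvg) a0.
exists (maxn k 1) => n; rewrite geq_max => /andP[kn n1].
have n0 : 0 < n%:R :> R by rewrite ltr0n.
have m0 : 0 < (m n)%:R :> R by rewrite ltr0n dim_gt0.
have := hk n kn; rewrite ler_norml => /andP[h _].
have h1 : alpha^-1 / 2 * n%:R <= (m n)%:R.
  rewrite -ler_pdivlMr // -/(aspect R (m n) n); lra.
rewrite -invfM -exprMn lef_pV2 ?posrE ?exprn_gt0 ?mulr_gt0 //.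
have h0 := ltW (mulr_gt0 a0 n0).
by apply: lerXn2r h1; rewrite nnegrE // ltW.
by rewrite invr_gt0.
Qed.

Lemma measurable_norm_dev n (i : 'I_n) :
  measurable_fun setT (fun w => (\sum_k tnth (@u n i w) k ^+ 2) / (m n)%:R - 1).
Proof.
apply: measurable_funB => //; apply: measurable_funM => //; apply: measurable_sum => k.
by apply: measurable_funX; exact: measurable_coord.
Qed.

Lemma norm_fourth_moment : exists2 K : R, 0 < K & forall n (i : 'I_n),
  (\int[P]_w (((\sum_k tnth (@u n i w) k ^+ 2) / (m n)%:R - 1) ^+ 4)%:E <= (K / (m n)%:R ^+ 2)%:E)%E.
Proof.
have [K K0 gq] := gaussian_quadratic_form P; exists K => // n i.
have m0 : 0 < (m n)%:R :> R by rewrite ltr0n dim_gt0.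
pose B (k l : 'I_(m n)) : R := (k == l)%:R.
have B1 k : \sum_l B k l ^+ 2 <= 1.
  rewrite (bigD1 k) //= big1 ?addr0 /B ?eqxx ?expr1n //.
  by move=> l /negPf lk; rewrite eq_sym lk expr0n.
have B2 l : \sum_k B k l ^+ 2 <= 1.
  rewrite (bigD1 l) //= big1 ?addr0 /B ?eqxx ?expr1n //.
  by move=> k /negPf lk; rewrite lk expr0n.
have E w : ((\sum_k tnth (@u n i w) k ^+ 2) / (m n)%:R - 1) ^+ 4 =
   (m n)%:R^-1 ^+ 4 * (quadratic_form B (@u n i w) - \sum_k B k k) ^+ 4.
  rewrite -exprMn; congr (_ ^+ 4); rewrite mulrBr [X in X - _]mulrC; congr (_ * _ - _).
    apply: eq_bigr => k _; rewrite (bigD1 k) //= big1 ?addr0 /B ?eqxx ?mul1r ?expr2 //.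
    by move=> l /negPf lk; rewrite eq_sym lk mul0r.
  rewrite (eq_bigr (fun=> 1)); last by move=> k _; rewrite /B eqxx.
  by rewrite sumr_const card_ord mulVf // gt_eqF.
under eq_integral do rewrite E EFinM.
have mq : measurable_fun setT (fun w => (quadratic_form B (@u n i w) - \sum_k B k k) ^+ 4).
  apply: measurable_funX; apply: measurable_funB => //.
  apply: measurable_sum => k; apply: measurable_sum => l; apply: measurable_funM => //.
  by apply: measurable_funM; exact: measurable_coord.
rewrite ge0_integralZl //; last 2 first.
- exact/measurable_EFinP.
- by move=> w _; rewrite lee_fin exprn_even_ge0.
apply: (@le_trans _ _ (((m n)%:R^-1 ^+ 4)%:E * (K * ((m n)%:R ^+ 2 * 1 ^+ 2))%:E)%E).
  apply: lee_wpmul2l; first by rewrite lee_fin exprn_ge0 // invr_ge0 ltW.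
  exact: (gq _ _ (u_gaussian i) B 1 B1 B2).
rewrite -EFinM lee_fin [leLHS](_ : _ = K / (m n)%:R ^+ 2) //.
by rewrite expr1n; field; rewrite gt_eqF.
Qed.

Section FixedPoint.
Variable z : R[i].
Hypothesis z_gt0 : 0 < complex.Im z.

(** All real quantities of sample i that must be small on average, in one family: [None] is the
    relative deviation of the squared length, [Some] a part of an entry of the leave-one-out
    error. *)
Definition sample_dev n (i : 'I_n) (o : option ('I_p * 'I_p * bool)) (w : Omega) : R :=
  if o is Some k then part k.2 ((loo_form (A n w) (U n w) z i -
     partial_trace (sample_res (A n w) (U n w) z (predC1 i))) k.1.1 k.1.2)
  else (\sum_k tnth (@u n i w) k ^+ 2) / (m n)%:R - 1.

Lemma sample_dev_moment : exists2 K : R, 0 < K & forall n (i : 'I_n) o,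
  measurable_fun setT (sample_dev i o) /\
  (\int[P]_w (sample_dev i o w ^+ 4)%:E <= (K / (m n)%:R ^+ 2)%:E)%E.
Proof.
have [K1 K10 h1] := norm_fourth_moment.
have [K2 K20 h2] := loo_fourth_moment P.
pose K3 := K2 * (complex.Im z)^-1 ^+ 4.
have K30 : 0 < K3 by rewrite mulr_gt0 // exprn_gt0 // invr_gt0.
exists (K1 + K3); first exact: addr_gt0.
move=> n i [[[mu nu] b]|]; last first.
  split; first exact: measurable_norm_dev.
  apply: (le_trans (h1 n i)); rewrite lee_fin ler_wpM2r ?invr_ge0 ?sqr_ge0 //.
  by rewrite lerDl ltW.
have mv : measurable_fun [set: r.-tuple R * (m n).-tuple R * q.-tuple R] (fun x => x.1.2).
  exact: measurableT_comp measurable_snd measurable_fst.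
have mA : measurableM (fun x : r.-tuple R * (m n).-tuple R * q.-tuple R => T x.2).
  move=> k l; have [a1 a2] := T_meas k l.
  by split; [exact: measurableT_comp a1 measurable_snd | exact: measurableT_comp a2 measurable_snd].
have [mq hq] := h2 _ _ n (m n) p (sample n) (fun x => x.1.2) (fun x => T x.2) z
  (@measurable_sample n) (@samples_indep n) mv (@u_gaussian n) mA (fun x => T_herm _) z_gt0 (dim_gt0 n) i b mu nu.
split; first exact: mq.
apply: (le_trans hq); rewrite lee_fin ler_wpM2r ?invr_ge0 ?sqr_ge0 //.
by rewrite lerDr ltW.
Qed.

(** Averaging the fourth powers over i keeps the bound O(n^-2) of the single moments, whatever the
    dependence between the terms; [young4] then returns to absolute values. *)
Lemma ae_cvg0_average (J : finType) (f : forall n, 'I_n -> J -> Omega -> R) (C : R) k :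
  (forall n (i : 'I_n) o, measurable_fun setT (f n i o)) ->
  (forall n (i : 'I_n) o, (k <= n)%N ->
     (\int[P]_w (f n i o w ^+ 4)%:E <= (C / n%:R ^+ 2)%:E)%E) ->
  {ae P, forall w, n%:R^-1 * \sum_(i < n) \sum_o `|f n i o w| @[n --> \oo] --> (0 : R)}.
Proof.
move=> mf fC; pose Y n w := n%:R^-1 * \sum_(i < n) \sum_o f n i o w ^+ 4.
have mY n : measurable_fun setT (Y n).
  apply: measurable_funM => //; apply: measurable_sum => i; apply: measurable_sum => o.
  exact: measurable_funX.
have Y0 n w : 0 <= Y n w.
  rewrite mulr_ge0 ?invr_ge0 //; apply: sumr_ge0 => i _; apply: sumr_ge0 => o _.
  by rewrite exprn_even_ge0.
have YC n : (maxn k 1 <= n)%N -> (\int[P]_w (Y n w)%:E <= (#|J|%:R * C / n%:R ^+ 2)%:E)%E.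
  rewrite geq_max => /andP[kn n1]; have n0 : 0 < n%:R :> R by rewrite ltr0n.
  under eq_integral do rewrite EFinM.
  have mi i o : measurable_fun setT (fun w => (f n i o w ^+ 4)%:E).
    by apply/measurable_EFinP; exact: measurable_funX.
  have p4 i o w : (0 <= (f n i o w ^+ 4)%:E)%E by rewrite lee_fin exprn_even_ge0.
  rewrite ge0_integralZl //; last 2 first.
  - apply/measurable_EFinP; apply: measurable_sum => i; apply: measurable_sum => o.
    exact: measurable_funX.
  - move=> w _; rewrite lee_fin; apply: sumr_ge0 => i _; apply: sumr_ge0 => o _.
    by rewrite exprn_even_ge0.
  have h : (\int[P]_w (\sum_(i < n) \sum_o f n i o w ^+ 4)%:E <= \sum_(i < n) \sum_(o : J) (C / n%:R ^+ 2)%:E)%E.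
    under eq_integral do rewrite -sumEFin.
    rewrite ge0_integral_sum //; last 2 first.
    + move=> i; under eq_fun do rewrite -sumEFin; exact: emeasurable_sum.
    + by move=> i w _; rewrite -sumEFin; apply: sume_ge0 => o _.
    apply: lee_sum => i _; under eq_integral do rewrite -sumEFin.
    by rewrite ge0_integral_sum //; apply: lee_sum => o _; exact: fC.
  apply: (le_trans (lee_wpmul2l _ h)); first by rewrite lee_fin invr_ge0.
  under eq_bigr do rewrite sumEFin.
  rewrite sumEFin -EFinM lee_fin !sum_cst card_ord.
  rewrite le_eqVlt; apply/orP; left; apply/eqP; field.
  by rewrite gt_eqF.
have := ae_cvg0_of_moments mY Y0 YC; apply: filterS => w hw.
apply: (@cvg0_young _ _ (Y ^~ w) #|J|%:R) hw.
  move=> n; rewrite mulr_ge0 ?invr_ge0 //; apply: sumr_ge0 => i _.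
  by apply: sumr_ge0 => o _.
move=> dl d0; near=> n.
have n0 : (0 < n)%N by near: n; exists 1%N.
have np : 0 < n%:R :> R by rewrite ltr0n.
rewrite /Y -mulrA -[X in _ <= X + _](mulKf (lt0r_neq0 np)) -mulrDr.
apply: ler_wpM2l; first by rewrite invr_ge0.
rewrite mulr_suml -[X in X * (_ * _)]mulr1n.
have -> : n%:R * (#|J|%:R * dl) = \sum_(i < n) \sum_(o : J) dl.
  by rewrite !sum_cst card_ord.
rewrite -big_split; apply: ler_sum => i _ /=; rewrite mulr_suml -big_split.
by apply: ler_sum => o _; exact: young4.
Unshelve. all: by end_near. Qed.

Lemma loo_ae_cvg : {ae P, forall w, n%:R^-1 * \sum_(i < n)
   (fnorm (loo_form (A n w) (U n w) z i - partial_trace (sample_res (A n w) (U n w) z (predC1 i))) +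
    `|(\sum_k tnth (@u n i w) k ^+ 2) / (m n)%:R - 1|) @[n --> \oo] --> (0 : R)}.
Proof.
have [K K0 h] := sample_dev_moment; have [c c0 [k hk]] := inv_dim_le.
have H n (i : 'I_n) o : (k <= n)%N ->
    (\int[P]_w (sample_dev i o w ^+ 4)%:E <= (K * c / n%:R ^+ 2)%:E)%E.
  move=> kn; apply: (le_trans (h n i o).2); rewrite lee_fin -mulrA ler_wpM2l ?(ltW K0) //.
  exact: hk.
have := ae_cvg0_average (fun n i o => (h n i o).1) H.
apply: filterS => w; apply: cvg0_le; apply: nearW => n.
rewrite mulr_ge0 ?invr_ge0 //=; last by apply: sumr_ge0 => i _; rewrite addr_ge0.
rewrite ler_wpM2l ?invr_ge0 //; apply: ler_sum => i _.
rewrite sum_option [leLHS]addrC; apply: lerD; first exact: lexx.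
exact: fnorm_le_parts.
Qed.

Variable M : 'M[R[i]]_p.
Hypothesis herg_M : herg (complex.Im z) M.
Local Notation K t := (Kf alpha^-1 M (T t)).
Local Notation mean_K := (meanM (expectation_mean law_y) (fun t => K t)).

Lemma measurable_K : measurableM (fun t => K t).
Proof. by apply: (measurableM_Kf _ z_gt0) => //; rewrite invr_gt0. Qed.

Lemma K_bound b mu nu t : `|part b (K t mu nu)| <= CK alpha^-1 CT z.
Proof.
have aV : 0 < alpha^-1 by rewrite invr_gt0.
have h := K_opb aV CT_ge0 T_herm T_opb z_gt0 t herg_M.
have := opb_entry mu nu h; apply: le_trans; rewrite /part.
by case: b; [exact: nc_Re | exact: nc_Im].
Qed.

Lemma measurable_part_K b mu nu : measurable_fun setT (fun t => part b (K t mu nu)).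
Proof. by have [h1 h2] := measurable_K mu nu; case: b. Qed.

Lemma mdomM_K : mdomM (expectation_mean law_y) (fun t => K t).
Proof.
move=> mu nu; split; apply: (@bounded_integrable _ _ _ law_y _ (CK alpha^-1 CT z)).
- exact: (measurable_part_K true).
- by move=> t; exact: (K_bound true).
- exact: (measurable_part_K false).
- by move=> t; exact: (K_bound false).
Qed.

Lemma kernel_ae_cvg : {ae P, forall w, fnorm ((n%:R^-1 : R)%:C *: \sum_(i < n) K (@y n i w) - mean_K)
  @[n --> \oo] --> (0 : R)}.
Proof.
pose e (k : 'I_p * 'I_p * bool) : R := part k.2 (mean_K k.1.1 k.1.2).
pose f n (i : 'I_n) (k : 'I_p * 'I_p * bool) w := part k.2 (K (@y n i w) k.1.1 k.1.2) - e k.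
pose g n k w := n%:R^-1 * \sum_(i < n) f n i k w.
have fE n (i : 'I_n) (k : 'I_p * 'I_p * bool) :
    (\int[P]_w (part k.2 (K (@y n i w) k.1.1 k.1.2))%:E = (e k)%:E)%E.
  have mf := measurable_part_K k.2 k.1.1 k.1.2.
  have i1 := bounded_integrable law_y mf (K_bound k.2 k.1.1 k.1.2).
  have i2 := bounded_integrable P (measurableT_comp mf (measurable_funP (@y n i)))
     (fun w => K_bound k.2 k.1.1 k.1.2 _).
  have -> : (e k)%:E = (\int[law_y]_t (part k.2 (K t k.1.1 k.1.2))%:E)%E.
    rewrite /e mxE /= /Rintegral -(fineK (integrable_fin_num measurableT i1)).
    by case: k.2.
  rewrite -[LHS]/(\int[P]_w ((fun t => (part k.2 (K t k.1.1 k.1.2))%:E) \o @y n i) w)%E.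
  rewrite -integral_distribution //; last exact/measurable_EFinP.
  by apply: eq_measure_integral => B mB _; exact: law_yE.
have aV : 0 < alpha^-1 by rewrite invr_gt0.
have mg n k : measurable_fun setT (g n k).
  apply: measurable_funM => //; apply: measurable_sum => i; apply: measurable_funB => //.
  exact: measurableT_comp (measurable_part_K k.2 k.1.1 k.1.2) (measurable_funP (@y n i)).
pose C := expR 4 * 7 * (2 * CK alpha^-1 CT z) ^+ 4.
have gC n (i : 'I_n) k : (1 <= n)%N -> (\int[P]_w (g n k w ^+ 4)%:E <= (C / n%:R ^+ 2)%:E)%E.
  move=> n1; have n0 : 0 < n%:R :> R by rewrite ltr0n.
  under eq_integral do rewrite exprMn EFinM.
  rewrite ge0_integralZl //; last 2 first.
  - apply/measurable_EFinP; apply: measurable_funX; apply: measurable_sum => j.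
    apply: measurable_funB => //.
    exact: measurableT_comp (measurable_part_K k.2 k.1.1 k.1.2) (measurable_funP (@y n j)).
  - by move=> w _; rewrite lee_fin exprn_even_ge0.
  have mf : measurable_fun [set: r.-tuple R * (m n).-tuple R * q.-tuple R]
      (fun x => part k.2 (K x.2 k.1.1 k.1.2)).
    exact: measurableT_comp (measurable_part_K k.2 k.1.1 k.1.2) measurable_snd.
  have h := bounded_fourth_moment (@measurable_sample n) (@samples_indep n) mf
    (fun x => K_bound k.2 k.1.1 k.1.2 x.2) (fun j => fE n j k).
  apply: (le_trans (lee_wpmul2l _ h)); first by rewrite lee_fin exprn_ge0 // invr_ge0 ltW.
  rewrite -EFinM lee_fin -/C le_eqVlt; apply/orP; left; apply/eqP; field.
  by rewrite gt_eqF.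
(* The variables [g n k] are already empirical means and are constant in i, so averaging over i
   leaves them unchanged. *)
have := @ae_cvg0_average _ (fun n i k => g n k) C 1 (fun n i k => mg n k) gC.
apply: filterS => w; apply: cvg0_le; near=> n.
have n0 : (0 < n)%N by near: n; exists 1%N.
have np : n%:R != 0 :> R by rewrite pnatr_eq0 -lt0n.
rewrite fnorm_ge0 /= sum_cst card_ord mulKf //.
apply: (le_trans (fnorm_le_parts _)); apply: ler_sum => k _.
rewrite [leRHS](_ : _ = `|part k.2 (((n%:R^-1 : R)%:C *: \sum_(i < n) K (@y n i w) - mean_K) k.1.1 k.1.2)|) //.
rewrite sub_mxE mxE summxE; congr (`|_|).
have pB (z1 z2 : R[i]) b : part b (z1 - z2) = part b z1 - part b z2.
  by case: b => /=; rewrite ?ReD ?ReN ?ImD ?ImN.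
have pZ (c : R) (z1 : R[i]) b : part b (c%:C * z1) = c * part b z1.
  by case: b => /=; rewrite ?ReZ ?ImZ.
rewrite pB pZ part_sum -/(e k) /g /f sumrB sum_cst card_ord mulrBr mulKf //.
Unshelve. all: by end_near. Qed.

End FixedPoint.

Lemma trace_ae_cvg (z : R[i]) : 0 < complex.Im z ->
  exists M : 'M[R[i]]_p, [/\ herg (complex.Im z) M,
    Phi (expectation_mean law_y) T alpha^-1 z M = M &
    {ae P, forall w, fnorm (partial_trace (sample_res (A n w) (U n w) z predT) - M)
      @[n --> \oo] --> (0 : R)}].
Proof.
move=> z0; have aV : 0 < alpha^-1 by rewrite invr_gt0.
have [M hM fM] := fixpoint_exists (mu := expectation_mean law_y) p_gt0 aV CT_ge0 T_herm T_opb z0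
   (fun M hM => mdomM_K z0 hM).
exists M; split => //.
have h1 := loo_ae_cvg z0; have h2 := kernel_ae_cvg z0 hM.
apply: filterS2 h1 h2 => w h1 h2.
exact: (trace_cvg_fixpoint p_gt0 aV CT_ge0 T_herm T_opb z0 (fun M hM => mdomM_K z0 hM) hM fM
  dim_gt0 aspect_sample_cvg h1 h2).
Qed.

End GaussianSamples.

(** * Analyticity and locally uniform convergence *)

Lemma cvg0_sum (R : realType) (J : finType) (f : nat -> J -> R) :
  (forall j, f n j @[n --> \oo] --> (0 : R)) -> \sum_j f n j @[n --> \oo] --> (0 : R).
Proof.
move=> h; have := @cvg_sumr R J (index_enum J) f (fun=> 0) h.
by rewrite big1.
Qed.

Lemma fnorm_dist2 (R : realType) m n (X Y Z : 'M[R[i]]_(m, n)) :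
  fnorm (X - Y) <= fnorm (X - Z) + fnorm (Y - Z).
Proof. by rewrite (fnormBC Y Z); exact: fnorm_triangle. Qed.

Section Completeness.
Variable R : realType.
Local Notation C := R[i].

Lemma cauchy_real_cvg (u : nat -> R) :
  (forall e, 0 < e -> exists k, forall n l, (k <= n)%N -> (k <= l)%N -> `|u n - u l| <= e) ->
  exists l : R, u n @[n --> \oo] --> l.
Proof.
move=> h; suff : cvg (u n @[n --> \oo]) by move=> /cvg_ex[l hl]; exists l.
apply: cauchy_cvg; apply/cauchy_ballP => e e0.
have [k hk] := h (e / 2) (divr_gt0 e0 (ltr0Sn _ 1)).
pose V := [set x | exists2 n, (k <= n)%N & x = u n].
exists (V, V); first by split; exists k => // n kn; exists n.
move=> [x y] /= [[n kn ->] [l kl ->]]; rewrite /ball /=.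
by apply: le_lt_trans (hk n l kn kl) _; lra.
Qed.

Lemma cauchy_mx_cvg m n (u : nat -> 'M[C]_(m, n)) :
  (forall e, 0 < e -> exists k, forall a b, (k <= a)%N -> (k <= b)%N -> fnorm (u a - u b) <= e) ->
  exists M : 'M[C]_(m, n), fnorm (u k - M) @[k --> \oo] --> (0 : R).
Proof.
move=> h.
have hr i j : exists l : R, complex.Re (u k i j) @[k --> \oo] --> l.
  apply: cauchy_real_cvg => e e0; have [k hk] := h e e0; exists k => a b ka kb.
  apply: le_trans (hk a b ka kb); rewrite -ReN -ReD -sub_mxE.
  exact: le_trans (nc_Re _) (fnorm_entry _ _ _).
have hi i j : exists l : R, complex.Im (u k i j) @[k --> \oo] --> l.
  apply: cauchy_real_cvg => e e0; have [k hk] := h e e0; exists k => a b ka kb.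
  apply: le_trans (hk a b ka kb); rewrite -ImN -ImD -sub_mxE.
  exact: le_trans (nc_Im _) (fnorm_entry _ _ _).
pose M : 'M[C]_(m, n) := \matrix_(i, j) (sval (cid (hr i j)) +i* sval (cid (hi i j))).
exists M; apply: fnorm_cvg0 => i j; rewrite mxE /=.
  by case: (cid (hr i j)).
by case: (cid (hi i j)).
Qed.

End Completeness.

(** * Pointwise limits of functions with uniform Taylor remainders *)

Section PowerSeries.
Variable R : realType.
Local Notation C := R[i].
Local Notation nc := (@ComplexField.Normc.normc R).
Variables (p : nat) (F : nat -> C -> 'M[C]_p) (a : nat -> nat -> 'M[C]_p).
Variables (M : C -> 'M[C]_p) (c rho r : R) (z0 : C).
Hypotheses (c_ge0 : 0 <= c) (rho_gt0 : 0 < rho) (r_gt0 : 0 < r) (r_rho : r * rho <= 1 / 2).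
Hypothesis F_taylor : forall n k h, nc h <= r ->
  fnorm (F n (z0 + h) - \sum_(j < k) h ^+ j *: a n j) <= c * (nc h * rho) ^+ k.
Hypothesis F_cvg : forall h, nc h <= r -> fnorm (F n (z0 + h) - M (z0 + h)) @[n --> \oo] --> (0 : R).

(** The Taylor formula to order k + 1 at the real increment t isolates t^k times the coefficient of
    order k. After division, values and lower coefficients carry t^-k, while the two remainders
    contribute only O(t). *)
Lemma coef_step k t n l : 0 < t -> t <= r ->
  fnorm (a n k - a l k) <= t ^- k * (fnorm (F n (z0 + t%:C) - F l (z0 + t%:C)) +
     \sum_(j < k) t ^+ j * fnorm (a n j - a l j)) + 2 * c * rho ^+ k.+1 * t.
Proof.
move=> t0 tr; have tn : nc t%:C = t by rewrite nc_real gtr0_norm.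
have tr' : nc t%:C <= r by rewrite tn.
have E : (t%:C) ^+ k *: (a n k - a l k) =
   (F n (z0 + t%:C) - F l (z0 + t%:C)) - \sum_(j < k) (t%:C) ^+ j *: (a n j - a l j) -
   ((F n (z0 + t%:C) - \sum_(j < k.+1) (t%:C) ^+ j *: a n j) -
    (F l (z0 + t%:C) - \sum_(j < k.+1) (t%:C) ^+ j *: a l j)).
  rewrite !big_ord_recr /=; under eq_bigr do rewrite scalerBr.
  rewrite sumrB scalerBr.
  move: (\sum_(i < k) _ *: a n i) (\sum_(i < k) _ *: a l i) (_ *: a n k) (_ *: a l k)
    (F n _) (F l _) => s1 s2 x y f1 f2.
  by apply/matrixP => i j; rewrite !mxE; ring.
have h1 := F_taylor n k.+1 tr'; have h2 := F_taylor l k.+1 tr'; rewrite tn in h1 h2.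
have : fnorm ((t%:C) ^+ k *: (a n k - a l k)) <=
  fnorm (F n (z0 + t%:C) - F l (z0 + t%:C)) + \sum_(j < k) t ^+ j * fnorm (a n j - a l j) +
  (c * (t * rho) ^+ k.+1 + c * (t * rho) ^+ k.+1).
  rewrite E; apply: (le_trans (fnormB _ _)); apply: lerD.
    apply: (le_trans (fnormB _ _)); rewrite lerD2l; apply: (le_trans (fnorm_sum _ _ _)).
    by apply: ler_sum => j _; rewrite fnormZ ncX tn.
  exact: (le_trans (fnormB _ _) (lerD h1 h2)).
rewrite fnormZ ncX tn mulrC -ler_pdivlMr ?exprn_gt0 // => /le_trans; apply.
rewrite le_eqVlt; apply/orP; left; apply/eqP.
have tk : t ^+ k != 0 by rewrite expf_neq0 // gt_eqF.
by rewrite exprMn !exprS; field; rewrite ?expf_neq0 // gt_eqF.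
Qed.

(** Strong induction on k. The increment t is fixed first, to make the remainder small; t^-k is then
    a constant, and the values at z0 + t and the lower coefficients converge. *)
Lemma coef_cvg k : exists b : 'M[C]_p, fnorm (a n k - b) @[n --> \oo] --> (0 : R).
Proof.
elim/ltn_ind: k => k IH; apply: cauchy_mx_cvg => e e0.
pose D := 2 * c * rho ^+ k.+1 + 1.
have D0 : 0 < D by rewrite ltr_wpDl // !mulr_ge0 // exprn_ge0 // ltW.
pose t := Num.min r (e / 2 / D).
have t0 : 0 < t by rewrite lt_min r_gt0 !divr_gt0.
have tr : t <= r by rewrite ge_min lexx.
have te : 2 * c * rho ^+ k.+1 * t <= e / 2.
  apply: (@le_trans _ _ (D * t)); first by rewrite ler_wpM2r ?(ltW t0) // lerDl.
  by rewrite mulrC -ler_pdivlMr // ge_min lexx orbT.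
have tn : nc t%:C <= r by rewrite nc_real gtr0_norm.
have b (j : 'I_k) : exists b : 'M[C]_p, fnorm (a n j - b) @[n --> \oo] --> (0 : R) by exact: IH.
pose bb j := sval (cid (b j)).
have hb j : fnorm (a n (j : 'I_k) - bb j) @[n --> \oo] --> (0 : R) by exact: svalP (cid (b j)).
pose v n := t ^- k * (fnorm (F n (z0 + t%:C) - M (z0 + t%:C)) + \sum_(j < k) t ^+ j * fnorm (a n j - bb j)).
have v0 : v n @[n --> \oo] --> (0 : R).
  apply: cvg0_mull; apply: cvg0_add; first exact: F_cvg.
  by apply: cvg0_sum => j; exact: cvg0_mull.
have e4 : 0 < e / 4 by rewrite divr_gt0.
have [K hK] := cvg0_eventually v0 e4; exists K => n l Kn Kl.
apply: (le_trans (coef_step k n l t0 tr)).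
have : t ^- k * (fnorm (F n (z0 + t%:C) - F l (z0 + t%:C)) +
   \sum_(j < k) t ^+ j * fnorm (a n j - a l j)) <= v n + v l.
  rewrite /v -mulrDr ler_wpM2l ?invr_ge0 ?exprn_ge0 ?(ltW t0) //.
  rewrite addrACA; apply: lerD.
    exact: fnorm_dist2.
  rewrite -big_split; apply: ler_sum => j _ /=; rewrite -mulrDr ler_wpM2l ?exprn_ge0 ?(ltW t0) //.
  exact: fnorm_dist2.
have := hK n Kn; have := hK l Kl; lra.
Qed.

(** On the disc the tails beyond degree k are at most c 2^-k for all n at once, and finitely many
    coefficients converge. This upgrades pointwise to uniform convergence and transfers the
    expansion to the limit. *)
Lemma power_series_limit : exists b : nat -> 'M[C]_p,
  [/\ forall k, fnorm (a n k - b k) @[n --> \oo] --> (0 : R),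
      forall k h, nc h <= r -> fnorm (M (z0 + h) - \sum_(j < k) h ^+ j *: b j) <= c * (nc h * rho) ^+ k &
      forall e, 0 < e -> exists k, forall n h, (k <= n)%N -> nc h <= r ->
        fnorm (F n (z0 + h) - M (z0 + h)) <= e].
Proof.
pose b k := sval (cid (coef_cvg k)).
have hb k : fnorm (a n k - b k) @[n --> \oo] --> (0 : R) by exact: svalP (cid (coef_cvg k)).
have lim k h : nc h <= r -> fnorm (M (z0 + h) - \sum_(j < k) h ^+ j *: b j) <= c * (nc h * rho) ^+ k.
  move=> hr; apply/ler_addgt0Pr => e e0.
  have s0 : (fnorm (F n (z0 + h) - M (z0 + h)) + \sum_(j < k) nc h ^+ j * fnorm (a n j - b j))
      @[n --> \oo] --> (0 : R).
    apply: cvg0_add; first exact: F_cvg.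
    by apply: cvg0_sum => j; exact: cvg0_mull.
  have [K hK] := cvg0_eventually s0 e0; have := hK K (leqnn K) => hs.
  apply: (le_trans (fnorm_triangle _ (F K (z0 + h)) _)).
  have h1 := fnorm_triangle (F K (z0 + h)) (\sum_(j < k) h ^+ j *: a K j) (\sum_(j < k) h ^+ j *: b j).
  have h2 : fnorm (\sum_(j < k) h ^+ j *: a K j - \sum_(j < k) h ^+ j *: b j) <=
     \sum_(j < k) nc h ^+ j * fnorm (a K j - b j).
    rewrite -sumrB; apply: (le_trans (fnorm_sum _ _ _)); apply: ler_sum => j _.
    by rewrite -scalerBr fnormZ ncX.
  have h3 := F_taylor K k hr.
  rewrite [X in X + _]fnormBC; move: hs h1 h2 h3; lra.
exists b; split=> // e e0.
have e4 : 0 < e / 4 by rewrite divr_gt0.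
have c1 : 0 < c + 1 by rewrite ltr_wpDl.
have half0 : (1 / 2 : R) ^+ k @[k --> \oo] --> (0 : R).
  by apply: cvg_expr; rewrite ger0_norm //; lra.
have ch0 : c * (1 / 2 : R) ^+ k @[k --> \oo] --> (0 : R) by exact: cvg0_mull.
have [k hk] := cvg0_eventually ch0 e4.
have v0 : \sum_(j < k) r ^+ j * fnorm (a n j - b j) @[n --> \oo] --> (0 : R).
  by apply: cvg0_sum => j; exact: cvg0_mull.
have [K hK] := cvg0_eventually v0 e4; exists K => n h Kn hr.
have tail : c * (nc h * rho) ^+ k <= e / 4.
  apply: le_trans (hk k (leqnn k)); rewrite ler_wpM2l //.
  apply: lerXn2r; rewrite ?nnegrE ?mulr_ge0 ?nc_ge0 ?(ltW rho_gt0) //.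
  by apply: le_trans r_rho; rewrite ler_wpM2r // ltW.
have h1 := fnorm_triangle (F n (z0 + h)) (\sum_(j < k) h ^+ j *: a n j) (M (z0 + h)).
have h2 := fnorm_triangle (\sum_(j < k) h ^+ j *: a n j) (\sum_(j < k) h ^+ j *: b j) (M (z0 + h)).
have h3 : fnorm (\sum_(j < k) h ^+ j *: a n j - \sum_(j < k) h ^+ j *: b j) <= e / 4.
  apply: le_trans (hK n Kn).
  rewrite -sumrB; apply: (le_trans (fnorm_sum _ _ _)); apply: ler_sum => j _.
  rewrite -scalerBr fnormZ ncX ler_wpM2r // lerXn2r ?nnegrE ?nc_ge0 ?(ltW r_gt0) //.
have h4 := F_taylor n k hr; have h5 := lim k h hr.
rewrite fnormBC in h5.
by move: h1 h2 h3 h4 h5 tail; lra.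
Qed.

End PowerSeries.

Section TraceTaylor.
Variable R : realType.
Local Notation C := R[i].
Local Notation nc := (@ComplexField.Normc.normc R).
Variables (p m : nat) (H : 'M[C]_(p * m)).
Hypothesis m_gt0 : (0 < m)%N.
Hypothesis H_herm : H ^t* = H.

Lemma fnorm_partial_trace (X : 'M[C]_(p * m)) (c : R) : opb X c ->
  fnorm (partial_trace X) <= (p * p)%:R * c.
Proof.
move=> hX; have mp : 0 < m%:R :> R by rewrite ltr0n.
apply: opb_fnorm => v; rewrite partial_traceE -scalemxAl fnormZ nc_real ger0_norm ?invr_ge0 ?(ltW mp) //.
rewrite mulrC ler_pdivrMr // mulmx_suml; apply: (le_trans (fnorm_sum _ _ _)).
apply: (@le_trans _ _ (\sum_(k < m) c * fnorm v)); last first.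
  by rewrite sumr_const card_ord mulr_natr.
apply: ler_sum => k _; rewrite -!mulmxA -[leLHS]mul1r.
have h := hX (blk R p k *m v); rewrite fnorm_blk_mul in h.
apply: le_trans h; rewrite mul1r -[leRHS]mul1r; apply: ler_fnorm => //.
rewrite expr1n mul1r [leRHS]fnorm2_blk (bigD1 k) //= lerDl sumr_ge0 // => l _.
exact: sqr_ge0.
Qed.

Fixpoint res_pow (G : 'M[C]_(p * m)) k : 'M[C]_(p * m) := if k is k'.+1 then G *m res_pow G k' else 1%:M.

Lemma opb_res_pow G k (c : R) : 0 <= c -> opb G c -> opb (res_pow G k) (c ^+ k).
Proof.
move=> c0 hG; elim: k => [|k IH]; first by move=> v; rewrite expr0 mul1r mul1mx.
by rewrite exprS; exact: opb_comp.
Qed.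

Lemma res_pow_comm G k : G *m res_pow G k = res_pow G k *m G.
Proof. by elim: k => [|k IH] /=; rewrite ?mulmx1 ?mul1mx // {1}IH mulmxA. Qed.

Local Notation G z := (invmx (H - z%:M)).

Lemma resolvent_identity z0 z : 0 < complex.Im z0 -> 0 < complex.Im z ->
  G z = G z0 + (z - z0) *: (G z0 *m G z).
Proof.
move=> h0 h; have [u0 _] := hermitian_resolvent H_herm h0; have [u _] := hermitian_resolvent H_herm h.
have e : G z0 - G z = - ((z - z0) *: (G z0 *m G z)).
  rewrite (invmx_sub u0 u) (_ : H - z%:M - (H - z0%:M) = (z0 - z)%:M); last first.
    by rewrite opprB addrC addrA subrK raddfB.
  by rewrite mul_mx_scalar -scalemxAl -scaleNr opprB.
by rewrite -[LHS](subKr (G z0)) e opprK.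
Qed.

Lemma resolvent_taylor z0 h k : 0 < complex.Im z0 -> 0 < complex.Im (z0 + h) ->
  G (z0 + h) = \sum_(j < k) h ^+ j *: res_pow (G z0) j.+1 + h ^+ k *: (res_pow (G z0) k *m G (z0 + h)).
Proof.
move=> h0 h1; elim: k => [|k IH]; first by rewrite big_ord0 add0r expr0 scale1r mul1mx.
rewrite {1}IH big_ord_recr /= -addrA; congr (_ + _).
rewrite {1}(resolvent_identity h0 h1) addrAC subrr add0r mulmxDr scalerDr -res_pow_comm; congr (_ + _).
by rewrite -scalemxAr scalerA -exprSr mulmxA -res_pow_comm.
Qed.

(** The disc of radius Im z0 / 2 stays at height at least Im z0 / 2, where the resolvent in the
    remainder is bounded by 2 / Im z0. The constants depend neither on m nor on H. *)
Lemma trace_taylor z0 k h : 0 < complex.Im z0 -> nc h <= complex.Im z0 / 2 ->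
  fnorm (partial_trace (G (z0 + h)) - \sum_(j < k) h ^+ j *: partial_trace (res_pow (G z0) j.+1)) <=
  2 * (p * p)%:R / complex.Im z0 * (nc h * (complex.Im z0)^-1) ^+ k.
Proof.
move=> h0 hr; set eta := complex.Im z0 in h0 hr *.
have h1 : eta / 2 <= complex.Im (z0 + h).
  have := le_trans (nc_Im h) hr; rewrite ImD -/eta ler_norml => /andP[]; lra.
have e2 : 0 < eta / 2 by rewrite divr_gt0.
have i0 : 0 < complex.Im (z0 + h) by exact: lt_le_trans h1.
rewrite (resolvent_taylor k h0 i0) partial_traceD partial_trace_sum.
under [X in X + _ - _]eq_bigr do rewrite partial_traceZ.
rewrite addrAC subrr add0r partial_traceZ fnormZ ncX.
have [_ g0] := hermitian_resolvent H_herm h0; have [_ g1] := hermitian_resolvent H_herm i0.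
have eV : 0 <= eta^-1 by rewrite invr_ge0 ltW.
have o := opb_comp (exprn_ge0 k eV) (opb_res_pow k eV (herg_opb h0 g0)) (herg_opb i0 g1).
have := fnorm_partial_trace o => h2.
apply: (le_trans (ler_wpM2l (exprn_ge0 k (nc_ge0 h)) h2)).
rewrite exprMn; have iV : (complex.Im (z0 + h))^-1 <= 2 / eta.
  by rewrite -[2]invrK -invfM lef_pV2 ?posrE ?mulr_gt0 ?invr_gt0 // mulrC.
rewrite [leLHS](_ : _ = (nc h ^+ k * eta^-1 ^+ k * (p * p)%:R) * (complex.Im (z0 + h))^-1); last by ring.
rewrite [leRHS](_ : _ = (nc h ^+ k * eta^-1 ^+ k * (p * p)%:R) * (2 / eta)); last by ring.
by rewrite ler_wpM2l // !mulr_ge0 ?exprn_ge0 ?nc_ge0.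
Qed.

End TraceTaylor.

Lemma fnorm_chain (R : realType) m n (X Y Z W : 'M[R[i]]_(m, n)) :
  fnorm (X - W) <= fnorm (Y - X) + fnorm (Y - Z) + fnorm (Z - W).
Proof.
apply: (le_trans (fnorm_triangle X Y W)); rewrite -addrA (fnormBC X).
by apply: lerD => //; exact: fnorm_triangle.
Qed.

Section ComplexTopology.
Variable R : realType.
Local Notation C := R[i].
Local Notation nc := (@ComplexField.Normc.normc R).

Lemma posC (e : C) : 0 < e -> 0 < complex.Re e /\ e = (complex.Re e)%:C.
Proof.
by case: e => a b; rewrite ltcE /= => /andP[/eqP -> a0].
Qed.

Lemma normC_lt (z : C) (e : R) : (`|z| < e%:C) = (nc z < e).
Proof. by rewrite nc_norm ltcR. Qed.

Lemma mx_ball_fnorm m n (A B : 'M[C]_(m, n)) (e : R) : fnorm (A - B) < e ->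
  @ball _ [the pseudoMetricType C of 'M[C^o]_(m, n)] A e%:C B.
Proof.
move=> h; split; first by rewrite ltcR (le_lt_trans (fnorm_ge0 _) h).
move=> i j; rewrite /ball /= normC_lt -sub_mxE.
exact: le_lt_trans (fnorm_entry _ _ _) h.
Qed.

Lemma fnorm_cvg_mx (T : Type) (F : set_system T) (FF : Filter F) m n (u : T -> 'M[C]_(m, n)) (M : 'M[C]_(m, n)) :
  fnorm (u k - M) @[k --> F] --> (0 : R) ->
  (u : T -> 'M[C^o]_(m, n)) @ F --> (M : 'M[C^o]_(m, n)).
Proof.
move=> h; apply/cvg_ballP => e /posC[e0 ->].
move/cvgrPdist_lt: h => /(_ _ e0); apply: filterS => k.
rewrite sub0r normrN ger0_norm // fnormBC; exact: mx_ball_fnorm.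
Qed.

Lemma nbhs_disc (z0 : C) (e : R) : 0 < e -> nbhs (z0 : C^o) [set z | nc (z - z0) < e].
Proof.
move=> e0; apply/nbhs_ballP; exists e%:C => /=; first by rewrite ltcR.
by move=> z; rewrite /ball /= normC_lt -ncN opprB.
Qed.

Lemma near0_pow (c x : R) : 0 <= x <= 1 / 2 -> c * x ^+ n @[n --> \oo] --> (0 : R).
Proof.
move=> /andP[x0 x1]; apply: cvg0_mull; apply: cvg_expr.
by rewrite ger0_norm //; lra.
Qed.

Lemma analytic_of_taylor p (M : C -> 'M[C]_p) :
  (forall z0, 0 < complex.Im z0 -> exists b : nat -> 'M[C]_p, exists c r : R, [/\ 0 < r &
     forall k h, nc h <= r -> fnorm (M (z0 + h) - \sum_(j < k) h ^+ j *: b j) <= c * (nc h / r / 2) ^+ k]) ->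
  analytic_on (@Cplus R) M.
Proof.
move=> H z0 hz0; have [b [c [r [r0 h]]]] := H z0 hz0; exists b.
apply: filterS (nbhs_disc z0 r0) => z /= zr.
apply: fnorm_cvg_mx.
apply: (@cvg0_le _ _ (fun k => c * (nc (z - z0) / r / 2) ^+ k)).
  apply: nearW => k; rewrite fnorm_ge0 /= fnormBC /series /= big_mkord.
  by have := h k (z - z0) (ltW zr); rewrite [z0 + _]addrC subrK.
apply: near0_pow; rewrite !divr_ge0 ?nc_ge0 ?(ltW r0) //=.
by rewrite ler_pM2r ?invr_gt0 // ler_pdivrMr // mul1r ltW.
Qed.

Lemma locally_uniform_of_fnorm p (F : nat -> C -> 'M[C]_p) (M : C -> 'M[C]_p) :
  (forall z0, 0 < complex.Im z0 -> exists2 r : R, 0 < r & forall e, 0 < e -> exists k, forall n h,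
     (k <= n)%N -> nc h <= r -> fnorm (F n (z0 + h) - M (z0 + h)) <= e) ->
  locally_uniform_cvg (@Cplus R) F M.
Proof.
move=> H z0 hz0; have [r r0 h] := H z0 hz0.
exists [set z | nc (z - z0) < r]; first exact: nbhs_disc.
move=> Q /uniform_nbhs[E [entE EQ]].
have [e e0 he] : exists2 e : C, 0 < e & forall A B, @ball _ [the pseudoMetricType C of 'M[C^o]_p] A e B -> E (A, B).
  move: entE; rewrite -entourage_ballE => -[e /= e0 he]; exists e => // A B AB.
  exact: (he (A, B)).
have [e0' eE] := posC e0.
have e2 : 0 < complex.Re e / 2 by rewrite divr_gt0.
have [k hk] := h _ e2.
exists k => // n /= kn; apply: EQ => z [/= zr _]; apply: he; rewrite eE; apply: mx_ball_fnorm.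
have := hk n (z - z0) kn (ltW zr); rewrite [z0 + _]addrC subrK fnormBC => h1.
by apply: le_lt_trans h1 _; lra.
Qed.

End ComplexTopology.

(** * One null set for all spectral parameters *)

Section AlmostSureLimit.
Context d (Omega : measurableType d) (R : realType) (P : probability Omega R).
Local Notation C := R[i].
Local Notation nc := (@ComplexField.Normc.normc R).
Variables (p : nat) (m : nat -> nat) (H : forall n, Omega -> 'M[C]_(p * m n)).
Hypothesis m_gt0 : forall n, (0 < m n)%N.
Hypothesis H_herm : forall n w, (H n w) ^t* = H n w.
Local Notation F n w z := (partial_trace (invmx (H n w - z%:M))).
Variable M : C -> 'M[C]_p.
Hypothesis M_cvg : forall z, 0 < complex.Im z ->
  {ae P, forall w, fnorm (F n w z - M z) @[n --> \oo] --> (0 : R)}.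

(** Deterministic facts about the limit M are proved along a single sample point of an almost sure
    event. *)
Lemma ae_exists (Q : Omega -> Prop) : {ae P, forall w, Q w} -> exists w, Q w.
Proof.
move=> [N [mN N0 QN]]; apply: contrapT => noQ.
have : N = setT.
  by apply/seteqP; split => // w _; apply: QN => /= Qw; apply: noQ; exists w.
move=> NT; move: N0; rewrite NT probability_setT => /eqP.
by rewrite onee_eq0.
Qed.

Lemma trace_lipschitz n w z z' : 0 < complex.Im z -> 0 < complex.Im z' ->
  fnorm (F n w z - F n w z') <= (p * p)%:R * (nc (z - z') / complex.Im z' / complex.Im z).
Proof.
move=> h h'; rewrite (resolvent_identity (H_herm n w) h' h) partial_traceD addrAC subrr add0r.
rewrite partial_traceZ fnormZ.
have [_ g0] := hermitian_resolvent (H_herm n w) h; have [_ g1] := hermitian_resolvent (H_herm n w) h'.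
have eV : 0 <= (complex.Im z')^-1 by rewrite invr_ge0 ltW.
have o := opb_comp eV (herg_opb h' g1) (herg_opb h g0).
apply: (le_trans (ler_wpM2l (nc_ge0 _) (fnorm_partial_trace (m_gt0 n) o))).
by rewrite le_eqVlt; apply/orP; left; apply/eqP; ring.
Qed.

Lemma limit_lipschitz z z' : 0 < complex.Im z -> 0 < complex.Im z' ->
  fnorm (M z - M z') <= (p * p)%:R * (nc (z - z') / complex.Im z' / complex.Im z).
Proof.
move=> h h'; have hw : {ae P, forall w, fnorm (F n w z - M z) @[n --> \oo] --> (0 : R) /\
    fnorm (F n w z' - M z') @[n --> \oo] --> (0 : R)} by apply: filterS2 (M_cvg h) (M_cvg h') => w.
have [w [c1 c2]] := ae_exists hw.
apply/ler_addgt0Pr => e e0; have := cvg0_add c1 c2 => c3.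
have [k hk] := cvg0_eventually c3 e0; have := hk k (leqnn k) => h1.
have := trace_lipschitz k w h h' => h2.
apply: (le_trans (fnorm_chain (M z) (F k w z) (F k w z') (M z'))).
by rewrite addrAC addrC; exact: lerD.
Qed.

(** Convergence is known for each z outside a null set depending on z. Countably many rational
    points leave one null set, and a Lipschitz bound shared by all n and by M reaches every z. *)
Lemma trace_cvg_all : {ae P, forall w, forall z, 0 < complex.Im z ->
  fnorm (F n w z - M z) @[n --> \oo] --> (0 : R)}.
Proof.
pose qz (x : rat * rat) : C := ratr x.1 +i* ratr x.2.
have ae1 : {ae P, forall w, forall k : nat, if unpickle k is Some x then
    (0 < complex.Im (qz x) -> fnorm (F n w (qz x) - M (qz x)) @[n --> \oo] --> (0 : R)) else True}.
  apply: ae_foralln => k; case: (unpickle k) => [x|]; last exact: aeW.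
  have [x0|x0] := ltP 0 (complex.Im (qz x)); last by apply: aeW.
  by apply: filterS (M_cvg x0) => w.
apply: filterS ae1 => w hw z z0.
pose L : R := (p * p)%:R / (complex.Im z) / (complex.Im z).
have L0 : 0 <= L by rewrite /L !divr_ge0 ?(ltW z0).
apply/cvgrPdist_le => e e0.
have L1 : 0 < 8 * (L + 1) by rewrite mulr_gt0 // ltr_wpDl.
pose dl := e / (8 * (L + 1)).
have dl0 : 0 < dl by rewrite divr_gt0.
have [a] : exists a : rat, ratr a \in `]complex.Re z, complex.Re z + dl[ by apply: rat_in_itvoo; rewrite ltrDl.
rewrite in_itv /= => /andP[a1 a2].
(* The rational point is taken higher than z, so that Im z bounds both heights from below in the
   Lipschitz constant. *)
have [b] : exists b : rat, ratr b \in `]complex.Im z, complex.Im z + dl[ by apply: rat_in_itvoo; rewrite ltrDl.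
rewrite in_itv /= => /andP[b1 b2].
have b0 : 0 < complex.Im (qz (a, b)) by exact: lt_trans b1.
have := hw (pickle (a, b)); rewrite pickleK => /(_ b0) hc.
have e2 : 0 < e / 2 by rewrite divr_gt0.
have [k hk] := cvg0_eventually hc e2.
have dz : nc (z - qz (a, b)) <= 2 * dl.
  apply: (le_trans (nc_le _)); rewrite ReD ReN ImD ImN /= !ler0_norm ?subr_le0 ?ltW //.
  by move: a2 b2; lra.
have Ld : (p * p)%:R * (nc (z - qz (a, b)) / complex.Im (qz (a, b)) / complex.Im z) <= e / 4.
  have b0' : complex.Im z <= complex.Im (qz (a, b)) by exact: ltW.
  have h1 : nc (z - qz (a, b)) / complex.Im (qz (a, b)) <= 2 * dl / complex.Im z.
    by apply: ler_pM; rewrite ?nc_ge0 ?invr_ge0 ?(ltW b0) // lef_pV2.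
  apply: (@le_trans _ _ ((p * p)%:R * (2 * dl / complex.Im z / complex.Im z))).
    by rewrite ler_wpM2l // ler_wpM2r // invr_ge0 ltW.
  rewrite (_ : _ * _ = L * dl * 2); last by rewrite /L; ring.
  have hd : 8 * (L + 1) * dl = e by rewrite /dl mulrC mulfVK // gt_eqF.
  have key (l x y : R) : 8 * (l + 1) * x = y -> 0 < x -> l * x * 2 <= y / 4 by move=> ? ?; lra.
  exact: key hd dl0.
near=> n; rewrite sub0r normrN ger0_norm //.
have kn : (k <= n)%N by near: n; exists k.
have h1 := trace_lipschitz n w z0 b0; have h2 := limit_lipschitz z0 b0; have h3 := hk n kn.
apply: (le_trans (fnorm_chain (F n w z) (F n w (qz (a, b))) (M (qz (a, b))) (M z))).
rewrite [X in X + _ + _]fnormBC [X in _ + X]fnormBC.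
have := lerD (lerD (le_trans h1 Ld) h3) (le_trans h2 Ld).
by move/le_trans; apply; lra.
Unshelve. all: by end_near. Qed.

Lemma trace_power_series w z0 :
  (forall z, 0 < complex.Im z -> fnorm (F n w z - M z) @[n --> \oo] --> (0 : R)) ->
  0 < complex.Im z0 -> exists b : nat -> 'M[C]_p,
  (forall k h, nc h <= complex.Im z0 / 2 -> fnorm (M (z0 + h) - \sum_(j < k) h ^+ j *: b j) <=
     2 * (p * p)%:R / complex.Im z0 * (nc h * (complex.Im z0)^-1) ^+ k) /\
  (forall e, 0 < e -> exists k, forall n h, (k <= n)%N -> nc h <= complex.Im z0 / 2 ->
        fnorm (F n w (z0 + h) - M (z0 + h)) <= e).
Proof.
move=> hw h0.
have eV : 0 < (complex.Im z0)^-1 by rewrite invr_gt0.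
have c0 : 0 <= 2 * (p * p)%:R / complex.Im z0 by rewrite divr_ge0 ?mulr_ge0 // ltW.
have r0 : 0 < complex.Im z0 / 2 by rewrite divr_gt0.
have rr : complex.Im z0 / 2 * (complex.Im z0)^-1 <= 1 / 2.
  by rewrite mulrAC mulfV ?gt_eqF.
have Fc h : nc h <= complex.Im z0 / 2 -> fnorm (F n w (z0 + h) - M (z0 + h)) @[n --> \oo] --> (0 : R).
  move=> hr; apply: hw; rewrite ImD.
  by have := le_trans (nc_Im h) hr; rewrite ler_norml => /andP[]; lra.
have [b [_ h1 h2]] := power_series_limit (F := fun n z => F n w z)
  (a := fun n j => partial_trace (res_pow (invmx (H n w - z0%:M)) j.+1)) c0 eV r0 rr
  (fun n k h hr => trace_taylor (m_gt0 n) (H_herm n w) k h0 hr) Fc.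
by exists b.
Qed.

Lemma trace_limit_analytic : analytic_on (@Cplus R) M.
Proof.
have [w hw] := ae_exists trace_cvg_all.
apply: analytic_of_taylor => z0 h0; have [b [h _]] := trace_power_series hw h0.
exists b, (2 * (p * p)%:R / complex.Im z0), (complex.Im z0 / 2); split; first by rewrite divr_gt0.
move=> k x hx; apply: (le_trans (h k x hx)).
by rewrite (_ : nc x / (complex.Im z0 / 2) / 2 = nc x * (complex.Im z0)^-1) //; field; rewrite gt_eqF.
Qed.

Lemma trace_cvg_locally_uniform :
  {ae P, forall w, locally_uniform_cvg (@Cplus R) (fun n z => F n w z) M}.
Proof.
apply: filterS trace_cvg_all => w hw; apply: locally_uniform_of_fnorm => z0 h0.
have r0 : 0 < complex.Im z0 / 2 by rewrite divr_gt0.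
exists (complex.Im z0 / 2) => // e e0.
have [b [_ h]] := trace_power_series hw h0; exact: h.
Qed.

End AlmostSureLimit.

(** * The self-consistent equation *)

Section OperatorNorms.
Variable R : realType.
Local Notation C := R[i].
Local Notation nc := (@ComplexField.Normc.normc R).

Lemma norm2C m (v : 'cV[C]_m) : norm2 nc v = fnorm v.
Proof. by rewrite /norm2 -fnorm_cV sqrtr_sqr ger0_norm. Qed.

Lemma norm2R m (v : 'cV[R]_m) : norm2 (fun x : R => `|x|) v = fnorm (toC v).
Proof.
rewrite -norm2C /norm2; congr (Num.sqrt _); apply: eq_bigr => i _.
by rewrite mxE nc_real.
Qed.

Lemma toC_mul m n l (A : 'M[R]_(m, n)) (B : 'M[R]_(n, l)) : toC (A *m B) = toC A *m toC B.
Proof. exact: map_mxM. Qed.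

Lemma opnormC_bounds m n (A : 'M[C]_(m, n)) : 0 <= opnormC A <= fnorm A.
Proof.
have ub v : norm2 nc v <= 1 -> norm2 nc (A *m v) <= fnorm A.
  by rewrite !norm2C => h; apply: (le_trans (fnormM _ _)); rewrite ler_piMr.
have v0 : norm2 nc (0 : 'cV[C]_n) <= 1 by rewrite norm2C fnorm0.
apply/andP; split; last first.
  apply: ge_sup; first by exists (norm2 nc (A *m 0)), 0.
  by move=> _ [v hv <-]; exact: ub.
apply: (@le_trans _ _ (norm2 nc (A *m 0))); first by rewrite norm2C.
apply: sup_upper_bound; last by exists 0.
split; first by exists (norm2 nc (A *m 0)), 0.
by exists (fnorm A) => _ [v hv <-]; exact: ub.
Qed.

Lemma opnormR_entry m n (A : 'M[R]_(m, n)) i j : `|A i j| <= opnormR A.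
Proof.
have n1 : norm2 (fun x : R => `|x|) (delta_mx j 0 : 'cV[R]_n) = 1.
  by rewrite norm2R /toC map_delta_mx fnorm_delta.
have ub (v : 'cV[R]_n) : norm2 (fun x : R => `|x|) v <= 1 ->
    norm2 (fun x : R => `|x|) (A *m v) <= fnorm (toC A).
  rewrite !norm2R toC_mul => h; apply: (le_trans (fnormM _ _)); by rewrite ler_piMr.
apply: (@le_trans _ _ (norm2 (fun x : R => `|x|) (A *m delta_mx j 0))).
  rewrite norm2R -colE -nc_real.
  have -> : (A i j)%:C = toC (col j A) i 0 by rewrite !mxE.
  exact: fnorm_entry.
apply: sup_upper_bound; last by exists (delta_mx j 0); rewrite //= n1.
split; first by exists (norm2 (fun x : R => `|x|) (A *m delta_mx j 0)), (delta_mx j 0); rewrite //= n1.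
by exists (fnorm (toC A)) => _ [v hv <-]; exact: ub.
Qed.

Lemma toC_herm n (A : 'M[R]_n) : A^T = A -> (toC A) ^t* = toC A.
Proof. by move=> h; apply/matrixP => i j; rewrite -{2}h !mxE conj_real. Qed.

Lemma mul_ctr_cdot n (a b : 'cV[C]_n) : (a ^t* *m b) 0 0 = cdot a b.
Proof. by rewrite cdotE mxE; apply: eq_bigr => i _; rewrite !mxE. Qed.

Lemma psdmx_imq p (M : 'M[C]_p) : psdmx (Immx M) <-> forall a, 0 <= imq M a.
Proof.
have E (a : 'cV[C]_p) : (a ^t* *m Immx M *m a) 0 0 = (imq M a)%:C.
  rewrite /Immx -scalemxAr -scalemxAl mxE mulmxBr mulmxBl sub_mxE -!mulmxA !mul_ctr_cdot.
  rewrite [cdot a (M ^t* *m a)]cdot_adj trmxCK [cdot (M *m a) a]cdotC.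
  rewrite /imq; case: (cdot a (M *m a)) => x y.
  apply: complex_eq.
    rewrite /= !(mul0r, mulr0, subr0, addr0, add0r, oppr0, expr0n, addrN, sub0r) /=.
    by rewrite expr2; field.
  rewrite /= !(mul0r, mulr0, subr0, addr0, add0r, oppr0, expr0n, addrN, sub0r) /=.
  by field.
split=> [[_ h] a|h]; first by have := h a; rewrite E lecR.
split; last by move=> a; rewrite E lecR.
rewrite is_hermitianmxE expr0 scale1r; apply/eqP.
rewrite /Immx ctrZ ctrD ctrN trmxCK -opprB scalerN -scaleNr; congr (_ *: _).
apply: complex_eq; rewrite /= !(mul0r, mulr0, subr0, addr0, add0r, oppr0, expr0n) //=.
Qed.

End OperatorNorms.

Section AlmostEverywhere.
Context d (X : measurableType d) (R : realType) (P : probability X R).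

Lemma ae_eq_Rintegral (f g : X -> R) : measurable_fun setT f -> measurable_fun setT g ->
  {ae P, forall x, f x = g x} -> P.-integrable setT (EFin \o g) ->
  P.-integrable setT (EFin \o f) /\ \int[P]_x f x = \int[P]_x g x.
Proof.
move=> mf mg fg ig.
have mfE : measurable_fun setT (EFin \o f) by exact/measurable_EFinP.
have mgE : measurable_fun setT (EFin \o g) by exact/measurable_EFinP.
split.
  apply/integrableP; split=> //.
  have [_ gi] := integrableP _ _ _ ig.
  rewrite (ae_eq_integral (fun x => `|(EFin \o g) x|%E)) //; first exact: measurableT_comp.
    exact: measurableT_comp.
  by apply: filterS fg => x fgx _; rewrite /= fgx.
rewrite /Rintegral (ae_eq_integral (EFin \o g)) //.
by apply: filterS fg => x fgx _; rewrite /= fgx.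
Qed.

Lemma Rintegral_ae_le0 (f : X -> R) : P.-integrable setT (EFin \o f) ->
  {ae P, forall x, f x <= 0} -> \int[P]_x f x <= 0.
Proof.
move=> fi f0; have mf : measurable_fun setT f by apply/measurable_EFinP; exact: (measurable_int P).
pose g x := Num.min (f x) 0.
have mg : measurable_fun setT g by apply: measurable_minr.
have ig : P.-integrable setT (EFin \o g).
  apply: (le_integrable measurableT _ _ fi); first exact/measurable_EFinP.
  move=> x _ /=; rewrite lee_fin /g; case: (leP (f x) 0) => // _.
  by rewrite normr0.
have [_ ->] : P.-integrable setT (EFin \o f) /\ \int[P]_x f x = \int[P]_x g x.
  apply: ae_eq_Rintegral => //.
  by apply: filterS f0 => x fx; rewrite /g; apply/esym/min_idPl.
rewrite -[leRHS](exp_cst P 0); apply: le_Rintegral => //.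
  exact: exp_cst_dom.
by move=> x _; rewrite /g ge_min lexx orbT.
Qed.

End AlmostEverywhere.

Lemma meanM_expectation d (X : measurableType d) (R : realType) (P : probability X R) p
    (F G : X -> 'M[R[i]]_p) :
  (forall i j, \int[P]_x complex.Re (F x i j) = \int[P]_x complex.Re (G x i j)) ->
  (forall i j, \int[P]_x complex.Im (F x i j) = \int[P]_x complex.Im (G x i j)) ->
  \matrix_(i, j) integralC P (fun x => F x i j) = meanM (expectation_mean P) G.
Proof. by move=> h1 h2; apply/matrixP => i j; rewrite !mxE /integralC h1 h2. Qed.

Section Truncation.
Variables (R : realType) (X : Type) (p : nat) (T : X -> 'M[R]_p) (c : R).

(* T is bounded almost everywhere only; the fixed-point map requires a bound at every point. *)
Definition truncate (t : X) : 'M[R]_p :=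
  if \sum_i \sum_j T t i j ^+ 2 <= (p%:R * c) ^+ 2 then T t else 0.

Lemma truncate_sym : (forall t, (T t)^T = T t) -> forall t, (truncate t)^T = truncate t.
Proof. by move=> h t; rewrite /truncate; case: ifP => _; rewrite ?h ?trmx0. Qed.

Lemma truncate_opb t : 0 <= c -> opb (toC (truncate t)) (p%:R * c).
Proof.
move=> c0 v; apply: (le_trans (fnormM _ _)); rewrite ler_wpM2r //.
rewrite -(@ler_pXn2r _ 2) ?nnegrE ?mulr_ge0 //.
rewrite fnorm2 (eq_bigr (fun i => \sum_j truncate t i j ^+ 2)); last first.
  move=> i _; apply: eq_bigr => j _; rewrite mxE nc_real.
  by rewrite -normrX ger0_norm ?sqr_ge0.
rewrite /truncate; case: ifP => // _; rewrite big1 ?sqr_ge0 // => i _.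
by rewrite big1 // => j _; rewrite mxE expr0n.
Qed.

(** Each of the p^2 entries is at most the operator norm; this is the origin of the threshold (p
    c)^2. A test on the sum of squared entries also makes the truncation visibly measurable. *)
Lemma truncate_id t : opnormR (T t) <= c -> truncate t = T t.
Proof.
move=> h; rewrite /truncate ifT //.
rewrite exprMn (_ : p%:R ^+ 2 * c ^+ 2 = \sum_(i < p) \sum_(j < p) c ^+ 2); last first.
  by rewrite !sum_cst !card_ord mulrA -expr2.
apply: ler_sum => i _; apply: ler_sum => j _.
have hij := le_trans (opnormR_entry (T t) i j) h.
rewrite -real_normK ?num_real //; apply: lerXn2r => //; rewrite ?nnegrE //.
exact: le_trans hij.
Qed.
End Truncation.

Lemma measurable_truncate d (R : realType) (X : measurableType d) (p : nat) (T : X -> 'M[R]_p) (c : R) :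
  (forall i j, measurable_fun setT (fun t => T t i j)) ->
  measurableM (fun t => toC (truncate T c t)).
Proof.
move=> mT i j; under eq_fun do rewrite mxE; apply: measurable_cfun_real.
rewrite /truncate (_ : (fun t => _) = fun t =>
  if \sum_i \sum_j T t i j ^+ 2 <= (p%:R * c) ^+ 2 then T t i j else 0); last first.
  by apply/funext => t; case: ifP => _ //; rewrite mxE.
apply: measurable_fun_ifT => //; apply: measurable_fun_ler => //.
apply: measurable_sum => k; apply: measurable_sum => l; exact: measurable_funX.
Qed.

Section SelfConsistent.
Variables (R : realType) (q p : nat) (law_y : probability (q.-tuple R) R).
Local Notation C := R[i].
Variables (T : q.-tuple R -> 'M[R]_p) (alpha c : R).
Hypothesis p_gt0 : (0 < p)%N.
Hypothesis T_sym : forall t, (T t)^T = T t.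
Hypothesis T_meas : forall i j, measurable_fun setT (fun t => T t i j).
Hypothesis c_gt0 : 0 < c.
Hypothesis T_bounded : {ae law_y, forall t, opnormR (T t) <= c}.
Hypothesis alpha_gt0 : 0 < alpha.
Local Notation T0 t := (toC (truncate T c t)).
Local Notation E := (expectation_mean law_y).
Local Notation Phi0 := (Phi E (fun t => T0 t) alpha^-1).

Lemma aV_gt0 : 0 < alpha^-1. Proof. by rewrite invr_gt0. Qed.
Lemma pc_ge0 : 0 <= p%:R * c. Proof. by rewrite mulr_ge0 // ltW. Qed.
Lemma T0_herm t : (T0 t) ^t* = T0 t.
Proof. exact: toC_herm (truncate_sym c T_sym t). Qed.
Lemma T0_opb t : opb (T0 t) (p%:R * c).
Proof. exact: truncate_opb (ltW c_gt0). Qed.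
Lemma T0_meas : measurableM (fun t => T0 t). Proof. exact: measurable_truncate. Qed.
Lemma toC_T_herm t : (toC (T t)) ^t* = toC (T t). Proof. exact: toC_herm. Qed.
Lemma TC_meas : measurableM (fun t => toC (T t)).
Proof. by move=> i j; under eq_fun do rewrite mxE; exact: measurable_cfun_real. Qed.

Lemma T0_dom z (M : 'M[C]_p) : 0 < complex.Im z -> herg (complex.Im z) M ->
  mdomM E (fun t => Kf alpha^-1 M (T0 t)).
Proof.
move=> z0 hM; exact: (mdomM_K law_y T0_meas pc_ge0 T0_herm T0_opb alpha_gt0 z0 hM).
Qed.

Lemma kernel_mean_truncate (M : 'M[C]_p) :
  measurableM (fun t => Kf alpha^-1 M (toC (T t))) -> measurableM (fun t => Kf alpha^-1 M (T0 t)) ->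
  mdomM E (fun t => Kf alpha^-1 M (T0 t)) ->
  (forall i j, integrableC law_y (fun t => Kf alpha^-1 M (toC (T t)) i j)) /\
  \matrix_(i, j) integralC law_y (fun t => Kf alpha^-1 M (toC (T t)) i j) =
    meanM E (fun t => Kf alpha^-1 M (T0 t)).
Proof.
move=> m1 m0 d0.
have ae : {ae law_y, forall t, truncate T c t = T t}.
  by apply: filterS T_bounded => t; exact: truncate_id.
have H i j : (law_y.-integrable setT (EFin \o (fun t => complex.Re (Kf alpha^-1 M (toC (T t)) i j))) /\
    \int[law_y]_t complex.Re (Kf alpha^-1 M (toC (T t)) i j) = \int[law_y]_t complex.Re (Kf alpha^-1 M (T0 t) i j)) /\
   (law_y.-integrable setT (EFin \o (fun t => complex.Im (Kf alpha^-1 M (toC (T t)) i j))) /\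
    \int[law_y]_t complex.Im (Kf alpha^-1 M (toC (T t)) i j) = \int[law_y]_t complex.Im (Kf alpha^-1 M (T0 t) i j)).
  have [r1 i1] := m1 i j; have [r0 i0] := m0 i j; have [dr di] := d0 i j.
  have aer : {ae law_y, forall t, complex.Re (Kf alpha^-1 M (toC (T t)) i j) = complex.Re (Kf alpha^-1 M (T0 t) i j)}.
    by apply: filterS ae => t ->.
  have aei : {ae law_y, forall t, complex.Im (Kf alpha^-1 M (toC (T t)) i j) = complex.Im (Kf alpha^-1 M (T0 t) i j)}.
    by apply: filterS ae => t ->.
  by split; [exact: (ae_eq_Rintegral r1 r0 aer dr) | exact: (ae_eq_Rintegral i1 i0 aei di)].
split=> [i j|]; first by have [[h1 _] [h2 _]] := H i j.
apply: meanM_expectation => i j; first by have [[_ e] _] := H i j.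
by have [_ [_ e]] := H i j.
Qed.

Lemma fixpoint_self_consistent (M : C -> 'M[C]_p) :
  (forall z, 0 < complex.Im z -> herg (complex.Im z) (M z) /\ Phi0 z (M z) = M z) ->
  self_consistent law_y T alpha M.
Proof.
move=> H z z0; have [hM fM] := H z z0 => D G.
have [u _ _ _] := Phi_props aV_gt0 T0_herm z0 (fun N hN => T0_dom z0 hN) hM.
have mK : measurableM (fun t => Kf alpha^-1 (M z) (toC (T t))).
  by apply: (measurableM_Kf aV_gt0 z0 hM) => //; [exact: toC_T_herm | exact: TC_meas].
have mK0 : measurableM (fun t => Kf alpha^-1 (M z) (T0 t)).
  by apply: (measurableM_Kf aV_gt0 z0 hM) => //; [exact: T0_herm | exact: T0_meas].
have [i1 e1] := kernel_mean_truncate mK mK0 (T0_dom z0 hM).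
have e2 : invmx (M z) = Amx E (fun t => T0 t) alpha^-1 z (M z) by rewrite -{1}fM /Phi invmxK.
have eG : G = (fun t => Kf alpha^-1 (M z) (toC (T t))).
  by apply/funext => t; rewrite KfE.
rewrite eG; split.
- by rewrite -fM /Phi unitmx_inv.
- by apply: aeW => t; exact: (Kf_unit aV_gt0 z0 hM (toC_T_herm t)).
- exact: i1.
- by rewrite e2 /Amx e1.
Qed.

(** The computation of [imq_Kf] for a matrix about which only Im M >= 0 and the invertibility are
    known, as is the case for a competing solution. *)
Lemma imq_Kf_le0 (M T1 : 'M[C]_p) (b : R) a : 0 < b -> (forall x, 0 <= imq M x) -> T1 ^t* = T1 ->
  1%:M + b%:C *: (M *m T1) \in unitmx -> imq (Kf b M T1) a <= 0.
Proof.
move=> b0 hM hT uD; rewrite KfE /imq -mulmxA; set w := invmx _ *m a.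
have -> : a = w + b%:C *: (M *m (T1 *m w)).
  rewrite -{1}[a](mul1mx a) -(mulmxV uD) -mulmxA -/w mulmxDl mul1mx -scalemxAl -mulmxA //.
rewrite cdotDl ImD -/(imq T1 w) imq_herm // add0r cdotC ImJ cdotZr ImZ oppr_le0.
by rewrite mulr_ge0 ?(ltW b0) //; exact: hM.
Qed.

(** A solution with Im M >= 0 lies in the class automatically: the mean kernel has nonpositive
    imaginary form, so that of M^-1 is at most -eta, and [accretive_inv] applies. Uniqueness then
    reduces to that of the fixed point at each z. *)
Lemma self_consistent_herg (M : C -> 'M[C]_p) z : 0 < complex.Im z ->
  psdmx (Immx (M z)) -> self_consistent law_y T alpha M ->
  herg (complex.Im z) (M z) /\ Phi0 z (M z) = M z.
Proof.
move=> z0 /psdmx_imq hM /(_ z z0)[uM uD iG eM].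
have dK : mdomM E (fun t => Kf alpha^-1 (M z) (toC (T t))).
  by move=> i j; have [h1 h2] := iG i j.
have eM' : invmx (M z) = - z%:M + meanM E (fun t => Kf alpha^-1 (M z) (toC (T t))).
  by rewrite eM.
have acc a : imq (invmx (M z)) a <= - (complex.Im z * fnorm a ^+ 2).
  rewrite eM' imqD imqN imq_scalar gerDl.
  have [d e] := mean_imq a dK; rewrite -e; apply: Rintegral_ae_le0; first exact: d.
  by apply: filterS uD => t; apply: imq_Kf_le0 aV_gt0 hM (toC_T_herm t).
have [u' h' _ _] := accretive_inv z0 acc; rewrite invmxK in h'.
split=> //.
have mK : measurableM (fun t => Kf alpha^-1 (M z) (toC (T t))).
  by apply: (measurableM_Kf aV_gt0 z0 h') => //; [exact: toC_T_herm | exact: TC_meas].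
have mK0 : measurableM (fun t => Kf alpha^-1 (M z) (T0 t)).
  by apply: (measurableM_Kf aV_gt0 z0 h') => //; [exact: T0_herm | exact: T0_meas].
have [_ e1] := kernel_mean_truncate mK mK0 (T0_dom z0 h').
by rewrite /Phi /Amx -e1 -[RHS]invmxK eM.
Qed.

Lemma self_consistent_unique (M M' : C -> 'M[C]_p) z : 0 < complex.Im z ->
  herg (complex.Im z) (M z) -> Phi0 z (M z) = M z ->
  psdmx (Immx (M' z)) -> self_consistent law_y T alpha M' -> M' z = M z.
Proof.
move=> z0 hM fM pM' sM'; have [hM' fM'] := self_consistent_herg z0 pM' sM'.
exact: (fixpoint_unique p_gt0 aV_gt0 pc_ge0 T0_herm T0_opb z0 (fun N hN => T0_dom z0 hN) hM' hM fM' fM).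
Qed.

(** The equation reads z M + 1 = K M with K the mean kernel. Here |M| <= 1/eta, and K stays bounded
    for eta >= 1 because [CK] decreases in eta. *)
Lemma fixpoint_decay (M : C -> 'M[C]_p) :
  (forall z, 0 < complex.Im z -> herg (complex.Im z) (M z) /\ Phi0 z (M z) = M z) ->
  exists B, forall eta, 1 <= eta -> fnorm ((0 +i* eta) *: M (0 +i* eta) - - 1%:M) <= B * eta^-1.
Proof.
move=> H; exists ((p * p)%:R * (2 * (2 * (p%:R * c) + (p%:R * c) ^+ 2 * alpha^-1))).
move=> eta e1; have e0 : 0 < eta by exact: lt_le_trans e1.
pose z : C := 0 +i* eta; have z0 : 0 < complex.Im z by [].
have [hM fM] := H z z0; rewrite -/z.
have [u _ _ _] := Phi_props aV_gt0 T0_herm z0 (fun N hN => T0_dom z0 hN) hM.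
pose K := meanM E (fun t => Kf alpha^-1 (M z) (T0 t)).
have E1 : z *: M z - - 1%:M = K *m M z.
  have : Amx E (fun t => T0 t) alpha^-1 z (M z) *m M z = 1%:M by rewrite -{2}fM mulmxV.
  rewrite /Amx -/K mulmxDl mulNmx mul_scalar_mx => <-.
  by rewrite opprK addrA addrN add0r.
rewrite E1.
have eV : 0 <= eta^-1 by rewrite invr_ge0 ltW.
apply: (le_trans (opb_mulr _ eV (herg_opb z0 hM))); rewrite mulrC ler_wpM2r //.
have CKb : CK alpha^-1 (p%:R * c) z <= 2 * (p%:R * c) + (p%:R * c) ^+ 2 * alpha^-1.
  rewrite /CK lerD2l ler_pdivrMr // ler_peMr //.
  by rewrite mulr_ge0 ?sqr_ge0 // ltW // aV_gt0.
have dK := T0_dom z0 hM.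
have fK := fnorm_meanM dK (fun t i j => opb_entry i j
  (K_opb aV_gt0 pc_ge0 T0_herm T0_opb z0 t hM)).
apply: (le_trans fK); by rewrite ler_wpM2l // ler_wpM2l.
Qed.

Lemma fixpoint_normalized (M : C -> 'M[C]_p) :
  (forall z, 0 < complex.Im z -> herg (complex.Im z) (M z) /\ Phi0 z (M z) = M z) ->
  ((0 +i* eta) *: M (0 +i* eta) : 'M[C^o]_p) @[eta --> +oo] --> (- 1%:M : 'M[C^o]_p).
Proof.
move=> H; apply: fnorm_cvg_mx; have [B bnd] := fixpoint_decay H.
apply: (@squeeze_cvgr _ _ _ _ (fun=> 0) (fun eta => B * eta^-1)).
- near=> eta; rewrite fnorm_ge0 /=; apply: bnd; near: eta; exact: nbhs_pinfty_ge.
- exact: cvg_cst.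
- rewrite -(mulr0 B); apply: cvgMr; apply/gtr0_cvgV0; last exact: cvg_id.
  by near=> eta; near: eta; exact: nbhs_pinfty_gt.
Unshelve. all: by end_near. Qed.

End SelfConsistent.

(** * From Stieltjes transforms to weak convergence *)

Section PoissonApproximation.
Variable R : realType.

(** Not normalized: the integral over t is pi, whence the factor 1/pi in [mollify]. *)
Definition poisson (t eta x : R) : R := eta / ((x - t) ^+ 2 + eta ^+ 2).

Lemma poisson_ge0 t eta x : 0 <= eta -> 0 <= poisson t eta x.
Proof. by move=> h; rewrite divr_ge0 // addr_ge0 // sqr_ge0. Qed.

Lemma ler_norm_sqr_diff (s u h : R) : s < u -> u < s + h -> h <= 1 ->
  `|(1 + s ^+ 2)^-1 - (1 + u ^+ 2)^-1| <= 2 * h * (1 + u ^+ 2)^-1.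
Proof.
move=> su ush h1; have ps : 0 < 1 + s ^+ 2 by rewrite ltr_pwDl // sqr_ge0.
have pu : 0 < 1 + u ^+ 2 by rewrite ltr_pwDl // sqr_ge0.
have -> : (1 + s ^+ 2)^-1 - (1 + u ^+ 2)^-1 = ((u - s) * (u + s)) / (1 + s ^+ 2) * (1 + u ^+ 2)^-1.
  by field; rewrite !gt_eqF.
rewrite normrM (@gtr0_norm _ (1 + u ^+ 2)^-1) ?invr_gt0 // ler_pM2r ?invr_gt0 //.
rewrite normrM (@gtr0_norm _ (1 + s ^+ 2)^-1) ?invr_gt0 // ler_pdivrMr //.
rewrite normrM (@gtr0_norm _ (u - s)) ?subr_gt0 //.
have a1 : u - s <= h by lra.
have a2 : `|u + s| <= 2 * (1 + s ^+ 2) by rewrite ler_norml; apply/andP; split; nra.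
apply: (le_trans (ler_pM _ _ a1 a2)); rewrite ?subr_ge0 ?(ltW su) //.
by rewrite mulrA (mulrC h).
Qed.

(** The error is relative to the increment of atan itself. Summed over a grid it therefore
    telescopes, uniformly in the point x and in the length of the grid. *)
Lemma atan_increment (s h : R) : 0 < h -> h <= 1 ->
  `|h * (1 + s ^+ 2)^-1 - (atan (s + h) - atan s)| <= 2 * h * (atan (s + h) - atan s).
Proof.
move=> h0 h1; have sh : s < s + h by rewrite ltrDl.
have d1 u : u \in `]s, s + h[ -> is_derive u (1 : R) (@atan R) (1 + u ^+ 2)^-1.
  by move=> _; exact: is_derive1_atan.
have c1 : {within `[s, s + h], continuous (@atan R)}.
  by apply: continuous_subspaceT => u; exact: continuous_atan.
have [u /[!in_itv]/= /andP[su ush] ->] := MVT sh d1 c1.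
rewrite [s + h - s]addrC addKr (mulrC h) -mulrBl normrM (gtr0_norm h0) mulrA ler_pM2r //.
exact: ler_norm_sqr_diff.
Qed.

Lemma poisson_increment t eta delta x : 0 < eta -> 0 < delta -> delta <= eta ->
  let D := atan ((t + delta - x) / eta) - atan ((t - x) / eta) in
  `|delta * poisson t eta x - D| <= 2 * (delta / eta) * D.
Proof.
move=> e0 d0 de; have h0 : 0 < delta / eta by rewrite divr_gt0.
have h1 : delta / eta <= 1 by rewrite ler_pdivrMr // mul1r.
have := atan_increment ((t - x) / eta) h0 h1.
have -> : (t - x) / eta + delta / eta = (t + delta - x) / eta by rewrite -mulrDl addrAC.
have -> : delta / eta * (1 + ((t - x) / eta) ^+ 2)^-1 = delta * poisson t eta x => [|//].
rewrite /poisson; have p1 : 0 < (x - t) ^+ 2 + eta ^+ 2 by rewrite ltr_wpDl ?sqr_ge0 ?exprn_gt0.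
have p2 : 0 < 1 + ((t - x) / eta) ^+ 2 by rewrite ltr_pwDl // sqr_ge0.
field; rewrite !gt_eqF //= (_ : _ + _ = (x - t) ^+ 2 + eta ^+ 2) //; ring.
Qed.

Definition grid (L : R) (J j : nat) : R := - L + j%:R * (2 * L / J%:R).

(* A Riemann sum for the Poisson integral of f: its mean under a measure is a
   linear combination of values of the Stieltjes transform. *)
Definition mollify (f : R -> R) (L eta : R) (J : nat) (x : R) : R :=
  pi^-1 * \sum_(j < J) f (grid L J j) * (2 * L / J%:R * poisson (grid L J j) eta x).

Lemma poisson_mass L eta (J : nat) x : 0 < L -> 0 < eta -> (0 < J)%N -> 2 * L / J%:R <= eta ->
  let A := atan ((L - x) / eta) - atan ((- L - x) / eta) in
  `|\sum_(j < J) 2 * L / J%:R * poisson (grid L J j) eta x - A| <= 2 * (2 * L / J%:R / eta) * A.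
Proof.
move=> L0 e0 J0 he; set h := 2 * L / J%:R.
have JR : 0 < J%:R :> R by rewrite ltr0n.
have h0 : 0 < h by rewrite divr_gt0 // mulr_gt0.
pose a j : R := atan ((grid L J j - x) / eta).
have E : (atan ((L - x) / eta) - atan ((- L - x) / eta)) = \sum_(j < J) (a j.+1 - a j).
  rewrite -(big_mkord xpredT (fun j => a j.+1 - a j)) telescope_sumr // /a /grid mul0r addr0.
  by congr (atan ((_ - _) / _) - _); rewrite -/h /h; field; rewrite gt_eqF.
rewrite /= E -sumrB; apply: (le_trans (ler_norm_sum _ _ _)); rewrite mulr_sumr; apply: ler_sum => j _.
have := @poisson_increment (grid L J j) eta h x e0 h0 he.
have -> : grid L J j + h = grid L J j.+1 by rewrite /grid -/h -addrA -natr1 mulrDl mul1r.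
exact.
Qed.

Lemma mollify_le f L eta J x (B : R) : 0 <= L -> 0 <= eta -> (forall x, `|f x| <= 1) ->
  \sum_(j < J) 2 * L / J%:R * poisson (grid L J j) eta x <= B * pi -> `|mollify f L eta J x| <= B.
Proof.
move=> L0 e0 f1 hS; rewrite /mollify normrM gtr0_norm ?invr_gt0 ?pi_gt0 // ler_pdivrMl ?pi_gt0 //.
rewrite [leRHS]mulrC; apply: le_trans hS; apply: (le_trans (ler_norm_sum _ _ _)); apply: ler_sum => j _.
rewrite normrM -[leRHS]mul1r; apply: ler_pM => //.
by rewrite ger0_norm // mulr_ge0 ?poisson_ge0 // !mulr_ge0 ?invr_ge0.
Qed.

(** The kernel has an infinite first moment, so |x - t| is compared with a scale kappa: below it the
    mass is kept, beyond it the weighted kernel is at most eta / kappa. On a window of length 2 L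
    the second term costs 2 L eta / kappa, small once eta is. *)
Lemma poisson_moment (t eta kappa x : R) : 0 < eta -> 0 < kappa ->
  `|x - t| * poisson t eta x <= kappa * poisson t eta x + eta / kappa.
Proof.
move=> e0 k0; rewrite /poisson; set s := x - t.
have p : 0 < s ^+ 2 + eta ^+ 2 by rewrite ltr_wpDl ?sqr_ge0 ?exprn_gt0.
rewrite -subr_ge0.
have -> : kappa * (eta / (s ^+ 2 + eta ^+ 2)) + eta / kappa - `|s| * (eta / (s ^+ 2 + eta ^+ 2)) =
  eta * (kappa ^+ 2 + s ^+ 2 + eta ^+ 2 - `|s| * kappa) / (kappa * (s ^+ 2 + eta ^+ 2)).
  by field; rewrite !gt_eqF.
rewrite -[s ^+ 2](real_normK (num_real s)) divr_ge0 ?mulr_ge0 ?(ltW e0) ?(ltW k0) //; last first.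
  by rewrite addr_ge0 ?sqr_ge0.
have := normr_ge0 s; move: `|s| => y y0; have := sqr_ge0 (kappa - y); have := sqr_ge0 eta; nra.
Qed.

Lemma mass_scalar (S A1 A2 h e c : R) : c / 2 - e / 8 <= A1 -> c / 2 - e / 8 <= - A2 -> A1 < c / 2 ->
  - (c / 2) < A2 -> 2 <= c -> 0 < e -> 0 <= h -> h <= e / 16 -> h <= 1 ->
  `|S - (A1 - A2)| <= 2 * h * (A1 - A2) -> `|c - S| <= e / 4 * c /\ S <= 3 * c.
Proof.
move=> a1 a2 a3 a4 p2 e1 hh0 hh1 hh2; rewrite !ler_norml => /andP[b1 b2].
have c1 : 2 * h * (A1 - A2) <= 2 * h * c by rewrite ler_wpM2l ?mulr_ge0 //; lra.
have c2 : 2 * h * c <= 2 * (e / 16) * c by rewrite ler_wpM2r //; lra.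
have c3 : 2 * h * c <= 2 * c by rewrite ler_wpM2r //; lra.
have c4 : e * 2 <= e * c by rewrite ler_wpM2l // ltW.
by split; [apply/andP; split|]; lra.
Qed.

Lemma mass_scalar_le (S A h c : R) : A < c -> 0 <= A -> 0 <= h -> h <= 1 ->
  `|S - A| <= 2 * h * A -> S <= 3 * c.
Proof.
move=> a1 a2 a3 a4; rewrite ler_norml => /andP[_ a5].
have : 2 * h * A <= 2 * A by rewrite ler_wpM2r //; lra.
by lra.
Qed.

(** The parameters are chosen in order: the scale k on which f varies little, Y beyond which atan is
    close to pi / 2, eta small against L / Y and k, and the mesh small against eta. Points with |x|
    <= L / 2 are far from the ends of the grid, so almost all the mass is captured. Elsewhere |f| <=
    1 and |mollify| <= 3 give 4. *)
Lemma mollify_close (f : R -> R) (C eps L : R) : (forall x, `|f x| <= 1) -> 0 <= C ->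
  (forall x y, `|f x - f y| <= C * `|x - y|) -> 0 < eps -> 0 < L ->
  exists eta J, [/\ 0 < eta, forall x, `|x| <= L / 2 -> `|f x - mollify f L eta J x| <= eps &
    forall x, `|f x - mollify f L eta J x| <= 4].
Proof.
move=> f1 C0 fC e0 L0.
pose k := eps / (12 * (C + 1)).
have C1 : 0 < C + 1 by rewrite ltr_wpDl.
have k0 : 0 < k by rewrite divr_gt0 // mulr_gt0.
have hk : C * k <= eps / 12.
  by rewrite /k mulrC -[X in X <= _]mulrA ler_pM2l // invfM -mulrA ler_piMr ?invr_ge0 // mulrC ler_pdivrMr //; lra.
have [Y Y0 hY] : exists2 Y, 0 < Y & forall y, Y <= y -> pi / 2 - eps / 8 <= atan y.
  have /cvgrPdist_le /(_ (eps / 8)) := @cvgy_atan R.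
  case=> [|Y [_ hY]]; first by rewrite divr_gt0.
  exists (Num.max (Y + 1) 1); first by rewrite lt_max ltr01 orbT.
  move=> y; rewrite ge_max => /andP[y1 _].
  have yY : Y < y by lra.
  by have := hY y yY; rewrite ler_norml => /andP[_ ?]; lra.
pose eta := Num.min (L / (2 * Y)) (eps * k / (8 * (C + 1) * L)).
have p8 : 0 < 8 * (C + 1) * L by rewrite !mulr_gt0.
have t0 : 0 < eta by rewrite lt_min !divr_gt0 // ?(mulr_gt0 e0 k0) // mulr_gt0.
have tY : Y * eta <= L / 2.
  have : eta <= L / (2 * Y) by rewrite ge_min lexx.
  by rewrite ler_pdivlMr ?mulr_gt0 //; lra.
have tk : C * (2 * L * (eta / k)) <= eps / 4.
  have : eta <= eps * k / (8 * (C + 1) * L) by rewrite ge_min lexx orbT.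
  rewrite ler_pdivlMr ?mulr_gt0 // => h1.
  have -> : C * (2 * L * (eta / k)) = (C * (2 * L * eta)) / k by field; rewrite gt_eqF.
  rewrite ler_pdivrMr //; have := mulr_gt0 L0 t0; nra.
pose w := Num.min 1 (eps / 16) * eta.
have w0 : 0 < w by rewrite mulr_gt0 // lt_min ltr01 divr_gt0.
pose J := (Num.bound (2 * L / w)).+1.
have JR : 0 < J%:R :> R by rewrite ltr0n.
have hJ : 2 * L / J%:R <= w.
  rewrite ler_pdivrMr // [leRHS]mulrC -ler_pdivrMr //; apply/ltW/(lt_le_trans (archi_boundP _)).
    by apply: divr_ge0; [rewrite mulr_ge0 // ltW|exact: ltW].
  by rewrite ler_nat.
have hJe : 2 * L / J%:R <= eta.
  by apply: (le_trans hJ); rewrite /w ler_piMl ?(ltW t0) // ge_min lexx.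
have hJ2 : 2 * L / J%:R / eta <= Num.min 1 (eps / 16) by rewrite ler_pdivrMr.
have h1 : 2 * L / J%:R / eta <= 1 by apply: (le_trans hJ2); rewrite ge_min lexx.
have h2 : 2 * L / J%:R / eta <= eps / 16 by apply: (le_trans hJ2); rewrite ge_min lexx orbT.
have h3 : 0 <= 2 * L / J%:R / eta by rewrite !divr_ge0 ?mulr_ge0 ?ler0n ?(ltW L0) ?(ltW t0).
exists eta, J; split => //.
- move=> x xL.
  have := poisson_mass x L0 t0 (ltn0Sn _) hJe; rewrite -/J.
  have A1 : pi / 2 - eps / 8 <= atan ((L - x) / eta).
    apply: hY; rewrite ler_pdivlMr //; apply: (le_trans tY).
    by move: xL; rewrite ler_norml => /andP[_ ?]; lra.
  have A2 : pi / 2 - eps / 8 <= - atan ((- L - x) / eta).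
    have -> : - atan ((- L - x) / eta) = atan ((L + x) / eta) by rewrite -atanN; congr atan; ring.
    apply: hY; rewrite ler_pdivlMr //; apply: (le_trans tY).
    by move: xL; rewrite ler_norml => /andP[? _]; lra.
  have A3 := atan_ltpi2 ((L - x) / eta).
  have A4 := atan_gtNpi2 ((- L - x) / eta).
  have hm := @poisson_moment _ eta k x t0 k0.
  move=> /= m0; have [m1 m2] := mass_scalar A1 A2 A3 A4 (pi_ge2 _) e0 h3 h2 h1 m0.
  pose S := \sum_(j < J) 2 * L / J%:R * poisson (grid L J j) eta x.
  have ppi := pi_gt0 R.
  have -> : f x - mollify f L eta J x = pi^-1 * (f x * (pi - S) +
     \sum_(j < J) (f x - f (grid L J j)) * (2 * L / J%:R * poisson (grid L J j) eta x)).
    under [in RHS]eq_bigr do rewrite mulrBl.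
    rewrite sumrB -mulr_sumr -/S mulrBr [f x * pi - _ + _]addrA addrNK mulrBr /mollify.
    by rewrite mulrCA mulVf ?mulr1 // gt_eqF.
  rewrite normrM gtr0_norm ?invr_gt0 // ler_pdivrMl //.
  apply: (le_trans (ler_normD _ _)).
  have b1 : `|f x * (pi - S)| <= eps / 4 * pi.
    by rewrite normrM -[leRHS]mul1r; apply: ler_pM.
  have b2 : `|\sum_(j < J) (f x - f (grid L J j)) * (2 * L / J%:R * poisson (grid L J j) eta x)| <=
     C * (k * S + 2 * L * (eta / k)).
    apply: (le_trans (ler_norm_sum _ _ _)).
    have -> : 2 * L * (eta / k) = \sum_(j < J) 2 * L / J%:R * (eta / k).
      by rewrite sumr_const card_ord -mulr_natr; field; rewrite !gt_eqF.
    rewrite /S mulr_sumr -big_split mulr_sumr; apply: ler_sum => j _.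
    have d0 : 0 <= 2 * L / J%:R by rewrite divr_ge0 ?mulr_ge0 ?(ltW L0).
    have p0 : 0 <= poisson (grid L J j) eta x by rewrite poisson_ge0 // ltW.
    rewrite normrM (ger0_norm (mulr_ge0 d0 p0)) /=.
    apply: (le_trans (ler_wpM2r (mulr_ge0 d0 p0) (fC _ _))).
    by rewrite -[C * _ * _]mulrA ler_wpM2l // [`|_| * _]mulrCA [k * _]mulrCA -mulrDr ler_wpM2l.
  have b3 : C * (k * S) <= eps / 12 * (3 * pi).
    rewrite mulrA; apply: (le_trans (ler_wpM2l _ m2)); first by rewrite mulr_ge0 // ltW.
    by rewrite ler_wpM2r ?mulr_ge0 ?(ltW ppi).
  have b4 : eps / 4 * 2 <= eps / 4 * pi by rewrite ler_wpM2l ?pi_ge2 // divr_ge0 // ltW.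
  rewrite mulrDr in b2.
  by apply: (le_trans (lerD b1 b2)); lra.
move=> x; have := poisson_mass x L0 t0 (ltn0Sn _) hJe; rewrite -/J.
have A1 := atan_gtNpi2 ((L - x) / eta); have A2 := atan_ltpi2 ((- L - x) / eta).
have A3 := atan_ltpi2 ((L - x) / eta); have A4 := atan_gtNpi2 ((- L - x) / eta).
have A5 : atan ((- L - x) / eta) <= atan ((L - x) / eta).
  by apply: le_atan; rewrite ler_pM2r ?invr_gt0 //; lra.
move=> /= m0.
have m : \sum_(j < J) 2 * L / J%:R * poisson (grid L J j) eta x <= 3 * pi.
  by apply: (mass_scalar_le _ _ h3 h1 m0); lra.
have := mollify_le (ltW L0) (ltW t0) f1 m; have := f1 x.
by rewrite !ler_norml => /andP[? ?] /andP[? ?]; apply/andP; split; lra.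
Qed.

End PoissonApproximation.

(** * Limits of means of Lipschitz functions *)

Section MeanLimits.
Variable R : realType.

(** Models averages over finitely many points, which are defined for every function; in contrast
    with [mean_functional], no domain is carried along. *)
Record positive_mean (e : (R -> R) -> R) : Prop := PositiveMean {
  pmeanD : forall f g, e (fun x => f x + g x) = e f + e g;
  pmeanZ : forall c f, e (fun x => c * f x) = c * e f;
  pmean1 : e (fun=> 1) = 1;
  pmean_le : forall f g, (forall x, f x <= g x) -> e f <= e g }.

Lemma pmean_cst e c : positive_mean e -> e (fun=> c) = c.
Proof.
move=> h; have := pmeanZ h c (fun=> 1); rewrite pmean1 // mulr1 => {2}<-.
by congr (e _); apply/funext => x; rewrite mulr1.
Qed.

Lemma pmeanB e f g : positive_mean e -> e (fun x => f x - g x) = e f - e g.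
Proof.
move=> h; rewrite (_ : (fun _ => _) = fun x => f x + (-1) * g x); last first.
  by apply/funext => x; rewrite mulN1r.
by rewrite pmeanD // (pmeanZ h (-1) g) mulN1r.
Qed.

Lemma pmean_sum e (J : Type) (s : seq J) (f : J -> R -> R) : positive_mean e ->
  e (fun x => \sum_(j <- s) f j x) = \sum_(j <- s) e (f j).
Proof.
move=> h; elim: s => [|j s IH].
  by rewrite big_nil -[RHS](pmean_cst 0 h); congr (e _); apply/funext => x; rewrite big_nil.
rewrite big_cons -IH -pmeanD //; congr (e _); apply/funext => x; rewrite big_cons //.
Qed.

Lemma pmean_dist e f g b : positive_mean e -> (forall x, `|f x - g x| <= b x) -> `|e f - e g| <= e b.
Proof.
move=> h fg; rewrite -pmeanB // ler_norml; apply/andP; split; last first.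
  by apply: pmean_le => // x; have := fg x; rewrite ler_norml => /andP[].
rewrite -[- e b]mulN1r -(pmeanZ h); apply: pmean_le => // x.
by have := fg x; rewrite ler_norml mulN1r => /andP[].
Qed.

Definition mean_sequence (Q : R -> R -> R) (e : nat -> (R -> R) -> R) :=
  (forall n, positive_mean (e n)) /\
  forall t eta, 0 < eta -> e n (poisson t eta) @[n --> \oo] --> Q t eta.

Variable Q : R -> R -> R.
Hypothesis Q_tight : forall eps : R, 0 < eps -> exists2 eta, 0 < eta & 1 - eta * Q 0 eta <= eps.

(** A is the value of the mollified f, a combination of values of Q alone, so one number serves all
    sequences [e]. Tightness disposes of the region outside the grid. *)
Lemma mean_limit_approx (f : R -> R) (C eps : R) : (forall x, `|f x| <= 1) -> 0 <= C ->
  (forall x y, `|f x - f y| <= C * `|x - y|) -> 0 < eps ->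
  exists A : R, forall e, mean_sequence Q e -> \forall n \near \oo, `|e n f - A| <= eps.
Proof.
move=> f1 C0 fC e0.
have e64 : 0 < eps / 64 by rewrite divr_gt0.
have [t t0 ht] := Q_tight e64.
have [||eta [J [n0 g1 g2]]] := @mollify_close R f C (eps / 4) (2 * t) f1 C0 fC.
- by rewrite divr_gt0.
- by rewrite mulr_gt0.
pose g := mollify f (2 * t) eta J.
pose cf j := pi^-1 * (f (grid (2 * t) J j) * (2 * (2 * t) / J%:R)).
have gE : g = fun x => \sum_(j < J) cf j * poisson (grid (2 * t) J j) eta x.
  by apply/funext => x; rewrite /g /mollify mulr_sumr; apply: eq_bigr => j _; rewrite /cf !mulrA.
exists (\sum_(j < J) cf j * Q (grid (2 * t) J j) eta) => e [he hQ].
have cg : e n g @[n --> \oo] --> \sum_(j < J) cf j * Q (grid (2 * t) J j) eta.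
  rewrite (_ : (fun n => e n g) = fun n => \sum_(j < J) cf j * e n (poisson (grid (2 * t) J j) eta)).
    by apply: cvg_sumr => j; apply: cvgMr; exact: hQ.
  by apply/funext => n; rewrite gE (pmean_sum _ (fun j : 'I_J => _) (he n)); apply: eq_bigr => j _; exact: (pmeanZ (he n)).
(* 1 - t poisson 0 t x equals x^2 / (x^2 + t^2), which is at least 1/2 outside [-t, t]; there the
   error is at most 4, whence the factor 8. *)
have bnd x : `|f x - g x| <= eps / 4 + 8 * (1 - t * poisson 0 t x).
  have p : 0 < x ^+ 2 + t ^+ 2 by rewrite ltr_wpDl ?sqr_ge0 ?exprn_gt0.
  have E : 1 - t * poisson 0 t x = x ^+ 2 / (x ^+ 2 + t ^+ 2).
    by rewrite /poisson subr0; field; rewrite gt_eqF.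
  have [xt|xt] := leP `|x| t.
    apply: (@le_trans _ _ (eps / 4)); first by apply: g1; rewrite mulrAC divff ?mul1r // pnatr_eq0.
    by rewrite lerDl E mulr_ge0 // divr_ge0 ?sqr_ge0 // ltW.
  apply: (le_trans (g2 x)); rewrite E.
  have h : 1 / 2 <= x ^+ 2 / (x ^+ 2 + t ^+ 2).
    rewrite ler_pdivlMr //; have : t ^+ 2 <= x ^+ 2; last by lra.
    by rewrite -[x ^+ 2](real_normK (num_real x)) ler_pXn2r ?nnegrE ?(ltW t0) // ltW.
  by lra.
have e4 : 0 < eps / 4 by rewrite divr_gt0.
have /cvgrPdist_le /(_ _ e4) h1 := cg.
have e64' : 0 < eps / 64 / t by rewrite divr_gt0.
have /cvgrPdist_le /(_ _ e64') h2 := hQ 0 t t0.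
near=> n.
have d1 := pmean_dist (he n) bnd.
rewrite (pmeanD (he n) (fun=> eps / 4) (fun x => 8 * (1 - t * poisson 0 t x))) in d1.
rewrite (pmeanZ (he n) 8 (fun x => 1 - t * poisson 0 t x)) (pmean_cst _ (he n)) in d1.
rewrite (pmeanB (fun=> 1) (fun x => t * poisson 0 t x) (he n)) (pmean1 (he n)) in d1.
rewrite (pmeanZ (he n) t (poisson 0 t)) in d1.
have d2 : `|\sum_(j < J) cf j * Q (grid (2 * t) J j) eta - e n g| <= eps / 4 by near: n; exact: h1.
have d3 : `|Q 0 t - e n (poisson 0 t)| <= eps / 64 / t by near: n; exact: h2.
have d4 : t * (Q 0 t - e n (poisson 0 t)) <= eps / 64.
  by rewrite mulrC -ler_pdivlMr //; apply: le_trans d3; exact: ler_norm.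
move: d1 d2; rewrite !ler_norml => /andP[a1 a2] /andP[a3 a4].
by apply/andP; split; lra.
Unshelve. all: by end_near.
Qed.

(** [e0] provides the existence of the limit; any other sequence with the same Q is eventually
    within eps of the same number A, hence has the same limit. *)
Lemma mean_limit e0 (f : R -> R) (C : R) : mean_sequence Q e0 -> (forall x, `|f x| <= 1) -> 0 <= C ->
  (forall x y, `|f x - f y| <= C * `|x - y|) ->
  exists l : R, forall e, mean_sequence Q e -> e n f @[n --> \oo] --> l.
Proof.
move=> s0 f1 C0 fC.
have [|l hl] := @cauchy_real_cvg _ (fun n => e0 n f).
  move=> eps eps0; have eps2 : 0 < eps / 2 by rewrite divr_gt0.
  have [A /(_ _ s0)[k _ hk]] := mean_limit_approx f1 C0 fC eps2; exists k => i j ki kj.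
  have := hk i ki; have := hk j kj; rewrite /= !ler_norml => /andP[? ?] /andP[? ?].
  by apply/andP; split; lra.
exists l => e se; apply/cvgrPdist_le => eps eps0; have eps2 : 0 < eps / 4 by rewrite divr_gt0.
have [A hA] := mean_limit_approx f1 C0 fC eps2.
have a1 := hA _ se; have a2 := hA _ s0.
have /cvgrPdist_le /(_ _ eps2) a3 := hl.
have [k [k1 k2]] : exists k, `|e0 k f - A| <= eps / 4 /\ `|l - e0 k f| <= eps / 4.
  have [k1 _ h1] := a2; have [k2 _ h2] := a3; exists (maxn k1 k2).
  by split; [apply: h1; exact: leq_maxl|apply: h2; exact: leq_maxr].
near=> n; have : `|e n f - A| <= eps / 4 by near: n; exact: a1.
move: k1 k2; rewrite !ler_norml => /andP[? ?] /andP[? ?] /andP[? ?].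
by apply/andP; split; lra.
Unshelve. all: by end_near.
Qed.

End MeanLimits.

Section StepFunctions.
Variable R : realType.

Definition step (a b x : R) : R := Num.max 0 (Num.min 1 ((b - x) / (b - a))).

Lemma step_ge0 a b x : 0 <= step a b x. Proof. by rewrite le_max lexx. Qed.
Lemma step_le1 a b x : step a b x <= 1.
Proof. by rewrite ge_max ler01 ge_min lexx. Qed.

Lemma step_left a b x : a < b -> x <= a -> step a b x = 1.
Proof.
move=> ab xa; rewrite /step min_l ?max_r // ler_pdivlMr ?subr_gt0 //; lra.
Qed.

Lemma step_right a b x : a < b -> b <= x -> step a b x = 0.
Proof.
move=> ab bx; rewrite /step max_l // ge_min; apply/orP; right.
by rewrite ler_pdivrMr ?subr_gt0 // mul0r subr_le0.
Qed.

Lemma step_le a b a' b' x : a < b -> b <= a' -> a' < b' -> step a b x <= step a' b' x.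
Proof.
move=> ab ba ab'; have [h|h] := leP b x; first by rewrite step_right // step_ge0.
by rewrite [leRHS]step_left ?step_le1 //; lra.
Qed.

Lemma clip_lipschitz (u v : R) :
  `|Num.max 0 (Num.min 1 u) - Num.max 0 (Num.min 1 v)| <= `|u - v|.
Proof.
have le (s t : R) : s <= t ->
    Num.max 0 (Num.min 1 s) <= Num.max 0 (Num.min 1 t) <= Num.max 0 (Num.min 1 s) + (t - s).
  move=> st; rewrite /Num.max /Num.min.
  by apply/andP; split; repeat case: ifPn; rewrite -?leNgt; lra.
have [h|h] := leP u v.
  have /andP[a b] := le _ _ h.
  by rewrite (ler0_norm (_ : u - v <= 0)) ?subr_le0 // ler0_norm ?subr_le0 //; lra.
have /andP[a b] := le _ _ (ltW h).
by rewrite (gtr0_norm (_ : 0 < u - v)) ?subr_gt0 // ger0_norm ?subr_ge0 //; lra.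
Qed.

Lemma step_lipschitz a b x y : a < b -> `|step a b x - step a b y| <= (b - a)^-1 * `|x - y|.
Proof.
move=> ab; apply: (le_trans (clip_lipschitz _ _)).
rewrite -mulrBl normrM (@gtr0_norm _ (b - a)^-1) ?invr_gt0 ?subr_gt0 // mulrC ler_pM2l ?invr_gt0 ?subr_gt0 //.
by rewrite (_ : b - x - (b - y) = y - x) 1?distrC //; ring.
Qed.

Lemma lipschitz_continuous (f : R -> R) (C : R) : 0 <= C ->
  (forall x y, `|f x - f y| <= C * `|x - y|) -> continuous f.
Proof.
move=> C0 h x; have C1 : 0 < C + 1 by rewrite ltr_wpDl.
apply/cvgrPdist_le => eps e0; near=> y.
apply: (le_trans (h _ _)); apply: (@le_trans _ _ ((C + 1) * `|x - y|)).
  by rewrite ler_wpM2r // lerDl.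
rewrite mulrC -ler_pdivlMr //; near: y.
have /cvgrPdist_le := @cvg_id _ (nbhs x); apply; rewrite divr_gt0 //.
Unshelve. all: by end_near. Qed.

Lemma step_continuous a b : a < b -> continuous (step a b).
Proof.
move=> ab; apply: (@lipschitz_continuous _ (b - a)^-1); first by rewrite invr_ge0 subr_ge0 ltW.
by move=> x y; exact: step_lipschitz.
Qed.

End StepFunctions.

Lemma distribution_of_cdf (R : realType) (F : R -> R) : nondecreasing_fun F -> right_continuous F ->
  F x @[x --> -oo] --> (0 : R) -> F x @[x --> +oo] --> (1 : R) ->
  exists mu : probability R R, forall r, mu [set x | x <= r] = (F r)%:E.
Proof.
move=> F1 F2 F3 F4.
pose m1 := isCumulative.Build R _ R^o F F1 F2.
pose m2 := isCumulativeBounded.Build R 0 1 F F3 F4.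
pose f : cumulativeBounded (0 : R) (1 : R) := HB.pack F m1 m2.
pose idTR : measurableTypeR R -> R := idfun.
pose m3 := @isMeasurableFun.Build _ _ _ _ idTR (@measurable_id _ _ setT).
pose X : {RV (lebesgue_stieltjes_measure f) >-> R} := HB.pack idTR m3.
exists (distribution (lebesgue_stieltjes_measure f) X) => r.
rewrite -[F r]/(f r) -(cdf_lebesgue_stieltjes_id f r).
by congr (distribution _ _ _); apply/seteqP; split => x; rewrite /= in_itv.
Qed.

(** * The limiting distribution function *)

Section LimitDistribution.
Variables (R : realType) (Q : R -> R -> R) (e0 : nat -> (R -> R) -> R).
Hypothesis Q_tight : forall eps : R, 0 < eps -> exists2 eta, 0 < eta & 1 - eta * Q 0 eta <= eps.
Hypothesis e0_seq : mean_sequence Q e0.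

Definition step_lim (a b : R) : R := lim (e0 n (step a b) @[n --> \oo]).

Lemma step_lim_cvg a b e : a < b -> mean_sequence Q e -> e n (step a b) @[n --> \oo] --> step_lim a b.
Proof.
move=> ab he; have [|||l hl] := mean_limit Q_tight e0_seq (f := step a b) (C := (b - a)^-1).
- by move=> x; rewrite ger0_norm ?step_ge0 ?step_le1.
- by rewrite invr_ge0 subr_ge0 ltW.
- by move=> x y; exact: step_lipschitz.
suff -> : step_lim a b = l by exact: hl.
by apply: cvg_lim => //; exact: hl.
Qed.

Lemma step_lim_mono a b a' b' : a < b -> b <= a' -> a' < b' -> step_lim a b <= step_lim a' b'.
Proof.
move=> ab ba ab'; have h1 := step_lim_cvg ab e0_seq; have h2 := step_lim_cvg ab' e0_seq.
apply: (ler_cvg_to h1 h2); apply: nearW => n; apply: (pmean_le (e0_seq.1 n)) => x.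
exact: step_le.
Qed.

Lemma step_lim_ge0 a b : a < b -> 0 <= step_lim a b.
Proof.
move=> ab; have h := step_lim_cvg ab e0_seq.
apply: (ler_cvg_to (cvg_cst _) h); apply: nearW => n; rewrite -(pmean_cst 0 (e0_seq.1 n)).
by apply: (pmean_le (e0_seq.1 n)) => x; exact: step_ge0.
Qed.

Lemma step_lim_le1 a b : a < b -> step_lim a b <= 1.
Proof.
move=> ab; have h := step_lim_cvg ab e0_seq.
apply: (ler_cvg_to h (cvg_cst _)); apply: nearW => n; rewrite -(pmean1 (e0_seq.1 n)).
by apply: (pmean_le (e0_seq.1 n)) => x; exact: step_le1.
Qed.

Lemma tail_bound (t x : R) : 0 < t -> t <= `|x| -> 1 <= 2 * (1 - t * poisson 0 t x).
Proof.
move=> t0 tx; have p : 0 < x ^+ 2 + t ^+ 2 by rewrite ltr_wpDl ?sqr_ge0 ?exprn_gt0.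
have -> : 2 * (1 - t * poisson 0 t x) = 2 * x ^+ 2 / (x ^+ 2 + t ^+ 2).
  by rewrite /poisson subr0; field; rewrite gt_eqF.
rewrite ler_pdivlMr //; have : t ^+ 2 <= x ^+ 2; last by lra.
by rewrite -[x ^+ 2](real_normK (num_real x)) ler_pXn2r ?nnegrE ?(ltW t0).
Qed.

Lemma poisson_le1 (t x : R) : 0 < t -> 0 <= 2 * (1 - t * poisson 0 t x).
Proof.
move=> t0; have p : 0 < x ^+ 2 + t ^+ 2 by rewrite ltr_wpDl ?sqr_ge0 ?exprn_gt0.
have -> : 1 - t * poisson 0 t x = x ^+ 2 / (x ^+ 2 + t ^+ 2).
  by rewrite /poisson subr0; field; rewrite gt_eqF.
by rewrite mulr_ge0 // divr_ge0 ?sqr_ge0 // ltW.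
Qed.

Lemma tail_cvg t : 0 < t ->
  e0 n (fun x => 2 * (1 - t * poisson 0 t x)) @[n --> \oo] --> 2 * (1 - t * Q 0 t).
Proof.
move=> t0; rewrite (_ : (fun n => _) = fun n => 2 * (1 - t * e0 n (poisson 0 t))); last first.
  apply/funext => n; have h := e0_seq.1 n; rewrite (pmeanZ h 2 (fun x => 1 - t * poisson 0 t x)).
  by rewrite (pmeanB (fun=> 1) (fun x => t * poisson 0 t x) h) (pmean1 h) (pmeanZ h t (poisson 0 t)).
apply: cvgMr; apply: cvgB; first exact: cvg_cst.
by apply: cvgMr; exact: e0_seq.2.
Qed.

Lemma step_lim_tails (eps : R) : 0 < eps -> exists2 t, 0 < t &
  (forall a b, a < b -> b <= - t -> step_lim a b <= eps) /\
  (forall a b, a < b -> t <= a -> 1 - eps <= step_lim a b).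
Proof.
move=> eps0; have e2 : 0 < eps / 2 by rewrite divr_gt0.
have [t t0 ht] := Q_tight e2; exists t => //.
have T := tail_cvg t0.
split=> a b ab h; have S := step_lim_cvg ab e0_seq.
- apply: (@le_trans _ _ (2 * (1 - t * Q 0 t))); last by lra.
  apply: (ler_cvg_to S T); apply: nearW => n; apply: (pmean_le (e0_seq.1 n)) => x.
  have [bx|xb] := leP b x; first by rewrite step_right // poisson_le1.
  apply: (le_trans (step_le1 _ _ _)); apply: tail_bound => //.
  by rewrite ler_normr; apply/orP; right; lra.
- suff : 1 - step_lim a b <= 2 * (1 - t * Q 0 t) by lra.
  have S' : 1 - e0 n (step a b) @[n --> \oo] --> 1 - step_lim a b by apply: cvgB S; exact: cvg_cst.
  apply: (ler_cvg_to S' T); apply: nearW => n; have H := e0_seq.1 n.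
  rewrite -{1}(pmean1 H) -(pmeanB (fun=> 1) _ H); apply: (pmean_le H) => x.
  have [xa|ax] := leP x a; first by rewrite step_left // subrr poisson_le1.
  apply: (@le_trans _ _ 1); first by rewrite gerBl step_ge0.
  by apply: tail_bound => //; rewrite ler_normr; apply/orP; left; lra.
Qed.

(* The infimum makes this function right-continuous, even though the limits
   of the means of [step a b] only determine the measure of (-oo, x] when x
   is not an atom. *)
Definition limit_cdf (x : R) : R := inf [set step_lim ab.1 ab.2 | ab in [set ab : R * R | x < ab.1 < ab.2]].

Lemma limit_cdf_le x a b : x < a -> a < b -> limit_cdf x <= step_lim a b.
Proof.
move=> xa ab; apply: ge_inf; last by exists (a, b) => //=; rewrite xa.
by exists 0 => _ [[a' b'] /= /andP[_ ab'] <-]; exact: step_lim_ge0.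
Qed.

Lemma limit_cdf_ge x l : (forall a b, x < a -> a < b -> l <= step_lim a b) -> l <= limit_cdf x.
Proof.
move=> h; apply: lb_le_inf; last by move=> _ [[a b] /= /andP[xa ab] <-]; exact: h.
by exists (step_lim (x + 1) (x + 2)), (x + 1, x + 2) => //=; lra.
Qed.

Lemma step_lim_cdf a b c : c < a -> a < b -> limit_cdf c <= step_lim a b <= limit_cdf b.
Proof.
move=> ca ab; rewrite limit_cdf_le //=; apply: limit_cdf_ge => a' b' ba ab'.
by apply: step_lim_mono => //; exact: ltW.
Qed.

Lemma limit_cdf_bounds x : 0 <= limit_cdf x <= 1.
Proof.
rewrite limit_cdf_ge /=; last by move=> a b _; exact: step_lim_ge0.
by apply: (le_trans (@limit_cdf_le _ (x + 1) (x + 2) _ _)); rewrite ?step_lim_le1 //; lra.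
Qed.

(** Right-continuity comes from the infimum over ramps strictly to the right of x, and the limits at
    both infinities from tightness through [step_lim_tails]. *)
Lemma limit_distribution : exists mu : probability R R, forall r, mu [set x | x <= r] = (limit_cdf r)%:E.
Proof.
have mono : nondecreasing_fun limit_cdf.
  move=> x y xy; apply: limit_cdf_ge => a b ya ab; apply: limit_cdf_le => //.
  exact: le_lt_trans ya.
apply: distribution_of_cdf => //.
- move=> x; apply/cvgrPdist_le => eps eps0.
  have : exists2 a, x < a & limit_cdf a <= limit_cdf x + eps.
    apply: contrapT => h; suff : limit_cdf x + eps <= limit_cdf x by lra.
    apply: limit_cdf_ge => a b xa ab; rewrite leNgt; apply/negP => h'.
    apply: h; exists ((x + a) / 2); first by lra.
    by apply: (le_trans (limit_cdf_le _ ab)); [lra|exact: ltW].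
  case=> a xa h; near=> y.
  have xy : x < y by near: y; exact: nbhs_right_gt.
  have ya : y < a by near: y; exact: nbhs_right_lt.
  have m1 := mono _ _ (ltW xy); have m2 := mono _ _ (ltW ya).
  by rewrite distrC ger0_norm ?subr_ge0 //; lra.
- apply/cvgrPdist_le => eps eps0; have [t t0 [h1 _]] := step_lim_tails eps0.
  near=> x; rewrite sub0r normrN; have /andP[l0 _] := limit_cdf_bounds x; rewrite ger0_norm //.
  have xt : x < - t - 2 by near: x; apply: nbhs_ninfty_lt; exact: num_real.
  by apply: (le_trans (@limit_cdf_le _ (- t - 2) (- t - 1) _ _)) => //; [|apply: h1]; lra.
- apply/cvgrPdist_le => eps eps0; have [t t0 [_ h2]] := step_lim_tails eps0.
  near=> x; have /andP[_ l1] := limit_cdf_bounds x; rewrite ger0_norm ?subr_ge0 //.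
  have xt : t < x by near: x; apply: nbhs_pinfty_gt; exact: num_real.
  suff : 1 - eps <= limit_cdf x by lra.
  by apply: limit_cdf_ge => a b xa ab; apply: h2 => //; lra.
Unshelve. all: by end_near. Qed.

End LimitDistribution.

(** * Piecewise linear interpolation and weak convergence *)

Section PiecewiseLinear.
Variable R : realType.
Implicit Types f : R -> R.

Lemma uniformly_continuous_segment f (a b eps : R) : continuous f -> 0 < eps ->
  exists2 dl, 0 < dl & forall x y, a <= x <= b -> `|x - y| < dl -> `|f x - f y| <= eps.
Proof.
move=> cf e0; have e2 : 0 < eps / 2 by rewrite divr_gt0.
have /compact_near_coveringP cK := @segment_compact R a b.
pose Pd (dl x : R) := forall y, `|x - y| < dl -> `|f x - f y| <= eps.
have := cK _ (0 : R)^'+ Pd _.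
case=> [x _|r /= r0 h].
  have /cvgrPdist_le /(_ _ e2) [r /= r0 hr] := cf x.
  have r2 : 0 < r / 2 by rewrite divr_gt0.
  exists ([set y | `|x - y| < r / 2], [set dl | dl < r / 2]) => /=.
    split; first by apply/nbhs_ballP; exists (r / 2).
    exact: nbhs_right_lt.
  move=> [x' dl] /= [hx hd] y hy.
  have h1 := hr x' _; have h2 := hr y _.
  have {}h1 : `|f x - f x'| <= eps / 2 by apply: h1 => /=; lra.
  have {}h2 : `|f x - f y| <= eps / 2.
    apply: h2 => /=; rewrite -(subrKA x') (le_lt_trans (ler_normD _ _)) //; lra.
  rewrite -(subrKA (f x)) (le_trans (ler_normD _ _)) // (distrC (f x')); lra.
exists (r / 2); first by rewrite divr_gt0.
move=> x y xab xy.
apply: (h (r / 2)) xy => //=.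
- by rewrite sub0r normrN gtr0_norm ?divr_gt0 //; lra.
- by rewrite divr_gt0.
Qed.

(** The piecewise linear interpolation of f at the nodes t0 + j h, constant outside them. It is
    written as a combination of ramps because the limiting means of ramps define [limit_cdf]. *)
Definition interpolant f (t0 h : R) (K : nat) (x : R) : R :=
  f t0 + \sum_(j < K) (f (t0 + j.+1%:R * h) - f (t0 + j%:R * h)) *
    (1 - step (t0 + j%:R * h) (t0 + j.+1%:R * h) x).

Lemma interpolantS f t0 h K x : interpolant f t0 h K.+1 x = interpolant f t0 h K x +
  (f (t0 + K.+1%:R * h) - f (t0 + K%:R * h)) * (1 - step (t0 + K%:R * h) (t0 + K.+1%:R * h) x).
Proof. by rewrite /interpolant big_ord_recr /= addrA. Qed.

Lemma node_lt (t0 h : R) (j : nat) : 0 < h -> t0 + j%:R * h < t0 + j.+1%:R * h.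
Proof. by move=> h0; rewrite ltrD2l ltr_pM2r // ltr_nat. Qed.

Lemma interpolant_left f t0 h K x : 0 < h -> x <= t0 -> interpolant f t0 h K x = f t0.
Proof.
move=> h0 xt; rewrite /interpolant big1 ?addr0 // => j _.
rewrite step_left ?subrr ?mulr0 ?node_lt //; apply: (le_trans xt).
by rewrite lerDl mulr_ge0 // ltW.
Qed.

Lemma interpolant_right f t0 h K x : 0 < h -> t0 + K%:R * h <= x -> interpolant f t0 h K x = f (t0 + K%:R * h).
Proof.
move=> h0; elim: K => [|K IH] xt; first by rewrite /interpolant big_ord0 addr0 mul0r addr0.
rewrite interpolantS IH; last by apply: le_trans xt; exact/ltW/node_lt.
by rewrite step_right ?node_lt // subr0 mulr1 addrC subrK.
Qed.

Lemma interpolant_close f t0 h K x eps : 0 < h -> t0 <= x <= t0 + K%:R * h ->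
  (forall y z, t0 <= y <= t0 + K%:R * h -> `|y - z| <= h -> `|f y - f z| <= eps) ->
  `|f x - interpolant f t0 h K x| <= 2 * eps.
Proof.
move=> h0; elim: K => [|K IH] /andP[tx xt] fe.
  have -> : x = t0 by apply/eqP; rewrite eq_le tx andbT; move: xt; rewrite mul0r addr0.
  rewrite /interpolant big_ord0 addr0 subrr normr0 mulr_ge0 //.
  by have := fe t0 t0; rewrite !subrr normr0 mul0r addr0 lexx (ltW h0) => /(_ isT isT).
have tK := node_lt t0 K h0.
have tK1 : t0 + K.+1%:R * h = t0 + K%:R * h + h by rewrite -natr1 mulrDl mul1r addrA.
have [xK|Kx] := leP x (t0 + K%:R * h).
  rewrite interpolantS step_left // subrr mulr0 addr0; apply: IH; first by rewrite tx.
  by move=> y z /andP[y1 y2]; apply: fe; rewrite y1 (le_trans y2) // ltW.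
rewrite interpolantS interpolant_right // ?(ltW Kx) // opprD addrA.
have tk0 : t0 <= t0 + K%:R * h by rewrite lerDl mulr_ge0 // ltW.
apply: (le_trans (ler_normB _ _)); rewrite (_ : 2 * eps = eps + eps); last by ring.
apply: lerD.
  by apply: fe; [rewrite tx|rewrite ger0_norm ?subr_ge0 ?(ltW Kx) //; lra].
rewrite normrM -[leRHS]mulr1; apply: ler_pM => //.
  apply: fe; first by rewrite lexx andbT (le_trans tk0) // ltW.
  by rewrite tK1 addrC addKr ger0_norm // ltW.
by rewrite ger0_norm ?subr_ge0 ?step_le1 // gerBl step_ge0.
Qed.

Lemma interpolant_error f t0 h K x eps c : 0 < h -> 1 <= K%:R * h -> (forall x, `|f x| <= c) ->
  (forall y z, t0 <= y <= t0 + K%:R * h -> `|y - z| <= h -> `|f y - f z| <= eps) ->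
  `|f x - interpolant f t0 h K x| <= 2 * eps + 2 * c *
    (step t0 (t0 + 1) x + (1 - step (t0 + K%:R * h - 1) (t0 + K%:R * h) x)).
Proof.
move=> h0 K1 fc fe.
have c0 : 0 <= c by exact: le_trans (normr_ge0 _) (fc 0).
have e0 : 0 <= eps.
  have := fe t0 t0; rewrite !subrr normr0 lexx (ltW h0) lerDl => H; apply: H => //; lra.
have s1 := step_ge0 t0 (t0 + 1) x; have s2 := step_le1 (t0 + K%:R * h - 1) (t0 + K%:R * h) x.
have out y z : `|f y - f z| <= 2 * c.
  by rewrite (le_trans (ler_normB _ _)) // mulr2n mulrDl mul1r lerD.
have [xt|tx] := ltP x t0.
  rewrite interpolant_left ?(ltW xt) // step_left ?ltrDl ?(ltW xt) //.
  apply: (le_trans (out _ _)); nra.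
have [Kx|xK] := ltP (t0 + K%:R * h) x.
  rewrite interpolant_right ?(ltW Kx) // (step_right (b := t0 + K%:R * h)) ?(ltW Kx) ?gtrBl //.
  apply: (le_trans (out _ _)); nra.
apply: (@le_trans _ _ (2 * eps)); first by apply: interpolant_close => //; rewrite tx.
by rewrite lerDl mulr_ge0 ?mulr_ge0 // addr_ge0 // subr_ge0.
Qed.

End PiecewiseLinear.

Section WeakLimit.
Variables (R : realType) (Q : R -> R -> R) (e0 : nat -> (R -> R) -> R).
Hypothesis Q_tight : forall eps : R, 0 < eps -> exists2 eta, 0 < eta & 1 - eta * Q 0 eta <= eps.
Hypothesis e0_seq : mean_sequence Q e0.
Local Notation L := (step_lim e0).
Local Notation F := (limit_cdf e0).
Variable mu : probability R R.
Hypothesis mu_cdf : forall r, mu [set x | x <= r] = (F r)%:E.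
Local Notation E := (expectation_mean mu).

Lemma continuous_dom f c : continuous f -> (forall x, `|f x| <= c) -> mdom E f.
Proof. by move=> cf fc; apply: (@bounded_integrable _ _ R mu f c) => //; exact: continuous_measurable_fun. Qed.

Lemma step_dom a b : a < b -> mdom E (step a b).
Proof.
move=> ab; apply: (continuous_dom (c := 1)); first exact: step_continuous.
by move=> x; rewrite ger0_norm ?step_ge0 ?step_le1.
Qed.

Lemma mean_half_line r : mdom E \1_[set x | x <= r] /\ E \1_[set x | x <= r] = F r.
Proof.
have m : measurable [set x : R | x <= r] by rewrite -set_itvNyc; exact: measurable_itv.
split; last first.
  rewrite /= /Rintegral (integral_indic mu measurableT m) setIT.
 by apply: (congr1 fine (y := (F r)%:E)); exact: mu_cdf.
apply: (@bounded_integrable _ _ R mu _ 1) => // x; rewrite indicE; case: (_ \in _); rewrite ?normr1 ?normr0 //.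
Qed.

Lemma mean_step a b : a < b -> F a <= E (step a b) <= F b.
Proof.
move=> ab; rewrite -(mean_half_line a).2 -(mean_half_line b).2; apply/andP; split; apply: mean_le;
  try exact: step_dom; try exact: (mean_half_line _).1; move=> x; rewrite indicE.
- case: (boolP (x \in _)) => [/[!inE] /= xa|_]; first by rewrite step_left.
  exact: step_ge0.
- case: (boolP (x \in _)) => [_|/negP]; first exact: step_le1.
  by rewrite inE /= => /negP; rewrite -ltNge => /ltW bx; rewrite step_right.
Qed.

Lemma step_lim_mean_close a b c : c < a -> a < b -> `|L a b - E (step a b)| <= F b - F c.
Proof.
move=> ca ab; have /andP[h1 h2] := step_lim_cdf Q_tight e0_seq ca ab.
have /andP[h3 h4] := mean_step ab.
have h5 : F c <= F a.
  by apply: limit_cdf_ge => x y ax xy; apply: (limit_cdf_le Q_tight e0_seq) => //; exact: lt_trans ax.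
by rewrite ler_norml; apply/andP; split; lra.
Qed.

(** Each window (t_j - h, t_(j+1)] covers two mesh cells, so the total mass is counted at most
    twice: two telescoping sums. *)
Lemma sum_cdf_increments (G : R -> R) t0 h K : 0 < h -> (forall x, 0 <= G x <= 1) ->
  \sum_(j < K) (G (t0 + j.+1%:R * h) - G (t0 + j%:R * h - h)) <= 2.
Proof.
move=> h0 G1; suff -> : \sum_(j < K) (G (t0 + j.+1%:R * h) - G (t0 + j%:R * h - h)) =
    G (t0 + K%:R * h) + G (t0 + K%:R * h - h) - (G t0 + G (t0 - h)).
  have [/andP[a1 a2] /andP[b1 b2]] := (G1 (t0 + K%:R * h), G1 (t0 + K%:R * h - h)).
  have [/andP[c1 c2] /andP[d1 d2]] := (G1 t0, G1 (t0 - h)).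
  lra.
elim: K => [|K IH]; first by rewrite big_ord0 mul0r addr0 subrr.
rewrite big_ord_recr /= IH (_ : t0 + K.+1%:R * h - h = t0 + K%:R * h); first by ring.
by rewrite -natr1; ring.
Qed.

Lemma mean_interpolant f t0 h K : 0 < h ->
  mdom E (interpolant f t0 h K) /\
  E (interpolant f t0 h K) = f t0 + \sum_(j < K) (f (t0 + j.+1%:R * h) - f (t0 + j%:R * h)) *
    (1 - E (step (t0 + j%:R * h) (t0 + j.+1%:R * h))).
Proof.
move=> h0.
pose g (j : 'I_K) x := (f (t0 + j.+1%:R * h) - f (t0 + j%:R * h)) *
    (1 - step (t0 + j%:R * h) (t0 + j.+1%:R * h) x).
have D1 (j : 'I_K) : mdom E (fun x => 1 - step (t0 + j%:R * h) (t0 + j.+1%:R * h) x).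
  by apply: mdomB; [exact: mdom_cst|apply: step_dom; exact: node_lt].
have D2 j : mdom E (g j) by exact: mdomZ.
rewrite (_ : interpolant f t0 h K = fun x => f t0 + \sum_j g j x) //; split.
  by apply: mdomD; [exact: mdom_cst|exact: mdom_sum].
rewrite (meanD (mdom_cst E (f t0)) (mdom_sum D2)) mean_cst mean_sum //; congr (_ + _).
apply: eq_bigr => j _; rewrite (meanZ _ (D1 j)); congr (_ * _).
rewrite (_ : (fun x => _) = fun x => 1 + (-1) * step (t0 + j%:R * h) (t0 + j.+1%:R * h) x); last first.
  by apply/funext => x; rewrite mulN1r.
have S := step_dom (node_lt t0 j h0).
by rewrite (meanD (mdom_cst E 1) (mdomZ _ S)) mean_cst (meanZ _ S) mulN1r.
Qed.

Lemma pmean_interpolant (e : (R -> R) -> R) f t0 h K : positive_mean e ->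
  e (interpolant f t0 h K) = f t0 + \sum_(j < K) (f (t0 + j.+1%:R * h) - f (t0 + j%:R * h)) *
    (1 - e (step (t0 + j%:R * h) (t0 + j.+1%:R * h))).
Proof.
move=> H; rewrite /interpolant (pmeanD H (fun=> f t0)) (pmean_cst _ H); congr (_ + _).
rewrite (pmean_sum _ (fun j : 'I_K => _) H); apply: eq_bigr => j _.
by rewrite (pmeanZ H _ (fun x => 1 - step _ _ x)) (pmeanB (fun=> 1) _ H) (pmean1 H).
Qed.

(** For a single ramp the limiting mean and the mean under mu may differ by a fixed amount, because
    of atoms. The discrepancies add up to at most 2 over all ramps, and each is multiplied by an
    increment of f of size at most eps. *)
Lemma interpolant_limit_close f t0 h K eps : 0 < h ->
  (forall y z, t0 <= y <= t0 + K%:R * h -> `|y - z| <= h -> `|f y - f z| <= eps) ->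
  `|(f t0 + \sum_(j < K) (f (t0 + j.+1%:R * h) - f (t0 + j%:R * h)) *
      (1 - L (t0 + j%:R * h) (t0 + j.+1%:R * h))) - E (interpolant f t0 h K)| <= 2 * eps.
Proof.
move=> h0 fe; rewrite (mean_interpolant f t0 K h0).2 opprD addrACA subrr add0r -sumrB.
apply: (le_trans (ler_norm_sum _ _ _)).
have e_ge0 : 0 <= eps.
  have := fe t0 t0; rewrite !subrr normr0 lexx (ltW h0) lerDl => H; apply: H => //.
  by rewrite mulr_ge0 // ltW.
apply: (@le_trans _ _ (\sum_(j < K) eps * (F (t0 + j.+1%:R * h) - F (t0 + j%:R * h - h)))).
  apply: ler_sum => j _; rewrite -mulrBr normrM; apply: ler_pM => //.
    rewrite distrC; apply: fe; last first.
      by rewrite -natr1 mulrDl mul1r addrA opprD addNKr normrN ger0_norm // ltW.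
    have j0 : 0 <= j%:R * h by rewrite mulr_ge0 // ltW.
    by rewrite lerDl j0 lerD2l ler_pM2r // ler_nat ltnW.
  rewrite (_ : forall u v : R, 1 - u - (1 - v) = v - u) 1?distrC; last by move=> u v; ring.
  apply: step_lim_mean_close; last exact: node_lt.
  by rewrite gtrBl.
rewrite -mulr_sumr [leRHS]mulrC ler_wpM2l //; apply: sum_cdf_increments => // x.
exact: (limit_cdf_bounds Q_tight e0_seq).
Qed.

Lemma mean_tails dl t0 : 0 < dl ->
  (forall a b, a < b -> b <= - t0 -> L a b <= dl) -> (forall a b, a < b -> t0 <= a -> 1 - dl <= L a b) ->
  E (step (- t0 - 3) (- t0 - 2)) <= dl /\ 1 - dl <= E (step (t0 + 2) (t0 + 3)).
Proof.
move=> d0 h1 h2; split.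
  have ab : - t0 - 3 < - t0 - 2 by lra.
  have /andP[_ H] := mean_step ab; apply: (le_trans H).
  by apply: (le_trans (limit_cdf_le Q_tight e0_seq (_ : _ < - t0 - 1) (_ : - t0 - 1 < - t0))); [lra|lra|apply: h1; lra].
have ab : t0 + 2 < t0 + 3 by lra.
have /andP[H _] := mean_step ab; apply: le_trans H.
by apply: limit_cdf_ge => a b ha hab; apply: h2 => //; lra.
Qed.

Theorem mean_weak_limit e f c : mean_sequence Q e -> continuous f -> (forall x, `|f x| <= c) ->
  e n f @[n --> \oo] --> E f.
Proof.
move=> es cf fc0.
have [c' c1 fc] : exists2 c', 0 < c' & forall x, `|f x| <= c'.
  exists (c + 1); first by rewrite ltr_wpDl // (le_trans _ (fc0 0)).
  by move=> x; rewrite (le_trans (fc0 x)) // lerDl.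
apply/cvgrPdist_le => eps0 eps0_gt0.
(* The final estimate adds errors of 4, 1, 2 and 4 times eps. *)
pose eps := eps0 / 16; have eps_gt0 : 0 < eps by rewrite divr_gt0.
pose dl := eps / (4 * c').
have dl0 : 0 < dl by rewrite divr_gt0 // mulr_gt0.
have dlc : 4 * c' * dl = eps by rewrite /dl mulrC divfK // gt_eqF // mulr_gt0.
have [t t_gt0 [T1 T2]] := step_lim_tails Q_tight e0_seq dl0.
pose a := - t - 3; pose b := t + 3.
have [r r0 hr] := @uniformly_continuous_segment R f a b eps cf eps_gt0.
pose K := (Num.bound ((b - a) / r)).+1; pose h := (b - a) / K%:R.
have KR : 0 < K%:R :> R by rewrite ltr0n.
have ab : 1 <= b - a by rewrite /a /b; lra.
have ab0 : 0 < b - a by exact: lt_le_trans ab.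
have h0 : 0 < h by rewrite divr_gt0.
have hK : K%:R * h = b - a by rewrite /h mulrC divfK // gt_eqF.
have hlt : h < r.
  rewrite ltr_pdivrMr // mulrC -ltr_pdivrMr //; apply: (lt_le_trans (archi_boundP _)).
    by rewrite divr_ge0 // ltW.
  by rewrite ler_nat.
have aK : a + K%:R * h = b by rewrite hK addrC subrK.
have fe y z : a <= y <= a + K%:R * h -> `|y - z| <= h -> `|f y - f z| <= eps.
  by rewrite aK => yab yz; apply: hr => //; exact: le_lt_trans hlt.
have K1 : 1 <= K%:R * h by rewrite hK.
pose g := interpolant f a h K.
pose bd x := 2 * eps + 2 * c' * (step a (a + 1) x + (1 - step (b - 1) b x)).
have fg x : `|f x - g x| <= bd x.
  by have := @interpolant_error R f a h K x eps c' h0 K1 fc fe; rewrite aK.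
have s1 : a < a + 1 by rewrite ltrDl.
have s2 : b - 1 < b by rewrite gtrBl.
have l1 : L a (a + 1) <= dl by apply: T1 => //; rewrite /a; lra.
have l2 : 1 - dl <= L (b - 1) b by apply: T2 => //; rewrite /b; lra.
have [m1 m2] := mean_tails dl0 T1 T2.
rewrite (_ : - t - 2 = a + 1) -/a in m1; last by rewrite /a; ring.
rewrite (_ : t + 2 = b - 1) -/b in m2; last by rewrite /b; ring.
have df : mdom E f by exact: continuous_dom cf fc.
have dg := (mean_interpolant f a K h0).1.
have D1 := step_dom s1; have D2 := step_dom s2.
have E1 : bd = fun x => (2 * eps + 2 * c') + (2 * c' * step a (a + 1) x + (- (2 * c')) * step (b - 1) b x).
  by apply/funext => x; rewrite /bd; ring.
have Dbd : mdom E bd.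
  by rewrite E1; exact: (mdomD (mdom_cst E _) (mdomD (mdomZ _ D1) (mdomZ _ D2))).
have tail_scalar (u v : R) : u <= 2 * dl -> 1 - 2 * dl <= v ->
    2 * eps + 2 * c' + (2 * c' * u + - (2 * c') * v) <= 4 * eps.
  move=> u1 v1; have : 2 * c' * (u - v) <= 2 * c' * (4 * dl - 1).
    by rewrite ler_wpM2l ?mulr_ge0 ?(ltW c1) //; lra.
  by lra.
have Ebd : E bd <= 4 * eps.
  rewrite E1 (meanD (mdom_cst E _) (mdomD (mdomZ _ D1) (mdomZ _ D2))) mean_cst.
  rewrite (meanD (mdomZ _ D1) (mdomZ _ D2)) (meanZ _ D1) (meanZ _ D2).
  by apply: tail_scalar; lra.
have d4 : `|E f - E g| <= 4 * eps.
  have up := mean_le df (mdomD dg Dbd) (fun x => _).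
  have lo := mean_le dg (mdomD df Dbd) (fun x => _).
  rewrite (meanD dg Dbd) in up; rewrite (meanD df Dbd) in lo.
  have {}up : E f <= E g + E bd.
    by apply: up => x; have := fg x; rewrite /g ler_norml lerBlDr [bd x + _]addrC => /andP[].
  have {}lo : E g <= E f + E bd.
    by apply: lo => x; have := fg x; rewrite /g distrC ler_norml lerBlDr [bd x + _]addrC => /andP[].
  by rewrite ler_norml; apply/andP; split; lra.
have d3 := interpolant_limit_close h0 fe.
have cg : e n g @[n --> \oo] --> f a + \sum_(j < K) (f (a + j.+1%:R * h) - f (a + j%:R * h)) *
      (1 - L (a + j%:R * h) (a + j.+1%:R * h)).
  rewrite (_ : (fun n => e n g) = fun n => f a + \sum_(j < K) (f (a + j.+1%:R * h) - f (a + j%:R * h)) *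
    (1 - e n (step (a + j%:R * h) (a + j.+1%:R * h)))); last first.
    by apply/funext => n; rewrite pmean_interpolant //; exact: es.1.
  apply: cvgD; first exact: cvg_cst.
  apply: cvg_sumr => j; apply: cvgMr; apply: cvgB; first exact: cvg_cst.
  by apply: (step_lim_cvg Q_tight e0_seq) es; exact: node_lt.
have /cvgrPdist_le /(_ _ eps_gt0) h2 := cg.
have /cvgrPdist_le /(_ _ dl0) h3 := step_lim_cvg Q_tight e0_seq s1 es.
have /cvgrPdist_le /(_ _ dl0) h4 := step_lim_cvg Q_tight e0_seq s2 es.
near=> n; have H := es.1 n.
have d1 := pmean_dist H fg.
have d2 : `|f a + \sum_(j < K) (f (a + j.+1%:R * h) - f (a + j%:R * h)) *
      (1 - L (a + j%:R * h) (a + j.+1%:R * h)) - e n g| <= eps by near: n; exact: h2.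
have u1 : `|L a (a + 1) - e n (step a (a + 1))| <= dl by near: n; exact: h3.
have u2 : `|L (b - 1) b - e n (step (b - 1) b)| <= dl by near: n; exact: h4.
have {}d1 : `|e n f - e n g| <= 4 * eps.
  apply: (le_trans d1); rewrite E1 (pmeanD H (fun=> _)) (pmean_cst _ H).
  rewrite (pmeanD H (fun x => 2 * c' * step a (a + 1) x) (fun x => - (2 * c') * step (b - 1) b x)).
  rewrite (pmeanZ H _ (step a (a + 1))) (pmeanZ H _ (step (b - 1) b)).
  move: u1 u2; rewrite !ler_norml => /andP[u1 u1'] /andP[u2 u2'].
  by apply: tail_scalar; lra.
move: d1 d2 d3 d4 (erefl eps); rewrite -/g /eps.
move: (f a + _) (e n f) (e n g) (E f) (E g) => x1 x2 x3 x4 x5.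
rewrite !ler_norml => /andP[a1 a1'] /andP[a2 a2'] /andP[a3 a3'] /andP[a4 a4'] _.
by apply/andP; split; lra.
Unshelve. all: by end_near. Qed.

End WeakLimit.

(** * The limiting spectral measure *)

Section ResolventTrace.
Variable R : realType.
Local Notation C := R[i].

Lemma diag_conj_resolvent (F : fieldType) n (A U : 'M[F]_n) (d : 'rV[F]_n) (z : F) :
  U \in unitmx -> A = invmx U *m diag_mx d *m U -> (forall i, d 0 i != z) ->
  \tr (invmx (A - z%:M)) = \sum_i (d 0 i - z)^-1.
Proof.
move=> uU -> dz; pose e := \row_i (d 0 i - z)^-1.
have uN : \tr (diag_mx e) = \sum_i (d 0 i - z)^-1.
  by rewrite mxtrace_diag; apply: eq_bigr => i _; rewrite mxE.
rewrite -{}uN.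
have E : (invmx U *m diag_mx d *m U - z%:M) *m (invmx U *m diag_mx e *m U) = 1%:M.
  have -> : invmx U *m diag_mx d *m U - z%:M = invmx U *m diag_mx (d - const_mx z) *m U.
    by rewrite raddfB /= diag_const_mx mulmxBr mulmxBl mul_mx_scalar -scalemxAl mulVmx // scalemx1.
  rewrite !mulmxA (mulmxK uU).
  have -> : invmx U *m diag_mx (d - const_mx z) *m diag_mx e = invmx U.
    rewrite -mulmxA mulmx_diag (_ : \row_j _ = const_mx 1) ?diag_const_mx ?mulmx1 //.
    by apply/matrixP => i j; rewrite !mxE mulfV // subr_eq0.
  by rewrite mulVmx.
have [u1 u2] := mulmx1_unit E.
have -> : invmx (invmx U *m diag_mx d *m U - z%:M) = invmx U *m diag_mx e *m U.
  by rewrite -[LHS]mulmx1 -E mulKmx.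
by rewrite mxtrace_mulC mulmxA mulmxV // mul1mx.
Qed.

Lemma tr_resolvent n (A : 'M[R]_n) (z : C) : A^T = A -> 0 < complex.Im z ->
  \tr (resolvent A z) = \sum_(k < n) ((nth 0 (eigenvalues A) k)%:C - z)^-1.
Proof.
move=> As z0.
have herm : toC A \is hermsymmx.
  by rewrite is_hermitianmxE expr0 scale1r -[X in _ == X]/((toC A) ^t*) toC_herm.
have /orthomx_spectralP Aeq := hermitian_normalmx herm.
have real := hermitian_spectral_diag_real herm.
have re i : spectral_diag (toC A) 0 i = (complex.Re (spectral_diag (toC A) 0 i))%:C.
  have := mxOverP real 0 i; case: (spectral_diag _ _ _) => x y.
  by rewrite complex_real /= => /eqP ->.
rewrite /resolvent (diag_conj_resolvent (spectral_unit _) Aeq); last first.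
  by move=> i; apply/eqP => H; move: z0; rewrite -H re ltxx.
apply: eq_bigr => k _; congr (_ - _)^-1; rewrite re /eigenvalues.
by rewrite (nth_map k) ?size_enum_ord // nth_ord_enum.
Qed.

Lemma tr_partial_trace p m (X : 'M[C]_(p * m)) : \tr (partial_trace X) = m%:R^-1 * \tr X.
Proof.
rewrite /mxtrace; under eq_bigr do rewrite mxE.
rewrite -mulr_sumr; congr (_ * _).
rewrite (reindex (@mxtens_index p m)) /=; last first.
  by exists (@mxtens_unindex p m) => k _; rewrite ?mxtens_indexK ?mxtens_unindexK.
by rewrite pair_bigA; apply: eq_bigr => -[i k].
Qed.

Lemma tr_matrix_stieltjes p m (A : 'M[R]_(p * m)) (z : C) : A^T = A -> 0 < complex.Im z ->
  p%:R^-1 * \tr (matrix_stieltjes A z) =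
  ((p * m)%:R^-1 : R)%:C * \sum_(k < p * m) ((nth 0 (eigenvalues A) k)%:C - z)^-1.
Proof.
move=> As z0; rewrite /matrix_stieltjes tr_partial_trace tr_resolvent // mulrA.
by rewrite fmorphV rmorph_nat natrM invfM.
Qed.

Definition spectral_mean N (A : 'M[R]_N) (f : R -> R) : R :=
  N%:R^-1 * \sum_(k < N) f (nth 0 (eigenvalues A) k).

Lemma spectral_mean_positive N (A : 'M[R]_N) : (0 < N)%N -> positive_mean (spectral_mean A).
Proof.
move=> N0; split; rewrite /spectral_mean => *.
- by rewrite big_split mulrDr.
- by rewrite -mulr_sumr mulrCA.
- by rewrite sumr_const card_ord mulVf // pnatr_eq0 -lt0n.
- by rewrite ler_wpM2l ?invr_ge0 // ler_sum.
Qed.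

Lemma empirical_integral_ge0 N (A : 'M[R]_N) (f : R -> \bar R) : measurable_fun setT f ->
  (forall x, 0 <= f x)%E ->
  (\int[empirical_spectral_measure A]_x f x = (N%:R^-1)%:E * \sum_(k < N) f (nth 0%R (eigenvalues A) k))%E.
Proof.
move=> mf f0; rewrite ge0_integral_mscale //= ge0_integral_measure_sum //; congr (_ * _)%E.
by apply: eq_bigr => k _; rewrite integral_dirac // diracT mul1e.
Qed.

Lemma empirical_Rintegral N (A : 'M[R]_N) (f : R -> R) : measurable_fun setT f ->
  \int[empirical_spectral_measure A]_x f x = spectral_mean A f.
Proof.
move=> mf; rewrite /Rintegral integralE.
have mE : measurable_fun setT (EFin \o f) by exact/measurable_EFinP.
rewrite !empirical_integral_ge0 //; try exact: measurable_funepos; try exact: measurable_funeneg.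
under eq_bigr do rewrite funeposE -EFin_max.
under [X in (_ - _ * X)%E]eq_bigr do rewrite funenegE -EFin_max.
rewrite !sumEFin -!EFinM -EFinB /= -mulrBr -sumrB; congr (_ * _); apply: eq_bigr => k _.
by case: (ltgtP (f _) 0) => h; rewrite /Num.max ?oppr_lt0; do ?case: ifPn; rewrite -?leNgt; lra.
Qed.

End ResolventTrace.

Section ResolventKernel.
Variable R : realType.
Local Notation C := R[i].
Local Notation nc := (@ComplexField.Normc.normc R).

Lemma Im_real_sub (x : R) (z : C) : complex.Im (x%:C - z) = - complex.Im z.
Proof. by rewrite ImD ImN /= sub0r. Qed.

Lemma Im_inv_poisson (t eta x : R) : complex.Im ((x%:C - (t +i* eta))^-1) = poisson t eta x.
Proof. by rewrite /poisson /= !sub0r sqrrN mulNr opprK. Qed.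

Lemma nc_inv_real_sub (x : R) (z : C) : 0 < complex.Im z -> nc (x%:C - z)^-1 <= (complex.Im z)^-1.
Proof.
move=> z0; apply: (le_trans (inv_le_nc _)); rewrite Im_real_sub ?oppr_eq0 ?gt_eqF //.
by rewrite normrN gtr0_norm.
Qed.

Lemma inv_real_sub_lipschitz (x y : R) (z : C) : 0 < complex.Im z ->
  nc ((x%:C - z)^-1 - (y%:C - z)^-1) <= (complex.Im z)^-2 * `|x - y|.
Proof.
move=> z0.
have nz u : u%:C - z != 0 by apply/eqP => H; have := Im_real_sub u z; rewrite H /=; lra.
have -> : (x%:C - z)^-1 - (y%:C - z)^-1 = (x%:C - z)^-1 * (y%:C - z)^-1 * (y - x)%:C.
  by rewrite raddfB /=; field; rewrite !nz.
rewrite !ncM nc_real distrC -exprVn expr2 ler_wpM2r // ler_pM ?nc_ge0 ?nc_inv_real_sub //.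
Qed.

Lemma Re_kernel_props z : 0 < complex.Im z ->
  continuous (fun x : R => complex.Re ((x%:C - z)^-1)) /\
  forall x : R, `|complex.Re ((x%:C - z)^-1)| <= (complex.Im z)^-1.
Proof.
move=> z0; split; last by move=> x; exact: le_trans (nc_Re _) (nc_inv_real_sub x z0).
apply: (@lipschitz_continuous _ _ ((complex.Im z)^-2)); first by rewrite invr_ge0 sqr_ge0.
by move=> x y; rewrite -ReN -ReD; exact: le_trans (nc_Re _) (inv_real_sub_lipschitz x y z0).
Qed.

Lemma Im_kernel_props z : 0 < complex.Im z ->
  continuous (fun x : R => complex.Im ((x%:C - z)^-1)) /\
  forall x : R, `|complex.Im ((x%:C - z)^-1)| <= (complex.Im z)^-1.
Proof.
move=> z0; split; last by move=> x; exact: le_trans (nc_Im _) (nc_inv_real_sub x z0).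
apply: (@lipschitz_continuous _ _ ((complex.Im z)^-2)); first by rewrite invr_ge0 sqr_ge0.
by move=> x y; rewrite -ImN -ImD; exact: le_trans (nc_Im _) (inv_real_sub_lipschitz x y z0).
Qed.

End ResolventKernel.

Section SpectralLimit.
Variables (R : realType) (p : nat) (m : nat -> nat).
Local Notation C := R[i].
Hypothesis p_gt0 : (0 < p)%N.
Hypothesis m_gt0 : forall n, (0 < m n)%N.
Variable M : C -> 'M[C]_p.
Variable B : R.
Hypothesis M_decay : forall eta, 1 <= eta -> fnorm ((0 +i* eta) *: M (0 +i* eta) - - 1%:M) <= B * eta^-1.
Local Notation mt z := ((p%:R^-1 : R)%:C * \tr (M z)).
Let Q (t eta : R) : R := complex.Im (mt (t +i* eta)).

(** The normalization of M at infinity, read on the imaginary axis: eta Q(0, eta) tends to 1, so no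
    mass escapes. *)
Lemma trace_tight (eps : R) : 0 < eps -> exists2 eta, 0 < eta & 1 - eta * Q 0 eta <= eps.
Proof.
move=> e0; pose eta := Num.max 1 (B / eps).
have e1 : 1 <= eta by rewrite le_max lexx.
have eta0 : 0 < eta by exact: lt_le_trans e1.
exists eta => //.
have h : B * eta^-1 <= eps by rewrite ler_pdivrMr // mulrC -ler_pdivrMr // le_max lexx orbT.
apply: le_trans h; apply: le_trans (M_decay e1).
pose X : 'M[C]_p := (0 +i* eta) *: M (0 +i* eta) - - 1%:M.
rewrite -[X in fnorm X]/X.
have P0 : 0 < p%:R :> R by rewrite ltr0n.
have -> : 1 - eta * Q 0 eta = p%:R^-1 * complex.Re (\tr X).
  rewrite /X opprK mxtraceD mxtraceZ mxtrace1 ReD /Q ImZ ReM /= mul0r sub0r.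
  rewrite (_ : complex.Re (p%:R : C) = p%:R) ?mulrDr ?mulVf ?gt_eqF //; first by ring.
  by rewrite -(rmorph_nat (real_complex R)).
rewrite ler_pdivrMl // /mxtrace Re_sum.
have -> : p%:R * fnorm X = \sum_(i < p) fnorm X by rewrite sum_cst card_ord.
by apply: ler_sum => i _; apply: le_trans (fnorm_entry X i i); exact: le_trans (ler_norm _) (nc_Re _).
Qed.

Definition spectral_cvg (A : forall n, 'M[R]_(p * m n)) :=
  (forall n, (A n)^T = A n) /\ forall z, 0 < complex.Im z ->
  fnorm (matrix_stieltjes (A n) z - M z) @[n --> \oo] --> (0 : R).

Lemma spectral_cvg_kernels A z : spectral_cvg A -> 0 < complex.Im z ->
  spectral_mean (A n) (fun x : R => complex.Re ((x%:C - z)^-1)) @[n --> \oo] --> complex.Re (mt z) /\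
  spectral_mean (A n) (fun x : R => complex.Im ((x%:C - z)^-1)) @[n --> \oo] --> complex.Im (mt z).
Proof.
move=> [As h] z0; have cv := h z z0.
have E n : (((p * m n)%:R^-1 : R)%:C * \sum_(k < p * m n) ((nth 0 (eigenvalues (A n)) k)%:C - z)^-1) =
   (p%:R^-1 : R)%:C * \tr (matrix_stieltjes (A n) z).
  by rewrite -tr_matrix_stieltjes // fmorphV rmorph_nat.
split.
- rewrite (_ : (fun n => _) = fun n => p%:R^-1 * \sum_i complex.Re (matrix_stieltjes (A n) z i i)); last first.
    by apply/funext => n; have := congr1 (@complex.Re R) (E n); rewrite !ReZ !Re_sum.
  rewrite ReZ Re_sum; apply: cvgMr; apply: cvg_sumr => i.
  exact: (cvg_fnorm_entry i i cv).1.
- rewrite (_ : (fun n => _) = fun n => p%:R^-1 * \sum_i complex.Im (matrix_stieltjes (A n) z i i)); last first.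
    by apply/funext => n; have := congr1 (@complex.Im R) (E n); rewrite !ImZ !Im_sum.
  rewrite ImZ Im_sum; apply: cvgMr; apply: cvg_sumr => i.
  exact: (cvg_fnorm_entry i i cv).2.
Qed.

Lemma spectral_mean_sequence A : spectral_cvg A -> mean_sequence Q (fun n => spectral_mean (A n)).
Proof.
move=> h; split=> [n|t eta eta0]; first by apply: spectral_mean_positive; rewrite muln_gt0 p_gt0 m_gt0.
have := (@spectral_cvg_kernels A (t +i* eta) h eta0).2.
rewrite (_ : (fun x : R => complex.Im ((x%:C - (t +i* eta))^-1)) = poisson t eta) //.
by apply/funext => x; exact: Im_inv_poisson.
Qed.

(** mu is built along the single realization [A0]. Since Q is read off from M, every realization
    with the same limit M has the same weak limit. *)
Lemma limit_spectral_measure A0 : spectral_cvg A0 -> exists mu : probability R R,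
  (forall A, spectral_cvg A -> weak_cvg (fun n => empirical_spectral_measure (A n)) mu) /\
  forall z, 0 < complex.Im z -> stieltjes mu z = mt z.
Proof.
move=> h0; have s0 := spectral_mean_sequence h0.
have [mu mu_cdf] := limit_distribution trace_tight s0.
have W A (f : R -> R) c : spectral_cvg A -> continuous f -> (forall x, `|f x| <= c) ->
    spectral_mean (A n) f @[n --> \oo] --> \int[mu]_x f x.
  move=> hA cf fc.
  exact: (mean_weak_limit trace_tight s0 mu_cdf (spectral_mean_sequence hA) cf fc).
exists mu; split.
  move=> A hA f cf [c fc].
  rewrite (_ : (fun n => _) = fun n => spectral_mean (A n) f); first exact: W hA cf fc.
  by apply/funext => n; rewrite empirical_Rintegral //; exact: continuous_measurable_fun.
move=> z z0; have [c1 c2] := spectral_cvg_kernels h0 z0.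
have [r1 r2] := Re_kernel_props z0; have [i1 i2] := Im_kernel_props z0.
rewrite /stieltjes /integralC; apply: complex_eq.
- exact: cvg_unique (W _ _ _ h0 r1 r2) c1.
- exact: cvg_unique (W _ _ _ h0 i1 i2) c2.
Qed.

End SpectralLimit.

(** * Compactness of the support *)

Section CompactSupport.
Variables (R : realType) (mu : probability R R) (m : R[i] -> R[i]).
Hypothesis mu_stieltjes : forall z, 0 < complex.Im z -> stieltjes mu z = m z.
Variables (K0 c : R).
Hypothesis c_ge0 : 0 <= c.
Hypothesis m_small : forall x eta : R, K0 < `|x| -> 0 < eta -> eta <= 1 ->
  complex.Im (m (x +i* eta)) <= c * eta.
Local Notation E := (expectation_mean mu).

Lemma poisson_dom t eta : 0 < eta -> mdom E (poisson t eta).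
Proof.
move=> e0; have [i1 i2] := @Im_kernel_props R (t +i* eta) e0.
have := continuous_dom mu i1 i2; rewrite (_ : (fun _ => _) = poisson t eta) //.
by apply/funext => x; exact: Im_inv_poisson.
Qed.

Lemma mean_poisson t eta : 0 < eta -> E (poisson t eta) = complex.Im (m (t +i* eta)).
Proof.
move=> e0; rewrite -mu_stieltjes //.
rewrite -[RHS]/(\int[mu]_x complex.Im ((x%:C - (t +i* eta))^-1)) -[LHS]/(\int[mu]_x poisson t eta x).
by congr (Rintegral _ _ _); apply/funext => x; rewrite Im_inv_poisson.
Qed.

(** A kernel of height h = 1/N is at least 1 / (2 h) at distance at most h from its centre, and
    every point of the interval is that close to a node; the weight 2 / N makes this one term at
    least 1. *)
Lemma poisson_cover (a x : R) (N : nat) : (0 < N)%N -> a <= x <= a + 1 ->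
  1 <= \sum_(j < N) 2 * N%:R^-1 * poisson (a + j%:R / N%:R) N%:R^-1 x.
Proof.
move=> N0 /andP[ax xa]; have NR : 0 < N%:R :> R by rewrite ltr0n.
(* The minimum matters at the right endpoint x = a + 1, which belongs to the last node. *)
pose k := minn (Num.truncn ((x - a) * N%:R)) N.-1.
have kN : (k < N)%N by rewrite -(prednK N0) ltnS geq_minr.
pose h : R := N%:R^-1; have h0 : 0 < h by rewrite invr_gt0.
rewrite (bigD1 (Ordinal kN)) //= -[leLHS]addr0; apply: lerD; last first.
  by apply: sumr_ge0 => j _; rewrite mulr_ge0 ?poisson_ge0 ?mulr_ge0 ?invr_ge0.
have hk : `|x - (a + k%:R / N%:R)| <= h.
  have y0 : 0 <= (x - a) * N%:R by rewrite mulr_ge0 ?subr_ge0.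
  have -> : x - (a + k%:R / N%:R) = ((x - a) * N%:R - k%:R) * h by rewrite /h; field; rewrite gt_eqF.
  rewrite normrM (gtr0_norm h0) ler_piMl ?(ltW h0) //.
  have /andP[t1 t2] := truncn_itv y0.
  have yN : (x - a) * N%:R <= N%:R by rewrite ler_piMl //; lra.
  rewrite /k; have [tN|tN] := leqP (Num.truncn ((x - a) * N%:R)) N.-1.
    rewrite ger0_norm ?subr_ge0 // lerBlDl natr1; exact: ltW.
  have NT : N%:R <= (x - a) * N%:R.
    by have := tN; rewrite prednK // => tN1; apply: le_trans t1; rewrite ler_nat.
  have -> : (x - a) * N%:R = N%:R by apply/eqP; rewrite eq_le yN.
  rewrite -natrB ?leq_pred // -{1}(prednK N0) subSnn normr1.
  exact: lexx.
rewrite -/h /poisson; move: (x - _) hk => s hs.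
have hs2 : s ^+ 2 <= h ^+ 2 by rewrite -[s ^+ 2](real_normK (num_real s)) ler_pXn2r ?nnegrE ?(ltW h0).
have q0 : 0 < s ^+ 2 + h ^+ 2 by rewrite ltr_wpDl ?sqr_ge0 ?exprn_gt0.
rewrite mulrA ler_pdivlMr // mul1r -mulrA -expr2; lra.
Qed.

(** N kernels of height 1/N cover the interval, each with weight 2 / N and mean at most c / N. The
    total 2 c / N tends to 0. *)
Lemma mean_unit_interval (a : R) : (forall x, a <= x <= a + 1 -> K0 < `|x|) -> mu [set x | a <= x <= a + 1] = 0%E.
Proof.
move=> ha; set S := [set x | _].
have mS : measurable S by rewrite /S -set_itvcc; exact: measurable_itv.
have D : mdom E \1_S.
  by apply: (@bounded_integrable _ _ R mu _ 1) => // x; rewrite indicE; case: (_ \in _); rewrite ?normr1 ?normr0.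
have ES : E \1_S = fine (mu S) by rewrite /= /Rintegral (integral_indic mu measurableT mS) setIT.
have bound N : (0 < N)%N -> E \1_S <= 2 * c / N%:R.
  move=> N0; have NR : 0 < N%:R :> R by rewrite ltr0n.
  have h0 : 0 < N%:R^-1 :> R by rewrite invr_gt0.
  pose g (j : 'I_N) x := 2 * N%:R^-1 * poisson (a + j%:R / N%:R) N%:R^-1 x.
  have Dg j : mdom E (g j) by apply: mdomZ; exact: poisson_dom.
  apply: (@le_trans _ _ (E (fun x => \sum_j g j x))).
    apply: mean_le => //; first exact: mdom_sum.
    move=> x; rewrite indicE; case: (boolP (x \in S)) => [/[!inE] xS|_]; first exact: poisson_cover.
    by apply: sumr_ge0 => j _; rewrite mulr_ge0 ?poisson_ge0 ?mulr_ge0 ?invr_ge0 ?ler0n.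
  rewrite mean_sum //.
  have -> : 2 * c / N%:R = \sum_(j < N) 2 * N%:R^-1 * (c * N%:R^-1).
    by rewrite sum_cst card_ord; field; rewrite gt_eqF.
  apply: ler_sum => j _; rewrite /g (meanZ _ (poisson_dom _ h0)) ler_wpM2l ?mulr_ge0 ?(ltW h0) //.
  rewrite mean_poisson //; apply: m_small => //.
    apply: ha; rewrite lerDl divr_ge0 //= lerD2l ler_pdivrMr // mul1r ler_nat; exact: ltnW.
  by rewrite invf_le1 // ler1n.
have E0 : 0 <= E \1_S.
  by rewrite ES fine_ge0.
have {}E0 : E \1_S = 0.
  apply/eqP; rewrite eq_le E0 andbT; apply/ler_addgt0Pr => e e0; rewrite add0r.
  pose N := (Num.bound (2 * c / e)).+1.
  apply: (le_trans (bound N isT)); rewrite ler_pdivrMr ?ltr0n // [leRHS]mulrC -ler_pdivrMr //.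
  apply/ltW/(lt_le_trans (archi_boundP _)); first by rewrite divr_ge0 ?mulr_ge0 // ltW.
  by rewrite ler_nat.
by move: E0; rewrite ES => /eqP; rewrite fine_eq0 ?fin_num_measure // => /eqP.
Qed.

Lemma stieltjes_compactly_supported : compactly_supported mu.
Proof.
exists [set x : R | - (K0 + 1) <= x <= K0 + 1].
  by rewrite -set_itvcc; exact: segment_compact.
pose F (k : nat) : set R := [set x | K0 + 1 + k%:R <= x <= K0 + 1 + k%:R + 1].
pose G (k : nat) : set R := [set x | - (K0 + 1) - k%:R - 1 <= x <= - (K0 + 1) - k%:R - 1 + 1].
have NF k : mu.-negligible (F k).
  exists (F k); split => //; first by rewrite /F -set_itvcc; exact: measurable_itv.
  apply: mean_unit_interval => x /andP[h _].
  by have k0 : 0 <= k%:R :> R by []; rewrite ltr_normr; apply/orP; left; lra.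
have NG k : mu.-negligible (G k).
  exists (G k); split => //; first by rewrite /G -set_itvcc; exact: measurable_itv.
  apply: mean_unit_interval => x /andP[_ h].
  by have k0 : 0 <= k%:R :> R by []; rewrite ltr_normr; apply/orP; right; lra.
apply: measure_negligible.
  by apply: measurableC; rewrite -set_itvcc; exact: measurable_itv.
apply: (negligibleS _ (negligibleU (negligible_bigcup NF) (negligible_bigcup NG))).
move=> x /= /negP; rewrite negb_and -!ltNge => /orP[h|h]; [right|left].
  have y0 : 0 <= - (K0 + 1) - x by lra.
  exists (Num.truncn (- (K0 + 1) - x)) => //; rewrite /G /=.
  by have /andP[t1 t2] := truncn_itv y0; rewrite -natr1 in t2; apply/andP; split; lra.
have y0 : 0 <= x - (K0 + 1) by lra.
exists (Num.truncn (x - (K0 + 1))) => //; rewrite /F /=.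
by have /andP[t1 t2] := truncn_itv y0; rewrite -natr1 in t2; apply/andP; split; lra.
Qed.

End CompactSupport.

(** * The fixed point far from the origin *)

Section FarFromSupport.
Variables (R : realType) (I : Type) (mu : mean_functional R I) (p : nat).
Local Notation C := R[i].
Local Notation nc := (@ComplexField.Normc.normc R).
Variables (T : I -> 'M[C]_p) (beta CT : R).
Hypothesis p_gt0 : (0 < p)%N.
Hypothesis beta_gt0 : 0 < beta.
Hypothesis CT_ge0 : 0 <= CT.
Hypothesis T_herm : forall x, (T x) ^t* = T x.
Hypothesis T_opb : forall x, opb (T x) CT.
Local Notation K M x := (Kf beta M (T x)).
Hypothesis K_dom : forall z (M : 'M[C]_p), 0 < complex.Im z -> herg (complex.Im z) M ->
  mdomM mu (fun x => K M x).

(** When beta |M| |T| <= 1/2 the inverse in the kernel has norm at most 2, with a bound independent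
    of eta. *)
Lemma Kf_opb_small (M : 'M[C]_p) eta dl x : 0 < eta -> herg eta M -> opb M dl -> 0 <= dl ->
  beta * dl * CT <= 1 / 2 -> opb (K M x) (2 * CT).
Proof.
move=> e0 hM hd d0 small a; rewrite KfE -mulmxA; set w := invmx _ *m a.
have uD := Kf_unit beta_gt0 e0 hM (T_herm x).
have aE : a = w + beta%:C *: (M *m (T x *m w)).
  by rewrite -{1}[a](mul1mx a) -(mulmxV uD) -mulmxA -/w mulmxDl mul1mx -scalemxAl -mulmxA.
have h1 : fnorm (beta%:C *: (M *m (T x *m w))) <= 1 / 2 * fnorm w.
  rewrite fnormZ nc_real gtr0_norm //.
  apply: (@le_trans _ _ (beta * dl * CT * fnorm w)); last by rewrite ler_wpM2r // fnorm_ge0.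
  rewrite -!mulrA ler_pM2l //; apply: (le_trans (hd _)); rewrite ler_wpM2l //; exact: T_opb.
have h2 : fnorm w <= fnorm a + fnorm (beta%:C *: (M *m (T x *m w))).
  by rewrite {1}(_ : w = a - beta%:C *: (M *m (T x *m w))) ?fnormB // {1}aE addrK.
apply: (le_trans (T_opb x w)); rewrite -[leRHS]mulrA [leRHS]mulrCA ler_wpM2l //.
by move: h1 h2; move: (fnorm w) (fnorm a) (fnorm _) => u v t; lra.
Qed.

Lemma eq_sub_of_add (V : zmodType) (v a b : V) : v = - a + b -> a = b - v.
Proof. by move=> ->; rewrite opprD opprK addrCA subrr addr0. Qed.

Definition mean_bound : R := (p * p)%:R * (2 * (2 * CT)).

(** The equation gives |z| |M v| <= |v| + |K| |M v| with K the mean kernel: once M is small enough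
    for K to be bounded, it is as small as 1 / (|z| - [mean_bound]). *)
Lemma fixpoint_opb_small (M : 'M[C]_p) z dl : 0 < complex.Im z -> herg (complex.Im z) M ->
  Phi mu T beta z M = M -> opb M dl -> 0 <= dl -> beta * dl * CT <= 1 / 2 -> mean_bound < nc z ->
  opb M (nc z - mean_bound)^-1.
Proof.
move=> z0 hM fM hd d0 small hz v.
have [u _ _ _] := Phi_props beta_gt0 T_herm z0 (fun N hN => K_dom z0 hN) hM.
pose X := meanM mu (fun x => K M x).
have hX : opb X mean_bound.
  move=> w; apply: (le_trans (fnorm_opb X w)); rewrite ler_wpM2r ?fnorm_ge0 //.
  apply: fnorm_meanM (K_dom z0 hM) _ => x i j.
  exact: opb_entry (Kf_opb_small x z0 hM hd d0 small).
have vE : v = - (z *: (M *m v)) + X *m (M *m v).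
  have E : Amx mu T beta z M *m (M *m v) = v.
    by rewrite -{2}fM mulmxA (mulmxV u) mul1mx.
  by rewrite -{1}E /Amx mulmxDl mulNmx mul_scalar_mx.
rewrite mulrC ler_pdivlMr ?subr_gt0 //.
have h1 : nc z * fnorm (M *m v) <= fnorm v + fnorm (X *m (M *m v)).
  rewrite -fnormZ (_ : z *: (M *m v) = X *m (M *m v) - v); first by rewrite [leRHS]addrC fnormB.
  exact: eq_sub_of_add vE.
have h2 := hX (M *m v); rewrite mulrBr.
by move: h1 h2; move: (fnorm (M *m v)) (fnorm v) (fnorm _) => a b c; lra.
Qed.

(** Im M = M^* (eta + beta E[K^* (Im M) K]) M. If Im M <= S, smallness of M gives Im M <= eta dl^2 +
    S / 2; [affine_improve] iterates this to 2 eta dl^2, a bound proportional to eta. *)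
Lemma fixpoint_imq_small (M : 'M[C]_p) z dl a : 0 < complex.Im z -> herg (complex.Im z) M ->
  Phi mu T beta z M = M -> opb M dl -> 0 < dl -> beta * dl * CT <= 1 / 2 ->
  4 * beta * CT ^+ 2 * dl ^+ 2 <= 1 / 2 -> fnorm a = 1 -> imq M a <= 2 * dl ^+ 2 * complex.Im z.
Proof.
move=> z0 hM fM hd d0 small small2 a1; set eta := complex.Im z.
have [_ _ _ E] := Phi_props beta_gt0 T_herm z0 (fun N hN => K_dom z0 hN) hM.
pose Pd S := 0 <= S /\ forall b : 'cV[C]_p, imq M b <= S * fnorm b ^+ 2.
have bnd t : 0 < t -> Pd (eta * dl ^+ 2 / (1 - 1 / 2) + t).
  apply: (@affine_improve R Pd (1 / 2) (eta * dl ^+ 2) dl).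
  - by apply/andP; split; lra.
  - by split; [exact: ltW|move=> b; exact: opb_imq].
  - move=> N N' NN [N0 h]; split; first exact: le_trans NN.
    by move=> b; apply: (le_trans (h b)); rewrite ler_wpM2r ?sqr_ge0.
  - move=> S _ [S0 h]; split; first by rewrite addr_ge0 ?mulr_ge0 ?sqr_ge0 ?(ltW z0) //; lra.
    move=> b; rewrite -{1}fM E fM; set w := M *m b.
    have wb : fnorm w ^+ 2 <= dl ^+ 2 * fnorm b ^+ 2.
      by rewrite -exprMn ler_pXn2r ?nnegrE ?mulr_ge0 ?fnorm_ge0 ?(ltW d0) //; exact: hd.
    rewrite (imq_Amx (fun N hN => K_dom z0 hN) w hM) opprD opprK.
    have low : - (4 * beta * CT ^+ 2 * S * fnorm w ^+ 2) <= mu (fun x => imq (K M x) w).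
      rewrite -(mean_cst mu (- _)); apply: mean_le; first exact: mdom_cst.
        exact: (mean_imq w (K_dom z0 hM)).1.
      move=> x; rewrite (imq_Kf beta_gt0 z0 hM (T_herm x)) lerN2.
      apply: (@le_trans _ _ (beta * (S * fnorm (K M x *m w) ^+ 2))); first by rewrite ler_pM2l.
      have kw : fnorm (K M x *m w) ^+ 2 <= (2 * CT) ^+ 2 * fnorm w ^+ 2.
        rewrite -exprMn ler_pXn2r ?nnegrE ?fnorm_ge0 ?mulr_ge0 ?fnorm_ge0 //.
        exact: (Kf_opb_small x z0 hM hd (ltW d0) small).
      have := ler_wpM2l (mulr_ge0 (ltW beta_gt0) S0) kw.
      by move: (fnorm _ ^+ 2) (fnorm _ ^+ 2) => f g; lra.
    have w0 := sqr_ge0 (fnorm w); have b0 := sqr_ge0 (fnorm b).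
    have c0 : 0 <= eta + 4 * beta * CT ^+ 2 * S.
      by rewrite addr_ge0 ?(ltW z0) // !mulr_ge0 ?sqr_ge0 ?(ltW beta_gt0).
    have h1 := ler_wpM2l c0 wb.
    have h2 : 4 * beta * CT ^+ 2 * dl ^+ 2 * (S * fnorm b ^+ 2) <= 1 / 2 * (S * fnorm b ^+ 2).
      by rewrite ler_wpM2r // mulr_ge0.
    rewrite -/eta; move: low h1 h2; move: (mu _) (fnorm w ^+ 2) (fnorm b ^+ 2) => m f g; lra.
apply/ler_addgt0Pr => t t0; have [_ h] := bnd t t0.
have half : (1 - 1 / 2 : R) = 2^-1 by lra.
rewrite half invrK in h; apply: (le_trans (h a)); rewrite a1 expr1n mulr1; lra.
Qed.

Variable M : C -> 'M[C]_p.
Hypothesis M_fix : forall z, 0 < complex.Im z -> herg (complex.Im z) (M z) /\ Phi mu T beta z (M z) = M z.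
Hypothesis M_lip : forall z z', 0 < complex.Im z -> 0 < complex.Im z' ->
  fnorm (M z - M z') <= (p * p)%:R * (nc (z - z') / complex.Im z' / complex.Im z).

(** Clamping the height at eta0 extends the function to the whole line with one Lipschitz constant,
    in the form the intermediate value theorem requires. *)
Lemma vertical_lipschitz (x eta0 : R) : 0 < eta0 ->
  continuous (fun eta : R => fnorm (M (x +i* (Num.max eta0 eta)))).
Proof.
move=> e0; apply: (@lipschitz_continuous _ _ ((p * p)%:R / eta0 ^+ 2)).
  by rewrite divr_ge0 ?sqr_ge0.
move=> s t; set a := Num.max eta0 s; set b := Num.max eta0 t.
have ea : eta0 <= a by rewrite le_max lexx.
have eb : eta0 <= b by rewrite le_max lexx.
have a0 : 0 < a by exact: lt_le_trans ea.
have b0 : 0 < b by exact: lt_le_trans eb.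
have ab : `|a - b| <= `|s - t|.
  rewrite /a /b /Num.max; case: ifPn => h1; case: ifPn => h2; rewrite ?subrr ?normr0 //;
  rewrite -?leNgt in h1 h2; rewrite ler_norml; apply/andP;
  have := ler_norm (s - t); have := ler_norm (- (s - t)); rewrite normrN; split; lra.
have h := @M_lip (x +i* a) (x +i* b) a0 b0.
have n1 : nc ((x +i* a) - (x +i* b)) = `|a - b|.
  by rewrite /= subrr expr0n add0r sqrtr_sqr.
rewrite n1 /= in h.
have h1 : `|fnorm (M (x +i* a)) - fnorm (M (x +i* b))| <= fnorm (M (x +i* a) - M (x +i* b)).
  have t1 := fnormD (M (x +i* a) - M (x +i* b)) (M (x +i* b)); rewrite subrK in t1.
  have t2 := fnormD (M (x +i* b) - M (x +i* a)) (M (x +i* a)); rewrite subrK fnormBC in t2.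
  by move: t1 t2; move: (fnorm _) (fnorm _) (fnorm _) => u v w; rewrite ler_norml; lra.
apply: (le_trans h1); apply: (le_trans h); rewrite -[leRHS]mulrA ler_wpM2l //.
rewrite -mulrA mulrC; apply: ler_pM => //.
  by rewrite mulr_ge0 // invr_ge0 ltW.
by rewrite -invfM lef_pV2 ?posrE ?mulr_gt0 ?exprn_gt0 // expr2 ler_pM // ltW.
Qed.

(* Far from the support the norm of M never takes values in (dl / 2, dl] and is
   at most dl / 2 high above the real axis, hence, by continuity, on the whole
   vertical half-line. *)
Lemma fixpoint_small_far dl : 0 < dl -> beta * dl * CT <= 1 / 2 ->
  exists K0, forall x eta, K0 < `|x| -> 0 < eta -> fnorm (M (x +i* eta)) <= dl.
Proof.
move=> d0 small; pose pp : R := (p * p)%:R.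
have pp0 : 0 <= pp by [].
(* Beyond this abscissa p^2 / (|z| - [mean_bound]) is at most dl / 2 at every height. *)
exists (mean_bound + 2 * (pp + 1) / dl).
move=> x eta0 hx e0.
have q0 : 0 < 2 * (pp + 1) / dl by rewrite divr_gt0 ?mulr_gt0 // ltr_wpDl.
have gap t : 0 < t -> fnorm (M (x +i* t)) <= dl -> fnorm (M (x +i* t)) <= dl / 2.
  move=> t0 h; have [hM fM] := @M_fix (x +i* t) t0.
  have nz : mean_bound + 2 * (pp + 1) / dl < nc (x +i* t) by exact: lt_le_trans (nc_Re (x +i* t)).
  have nz' : mean_bound < nc (x +i* t) by rewrite (lt_trans _ nz) // ltrDl.
  have o : opb (M (x +i* t)) dl by move=> v; apply: (le_trans (fnormM _ _)); rewrite ler_wpM2r ?fnorm_ge0.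
  have := opb_fnorm (@fixpoint_opb_small _ (x +i* t) dl t0 hM fM o (ltW d0) small nz') => /le_trans; apply.
  rewrite -/pp ler_pdivrMr ?subr_gt0 //.
  have : 2 * (pp + 1) / dl <= nc (x +i* t) - mean_bound by lra.
  rewrite ler_pdivrMr //; lra.
pose eta1 := Num.max eta0 (2 * (pp + 1) / dl).
have e01 : eta0 <= eta1 by rewrite le_max lexx.
have e1 : 0 < eta1 by exact: lt_le_trans e01.
have top : fnorm (M (x +i* eta1)) <= dl / 2.
  have [hM _] := @M_fix (x +i* eta1) e1.
  apply: (le_trans (opb_fnorm (herg_opb e1 hM))); rewrite -/pp /= ler_pdivrMr //.
  have : 2 * (pp + 1) / dl <= eta1 by rewrite le_max lexx orbT.
  rewrite ler_pdivrMr //; lra.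
rewrite leNgt; apply/negP => bad.
pose g eta := fnorm (M (x +i* (Num.max eta0 eta))).
have g0 : g eta0 = fnorm (M (x +i* eta0)) by rewrite /g max_l.
have g1 : g eta1 = fnorm (M (x +i* eta1)) by rewrite /g max_r.
have cg : {within `[eta0, eta1], continuous g}.
  by apply: continuous_subspaceT; exact: vertical_lipschitz.
(* The value 3/4 dl lies in the forbidden interval (dl / 2, dl]. *)
have [|t tin gt] := @IVT R g eta0 eta1 (3 / 4 * dl) e01 cg.
  rewrite g0 g1 ge_min le_max; apply/andP; split; apply/orP; [right|left]; lra.
move: tin; rewrite in_itv /= => /andP[t0 _].
have := gap t (lt_le_trans e0 t0); move: gt; rewrite /g max_r // => ->.
by move=> /(_ _); lra.
Qed.

Lemma fixpoint_trace_far : exists K0 c, 0 <= c /\ forall x eta, K0 < `|x| -> 0 < eta ->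
  complex.Im ((p%:R^-1 : R)%:C * \tr (M (x +i* eta))) <= c * eta.
Proof.
(* With dl = 1 / D both beta dl CT and 4 beta CT^2 dl^2 are at most 1/2; the shifts by 1 keep D
   positive and at least 2. *)
pose D := 4 * (beta + 1) * (CT + 1) ^+ 2.
have c1 : 1 <= (CT + 1) ^+ 2 by rewrite exprn_ege1 // lerDr.
have D0 : 0 < D.
  by apply: mulr_gt0; [apply: mulr_gt0 => //; exact: addr_gt0|exact: lt_le_trans c1].
pose dl := D^-1.
have d0 : 0 < dl by rewrite invr_gt0.
have s1 : beta * dl * CT <= 1 / 2.
  rewrite mulrAC ler_pdivrMr // /D; have := mulr_ge0 (ltW beta_gt0) CT_ge0.
  have := mulr_ge0 (ltW beta_gt0) (sqr_ge0 CT); move: beta_gt0 CT_ge0; nra.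
have s2 : 4 * beta * CT ^+ 2 * dl ^+ 2 <= 1 / 2.
  have cc : CT ^+ 2 <= (CT + 1) ^+ 2 by rewrite ler_pXn2r ?nnegrE ?addr_ge0 // lerDl.
  have bc : beta * CT ^+ 2 <= (beta + 1) * (CT + 1) ^+ 2.
    by apply: ler_pM; rewrite ?sqr_ge0 ?(ltW beta_gt0) // lerDl.
  rewrite /dl exprVn ler_pdivrMr ?exprn_gt0 //.
  apply: (@le_trans _ _ D); first by rewrite /D; lra.
  have D4 : 2 <= D.
    rewrite /D; have := ler_pM ler01 ler01 (_ : 1 <= beta + 1) c1; rewrite lerDr (ltW beta_gt0) => /(_ isT); lra.
  by rewrite expr2; have := ler_wpM2l (ltW D0) D4; lra.
have [K0 h] := fixpoint_small_far d0 s1; exists K0, (2 * dl ^+ 2); split.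
  by rewrite mulr_ge0 // sqr_ge0.
move=> x eta hx e0; rewrite ImZ ler_pdivrMl ?ltr0n // /mxtrace Im_sum.
have -> : p%:R * (2 * dl ^+ 2 * eta) = \sum_(i < p) 2 * dl ^+ 2 * eta by rewrite sum_cst card_ord.
apply: ler_sum => i _; rewrite -cdot_delta.
have [hM fM] := @M_fix (x +i* eta) e0.
have o : opb (M (x +i* eta)) dl.
  by move=> v; apply: (le_trans (fnormM _ _)); rewrite ler_wpM2r ?fnorm_ge0 //; exact: h.
exact: (@fixpoint_imq_small _ (x +i* eta) dl _ e0 hM fM o d0 s1 s2 (fnorm_delta _ i)).
Qed.

End FarFromSupport.

(** * The sample matrices and their limiting spectrum *)

Lemma toC_sample_matrix (R : realType) q p m n (T : q.-tuple R -> 'M[R]_p)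
    (y : 'I_n -> q.-tuple R) (u : 'I_n -> m.-tuple R) :
  toC (sample_matrix T y u) = sample_mx (fun i => toC (T (y i))) (fun i => tnth (u i)) predT.
Proof.
rewrite /sample_matrix /toC map_mxZ; congr (_ *: _).
rewrite (raddf_sum (@map_mx _ _ (real_complex R) (p * m) (p * m))); apply: eq_bigr => i _.
exact: tensmx_liftv.
Qed.

Lemma sample_matrix_sym (R : realType) q p m n (T : q.-tuple R -> 'M[R]_p)
    (y : 'I_n -> q.-tuple R) (u : 'I_n -> m.-tuple R) : (forall t, (T t)^T = T t) ->
  (sample_matrix T y u)^T = sample_matrix T y u.
Proof.
move=> h; rewrite /sample_matrix linearZ raddf_sum /=; congr (_ *: _); apply: eq_bigr => i _.
by rewrite trmx_tens h trmx_mul trmxK.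
Qed.

Lemma ae_samples d (X : measurableType d) (R : realType) (P : probability X R) d' (Y : measurableType d')
    (law_y : probability Y R) (y : forall n, 'I_n -> {RV P >-> Y}) (S : Y -> Prop) :
  (forall n (i : 'I_n) B, measurable B -> distribution P (y n i) B = law_y B) ->
  {ae law_y, forall t, S t} -> {ae P, forall w, forall n (i : 'I_n), S (y n i w)}.
Proof.
move=> lawE [N [mN N0 SN]]; apply: ae_foralln => n; apply: filter_forall => i.
exists (y n i @^-1` N); split.
- exact: measurable_funPTI.
- by have := lawE n i N mN; rewrite N0.
- by move=> w /= hw; apply: SN.
Qed.

Theorem proposition2p1 (R : realType) (r q p : nat)
  (r_gt0 : (0 < r)%N) (q_gt0 : (0 < q)%N) (p_gt0 : (0 < p)%N)
  (disp : measure_display) (Omega : measurableType disp)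
  (P : probability Omega R)
  (Pstar : R.-pker (r.-tuple R) ~> (q.-tuple R))
  (d : nat -> nat) (r_lt_d : forall n, (r < d n)%N)
  (s : forall n, 'I_n -> {RV P >-> r.-tuple R})
  (u : forall n, 'I_n -> {RV P >-> (d n - r).-tuple R})
  (y : forall n, 'I_n -> {RV P >-> q.-tuple R})
  (s_gaussian : forall n (i : 'I_n), std_gaussian_vector P (s n i))
  (y_given_s : forall n (i : 'I_n), conditional_law P (s n i) (y n i) Pstar)
  (u_gaussian : forall n (i : 'I_n), std_gaussian_vector P (u n i))
  (u_indep : forall n (i : 'I_n),
     independent P (u n i) (fun w => (s n i w, y n i w)))
  (samples_indep : forall n,
     mutually_independent P (fun (i : 'I_n) w => (s n i w, u n i w, y n i w)))
  (law_y : probability (q.-tuple R) R)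
  (law_yE : forall n (i : 'I_n) B, measurable B ->
     distribution P (y n i) B = law_y B)
  (T : q.-tuple R -> 'M[R]_p)
  (T_sym : forall t, (T t)^T = T t)
  (T_meas : forall i j, measurable_fun setT (fun t => T t i j))
  (T_neq0 : (0 < law_y [set t | T t <> 0%R])%E)
  (C_T : R) (C_T_gt0 : 0 < C_T)
  (T_bounded : {ae law_y, forall t, opnormR (T t) <= C_T})
  (alpha : R) (alpha_gt0 : 0 < alpha)
  (d_infty : d n @[n --> \oo] --> \oo)
  (n_over_d : (n%:R / (d n)%:R : R) @[n --> \oo] --> alpha) :
  let Pn n w := sample_matrix T (fun i => y n i w) (fun i => u n i w) in
  let Mn n w := matrix_stieltjes (Pn n w) in
  exists M : R[i] -> 'M[R[i]]_p,
  [/\ {ae P, forall w, locally_uniform_cvg (@Cplus R) (Mn ^~ w) M},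
      normalized_herglotz M /\ self_consistent law_y T alpha M,
      forall M' : R[i] -> 'M[R[i]]_p,
        normalized_herglotz M' -> self_consistent law_y T alpha M' ->
        forall z, Cplus z -> M' z = M z,
      forall z, Cplus z ->
        {ae P, forall w, opnormC (Mn n w z - M z) @[n --> \oo] --> (0 : R)}
    & exists mu : probability R R,
        [/\ compactly_supported mu,
            {ae P, forall w,
               weak_cvg (fun n => empirical_spectral_measure (Pn n w)) mu}
          & forall z, Cplus z -> stieltjes mu z = p%:R^-1 * \tr (M z)]].
Proof.
move=> Pn Mn.
(* [H] uses the truncated T, which is bounded at every point. On the almost sure event [good] it
   coincides with P_n for all n simultaneously. *)
pose T0 t := toC (truncate T C_T t).
pose H n w := sample_mx (fun i => T0 (y n i w)) (fun i => tnth (u n i w)) predT.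
have H_herm n w : (H n w) ^t* = H n w.
  by apply: sample_mx_herm => i; exact: (T0_herm C_T T_sym).
have m_gt0 n : (0 < d n - r)%N by rewrite subn_gt0.
have good : {ae P, forall w, forall n, toC (Pn n w) = H n w}.
  have := ae_samples law_yE T_bounded; apply: filterS => w hw n.
  rewrite /Pn toC_sample_matrix.
  have -> // : (fun i : 'I_n => toC (T (y n i w))) = (fun i => T0 (y n i w)).
  by apply/funext => i; rewrite /T0 truncate_id.
have T0m : measurableM T0 by exact: measurable_truncate.
(* Outside the upper half-plane the value 0 is a default, so that choice yields a function on all of
   R[i]. *)
have pick z : exists Mz : 'M[R[i]]_p, 0 < complex.Im z ->
  [/\ herg (complex.Im z) Mz, Phi (expectation_mean law_y) T0 alpha^-1 z Mz = Mz &
    {ae P, forall w, fnorm (partial_trace (invmx (H n w - z%:M)) - Mz) @[n --> \oo] --> (0 : R)}].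
  have [z0|z0] := ltP 0 (complex.Im z); last by exists 0.
  have [Mz hMz] := trace_ae_cvg p_gt0 r_lt_d u_gaussian samples_indep law_yE T0m
    (pc_ge0 p C_T_gt0) (T0_herm C_T T_sym) (T0_opb T C_T_gt0) alpha_gt0 n_over_d z0.
  by exists Mz.
have [M hM] := choice pick.
have M_fix z : 0 < complex.Im z ->
    herg (complex.Im z) (M z) /\ Phi (expectation_mean law_y) T0 alpha^-1 z (M z) = M z.
  by move=> z0; have [h1 h2 _] := hM z z0.
have M_cvg z : 0 < complex.Im z ->
    {ae P, forall w, fnorm (partial_trace (invmx (H n w - z%:M)) - M z) @[n --> \oo] --> (0 : R)}.
  by move=> z0; have [_ _ h] := hM z z0.
pose lu := trace_cvg_locally_uniform m_gt0 H_herm M_cvg.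
pose all_z := trace_cvg_all m_gt0 H_herm M_cvg.
have Mn_eq w : (forall n, toC (Pn n w) = H n w) ->
    forall n z, Mn n w z = partial_trace (invmx (H n w - z%:M)).
  by move=> h n z; rewrite -h.
have [B M_decay] := fixpoint_decay T_sym T_meas C_T_gt0 alpha_gt0 M_fix.
have specA : {ae P, forall w, spectral_cvg M (fun n => Pn n w)}.
  apply: filterS2 good all_z => w h1 h2; split; first by move=> n; exact: sample_matrix_sym.
  move=> z z0; rewrite (_ : (fun n => _) = fun n => fnorm (partial_trace (invmx (H n w - z%:M)) - M z)).
    exact: h2.
  by apply/funext => n; rewrite -(Mn_eq w h1).
(* One sample point supplies the realization from which mu is constructed. *)
have [w0 A0] := ae_exists specA.
have [mu [mu_weak mu_stieltjes]] := limit_spectral_measure p_gt0 m_gt0 M_decay A0.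
exists M; split.
- apply: filterS2 good lu => w h1.
  by rewrite (_ : Mn ^~ w = fun n z => partial_trace (invmx (H n w - z%:M))) //; do 2!apply/funext => ?; rewrite (Mn_eq w h1).
- split; last exact: (fixpoint_self_consistent T_sym T_meas C_T_gt0 T_bounded alpha_gt0 M_fix).
  split.
  + exact: (trace_limit_analytic m_gt0 H_herm M_cvg).
  + move=> z z0; apply/psdmx_imq => a; exact: (herg_ge0 _ z0 (M_fix z z0).1).
  + exact: (fixpoint_normalized T_sym T_meas C_T_gt0 alpha_gt0 M_fix).
- move=> M' [_ M'_psd _] M'_sc z z0; have [h1 h2] := M_fix z z0.
  exact: (self_consistent_unique p_gt0 T_sym T_meas C_T_gt0 T_bounded alpha_gt0 z0 h1 h2 (M'_psd z z0) M'_sc).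
- move=> z z0; apply: filterS2 good (M_cvg z z0) => w h1.
  apply: cvg0_le; apply: nearW => n; rewrite (Mn_eq w h1); exact: opnormC_bounds.
- exists mu; split.
  + have [K0 [c [c0 far]]] := fixpoint_trace_far p_gt0 (aV_gt0 alpha_gt0) (pc_ge0 p C_T_gt0)
      (T0_herm C_T T_sym) (T0_opb T C_T_gt0) (fun z N z0 hN => T0_dom law_y T_sym T_meas C_T_gt0 alpha_gt0 z0 hN)
      M_fix (limit_lipschitz m_gt0 H_herm M_cvg).
    apply: (@stieltjes_compactly_supported _ mu (fun z => (p%:R^-1 : R)%:C * \tr (M z)) mu_stieltjes K0 c c0) => x eta hx e0 _; exact: far.
  + by apply: filterS specA => w; exact: mu_weak.
  + by move=> z z0; rewrite mu_stieltjes // fmorphV rmorph_nat.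
Qed.
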